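(* Let $s\geq 1$ and $k\geq 2$ be integers and let $\lambda<0$. Let $V:\mathbb{R}\to\mathbb{R}$ be a real valued potential with $V\in L^\infty(\mathbb{R})$, such that for every $j=1,\dots,s$ there is a constant $C_j>0$ with $$|\partial_x^j V(x)|\leq C_j (1+|x|)^{-1}\quad\text{for all } x\in\mathbb{R},$$ such that $-\partial_x^2-V\geq 0$ in the operator sense on $L^2(\mathbb{R})$, and such that for every $g\in L^2(\mathbb{R})$ there exist $g_\pm\in L^2(\mathbb{R})$ with $$\|e^{it(\partial_x^2+V)}g-e^{it\partial_x^2}g_\pm\|_{L^2(\mathbb{R})}\to 0\quad\text{as } t\to\pm\infty .$$ Let $f\in\Sigma_s(\mathbb{R})$ and let $u\in\mathcal{C}(\mathbb{R};H^1(\mathbb{R}))$ be the unique global solution to $$\big(i\partial_t+\partial_x^2+V(x)+\lambda|u|^{2k}\big)u=0,\quad (t,x)\in\mathbb{R}\times\mathbb{R},\qquad u(0,x)=f(x).$$ Assume that $$\sup_{(t,x)\in\mathbb{R}^2}\langle t\rangle^{\frac12}|u(t,x)|<\infty .$$ Then $u\in\mathcal{C}(\mathbb{R};H^s(\mathbb{R}))$ and there exist $f_\pm\in H^s(\mathbb{R})$ such that $$\lim_{t\to\pm\infty}\|u(t,\cdot)-e^{it\partial_x^2}f_\pm\|_{H^s(\mathbb{R})}=0 .$$ Moreover $$\lim_{t\to\pm\infty}\int_{\mathbb{R}}\Big(\frac{x}{t}\Big)^{2s}|u(t,x)|^2\,dx=2^{2s}\int_{\mathbb{R}}|\partial_x^s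 f_\pm|^2\,dx .$$
   Context: For an integer $s\ge 1$, $\Sigma_s(\mathbb{R})$ is the space of (complex valued) functions with finite norm $\|f\|_{\Sigma_s(\mathbb{R})}^2=\|f\|_{H^s(\mathbb{R})}^2+\int_{\mathbb{R}}x^{2s}|f(x)|^2\,dx$, where $H^s(\mathbb{R})$ is the classical Sobolev space. $\langle t\rangle=(1+t^2)^{1/2}$. $e^{it(\partial_x^2+V)}$ is the unitary group on $L^2(\mathbb{R})$ generated by the self-adjoint operator $\partial_x^2+V$ (domain $H^2(\mathbb{R})$); $e^{it\partial_x^2}$ is the same with $V=0$. Since $\lambda<0$ (defocusing case), for every $f\in H^1(\mathbb{R})$ the Cauchy problem has a unique global solution in $\mathcal{C}(\mathbb{R};H^1(\mathbb{R}))$ (in the sense of the Duhamel integral formulation); this is a known fact taken for granted. *)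

(* Defs.v *)
From HB Require Import structures.
From mathcomp Require Import all_boot all_order all_algebra.
From mathcomp Require Import complex.
From mathcomp Require Import all_classical all_reals all_analysis.

Set Implicit Arguments.
Unset Strict Implicit.
Unset Printing Implicit Defensive.

Import Order.TTheory GRing.Theory Num.Theory.
Import numFieldNormedType.Exports.
Local Open Scope classical_set_scope.
Local Open Scope ring_scope.
Local Open Scope complex_scope.

(* Elements of L^2 and H^s are represented by genuine functions R -> R[i];
   equality of classes is equality almost everywhere. *)

Section defs.
Context {R : realType}.
Implicit Types (f g h : R -> R[i]) (V phi : R -> R) (D : set R).

Local Notation leb := (@lebesgue_measure R).
Local Notation cmod := (@ComplexField.Normc.normc R).

Definition toC V : R -> R[i] := fun x => (V x)%:C.

Definition Cmeasurable f : Prop :=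
  measurable_fun setT (fun x => complex.Re (f x)) /\
  measurable_fun setT (fun x => complex.Im (f x)).

Definition Clocally_integrable f : Prop :=
  locally_integrable setT (fun x => complex.Re (f x)) /\
  locally_integrable setT (fun x => complex.Im (f x)).

Definition Cintegrable D f : Prop :=
  leb.-integrable D (fun x => (complex.Re (f x))%:E) /\
  leb.-integrable D (fun x => (complex.Im (f x))%:E).

Definition Cintegral D f : R[i] :=
  (\int[leb]_(x in D) complex.Re (f x)) +i* (\int[leb]_(x in D) complex.Im (f x)).

Definition ae_equal f g : Prop := {ae leb, forall x, f x = g x}.

Definition L2norm f : \bar R := ('N[leb]_(2%:E)[EFin \o (cmod \o f)])%E.

Definition L2 f : Prop := Cmeasurable f /\ (L2norm f < +oo)%E.

Definition L2dot f g : R[i] := Cintegral setT (fun x => f x * (g x)^*).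

Definition test_function phi : Prop :=
  (forall n x, derivable (derive1n n phi) x 1) /\
  (exists M : R, forall x, M < `|x| -> phi x = 0).

(* Real-valued test functions suffice, both sides being complex linear. *)
Definition is_weak_derivative (j : nat) f g : Prop :=
  [/\ Clocally_integrable f, Clocally_integrable g &
      forall phi, test_function phi ->
        Cintegral setT (fun x => f x * (derive1n j phi x)%:C) =
        (-1) ^+ j * Cintegral setT (fun x => g x * (phi x)%:C)].

(* The j-th weak derivative of f when it exists in L^2; 0 otherwise. *)
Definition wderiv (j : nat) f : R -> R[i] :=
  xget (cst 0) [set g | L2 g /\ is_weak_derivative j f g].

Definition Hs (s : nat) f : Prop :=
  L2 f /\ forall j, (j <= s)%N -> exists2 g, L2 g & is_weak_derivative j f g.

(* Equal to +oo outside H^s, so that convergence to 0 entails membership. *)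
Definition Hsnorm (s : nat) f : \bar R :=
  if `[< Hs s f >] then
    ((\sum_(j < s.+1) L2norm (wderiv j f) ^+ 2) `^ 2^-1)%E
  else +oo%E.

Definition Sigma_normsq (s : nat) f : \bar R :=
  (Hsnorm s f ^+ 2 + \int[leb]_x (x ^+ (2 * s) * cmod (f x) ^+ 2)%:E)%E.

Definition Sigma (s : nat) f : Prop := (Sigma_normsq s f < +oo)%E.

Definition continuous_Hs (s : nat) (u : R -> R -> R[i]) : Prop :=
  (forall t, Hs s (u t)) /\
  (forall t0, Hsnorm s (u t \- u t0) @[t --> t0] --> 0%E).

(* The operator d^2/dx^2 + V, of domain H^2. *)
Definition schrodinger V g : R -> R[i] :=
  fun x => wderiv 2 g x + (V x)%:C * g x.

(* U t = e^{it(d^2/dx^2 + V)}: U is a strongly continuous one-parameter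
   unitary group on L^2 (isometries with the group law are unitary) whose
   infinitesimal generator is exactly i(d^2/dx^2 + V) with domain H^2.  When
   d^2/dx^2 + V is self-adjoint on H^2, Stone's theorem provides such a U,
   unique up to equality almost everywhere. *)
Record is_unitary_group V (U : R -> (R -> R[i]) -> (R -> R[i])) : Prop := {
  group_L2 : forall t g, L2 g -> L2 (U t g);
  group_linear : forall t (a : R[i]) g h, L2 g -> L2 h ->
    ae_equal (U t (fun x => a * g x + h x)) (fun x => a * U t g x + U t h x);
  group_isometry : forall t g, L2 g -> L2norm (U t g) = L2norm g;
  group_zero : forall g, L2 g -> ae_equal (U 0 g) g;
  group_add : forall t t' g, L2 g -> ae_equal (U (t + t') g) (U t (U t' g));
  group_continuous : forall g, L2 g ->
    L2norm (U t g \- g) @[t --> (0 : R)] --> 0%E;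
  group_generator : forall g h, L2 g -> L2 h ->
    (L2norm (fun x => (t^-1)%:C * (U t g x - g x) - h x)
       @[t --> (0 : R)^'] --> 0%E) <->
    (Hs 2 g /\ ae_equal h (fun x => 'i * schrodinger V g x))
}.

(* Vector-valued integral of F over D, tested against the dual of L^2
   (Rudin, Functional Analysis, Definition 3.26); it is the Bochner integral
   whenever the latter exists, in particular for F continuous on a compact
   interval. *)
Definition is_L2integral (F : R -> R -> R[i]) D g : Prop :=
  L2 g /\ forall phi : R -> R[i], L2 phi ->
    Cintegrable D (fun tau => L2dot (F tau) phi) /\
    L2dot g phi = Cintegral D (fun tau => L2dot (F tau) phi).

(* g is the oriented integral of F from 0 to t, for t of either sign. *)
Definition is_L2primitive (F : R -> R -> R[i]) (t : R) g : Prop :=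
  if 0 <= t then is_L2integral F `[0, t] g
  else is_L2integral F `[t, 0] (fun x => - g x).

Definition nonlinearity (lam : R) (k : nat) g : R -> R[i] :=
  fun x => (lam * cmod (g x) ^+ (2 * k))%:C * g x.

(* u in C(R; H^1) solves i u_t + u_xx + V u + lam |u|^(2k) u = 0, u(0) = f, i.e.
   u(t) = U(t) f + i int_0^t U(t - tau) (lam |u|^(2k) u)(tau) dtau. *)
Definition is_solution (U : R -> (R -> R[i]) -> (R -> R[i]))
    (lam : R) (k : nat) f (u : R -> R -> R[i]) : Prop :=
  [/\ continuous_Hs 1 u,
      ae_equal (u 0) f &
      forall t, exists2 w : R -> R[i],
        is_L2primitive (fun tau => U (t - tau) (nonlinearity lam k (u tau))) t w &
        ae_equal (u t) (fun x => U t f x + 'i * w x)].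

Definition nonnegative_operator (A : (R -> R[i]) -> (R -> R[i]))
    (dom : (R -> R[i]) -> Prop) : Prop :=
  forall g, dom g -> 0 <= L2dot (A g) g.

Definition japanese (t : R) : R := (1 + t ^+ 2) `^ 2^-1.

End defs.

(* Main.v *)
Require Import Defs.
From HB Require Import structures.
From mathcomp Require Import all_boot all_order all_algebra.
From mathcomp Require Import complex.
From mathcomp Require Import all_classical all_reals all_analysis.
From mathcomp Require Import measurable_realfun ess_sup_inf hoelder.
From mathcomp Require Import ring lra zify.
Import Order.TTheory GRing.Theory Num.Theory.
Import numFieldNormedType.Exports.
Local Open Scope classical_set_scope.
Local Open Scope ring_scope.
Local Open Scope complex_scope.
Set Implicit Arguments.
Unset Strict Implicit.
Unset Printing Implicit Defensive.

(* Scattering: Gagliardo-Nirenberg interpolation between the decay hypothesis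
   and H^s makes the nonlinearity O(t^(-3/2)) times the H^s norm, uniformly in
   time; hence the H^s norm stays bounded and e^(-itA) u(t) converges in H^s,
   A = d^2/dx^2 + V.  Interpolating the given L^2 wave operators with uniform
   H^s bounds for both groups replaces e^(itA) by the free group.
   Moments: with w_e = x / (1 + e x^2) in place of x, y = |w_e^s u| obeys a
   differential inequality whose right-hand side is controlled by
   y^(1 - 1/s) |D^s u|^(1/s), because |w^(s-1) D u| interpolates between the
   weighted norm and |D^s u|; integrating gives
   |x^s u(t)| <= (|D^s f_+| + eps) (2 (t + c))^s for large t.
   Conversely x e^(it d^2) = e^(it d^2) (x - 2 i t d) on test functions, so
   pairing x^s u(t) / t^s with the free evolution of a test function close to
   D^s f_+ gives the matching lower bound.  Negative times follow by complex
   conjugation. *)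


(** * The real Hilbert space of square-integrable complex functions *)

Section complex_facts.
Context {R : rcfType}.
Implicit Types (z w : R[i]) (a b : R).

(** Neither the Fourier transform nor the Bochner integral is used. Everything is read off scalar
    derivatives of inner products: weak differentiation is the generator of translations, so it
    obeys the same theory of unitary groups as the propagators, and the Duhamel formula becomes a
    formula for the derivative of [dot (S (- t) (u t)) v]. Norm bounds come back by duality. The
    exponent 3/2: 2k factors of size t^(-1/2) give t^(-k), at most t^(-2) as k >= 2, and
    interpolating intermediate derivatives between the decay and the top norm costs t^(1/2). The
    bound is linear in the top norm and integrable, so it is absorbed after a large time and no
    Gronwall growth appears. The moment needs its sharp constant. With sg = 2 (t + c) the numbers
    sg^j |w^(s-j) D^j u| are convex in j up to an error O(1/sg), so the one with j = 1 lies below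
    the chord, with weights 1 - 1/s and 1/s up to an arbitrarily small loss. This makes L^2 sg^(2s),
    with L slightly above |D^s u|, a barrier for the squared weighted norm; c does not depend on the
    regularisation e. *)

Definition n2 z : R := complex.Re z ^+ 2 + complex.Im z ^+ 2.
Definition rdot z w : R := complex.Re z * complex.Re w + complex.Im z * complex.Im w.
Local Notation cmod := (@ComplexField.Normc.normc R).

Lemma n2_ge0 z : 0 <= n2 z. Proof. by rewrite addr_ge0 ?sqr_ge0. Qed.
Lemma normc_sqr z : cmod z ^+ 2 = n2 z.
Proof. by case: z => a b; rewrite sqr_sqrtr //= addr_ge0 ?sqr_ge0. Qed.
Lemma normc_ge0' z : 0 <= cmod z.
Proof. by case: z => a b; rewrite sqrtr_ge0. Qed.
Lemma normc_sqrt z : cmod z = Num.sqrt (n2 z).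
Proof. by case: z. Qed.
Lemma ReM z w : complex.Re (z * w) = complex.Re z * complex.Re w - complex.Im z * complex.Im w.
Proof. by case: z; case: w. Qed.
Lemma ImM z w : complex.Im (z * w) = complex.Re z * complex.Im w + complex.Im z * complex.Re w.
Proof. by case: z => a b; case: w. Qed.
Lemma ReD z w : complex.Re (z + w) = complex.Re z + complex.Re w.
Proof. by case: z; case: w. Qed.
Lemma ImD z w : complex.Im (z + w) = complex.Im z + complex.Im w.
Proof. by case: z; case: w. Qed.
Lemma ReN z : complex.Re (- z) = - complex.Re z.
Proof. by case: z. Qed.
Lemma ImN z : complex.Im (- z) = - complex.Im z.
Proof. by case: z. Qed.
Lemma ReJ z : complex.Re (z^*) = complex.Re z.
Proof. by case: z. Qed.
Lemma ImJ z : complex.Im (z^*) = - complex.Im z.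
Proof. by case: z. Qed.
Lemma ReC a : complex.Re a%:C = a. Proof. by []. Qed.
Lemma ImC a : complex.Im a%:C = 0. Proof. by []. Qed.
Lemma Rei : complex.Re ('i : R[i]) = 0. Proof. by []. Qed.
Lemma Imi : complex.Im ('i : R[i]) = 1. Proof. by []. Qed.
Lemma ReR0 : complex.Re (0 : R[i]) = 0. Proof. by []. Qed.
Lemma ImR0 : complex.Im (0 : R[i]) = 0. Proof. by []. Qed.
Lemma ReiM z : complex.Re ('i * z) = - complex.Im z.
Proof. by case: z => a b /=; ring. Qed.
Lemma ImiM z : complex.Im ('i * z) = complex.Re z.
Proof. by case: z => a b /=; ring. Qed.
Definition ReImE := (ReiM, ImiM, ReM, ImM, ReD, ImD, ReN, ImN, ReJ, ImJ, ReC, ImC, Rei, Imi, ReR0, ImR0).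
Lemma cplx_eq z w : complex.Re z = complex.Re w -> complex.Im z = complex.Im w -> z = w.
Proof. by case: z => a b; case: w => c d /= -> ->. Qed.
Lemma n2M z w : n2 (z * w) = n2 z * n2 w.
Proof. by rewrite /n2 !ReImE; ring. Qed.
Lemma n2J z : n2 z^* = n2 z.
Proof. by rewrite /n2 !ReImE sqrrN. Qed.
Lemma n2C a : n2 a%:C = a ^+ 2.
Proof. by rewrite /n2 !ReImE expr0n addr0. Qed.
Lemma n2i : n2 ('i : R[i]) = 1.
Proof. by rewrite /n2 !ReImE expr0n add0r expr1n. Qed.
Lemma n20 : n2 0 = 0. Proof. by rewrite /n2 !ReImE; ring. Qed.
Lemma n2_eq0 z : n2 z = 0 -> z = 0.
Proof.
move=> /eqP; rewrite /n2 paddr_eq0 ?sqr_ge0// !sqrf_eq0 => /andP[/eqP h /eqP k].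
exact: cplx_eq.
Qed.
Lemma n2D z w : n2 (z + w) = n2 z + rdot z w *+ 2 + n2 w.
Proof. by rewrite /n2 /rdot !ReImE; ring. Qed.
Lemma n2DB z w : n2 (z + w) <= 2 * n2 z + 2 * n2 w.
Proof.
rewrite n2D; have := n2_ge0 (z - w); rewrite n2D /rdot /n2 !ReImE; lra.
Qed.
Lemma rdot_n2 z w : `|rdot z w| <= n2 z + n2 w.
Proof.
have := n2_ge0 (z + w); have := n2_ge0 (z - w); have := n2_ge0 z; have := n2_ge0 w.
rewrite !n2D /rdot /n2 !ReImE ler_norml; lra.
Qed.
End complex_facts.

Section almost_everywhere.
Context {R : realType}.
Local Notation mu := (@lebesgue_measure R).
Implicit Types P Q S : R -> Prop.
Definition ae P : Prop := {ae mu, forall x, P x}.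
Let F := ae_filter_ringOfSetsType (@lebesgue_measure R).
Lemma aeS P Q : (forall x, P x -> Q x) -> ae P -> ae Q.
Proof. exact: (@filterS _ _ F). Qed.
Lemma aeS2 P Q S : (forall x, P x -> Q x -> S x) -> ae P -> ae Q -> ae S.
Proof. exact: (@filterS2 _ _ F). Qed.
Lemma aeS3 P Q S P' : (forall x, P x -> Q x -> S x -> P' x) -> ae P -> ae Q -> ae S -> ae P'.
Proof. exact: (@filterS3 _ _ F). Qed.
Lemma aeI P Q : ae P -> ae Q -> ae (fun x => P x /\ Q x).
Proof. by apply: aeS2. Qed.
Lemma aeW' P : (forall x, P x) -> ae P.
Proof. by move=> h; apply: aeW. Qed.
End almost_everywhere.

(** * Measurability and square integrability of complex functions *)

Section L2fun.
Context {R : realType}.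
Implicit Types (f g h : R -> R[i]) (c : R -> R).
Local Notation mu := (@lebesgue_measure R).
Local Notation cmod := (@ComplexField.Normc.normc R).

Lemma CmD f g : Cmeasurable f -> Cmeasurable g -> Cmeasurable (fun x => f x + g x).
Proof.
move=> [f1 f2] [g1 g2]; split.
  by under eq_fun do rewrite ReD; apply: measurable_funD.
by under eq_fun do rewrite ImD; apply: measurable_funD.
Qed.
Lemma CmM f g : Cmeasurable f -> Cmeasurable g -> Cmeasurable (fun x => f x * g x).
Proof.
move=> [f1 f2] [g1 g2]; split.
  by under eq_fun do rewrite ReM; apply: measurable_funB; apply: measurable_funM.
by under eq_fun do rewrite ImM; apply: measurable_funD; apply: measurable_funM.
Qed.
Lemma CmC c : measurable_fun setT c -> Cmeasurable (fun x => (c x)%:C).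
Proof. by move=> mc; split. Qed.
Lemma Cmcst (z : R[i]) : Cmeasurable (fun=> z).
Proof. by split; exact: measurable_cst. Qed.
Lemma CmJ f : Cmeasurable f -> Cmeasurable (fun x => (f x)^*).
Proof.
move=> [f1 f2]; split.
  by under eq_fun do rewrite ReJ.
by under eq_fun do rewrite ImJ; apply: measurableT_comp.
Qed.
Lemma CmN f : Cmeasurable f -> Cmeasurable (fun x => - f x).
Proof.
move=> [f1 f2]; split.
  by under eq_fun do rewrite ReN; apply: measurableT_comp.
by under eq_fun do rewrite ImN; apply: measurableT_comp.
Qed.
Lemma m_n2 f : Cmeasurable f -> measurable_fun setT (fun x => n2 (f x)).
Proof. by move=> [f1 f2]; apply: measurable_funD; apply: measurable_funX. Qed.
Lemma m_rdot f g : Cmeasurable f -> Cmeasurable g ->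
  measurable_fun setT (fun x => rdot (f x) (g x)).
Proof. by move=> [f1 f2] [g1 g2]; apply: measurable_funD; apply: measurable_funM. Qed.
Lemma m_cmod f : Cmeasurable f -> measurable_fun setT (fun x => cmod (f x)).
Proof.
move=> mf; under eq_fun do rewrite normc_sqrt -powR12_sqrt ?n2_ge0//.
by apply: (measurableT_comp (measurable_powR _)); exact: m_n2.
Qed.

Lemma L2normE f : L2norm f = ((\int[mu]_x (n2 (f x))%:E) `^ 2^-1)%E.
Proof.
rewrite /L2norm unlock; congr (poweR _ _); apply: eq_integral => x _; rewrite [(EFin \o _) x]/=.
rewrite abse_EFin.
by rewrite poweR_EFin ger0_norm ?normc_ge0'// powR_mulrn ?normc_ge0'// normc_sqr.
Qed.

Lemma L2P f : L2 f <-> Cmeasurable f /\ mu.-integrable setT (fun x => (n2 (f x))%:E).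
Proof.
split=> -[mf h]; split=> //.
  apply/integrableP; split.
    by apply/measurable_EFinP; exact: m_n2.
  under eq_integral do rewrite /= ger0_norm ?n2_ge0//.
  by move: h; rewrite L2normE => /lty_poweRy; apply; rewrite invr_eq0.
rewrite L2normE; apply: poweR_lty.
case/integrableP: h => _; under eq_integral do rewrite /= ger0_norm ?n2_ge0//.
by [].
Qed.

Lemma L2_n2int f : L2 f -> mu.-integrable setT (fun x => (n2 (f x))%:E).
Proof. by case/L2P. Qed.

Lemma ae_le_integral (p q : R -> R) : measurable_fun setT p -> measurable_fun setT q ->
  (forall x, 0 <= p x) -> (forall x, 0 <= q x) -> ae (fun x => p x <= q x) ->
  (\int[mu]_x (p x)%:E <= \int[mu]_x (q x)%:E)%E.
Proof.
move=> mp mq p0 q0 h; apply: ae_ge0_le_integral => //.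
- by move=> x _; rewrite lee_fin.
- exact/measurable_EFinP.
- by move=> x _; rewrite lee_fin.
- exact/measurable_EFinP.
- refine (@filterS _ _ (ae_filter_ringOfSetsType (@lebesgue_measure R)) _ _ _ h).
  by move=> x h' _; rewrite lee_fin.
Qed.

Lemma integrable_le (p q : R -> R) : measurable_fun setT p -> (forall x, `|p x| <= q x) ->
  mu.-integrable setT (EFin \o q) -> mu.-integrable setT (EFin \o p).
Proof.
move=> mp h iq; apply: (le_integrable _ _ _ iq) => //; first exact/measurable_EFinP.
by move=> x _ /=; rewrite lee_fin (le_trans (h x))// ler_norm.
Qed.

Lemma L2_le f g K : Cmeasurable f -> L2 g -> ae (fun x => n2 (f x) <= K * n2 (g x)) ->
  L2 f.
Proof.
move=> mf /L2P[mg ig] h; apply/L2P; split=> //.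
apply/integrableP; split; first by apply/measurable_EFinP; exact: m_n2.
have iKg : mu.-integrable setT (fun x => (`|K| * n2 (g x))%:E).
  by under eq_fun do rewrite EFinM; apply: integrableZl.
case/integrableP: iKg => mK; apply: le_lt_trans.
under eq_integral do rewrite abse_EFin ger0_norm ?n2_ge0//.
under [leRHS]eq_integral do rewrite abse_EFin ger0_norm ?mulr_ge0 ?n2_ge0//.
apply: ae_le_integral => //; first exact: m_n2.
- by apply: measurable_funM => //; exact: m_n2.
- by move=> x; exact: n2_ge0.
- by move=> x; rewrite mulr_ge0 ?n2_ge0.
- by move: h; apply: aeS => x /le_trans; apply; rewrite ler_wpM2r ?n2_ge0// ler_norm.
Qed.

Lemma L2D f g : L2 f -> L2 g -> L2 (fun x => f x + g x).
Proof.
move=> /L2P[mf lf] /L2P[mg lg].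
apply/L2P; split; first exact: CmD.
apply: (integrable_le (q := fun x => 2 * n2 (f x) + 2 * n2 (g x))) => //.
- by apply: m_n2; exact: CmD.
- by move=> x; rewrite ger0_norm ?n2_ge0 ?n2DB.
- have -> : (EFin \o (fun x => 2 * n2 (f x) + 2 * n2 (g x))) =
    ((fun x => 2%:E * (n2 (f x))%:E) \+ (fun x => 2%:E * (n2 (g x))%:E))%E.
    by apply/funext => x /=; rewrite EFinD !EFinM.
  by apply: integrableD => //; apply: integrableZl.
Qed.

Lemma L2_ae f g : Cmeasurable g -> L2 f -> ae_equal f g -> L2 g.
Proof.
move=> mg lf fg; apply: (L2_le (K := 1) mg lf).
by move: fg; apply: aeS => x <-; rewrite mul1r.
Qed.

Lemma L2Mb f (c : R -> R[i]) K : Cmeasurable c -> ae (fun x => n2 (c x) <= K) -> L2 f ->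
  L2 (fun x => c x * f x).
Proof.
move=> mc hc lf; apply: (L2_le (K := K) _ lf).
  by case: lf => mf _; exact: CmM.
by move: hc; apply: aeS => x h; rewrite n2M ler_wpM2r ?n2_ge0.
Qed.

Lemma L2Z (z : R[i]) f : L2 f -> L2 (fun x => z * f x).
Proof.
by move=> lf; apply: (L2Mb (Cmcst z) (K := n2 z) _ lf); apply: aeW'.
Qed.
Lemma L2N f : L2 f -> L2 (fun x => - f x).
Proof.
move=> lf; apply: (L2_le (K := 1) _ lf); first by case: lf => mf _; exact: CmN.
by apply: aeW' => x; rewrite mul1r /n2 !ReImE !sqrrN.
Qed.
Lemma L2J f : L2 f -> L2 (fun x => (f x)^*).
Proof.
move=> lf; apply: (L2_le (K := 1) _ lf); first by case: lf => mf _; exact: CmJ.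
by apply: aeW' => x; rewrite mul1r n2J.
Qed.
Lemma L20 : L2 (fun=> 0 : R[i]).
Proof.
apply/L2P; split; first exact: Cmcst.
by under eq_fun do rewrite n20; exact: integrable0.
Qed.

Lemma int_rdot f g : L2 f -> L2 g -> mu.-integrable setT (fun x => (rdot (f x) (g x))%:E).
Proof.
move=> /L2P[mf lf] /L2P[mg lg].
apply: (integrable_le (q := fun x => n2 (f x) + n2 (g x))) => //.
- exact: m_rdot.
- by move=> x; exact: rdot_n2.
- by apply: (integrableD _ lf lg).
Qed.

Lemma ae_eq_refl f : ae_equal f f. Proof. by apply: aeW'. Qed.
Lemma ae_eq_sym f g : ae_equal f g -> ae_equal g f.
Proof. by apply: aeS => x ->. Qed.
Lemma ae_eq_trans f g h : ae_equal f g -> ae_equal g h -> ae_equal f h.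
Proof. by apply: aeS2 => x -> ->. Qed.

End L2fun.

(* Elements of L^2 are encoded by one chosen representative per class, so that
   almost everywhere equality becomes Leibniz equality. *)
Definition crep {R : realType} (f : R -> R[i]) : R -> R[i] :=
  xget (fun=> 0) [set g | L2 g /\ ae_equal f g].

Record Hsp (R : realType) := MkHsp {
  hval :> R -> R[i];
  hvalP : L2 hval /\ crep hval = hval }.

HB.instance Definition _ (R : realType) := gen_eqMixin (Hsp R).
HB.instance Definition _ (R : realType) := gen_choiceMixin (Hsp R).

Lemma crepP {R : realType} (f : R -> R[i]) : L2 f -> L2 (crep f) /\ ae_equal f (crep f).
Proof.
move=> lf; rewrite /crep; case: xgetP => [g _ //|] /(_ f) []; split=> //; exact: ae_eq_refl.
Qed.
Lemma crep_ae {R : realType} (f g : R -> R[i]) : ae_equal f g -> crep f = crep g.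
Proof.
move=> fg; congr (xget _ _); apply/seteqP; split=> h /= [lh fh]; split=> //.
  exact: ae_eq_trans (ae_eq_sym fg) fh.
exact: ae_eq_trans fg fh.
Qed.
Lemma mk_subproof {R : realType} (f : R -> R[i]) : L2 f -> L2 (crep f) /\ crep (crep f) = crep f.
Proof.
by move=> /crepP[l e]; split=> //; apply: crep_ae; apply: ae_eq_sym.
Qed.
(* [mk] and [dot] are locked: otherwise unification unfolds them down to
   Lebesgue integrals. *)
HB.lock Definition mk {R : realType} (f : R -> R[i]) : Hsp R :=
  match pselect (L2 f) with
  | left h => MkHsp (mk_subproof h)
  | right _ => MkHsp (mk_subproof L20)
  end.
(* The real part of the L^2 pairing: the space is used as a real Hilbert space,
   on which multiplication by i is a skew isometry. *)
HB.lock Definition dot {R : realType} (u v : Hsp R) : R :=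
  \int[@lebesgue_measure R]_x rdot (u x) (v x).

(** * Vector space structure and real inner product on classes *)

Section Hsp_basic.
Context {R : realType}.
Implicit Types (f g h : R -> R[i]) (u v w : Hsp R).
Local Notation mu := (@lebesgue_measure R).

Lemma L2h u : L2 u. Proof. by case: (hvalP u). Qed.
Hint Resolve L2h : core.
Lemma eqH u v : ae_equal u v -> u = v.
Proof.
move=> uv; have E : hval u = hval v.
  by case: (hvalP u) => _ <-; case: (hvalP v) => _ <-; exact: crep_ae.
case: u v E uv => [u pu] [v pv] /= E _; rewrite E in pu *; congr MkHsp; exact: Prop_irrelevance.
Qed.

Lemma dotE u v : dot u v = \int[mu]_x rdot (u x) (v x).
Proof. by rewrite dot.unlock. Qed.
Lemma mkE f : L2 f -> ae_equal (mk f) f.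
Proof.
by rewrite mk.unlock; case: pselect => // h _ /=; apply: ae_eq_sym; case: (crepP h).
Qed.
Lemma mk_ae f g : L2 f -> L2 g -> ae_equal f g -> mk f = mk g.
Proof.
move=> lf lg fg; apply: eqH; apply: ae_eq_trans (mkE lf) _.
exact: ae_eq_trans fg (ae_eq_sym (mkE lg)).
Qed.
Lemma mkK u : mk u = u. Proof. exact/eqH/mkE. Qed.

Definition Hadd u v := mk (fun x => u x + v x).
Definition Hopp u := mk (fun x => - u x).
Definition Hscale (a : R) u := mk (fun x => a%:C * u x).
Definition Hzero : Hsp R := mk (fun=> 0).
Lemma HaddE u v : ae_equal (Hadd u v) (fun x => u x + v x).
Proof. by apply: mkE; exact: L2D. Qed.
Lemma HoppE u : ae_equal (Hopp u) (fun x => - u x).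
Proof. by apply: mkE; exact: L2N. Qed.
Lemma HscaleE a u : ae_equal (Hscale a u) (fun x => a%:C * u x).
Proof. by apply: mkE; exact: L2Z. Qed.
Lemma HzeroE : ae_equal Hzero (fun=> 0).
Proof. by apply: mkE; exact: L20. Qed.

Lemma HaddA : associative Hadd.
Proof.
move=> u v w; apply: eqH.
apply: aeS (aeI (aeI (HaddE u (Hadd v w)) (HaddE v w))
  (aeI (HaddE (Hadd u v) w) (HaddE u v))) => x [[-> ->] [-> ->]].
by rewrite addrA.
Qed.
Lemma HaddC : commutative Hadd.
Proof.
move=> u v; apply: eqH; apply: aeS2 (HaddE u v) (HaddE v u) => x -> ->.
by rewrite addrC.
Qed.
Lemma Hadd0 : left_id Hzero Hadd.
Proof.
move=> u; apply: eqH; apply: aeS2 (HaddE Hzero u) HzeroE => x -> ->.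
by rewrite add0r.
Qed.
Lemma HaddN : left_inverse Hzero Hopp Hadd.
Proof.
move=> u; apply: eqH; apply: aeS3 (HaddE (Hopp u) u) HzeroE (HoppE u) => x -> -> ->.
by rewrite addNr.
Qed.
HB.instance Definition _ := GRing.isZmodule.Build (Hsp R) HaddA HaddC Hadd0 HaddN.

Lemma HscaleA a b u : Hscale a (Hscale b u) = Hscale (a * b) u.
Proof.
apply: eqH; apply: aeS3 (HscaleE a (Hscale b u)) (HscaleE b u) (HscaleE (a * b) u) => x -> -> ->.
by rewrite mulrA rmorphM.
Qed.
Lemma Hscale1 : left_id 1 Hscale.
Proof. by move=> u; apply: eqH; apply: aeS (HscaleE 1 u) => x ->; rewrite mul1r. Qed.
Lemma HscaleDr : right_distributive Hscale +%R.
Proof.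
move=> a u v; apply: eqH.
apply: aeS (aeI (aeI (HscaleE a (u + v)) (HaddE u v))
  (aeI (HaddE (Hscale a u) (Hscale a v)) (aeI (HscaleE a u) (HscaleE a v)))) =>
  x [[-> ->] [-> [-> ->]]].
by rewrite mulrDr.
Qed.
Lemma HscaleDl v : {morph Hscale^~ v : a b / a + b}.
Proof.
move=> a b; apply: eqH.
apply: aeS (aeI (HscaleE (a + b) v)
  (aeI (HaddE (Hscale a v) (Hscale b v)) (aeI (HscaleE a v) (HscaleE b v)))) =>
  x [-> [-> [-> ->]]].
by rewrite -mulrDl rmorphD.
Qed.
HB.instance Definition _ :=
  GRing.Zmodule_isLmodule.Build R (Hsp R) HscaleA Hscale1 HscaleDr HscaleDl.

Lemma hD u v : ae_equal (u + v) (fun x => u x + v x). Proof. exact: HaddE. Qed.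
Lemma hN u : ae_equal (- u) (fun x => - u x). Proof. exact: HoppE. Qed.
Lemma hZ a u : ae_equal (a *: u) (fun x => a%:C * u x). Proof. exact: HscaleE. Qed.
Lemma h0 : ae_equal (0 : Hsp R) (fun=> 0). Proof. exact: HzeroE. Qed.
Lemma hB u v : ae_equal (u - v) (fun x => u x - v x).
Proof. by apply: aeS2 (hD u (- v)) (hN v) => x -> ->. Qed.

Lemma dotC u v : dot u v = dot v u.
Proof. by rewrite !dotE; apply: eq_Rintegral => x _; rewrite /rdot; ring. Qed.

Lemma Rint_ae (p q : R -> R) : measurable_fun setT p -> measurable_fun setT q ->
  ae (fun x => p x = q x) -> \int[mu]_x p x = \int[mu]_x q x.
Proof.
move=> mp mq h; congr fine; apply: ae_eq_integral => //.
- exact/measurable_EFinP.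
- exact/measurable_EFinP.
- by apply: aeS h => x -> _.
Qed.

Lemma dot_ae u v f g : Cmeasurable f -> Cmeasurable g -> ae_equal u f -> ae_equal v g ->
  dot u v = \int[mu]_x rdot (f x) (g x).
Proof.
move=> mf mg uf vg; rewrite dotE; apply: Rint_ae.
- by apply: m_rdot; [case: (L2h u)|case: (L2h v)].
- exact: m_rdot.
- by apply: aeS2 uf vg => x -> ->.
Qed.
Lemma Cmh u : Cmeasurable u. Proof. by case: (L2h u). Qed.
Hint Resolve Cmh : core.

Lemma dotDl u v w : dot (u + v) w = dot u w + dot v w.
Proof.
rewrite (dot_ae (CmD (Cmh u) (Cmh v)) (Cmh w) (hD u v) (ae_eq_refl w)).
rewrite !dotE -RintegralD //.
- by apply: eq_Rintegral => x _; rewrite /rdot !ReImE; ring.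
- exact: int_rdot.
- exact: int_rdot.
Qed.
Lemma dotZl a u w : dot (a *: u) w = a * dot u w.
Proof.
rewrite (dot_ae (CmM (Cmcst _) (Cmh u)) (Cmh w) (hZ a u) (ae_eq_refl w)).
rewrite !dotE -RintegralZl //; last exact: int_rdot.
by apply: eq_Rintegral => x _; rewrite /rdot !ReImE; ring.
Qed.
Lemma dotNl u w : dot (- u) w = - dot u w.
Proof. by rewrite -scaleN1r dotZl mulN1r. Qed.
Lemma dotBl u v w : dot (u - v) w = dot u w - dot v w.
Proof. by rewrite dotDl dotNl. Qed.
Lemma dotDr u v w : dot w (u + v) = dot w u + dot w v.
Proof. by rewrite dotC dotDl !(dotC w). Qed.
Lemma dotZr a u w : dot w (a *: u) = a * dot w u.
Proof. by rewrite dotC dotZl (dotC w). Qed.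
Lemma dotNr u w : dot w (- u) = - dot w u.
Proof. by rewrite dotC dotNl (dotC w). Qed.
Lemma dotBr u v w : dot w (u - v) = dot w u - dot w v.
Proof. by rewrite dotC dotBl !(dotC w). Qed.
Lemma dot0l w : dot 0 w = 0.
Proof. by rewrite -(scale0r 0) dotZl mul0r. Qed.
Lemma dot0r w : dot w 0 = 0.
Proof. by rewrite dotC dot0l. Qed.
Lemma dotuu u : dot u u = \int[mu]_x n2 (u x).
Proof. by rewrite dotE; apply: eq_Rintegral => x _; rewrite /rdot /n2; ring. Qed.
Lemma dot_ge0 u : 0 <= dot u u.
Proof. by rewrite dotuu; apply: Rintegral_ge0 => x _; exact: n2_ge0. Qed.
Lemma dot_eq0 u : dot u u = 0 -> u = 0.
Proof.
rewrite dotuu /Rintegral => h.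
have h2 : (\int[mu]_x `|(n2 (u x))%:E| = 0)%E.
  under eq_integral do rewrite abse_EFin ger0_norm ?n2_ge0//.
  rewrite -[LHS]fineK ?h//; apply: integrable_fin_num => //; exact: L2_n2int.
have mn : measurable_fun setT (fun x => (n2 (u x))%:E).
  by apply/measurable_EFinP; apply: m_n2.
have [/(_ h2) h3 _] := ae_eq_integral_abs mu measurableT mn.
by apply: eqH; apply: aeS2 h3 h0 => x /(_ I) [/n2_eq0 ->] ->.
Qed.

End Hsp_basic.

Section norm.
Context {R : realType}.
Implicit Types (u v w : Hsp R).
Local Notation mu := (@lebesgue_measure R).
Hint Resolve L2h Cmh : core.

Definition hnorm u : R := Num.sqrt (dot u u).
Lemma CS_sqr u v : dot u v ^+ 2 <= dot u u * dot v v.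
Proof.
have [v0|v0] := eqVneq (dot v v) 0.
  by rewrite (dot_eq0 v0) !dot0r expr0n mulr0.
have vp : 0 < dot v v by rewrite lt_neqAle eq_sym v0 dot_ge0.
have := mulr_ge0 (ltW vp) (dot_ge0 (u - (dot u v / dot v v) *: v)).
rewrite dotBl !dotBr !dotZl !dotZr (dotC v u) => h.
rewrite -subr_ge0; apply: le_trans h _; rewrite le_eqVlt; apply/orP; left; apply/eqP.
by field.
Qed.
Lemma CS u v : `|dot u v| <= hnorm u * hnorm v.
Proof.
by rewrite -sqrtr_sqr -sqrtrM ?dot_ge0// ler_wsqrtr// CS_sqr.
Qed.
Lemma hnorm_sqr u : hnorm u ^+ 2 = dot u u.
Proof. by rewrite sqr_sqrtr// dot_ge0. Qed.
Lemma hnormD u v : hnorm (u + v) <= hnorm u + hnorm v.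
Proof.
rewrite -(ler_pXn2r (n := 2))// ?nnegrE ?addr_ge0 ?sqrtr_ge0//.
rewrite hnorm_sqr dotDl !dotDr (dotC v u) sqrrD !hnorm_sqr mulr2n.
have := le_trans (ler_norm _) (CS u v); lra.
Qed.
Lemma hnormZ a u : hnorm (a *: u) = `|a| * hnorm u.
Proof.
by rewrite /hnorm dotZl dotZr mulrA -expr2 sqrtrM ?sqr_ge0// sqrtr_sqr.
Qed.
Lemma hnorm0_eq0 u : hnorm u = 0 -> u = 0.
Proof. by move=> h; apply: dot_eq0; rewrite -hnorm_sqr h expr0n. Qed.
End norm.

HB.instance Definition _ (R : realType) := isPointed.Build (Hsp R) 0.
HB.instance Definition _ (R : realType) :=
  @Lmodule_isNormed.Build R (Hsp R) hnorm hnormD hnormZ hnorm0_eq0.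

Section norm_theory.
Context {R : realType}.
Implicit Types (u v w : Hsp R) (c : R -> R[i]).
Local Notation mu := (@lebesgue_measure R).
Local Notation cmod := (@ComplexField.Normc.normc R).
Hint Resolve L2h Cmh : core.

Lemma nrmE u : `|u| = Num.sqrt (dot u u). Proof. by []. Qed.
Lemma nrm_sqr u : `|u| ^+ 2 = dot u u. Proof. exact: hnorm_sqr. Qed.
Lemma dot_le u v : `|dot u v| <= `|u| * `|v|. Proof. exact: CS. Qed.
Lemma dot_le' u v : dot u v <= `|u| * `|v|.
Proof. exact: le_trans (ler_norm _) (dot_le _ _). Qed.

Lemma L2norm_h u : L2norm u = (`|u|)%:E.
Proof.
rewrite L2normE nrmE dotuu /Rintegral.
have h : (\int[mu]_x (n2 (u x))%:E)%E \is a fin_num.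
  by apply: integrable_fin_num => //; exact: L2_n2int.
rewrite -[in LHS](fineK h) poweR_EFin powR12_sqrt//.
by apply: fine_ge0; apply: integral_ge0 => x _; rewrite lee_fin n2_ge0.
Qed.
Lemma L2norm_ae (f g : R -> R[i]) : Cmeasurable f -> Cmeasurable g -> ae_equal f g ->
  L2norm f = L2norm g.
Proof.
move=> mf mg h; rewrite !L2normE; congr (poweR _ _); apply: ae_eq_integral => //.
- by apply/measurable_EFinP; apply: m_n2.
- by apply/measurable_EFinP; apply: m_n2.
- by apply: aeS h => x -> _.
Qed.
Lemma L2norm_mk (f : R -> R[i]) : L2 f -> L2norm f = (`|mk f|)%:E.
Proof.
move=> lf; rewrite -L2norm_h; apply: L2norm_ae => //; first by case: lf.
by apply: ae_eq_sym; exact: mkE.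
Qed.

Lemma dot_mk (f g : R -> R[i]) : L2 f -> L2 g -> dot (mk f) (mk g) = \int[mu]_x rdot (f x) (g x).
Proof.
move=> lf lg; apply: dot_ae; [by case: lf|by case: lg|exact: mkE|exact: mkE].
Qed.

Lemma nrm_le_ae u v K : 0 <= K -> ae (fun x => n2 (u x) <= K ^+ 2 * n2 (v x)) -> `|u| <= K * `|v|.
Proof.
move=> K0 h; rewrite -(ler_pXn2r (n := 2))// ?nnegrE ?mulr_ge0//.
rewrite exprMn !nrm_sqr !dotuu -RintegralZl//; last exact: L2_n2int.
have i1 := L2_n2int (L2h u); have i2 := L2_n2int (L2h v).
have i3 : mu.-integrable setT (EFin \o (fun x => K ^+ 2 * n2 (v x))).
  by have := integrableZl measurableT (K ^+ 2) i2; apply: eq_integrable.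
apply: fine_le; [exact: integrable_fin_num|exact: integrable_fin_num|].
apply: ae_le_integral => //.
- exact: m_n2.
- by apply: measurable_funM => //; exact: m_n2.
- by move=> x; exact: n2_ge0.
- by move=> x; rewrite mulr_ge0 ?n2_ge0 ?sqr_ge0.
Qed.

(** The bound is essential, and [c] is a plain function: potentials and weights act as multipliers
    without being square integrable. *)
Definition bd (K : R) c := [/\ Cmeasurable c, 0 <= K & ae (fun x => n2 (c x) <= K ^+ 2)].
Definition mulf c u : Hsp R := mk (fun x => c x * u x).
Lemma bdL2 K c u : bd K c -> L2 (fun x => c x * u x).
Proof. by move=> [mc K0 h]; apply: (L2Mb mc h). Qed.
Lemma mulfE K c u : bd K c -> ae_equal (mulf c u) (fun x => c x * u x).
Proof. by move=> h; apply/mkE/(bdL2 _ h). Qed.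
Lemma mulf_le K c u : bd K c -> `|mulf c u| <= K * `|u|.
Proof.
move=> h; have [mc K0 hc] := h; apply: nrm_le_ae => //.
apply: aeS2 (mulfE u h) hc => x -> hx.
by rewrite n2M ler_wpM2r// n2_ge0.
Qed.
Lemma mulfD K c u v : bd K c -> mulf c (u + v) = mulf c u + mulf c v.
Proof.
move=> h; apply: eqH.
apply: aeS (aeI (aeI (mulfE (u + v) h) (hD u v)) (aeI (hD (mulf c u) (mulf c v))
  (aeI (mulfE u h) (mulfE v h)))) => x [[-> ->] [-> [-> ->]]].
by rewrite mulrDr.
Qed.
Lemma mulfZ K c a u : bd K c -> mulf c (a *: u) = a *: mulf c u.
Proof.
move=> h; apply: eqH.
apply: aeS (aeI (aeI (mulfE (a *: u) h) (hZ a u)) (aeI (hZ a (mulf c u)) (mulfE u h)))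
  => x [[-> ->] [-> ->]].
by rewrite mulrCA.
Qed.
Lemma mulfN K c u : bd K c -> mulf c (- u) = - mulf c u.
Proof. by move=> h; rewrite -scaleN1r (mulfZ _ _ h) scaleN1r. Qed.
Lemma mulfB K c u v : bd K c -> mulf c (u - v) = mulf c u - mulf c v.
Proof. by move=> h; rewrite (mulfD _ _ h) (mulfN _ h). Qed.
Lemma dot_mulf K c u v : bd K c -> dot (mulf c u) v = dot u (mulf (fun x => (c x)^*) v).
Proof.
move=> h; have [mc K0 hc] := h.
have h' : bd K (fun x => (c x)^*).
  split=> //; first exact: CmJ.
  by apply: aeS hc => x; rewrite n2J.
rewrite (dot_ae _ _ (mulfE u h) (ae_eq_refl v))//; last exact: CmM.
rewrite (dot_ae _ _ (ae_eq_refl u) (mulfE v h'))//; last by apply: CmM => //; exact: CmJ.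
by rewrite ?dotE; apply: eq_Rintegral => x _; rewrite /rdot !ReImE; ring.
Qed.
Lemma bdM K c K' c' : bd K c -> bd K' c' -> bd (K * K') (fun x => c x * c' x).
Proof.
move=> [mc K0 hc] [mc' K0' hc']; split; [exact: CmM|exact: mulr_ge0|].
by apply: aeS2 hc hc' => x h h'; rewrite n2M exprMn ler_pM ?n2_ge0.
Qed.
Lemma bdJ K c : bd K c -> bd K (fun x => (c x)^*).
Proof.
by move=> [mc K0 hc]; split=> //; [exact: CmJ|apply: aeS hc => x; rewrite n2J].
Qed.
Lemma bdcst (z : R[i]) : bd (cmod z) (fun=> z).
Proof.
by split; [exact: Cmcst|exact: normc_ge0'|apply: aeW' => x; rewrite normc_sqr].
Qed.
Lemma n2_sqrt_le (z : R[i]) (K : R) : 0 <= K -> (n2 z <= K ^+ 2) = (cmod z <= K).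
Proof.
by move=> K0; rewrite -normc_sqr ler_pXn2r// ?nnegrE// normc_ge0'.
Qed.
Lemma bdD K c K' c' : bd K c -> bd K' c' -> bd (K + K') (fun x => c x + c' x).
Proof.
move=> [mc K0 hc] [mc' K0' hc']; split; [exact: CmD|exact: addr_ge0|].
apply: aeS2 hc hc' => x; rewrite !n2_sqrt_le ?addr_ge0// => h h'.
exact: le_trans (le_normcD _ _) (lerD h h').
Qed.
Lemma bd_le K K' c : K <= K' -> bd K c -> bd K' c.
Proof.
move=> KK [mc K0 hc]; split=> //; first exact: le_trans KK.
by apply: aeS hc => x /le_trans; apply; rewrite ler_pXn2r// nnegrE// (le_trans K0).
Qed.
Lemma bd_ae K c c' : Cmeasurable c' -> ae_equal c c' -> bd K c -> bd K c'.
Proof. by move=> mc' e [mc K0 hc]; split=> //; apply: aeS2 e hc => x ->. Qed.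
Lemma mulf_ae K c c' u : bd K c -> Cmeasurable c' -> ae_equal c c' -> mulf c u = mulf c' u.
Proof.
move=> h mc' e; apply: mk_ae; [exact: bdL2 h|exact: bdL2 (bd_ae mc' e h)|].
by apply: aeS e => x ->.
Qed.
Lemma mulf_comp K c K' c' u : bd K c -> bd K' c' ->
  mulf c (mulf c' u) = mulf (fun x => c x * c' x) u.
Proof.
move=> h h'; apply: eqH.
apply: aeS (aeI (mulfE (mulf c' u) h) (aeI (mulfE u h') (mulfE u (bdM h h')))) => x [-> [-> ->]].
by rewrite mulrA.
Qed.

Definition J u := mulf (fun=> 'i) u.
Lemma bdi : bd 1 (fun=> 'i : R[i]).
Proof.
by have := bdcst 'i; rewrite normc_sqrt n2i sqrtr1.
Qed.
Lemma JE u : ae_equal (J u) (fun x => 'i * u x). Proof. exact: mulfE bdi. Qed.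
Lemma JD u v : J (u + v) = J u + J v. Proof. exact: mulfD bdi. Qed.
Lemma JZ a u : J (a *: u) = a *: J u. Proof. exact: mulfZ bdi. Qed.
Lemma JN u : J (- u) = - J u. Proof. exact: mulfN bdi. Qed.
Lemma JB u v : J (u - v) = J u - J v. Proof. by rewrite JD JN. Qed.
Lemma J0 : J 0 = 0. Proof. by rewrite -(scale0r 0) JZ !scale0r. Qed.
Lemma dotJJ u v : dot (J u) (J v) = dot u v.
Proof.
rewrite (dot_ae _ _ (JE u) (JE v)); [|by apply: CmM => //; exact: Cmcst..].
by rewrite ?dotE; apply: eq_Rintegral => x _; rewrite /rdot !ReImE; ring.
Qed.
Lemma JJ u : J (J u) = - u.
Proof.
apply: eqH; apply: aeS (aeI (JE (J u)) (aeI (JE u) (hN u))) => x [-> [-> ->]].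
by rewrite mulrA -expr2 sqr_i mulN1r.
Qed.
Lemma dotJl u v : dot (J u) v = - dot u (J v).
Proof. by rewrite -dotJJ JJ dotNl. Qed.
Lemma nrmJ u : `|J u| = `|u|. Proof. by rewrite !nrmE dotJJ. Qed.
Lemma mulfJ K c u : bd K c -> mulf c (J u) = J (mulf c u).
Proof.
move=> h; rewrite /J (mulf_comp _ h bdi) (mulf_comp _ bdi h).
by congr mk; apply/funext => x; congr (_ * _); rewrite mulrC.
Qed.

Definition cj u : Hsp R := mk (fun x => (u x)^*).
Lemma cjE u : ae_equal (cj u) (fun x => (u x)^*). Proof. by apply: mkE; exact: L2J. Qed.
Lemma cjD u v : cj (u + v) = cj u + cj v.
Proof.
apply: eqH; apply: aeS (aeI (aeI (cjE (u + v)) (hD u v))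
  (aeI (hD (cj u) (cj v)) (aeI (cjE u) (cjE v)))) => x [[-> ->] [-> [-> ->]]].
by rewrite rmorphD.
Qed.
Lemma cjZ a u : cj (a *: u) = a *: cj u.
Proof.
apply: eqH; apply: aeS (aeI (aeI (cjE (a *: u)) (hZ a u))
  (aeI (hZ a (cj u)) (cjE u))) => x [[-> ->] [-> ->]].
by apply: cplx_eq; rewrite !ReImE; ring.
Qed.
Lemma cjN u : cj (- u) = - cj u. Proof. by rewrite -scaleN1r cjZ scaleN1r. Qed.
Lemma cjB u v : cj (u - v) = cj u - cj v. Proof. by rewrite cjD cjN. Qed.
Lemma cjK u : cj (cj u) = u.
Proof. by apply: eqH; apply: aeS2 (cjE (cj u)) (cjE u) => x -> ->; apply: conjCK. Qed.
Lemma dotcj u v : dot (cj u) (cj v) = dot u v.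
Proof.
rewrite (dot_ae _ _ (cjE u) (cjE v)); [|exact: CmJ..].
by rewrite ?dotE; apply: eq_Rintegral => x _; rewrite /rdot !ReImE; ring.
Qed.
Lemma nrmcj u : `|cj u| = `|u|. Proof. by rewrite !nrmE dotcj. Qed.
Lemma dotcjl u v : dot (cj u) v = dot u (cj v).
Proof. by rewrite -dotcj cjK. Qed.
Lemma cjJ u : cj (J u) = - J (cj u).
Proof.
apply: eqH; apply: aeS (aeI (aeI (cjE (J u)) (JE u))
  (aeI (hN (J (cj u))) (aeI (JE (cj u)) (cjE u)))) => x [[-> ->] [-> [-> ->]]].
by apply: cplx_eq; rewrite !ReImE; ring.
Qed.
End norm_theory.

(** * Completeness of L^2 *)

Section complete.
Context {R : realType}.
Implicit Types (u v w : Hsp R) (c : R -> R[i]).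
Local Notation mu := (@lebesgue_measure R).
Local Notation cmod := (@ComplexField.Normc.normc R).
Hint Resolve L2h Cmh : core.

Lemma hsum (d : nat -> Hsp R) (N : nat) :
  ae_equal (\sum_(n < N) d n) (fun x => \sum_(n < N) d n x).
Proof.
elim: N => [|N IH].
  by rewrite big_ord0; apply: aeS (@h0 R) => x ->; rewrite big_ord0.
rewrite big_ord_recr /=; apply: aeS2 IH (hD (\sum_(n < N) d n) (d N)) => x h ->.
by rewrite big_ord_recr /= h.
Qed.

Lemma abs_Re (z : R[i]) : `|complex.Re z| <= cmod z.
Proof.
by rewrite normc_sqrt -sqrtr_sqr ler_wsqrtr// /n2 lerDl sqr_ge0.
Qed.
Lemma abs_Im (z : R[i]) : `|complex.Im z| <= cmod z.
Proof.
by rewrite normc_sqrt -sqrtr_sqr ler_wsqrtr// /n2 lerDr sqr_ge0.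
Qed.

Lemma geo_sum (N : nat) : \sum_(n < N) (2^-1 : R) ^+ n <= 2.
Proof.
have -> : \sum_(n < N) (2^-1 : R) ^+ n = 2 - 2 * 2^-1 ^+ N.
  elim: N => [|N IH]; first by rewrite big_ord0 expr0 mulr1 subrr.
  by rewrite big_ord_recr /= IH exprS; field.
by rewrite gerBl mulr_ge0 // exprn_ge0.
Qed.

Lemma cvg_of_abs_summable (a : nat -> R) (b : nat -> R) (B : R) :
  (forall n, `|a n.+1 - a n| <= b n) -> (forall N, \sum_(n < N) b n <= B) -> cvgn a.
Proof.
move=> hab hB.
have b0 n : 0 <= b n by exact: le_trans (hab n).
have h : cvgn (series (fun n => `|a n.+1 - a n|)).
  apply: nondecreasing_is_cvgn.
    by apply/nondecreasing_seqP => n; rewrite /series [leRHS]big_nat_recr//= lerDl.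
  exists B => _ [n _ <-]; rewrite /series /= big_mkord.
  by apply: le_trans (hB n); apply: ler_sum => i _.
have hc := @normed_cvg R R^o (fun n => a n.+1 - a n) h.
have -> : a = (fun n => a 0%N + series (fun n => a n.+1 - a n) n).
  apply/funext => n; rewrite /series /= big_mkord.
  elim: n => [|n IH]; first by rewrite big_ord0 addr0.
  by rewrite big_ord_recr /= addrA -IH; ring.
by apply: is_cvgD => //; apply: is_cvg_cst.
Qed.

(** The sum of the moduli of the increments has L^2 norm at most 2. Monotone convergence makes it
    finite almost everywhere, so the sequence converges there, and Fatou's lemma bounds the distance
    to the limit. The explicit rate serves the projection theorem as well. *)
Lemma Riesz_Fischer_seq (x : nat -> Hsp R) :
  (forall n, `|x n.+1 - x n| <= 2^-1 ^+ n) ->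
  exists l, forall n, `|l - x n| <= 2 * 2^-1 ^+ n.
Proof.
move=> hx; pose d n := x n.+1 - x n.
have L2abs n : L2 (fun y => (cmod (d n y))%:C).
  apply: (L2_le (K := 1) _ (L2h (d n))); first by apply: CmC; exact: m_cmod.
  by apply: aeW' => y; rewrite n2C normc_sqr mul1r.
pose a n := mk (fun y => (cmod (d n y))%:C).
have na n : `|a n| <= 2^-1 ^+ n.
  apply: le_trans (hx n); rewrite -[X in _ <= X]mul1r; apply: nrm_le_ae => //.
  by apply: aeS (mkE (L2abs n)) => y ->; rewrite n2C normc_sqr expr1n mul1r.
pose s N := \sum_(n < N) a n.
have ns N : `|s N| <= 2.
  apply: le_trans (geo_sum N); apply: le_trans (ler_norm_sum _ _ _) _.
  by apply: ler_sum => i _; exact: na.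
pose S N y := \sum_(n < N) cmod (d n y).
have S0 N y : 0 <= S N y by apply: sumr_ge0 => i _; exact: normc_ge0'.
have mS N : measurable_fun setT (S N).
  apply: measurable_sum => n; exact: m_cmod.
have sS N : ae (fun y => n2 (s N y) = (S N y) ^+ 2).
  have := aeS2 _ (hsum a N) (ae_foralln (fun n => mkE (L2abs n))); apply => y -> h.
  rewrite -n2C; congr n2; rewrite /S rmorph_sum; apply: eq_bigr => i _; exact: h.
have iS N : (\int[mu]_y ((S N y) ^+ 2)%:E <= 4%:E)%E.
  have -> : (\int[mu]_y ((S N y) ^+ 2)%:E = (dot (s N) (s N))%:E)%E.
    rewrite dotuu /Rintegral fineK; last by apply: integrable_fin_num => //; exact: L2_n2int.
    apply: ae_eq_integral => //.
    - by apply/measurable_EFinP; apply: measurable_funX; exact: mS.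
    - by apply/measurable_EFinP; apply: m_n2.
    - by apply: aeS (sS N) => y -> _.
  rewrite lee_fin -nrm_sqr (_ : 4 = 2 ^+ 2); last by rewrite -natrX.
  by rewrite ler_pXn2r ?nnegrE// ns.
have bS : ae (fun y => exists B, forall N, S N y <= B).
  have mono y : {homo (fun N => ((S N y) ^+ 2)%:E) : n m / (n <= m)%N >-> (n <= m)%E}.
    apply: homo_leq => [e|e1 e2 e3|n]; [exact: lexx|exact: le_trans|]; rewrite lee_fin ler_pXn2r ?nnegrE//.
    by rewrite /S big_ord_recr /= lerDl normc_ge0'.
  have mS2 N : measurable_fun setT (fun y => ((S N y) ^+ 2)%:E).
    by apply/measurable_EFinP; apply: measurable_funX; exact: mS.
  have int_lim : (\int[mu]_y limn (fun N => ((S N y) ^+ 2)%:E) <= 4%:E)%E.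
    rewrite (monotone_convergence mu measurableT mS2)//; last first.
      by move=> n y _; rewrite lee_fin sqr_ge0.
    apply: lime_le; last by apply: nearW => n; exact: iS.
    apply: ereal_nondecreasing_is_cvgn => m n mn; apply: ge0_le_integral => //;
      first [exact: mS2|by move=> y _; rewrite lee_fin sqr_ge0|by move=> y _; exact: mono].
  have mlim : measurable_fun setT (fun y => limn (fun N => ((S N y) ^+ 2)%:E)).
    apply: (emeasurable_fun_cvg (fun N y => ((S N y) ^+ 2)%:E)) => // y _.
    exact: ereal_nondecreasing_is_cvgn.
  have lim0 y : (0 <= limn (fun N => ((S N y) ^+ 2)%:E))%E.
    apply: lime_ge; first exact: ereal_nondecreasing_is_cvgn.
    by apply: nearW => n; rewrite lee_fin sqr_ge0.
  have ilim : mu.-integrable setT (fun y => limn (fun N => ((S N y) ^+ 2)%:E)).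
    apply/integrableP; split => //.
    under eq_integral do rewrite gee0_abs//.
    exact: le_lt_trans int_lim (ltry _).
  apply: aeS (integrable_ae measurableT ilim) => y /(_ I) hf.
  exists (1 + fine (limn (fun N => ((S N y) ^+ 2)%:E))) => N.
  have : (((S N y) ^+ 2)%:E <= limn (fun N => ((S N y) ^+ 2)%:E))%E.
    apply: lime_ge; first exact: ereal_nondecreasing_is_cvgn.
    by exists N => // n /= Nn; exact: mono.
  rewrite -[X in (_ <= X)%E](fineK hf) lee_fin.
  set c := fine _; have := S0 N y; nra.
have dx : ae (fun y => forall n, d n y = x n.+1 y - x n y).
  by apply: ae_foralln => n; exact: hB.
(* Upper limits followed by [fine] give a function that is measurable and defined everywhere; off a
   null set it is the pointwise limit. *)
pose l0 y : R[i] := fine (limn_esup (fun n => (complex.Re (x n y))%:E)) +i*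
  fine (limn_esup (fun n => (complex.Im (x n y))%:E)).
have ml0 : Cmeasurable l0.
  split; apply: measurableT_comp => //; apply: measurable_fun_limn_esup => n;
    apply/measurable_EFinP; by case: (Cmh (x n)).
have cl0 : ae (fun y => (fun n => complex.Re (x n y)) @ \oo --> complex.Re (l0 y) /\
   (fun n => complex.Im (x n y)) @ \oo --> complex.Im (l0 y)).
  apply: aeS2 bS dx => y [B hB] hd.
  have cR : cvgn (fun n => complex.Re (x n y)).
    apply: (cvg_of_abs_summable (b := fun n => cmod (d n y)) _ hB) => n.
    by rewrite /= hd -ReN -ReD; exact: abs_Re.
  have cI : cvgn (fun n => complex.Im (x n y)).
    apply: (cvg_of_abs_summable (b := fun n => cmod (d n y)) _ hB) => n.
    by rewrite /= hd -ImN -ImD; exact: abs_Im.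
  split.
    have h : (complex.Re (x n y))%:E @[n --> \oo] --> (limn (fun n => complex.Re (x n y)))%:E.
      by apply/fine_cvgP; split; [exact: nearW|exact: cR].
    by rewrite /l0 /= (cvg_limn_einf_sup h).2.
  have h : (complex.Im (x n y))%:E @[n --> \oo] --> (limn (fun n => complex.Im (x n y)))%:E.
    by apply/fine_cvgP; split; [exact: nearW|exact: cI].
  by rewrite /l0 /= (cvg_limn_einf_sup h).2.
have xx n m : (n <= m)%N -> `|x m - x n| <= 2 * 2^-1 ^+ n.
  move=> nm; rewrite -(subnKC nm); set k := (m - n)%N.
  have : `|x (n + k)%N - x n| <= \sum_(i < k) 2^-1 ^+ (n + i).
    elim: k => [|k IH]; first by rewrite addn0 subrr normr0 big_ord0.
    rewrite big_ord_recr /= addnS -(subrKA (x (n + k)%N)) addrC.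
    by apply: le_trans (ler_normD _ _) _; apply: lerD.
  move/le_trans; apply; under eq_bigr do rewrite exprD.
  by rewrite -mulr_sumr mulrC ler_wpM2r ?exprn_ge0 ?geo_sum.
have key n : L2 (fun y => l0 y - x n y) /\
    (\int[mu]_y (n2 (l0 y - x n y))%:E <= ((2 * 2^-1 ^+ n) ^+ 2)%:E)%E.
  have mm : Cmeasurable (fun y => l0 y - x n y) by apply: CmD => //; exact: CmN.
  have mxx m : Cmeasurable (fun y => x m y - x n y) by apply: CmD => //; exact: CmN.
  suff h : (\int[mu]_y (n2 (l0 y - x n y))%:E <= ((2 * 2^-1 ^+ n) ^+ 2)%:E)%E.
    split=> //; apply/L2P; split=> //; apply/integrableP; split.
      by apply/measurable_EFinP; exact: m_n2.
    under eq_integral do rewrite abse_EFin ger0_norm ?n2_ge0//.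
    exact: le_lt_trans h (ltry _).
  have mf m : measurable_fun setT (fun y => (n2 (x m y - x n y))%:E).
    by apply/measurable_EFinP; exact: m_n2.
  have -> : (\int[mu]_y (n2 (l0 y - x n y))%:E =
      \int[mu]_y limn_einf (fun m => (n2 (x m y - x n y))%:E))%E.
    apply: ae_eq_integral => //.
    - by apply/measurable_EFinP; exact: m_n2.
    - have -> : (fun y => limn_einf (fun m => (n2 (x m y - x n y))%:E)) =
        (fun y => - limn_esup (fun m => - (n2 (x m y - x n y))%:E))%E.
        apply/funext => y; rewrite -limn_einfN; congr limn_einf.
        by apply/funext => m /=; rewrite opprK.
      apply: measurableT_comp => //; apply: measurable_fun_limn_esup => m.
      apply: (measurableT_comp _ (mf m)) => //.
    - apply: aeS cl0 => y [hR hI] _; apply/esym.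
      apply: (cvg_limn_einf_sup _).1; apply/fine_cvgP; split; first exact: nearW.
      rewrite /n2 !ReImE; under eq_fun do rewrite /= !ReImE.
      have sq (b : nat -> R) (e : R) : b @ \oo --> e -> (fun k => b k ^+ 2) @ \oo --> e ^+ 2.
        by move=> hb; apply: (cvgM hb hb).
      by apply: cvgD; apply: sq; apply: cvgB => //; apply: cvg_cst.
  have ff := fatou mu measurableT (f := fun m y => (n2 (x m y - x n y))%:E) mf.
  apply: le_trans (ff _) _; first by move=> m y _; rewrite lee_fin n2_ge0.
  rewrite limn_einf_lim; apply: lime_le; first exact: is_cvg_einfs.
  exists n => // m /= nm; apply: le_trans (ereal_inf_lbound _) _.
    by exists m => //=; exact: leqnn.
  have -> : (\int[mu]_y (n2 (x m y - x n y))%:E = (dot (x m - x n) (x m - x n))%:E)%E.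
    rewrite dotuu /Rintegral fineK; last by apply: integrable_fin_num => //; exact: L2_n2int.
    apply: ae_eq_integral => //.
      by apply/measurable_EFinP; exact: m_n2.
      by apply/measurable_EFinP; exact: m_n2.
    by apply: aeS (hB (x m) (x n)) => y -> _.
  by rewrite lee_fin -nrm_sqr ler_pXn2r ?nnegrE ?xx// mulr_ge0// exprn_ge0.
have Ll0 : L2 l0.
  have := L2D (key 0%N).1 (L2h (x 0%N)); congr L2.
  by apply/funext => y; rewrite subrK.
exists (mk l0) => n.
rewrite -(ler_pXn2r (n := 2))// ?nnegrE ?mulr_ge0 ?exprn_ge0//.
rewrite nrm_sqr dotuu -lee_fin /Rintegral fineK; last first.
  by apply: integrable_fin_num => //; exact: L2_n2int.
apply: le_trans (key n).2; rewrite le_eqVlt; apply/orP; left; apply/eqP.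
apply: ae_eq_integral => //.
- by apply/measurable_EFinP; exact: m_n2.
- by apply/measurable_EFinP; apply: m_n2; apply: CmD => //; exact: CmN.
- by apply: aeS2 (hB (mk l0) (x n)) (mkE Ll0) => y -> -> _.
Qed.

(** A Cauchy filter has a member of diameter at most 2^-n for each n. Points chosen in the finite
    intersections of these members form a fast Cauchy sequence, whose limit attracts the filter. *)
Lemma Riesz_Fischer (F : set_system (Hsp R)) : ProperFilter F -> cauchy F -> cvg F.
Proof.
move=> FF /cauchy_ballP FC.
have h n : exists A, F A /\ forall a b, A a -> A b -> `|a - b| <= 2^-1 ^+ n.
  have e0 : 0 < (2^-1 : R) ^+ n by rewrite exprn_gt0.
  have := FC _ e0; rewrite near_simpl => -[[A B] /= [FA FB] AB].
  exists (A `&` B); split; first exact: filterI.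
  move=> a b [Aa Ba] [Ab Bb]; have := AB (a, b) (conj Aa Bb).
  by rewrite /= -ball_normE /= => /ltW.
have [A hA] := choice h.
pose B n := [set a | forall k, (k <= n)%N -> A k a].
have FB n : F (B n).
  elim: n => [|n IH].
    by apply: filterS (hA 0%N).1 => a Aa k; rewrite leqn0 => /eqP ->.
  apply: filterS2 IH (hA n.+1).1 => a Ba Aa k; rewrite leq_eqVlt => /predU1P[->//|].
  exact: Ba.
have [x hx] := choice (fun n => filter_ex (FB n)).
have hxA n k : (k <= n)%N -> A k (x n) by move=> kn; apply: (hx n).
have [l hl] := Riesz_Fischer_seq (x := x) (fun n => (hA n).2 _ _ (hxA _ _ (leqnSn n)) (hxA _ _ (leqnn n))).
apply/cvg_ex; exists l; apply/cvgrPdist_le => e e0.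
have [n hn] : exists n, 3 * (2^-1 : R) ^+ n <= e.
  have : (fun n => 3 * (2^-1 : R) ^+ n) @ \oo --> (3 * 0 : R).
    apply: cvgMr; apply: cvg_expr; rewrite ger0_norm ?invr_ge0// invf_lt1//; lra.
  rewrite mulr0 => /cvgrPdist_le /(_ _ e0) [n _ /(_ n (leqnn n))] /= hn.
  by exists n; rewrite sub0r normrN ger0_norm// in hn; rewrite mulr_ge0// exprn_ge0.
apply: filterS (hA n).1 => a Aa.
rewrite -(subrKA (x n)); apply: le_trans (ler_normD _ _) _; apply: le_trans hn.
have -> : 3 * (2^-1 : R) ^+ n = 2 * 2^-1 ^+ n + 2^-1 ^+ n by ring.
by apply: lerD => //; apply: (hA n).2 => //; exact: hxA.
Qed.
End complete.

HB.instance Definition _ (R : realType) := Uniform_isComplete.Build (Hsp R) (@Riesz_Fischer R).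

(** * Real calculus and weakly differentiable paths *)

Section real_calculus.
Context {R : realType}.
Implicit Types (f g : R -> R) (a b t : R).
Local Notation mu := (@lebesgue_measure R).

Lemma is_derive_cont f t d : is_derive t 1 f d -> {for t, continuous f}.
Proof. by move=> h; apply: differentiable_continuous; apply/derivable1_diffP; case: h. Qed.

Lemma is_derive_lin (c y : R) : is_derive y 1 (fun z : R => c * z) c.
Proof.
have h := @is_deriveZ R R R^o id c y 1 1 (is_derive_id y 1).
by apply: (is_derive_eq h); rewrite /GRing.scale /= mulr1.
Qed.

Lemma mono_le f f' g g' a b : a <= b ->
  (forall t, a <= t <= b -> is_derive t 1 f (f' t)) ->
  (forall t, a <= t <= b -> is_derive t 1 g (g' t)) ->
  (forall t, a <= t <= b -> f' t <= g' t) -> f b - f a <= g b - g a.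
Proof.
move=> ab hf hg hfg.
have hd t : a <= t <= b -> is_derive t 1 (g - f) (g' t - f' t).
  by move=> tab; apply: is_deriveB; [exact: hg|exact: hf].
have [||c] := @MVT_segment R (g - f) (fun t => g' t - f' t) a b ab.
- by move=> x; rewrite in_itv /= => /andP[h1 h2]; apply: hd; rewrite !ltW.
- apply: continuous_in_subspaceT => x; rewrite inE /= in_itv /= => h.
  exact: is_derive_cont (hd _ h).
rewrite in_itv /= => hc E.
have : 0 <= (g - f) b - (g - f) a.
  by rewrite E mulr_ge0 ?subr_ge0// hfg.
by rewrite -[(g - f) b]/(g b - f b) -[(g - f) a]/(g a - f a); lra.
Qed.

Lemma mono_norm f f' g g' a b : a <= b ->
  (forall t, a <= t <= b -> is_derive t 1 f (f' t)) ->
  (forall t, a <= t <= b -> is_derive t 1 g (g' t)) ->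
  (forall t, a <= t <= b -> `|f' t| <= g' t) -> `|f b - f a| <= g b - g a.
Proof.
move=> ab hf hg hfg; rewrite ler_norml; apply/andP; split.
  have hn t : a <= t <= b -> is_derive t 1 (fun x => - g x) (- g' t).
    by move=> /hg h; apply: is_deriveN.
  have := mono_le ab hn hf; rewrite !opprD !opprK => h.
  suff: - g b + g a <= f b - f a by lra.
  by apply: h => t /hfg; rewrite ler_norml => /andP[].
by apply: (mono_le ab hf hg) => t /hfg; rewrite ler_norml => /andP[].
Qed.

Lemma deriv0_cst f a b : a <= b ->
  (forall t, a <= t <= b -> is_derive t 1 f 0) -> f b = f a.
Proof.
move=> ab h; have := @mono_norm f (fun=> 0) (fun=> 0) (fun=> 0) a b ab h.
move=> /(_ (fun t _ => is_derive_cst _ _ _)) H.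
have : `|f b - f a| <= 0.
  by rewrite -(subrr (0 : R)); apply: H => t _; rewrite normr0.
by rewrite normr_le0 subr_eq0 => /eqP.
Qed.

Lemma deriv0_const f : (forall t, is_derive t 1 f 0) -> forall t, f t = f 0.
Proof.
move=> h t; have [t0|t0] := leP 0 t; first by apply: deriv0_cst.
by apply/esym; apply: deriv0_cst => //; exact: ltW.
Qed.

Lemma is_derive_FTC f (M x : R) : continuous f -> - M < x ->
  is_derive x 1 (fun y => \int[mu]_(z in `[- M, y]) f z) (f x).
Proof.
move=> cf Mx.
have [||||] := @continuous_FTC1 R f (BLeft (- M)) x (x + 1) _ _ _ _.
- by rewrite ltrDl.
- apply: continuous_compact_integrable; first exact: segment_compact.
  exact: continuous_subspaceT.
- by rewrite /= lte_fin.
- exact: cf.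
by move=> d1 d2; apply: DeriveDef; [exact: d1|rewrite -derive1E; exact: d2].
Qed.

(** The oriented primitive from 0, for both signs of [t]. Both integrals start strictly to the left
    of 0 and of [t], since the fundamental theorem is applied with a fixed left endpoint. *)
Definition prim f t : R :=
  \int[mu]_(z in `[- (`|t| + 1), t]) f z - \int[mu]_(z in `[- (`|t| + 1), 0]) f z.

(** Integrals from two base points have the same derivative in the upper bound, so a change of base
    point shifts both terms by the same constant. *)
Lemma primE f (M : R) t : continuous f -> `|t| < M ->
  prim f t = \int[mu]_(z in `[- M, t]) f z - \int[mu]_(z in `[- M, 0]) f z.
Proof.
move=> cf tM; rewrite /prim; set m := `|t| + 1.
pose h y := \int[mu]_(z in `[- M, y]) f z - \int[mu]_(z in `[- m, y]) f z.
have hd y : - `|t| <= y -> is_derive y 1 h 0.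
  move=> ty; rewrite -(subrr (f y)); apply: is_deriveB; apply: is_derive_FTC => //.
    by apply: lt_le_trans ty; rewrite ltrN2.
  by apply: lt_le_trans ty; rewrite ltrN2 ltrDl.
suff : h t = h 0 by rewrite /h; lra.
have := ler_norm t; have := ler_norm (- t); rewrite normrN => h1 h2.
have [t0|t0] := leP 0 t.
  by apply: deriv0_cst => // y /andP[y0 _]; apply: hd; apply: le_trans y0; rewrite oppr_le0.
by apply/esym; apply: deriv0_cst => [|y /andP[y0 _]]; [exact: ltW|apply: hd; lra].
Qed.

Lemma prim0 f : prim f 0 = 0. Proof. by rewrite /prim subrr. Qed.

Lemma prim_derive f t : continuous f -> is_derive t 1 (prim f) (f t).
Proof.
move=> cf; set M := `|t| + 1.
have h : is_derive t 1 (fun y => \int[mu]_(z in `[- M, y]) f z - \int[mu]_(z in `[- M, 0]) f z) (f t).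
  rewrite -[X in is_derive _ _ _ X]subr0; apply: is_deriveB.
  apply: is_derive_FTC => //.
  by have := ler_norm (- t); rewrite normrN /M; lra.
apply: (near_eq_is_derive _ h).
have : \forall y \near t, `|t - y| < 1.
  by apply/nbhs_ballP; exists 1 => /=.
apply: filterS => y hy; apply/esym/primE => //; rewrite /M.
have -> : y = t - (t - y) by ring.
by apply: le_lt_trans (ler_normB _ _) _; rewrite ltrD2l.
Qed.

(** Uniform convergence of the derivatives on bounded sets lets [f n] be compared with [prim G] by
    the mean value inequality, so the limit is [prim G] up to a constant. *)
Lemma deriv_limit (f : nat -> R -> R) (g : nat -> R -> R) (F G : R -> R) :
  (forall n t, is_derive t 1 (f n) (g n t)) ->
  (forall t, f n t @[n --> \oo] --> F t) -> continuous G ->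
  (forall T e : R, 0 < e -> \forall n \near \oo, forall t, `|t| <= T -> `|g n t - G t| <= e) ->
  forall t, is_derive t 1 F (G t).
Proof.
move=> hf hF cG hg t.
have E : F = prim G \+ cst (F 0).
  apply/funext => x /=; apply/eqP; rewrite -subr_eq -subr_eq0 -normr_le0.
  apply/ler_addgt0Pr => e e0; rewrite add0r.
  have e1 : 0 < e / (`|x| + 1) by rewrite divr_gt0// ltr_wpDl.
  have c : `|f n x - f n 0 - prim G x| @[n --> \oo] --> `|F x - F 0 - prim G x|.
    by apply: cvg_norm; apply: cvgB; [exact: cvgB|exact: cvg_cst].
  rewrite -(cvg_lim (@Rhausdorff R) c); apply: limr_le; first exact: cvgP c.
  apply: filterS (hg `|x| _ e1) => n hn.
  pose h y := f n y - prim G y.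
  have hd (y : R) : is_derive y 1 h (g n y - G y).
    by apply: is_deriveB => //; exact: prim_derive.
  have hc (y : R) : is_derive y 1 (fun z : R => e / (`|x| + 1) * z) (e / (`|x| + 1)).
    exact: is_derive_lin.
  have -> : f n x - f n 0 - prim G x = h x - h 0 by rewrite /h prim0; ring.
  have le : e / (`|x| + 1) * `|x| <= e.
    rewrite -mulrA ger_pMr// mulrC ler_pdivrMr; last by rewrite ltr_wpDl.
    by rewrite mul1r lerDl.
  apply: le_trans le.
  have := ler_norm x; have := ler_norm (- x); rewrite normrN => h1 h2.
  set cc := e / (`|x| + 1) in e1 hn hc *.
  have [x0|x0] := leP 0 x.
    rewrite (ger0_norm x0) in hn *.
    have := mono_norm x0 (fun y _ => hd y) (fun y _ => hc y); rewrite mulr0 subr0; apply.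
    by move=> y /andP[y0 yx]; apply: hn; rewrite (ger0_norm y0).
  rewrite (ltr0_norm x0) in hn *; rewrite distrC.
  have := mono_norm (ltW x0) (fun y _ => hd y) (fun y _ => hc y).
  rewrite mulr0 sub0r -mulrN; apply => y /andP[y0 yx].
  by apply: hn; rewrite (ler0_norm yx) lerN2.
rewrite E -[G t]addr0; apply: is_deriveD; exact: prim_derive.
Qed.
End real_calculus.

(* Keeps [ring], [field] and [lra] from comparing inner products up to conversion. *)
Ltac gen_dots := repeat match goal with
  | |- context [@dot ?R ?a ?b] => let x := fresh "x" in generalize (@dot R a b) => x end.

(** * Duality, projection, Riesz representation and weakly differentiable paths *)

Section Hilbert.
Context {R : realType}.
Local Notation H := (Hsp R).
Implicit Types (u v w : H) (D : set H).

Lemma cvg_dot T (F : set_system T) (FF : Filter F) (f g : T -> H) u v :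
  f x @[x --> F] --> u -> g x @[x --> F] --> v -> dot (f x) (g x) @[x --> F] --> dot u v.
Proof.
move=> hf hg; apply/cvgrPdist_lt => e e0.
have h : (fun x => `|f x - u| * `|g x| + `|u| * `|g x - v|) @ F --> `|u - u| * `|v| + `|u| * `|v - v|.
  apply: cvgD; apply: cvgM; apply: cvg_norm => //.
  - by apply: cvgB => //; exact: cvg_cst.
  - exact: cvg_cst.
  - by apply: cvgB => //; exact: cvg_cst.
rewrite !subrr normr0 mul0r mulr0 addr0 in h.
move/cvgrPdist_lt: h => /(_ _ e0); apply: filterS => x; rewrite sub0r normrN => hx.
have E : dot u v - dot (f x) (g x) = - (dot (f x - u) (g x) + dot u (g x - v)).
  by rewrite dotBr dotBl; gen_dots; ring.
rewrite E normrN; apply: le_lt_trans (ler_normD _ _) _.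
apply: le_lt_trans (lerD (dot_le _ _) (dot_le _ _)) _.
exact: le_lt_trans (ler_norm _) hx.
Qed.
Lemma cvg_dotl T (F : set_system T) (FF : Filter F) (f : T -> H) u v :
  f x @[x --> F] --> u -> dot (f x) v @[x --> F] --> dot u v.
Proof. by move=> h; apply: cvg_dot => //; apply: cvg_cst. Qed.

Definition dn D := forall u (e : R), 0 < e -> exists2 v, D v & `|u - v| <= e.

(** A test vector close to [u] itself nearly attains the norm, so an upper bound of the pairing on a
    dense set is enough and no absolute value is required. *)
Lemma dual_bound D K u : dn D -> 0 <= K -> (forall v, D v -> dot u v <= K * `|v|) -> `|u| <= K.
Proof.
move=> hD K0 h; have [/normr0P/eqP u0|u0] := eqVneq `|u| 0; first by rewrite u0 normr0.
have up : 0 < `|u| by rewrite lt_neqAle eq_sym u0 /=.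
suff : `|u| ^+ 2 <= K * `|u| by rewrite expr2 ler_pM2r.
apply/ler_addgt0Pr => e e0.
(* Replacing [u] by [v] costs at most [|u|] + K times this distance, that is at most [e]. *)
have e1 : 0 < e / (`|u| + K) by rewrite divr_gt0// ltr_pwDl.
have [v Dv uv] := hD u _ e1.
have -> : `|u| ^+ 2 = dot u v + dot u (u - v) by rewrite dotBr nrm_sqr; gen_dots; ring.
have vu : `|v| <= `|u| + e / (`|u| + K).
  have -> : v = u - (u - v) by rewrite opprB addrCA subrr addr0.
  by apply: le_trans (ler_normB _ _) _; rewrite lerD2l.
have h1 : dot u v <= K * (`|u| + e / (`|u| + K)).
  by apply: le_trans (h _ Dv) _; rewrite ler_wpM2l.
have h2 : dot u (u - v) <= `|u| * (e / (`|u| + K)).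
  by apply: le_trans (dot_le' _ _) _; rewrite ler_wpM2l.
apply: le_trans (lerD h1 h2) _; rewrite le_eqVlt; apply/orP; left; apply/eqP.
by field; rewrite gt_eqF// ltr_pwDl.
Qed.

Lemma dot_eq_all u u' : (forall v, dot u v = dot u' v) -> u = u'.
Proof.
move=> h; apply/eqP; rewrite -subr_eq0; apply/eqP/dot_eq0.
by rewrite dotBl h subrr.
Qed.
Lemma dot_eq_dense D u u' : dn D -> (forall v, D v -> dot u v = dot u' v) -> u = u'.
Proof.
move=> hD h; apply/eqP; rewrite -subr_eq0 -normr_le0; apply: (dual_bound hD) => // v Dv.
by rewrite dotBl h// subrr mul0r.
Qed.

Lemma expn_small (e : R) : 0 < e -> exists n, (2^-1 : R) ^+ n <= e.
Proof.
move=> e0; have : (fun n => (2^-1 : R) ^+ n) @ \oo --> (0 : R).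
  by apply: cvg_expr; rewrite ger0_norm ?invr_ge0// invf_lt1//; lra.
move=> /cvgrPdist_le /(_ _ e0) [n _ /(_ n (leqnn n))] /= hn.
by exists n; rewrite sub0r normrN ger0_norm// in hn; rewrite exprn_ge0.
Qed.

Definition subspace D := D 0 /\ forall a u v, D u -> D v -> D (a *: u + v).

(** [D] may fail to be closed, so [p] is only approximated from [D]. Minimising sequences are Cauchy
    by the parallelogram identity, and minimality along each direction [v] forces orthogonality. *)
Lemma projection D u : subspace D -> exists p, (forall e : R, 0 < e -> exists2 v, D v & `|p - v| <= e) /\
  (forall v, D v -> dot (u - p) v = 0).
Proof.
move=> [D0 Dl].
have Ds a v : D v -> D (a *: v) by move=> Dv; rewrite -[_ *: _]addr0; apply: Dl.
pose S := [set `|u - v| ^+ 2 | v in D].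
have S0 : has_inf S.
  split; first by exists (`|u - 0| ^+ 2); exists 0.
  by exists 0 => _ [v _ <-]; exact: sqr_ge0.
pose d := inf S.
have dle v : D v -> d <= `|u - v| ^+ 2.
  by move=> Dv; apply: ge_inf; [exact: S0.2|exists v].
(* The excess is chosen so that the parallelogram identity yields increments at most 2^-n, the rate
   asked for by [Riesz_Fischer_seq]. *)
have hv n : exists v, D v /\ `|u - v| ^+ 2 <= d + (2^-1 ^+ n) ^+ 2 / 4.
  have e0 : 0 < (2^-1 ^+ n) ^+ 2 / 4 :> R by rewrite divr_gt0// !exprn_gt0.
  have [_ [v Dv <-] hlt] := inf_adherent e0 S0.
  by exists v; split=> //; exact: ltW.
have [x hx] := choice hv.
have par v w : `|v - w| ^+ 2 = 2 * `|u - v| ^+ 2 + 2 * `|u - w| ^+ 2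
    - 4 * `|u - 2^-1 *: (v + w)| ^+ 2.
  by rewrite !nrm_sqr !(dotBl, dotBr, dotDl, dotDr, dotZl, dotZr) (dotC v u) (dotC w u) (dotC w v); gen_dots; field.
have hc n : `|x n.+1 - x n| <= 2^-1 ^+ n.
  rewrite -(ler_pXn2r (n := 2))// ?nnegrE ?exprn_ge0// par.
  have h1 := (hx n).2; have h2 := (hx n.+1).2.
  have h3 : d <= `|u - 2^-1 *: (x n.+1 + x n)| ^+ 2.
    apply: dle; apply: Ds; rewrite -[x n.+1]scale1r; apply: Dl; exact: (hx _).1.
  have h4 : ((2^-1 : R) ^+ n.+1) ^+ 2 <= (2^-1 ^+ n) ^+ 2.
    by rewrite ler_pXn2r ?nnegrE ?exprn_ge0// exprS ger_pMl ?exprn_gt0// invf_le1//; lra.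
  move: h1 h2 h3 h4; move: (`|u - x n| ^+ 2) (`|u - x n.+1| ^+ 2)
    (`|u - 2^-1 *: (x n.+1 + x n)| ^+ 2) ((2^-1 ^+ n) ^+ 2) ((2^-1 ^+ n.+1) ^+ 2) => a b c e k; lra.
have [p hp] := Riesz_Fischer_seq hc.
exists p; split=> [e e0|v Dv].
  have e1 : 0 < e / 2 by rewrite divr_gt0.
  have [n hn] := expn_small e1.
  exists (x n); first exact: (hx n).1.
  by apply: le_trans (hp n) _; move: hn; rewrite ler_pdivlMr// mulrC.
have [/normr0P/eqP->|v0] := eqVneq `|v| 0; first by rewrite dot0r.
have vp : 0 < `|v| by rewrite lt_neqAle eq_sym v0 /=.
have key n : `|dot (u - x n) v| <= 2^-1 ^+ n * `|v|.
  rewrite -(ler_pXn2r (n := 2))// ?nnegrE ?mulr_ge0 ?exprn_ge0//.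
  set s := dot (u - x n) v / dot v v.
  have h : d <= `|u - (s *: v + x n)| ^+ 2 by apply: dle; apply: Dl => //; exact: (hx n).1.
  have vv : 0 < dot v v by rewrite -nrm_sqr exprn_gt0.
  have E : `|u - (s *: v + x n)| ^+ 2 = `|u - x n| ^+ 2 - dot (u - x n) v ^+ 2 / dot v v.
    rewrite !nrm_sqr opprD addrCA addrC !(dotBl, dotBr, dotDl, dotDr, dotZl, dotZr, dotNl, dotNr).
    rewrite /s !(dotBl, dotBr) (dotC v u) (dotC v (x n)) (dotC (x n) u).
    by move: (gt_eqF vv); gen_dots => n0; field; rewrite n0.
  rewrite E in h; have h2 := (hx n).2.
  have : dot (u - x n) v ^+ 2 / dot v v <= (2^-1 ^+ n) ^+ 2 / 4.
    by move: h h2; move: (`|u - x n| ^+ 2) (_ / dot v v) (_ / 4) => a b c; lra.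
  rewrite ler_pdivrMr// real_normK ?num_real// exprMn nrm_sqr => /le_trans; apply.
  rewrite ler_wpM2r ?(ltW vv)// ler_pdivrMr// ler_peMr ?sqr_ge0//; lra.
apply/eqP; rewrite -normr_le0; apply/ler_addgt0Pr => e e0; rewrite add0r.
have e1 : 0 < e / (3 * `|v|) by rewrite divr_gt0// mulr_gt0.
have [n hn] := expn_small e1.
have -> : dot (u - p) v = dot (u - x n) v + dot (x n - p) v by rewrite !dotBl; gen_dots; ring.
apply: le_trans (ler_normD _ _) _; apply: le_trans (lerD (key n) (dot_le _ _)) _.
rewrite distrC; have h2 : `|p - x n| * `|v| <= 2 * 2^-1 ^+ n * `|v| by rewrite ler_wpM2r.
apply: le_trans (lerD (lexx _) h2) _.
have -> : 2^-1 ^+ n * `|v| + 2 * 2^-1 ^+ n * `|v| = 2^-1 ^+ n * (3 * `|v|) by ring.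
by move: hn; rewrite ler_pdivlMr// mulr_gt0.
Qed.

Lemma dense_of_orth D : subspace D -> (forall u, (forall v, D v -> dot u v = 0) -> u = 0) -> dn D.
Proof.
move=> hD h u e e0; have [p [h1 h2]] := projection u hD.
by have /eqP := h _ h2; rewrite subr_eq0 => /eqP ->; exact: h1.
Qed.

(** The representing vector is a multiple of [f - p], where [l f] is nonzero and [p] is the
    projection of [f] on the kernel. Every [v] differs from a multiple of [f - p] by an element of
    the kernel. *)
Lemma Riesz (l : H -> R) (K : R) : (forall a u v, l (a *: u + v) = a * l u + l v) ->
  (forall v, `|l v| <= K * `|v|) -> exists w, forall v, l v = dot w v.
Proof.
move=> lin bnd.
have l0 : l 0 = 0 by have := lin 1 0 0; rewrite scale1r addr0; lra.
have lZ a v : l (a *: v) = a * l v by rewrite -[_ *: _]addr0 lin l0 addr0.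
have lB u v : l (u - v) = l u - l v by rewrite addrC -scaleN1r lin mulN1r addrC.
have [h|/existsNP[f lf]] := pselect (forall v, l v = 0).
  by exists 0 => v; rewrite h dot0l.
have hD : subspace [set v | l v = 0].
  by split=> //= a u v lu lv; rewrite lin lu lv mulr0 addr0.
have [p [hp1 hp2]] := projection f hD.
have lp : l p = 0.
  apply/eqP; rewrite -normr_le0; apply/ler_addgt0Pr => e e0; rewrite add0r.
  have e1 : 0 < e / (`|K| + 1) by rewrite divr_gt0// ltr_wpDl.
  have [v lv pv] := hp1 _ e1.
  have -> : l p = l (p - v) by rewrite lB lv subr0.
  apply: le_trans (bnd _) _.
  have hK : K * `|p - v| <= (`|K| + 1) * `|p - v|.
    by rewrite ler_wpM2r//; have := ler_norm K; lra.
  have K1 : 0 < `|K| + 1 by rewrite ltr_wpDl.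
  by apply: le_trans hK _; move: pv; rewrite ler_pdivlMr// mulrC.
pose g := f - p.
have lg : l g != 0 by rewrite /g lB lp subr0; apply/eqP.
have gg : dot g g != 0.
  by apply: contra lg => /eqP /dot_eq0 ->; rewrite l0.
exists ((l g / dot g g) *: g) => v.
have := hp2 (v - (l v / l g) *: g); rewrite /= lB lZ divfK// subrr => /(_ erefl).
rewrite -/g dotBr dotZr => /eqP; rewrite subr_eq0 => /eqP E.
by rewrite dotZl E; move: lg gg; gen_dots => lg gg; field; rewrite lg gg.
Qed.

Lemma cont_bounded (F : R -> H) (T : R) : continuous F -> exists2 K : R, 0 <= K & forall t, `|t| <= T -> `|F t| <= K.
Proof.
move=> cF; have [T0|T0] := leP 0 T; last first.
  by exists 0 => // t h; have := le_lt_trans h T0; rewrite normr_lt0.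
have TT : - T <= T by lra.
have [|c _ hc] := @EVT_max R (fun t => `|F t|) (- T) T TT.
  by apply: continuous_subspaceT => t; apply: cvg_norm; exact: cF.
exists `|F c| => // t; rewrite ler_norml => ht; apply: hc.
by rewrite in_itv.
Qed.

(** The integral of a continuous path is obtained weakly: for fixed [t] the primitive of the pairing
    is a bounded linear functional of [v], and the Riesz theorem supplies the vector. *)
Lemma integral_exists (F : R -> H) : continuous F -> exists G : R -> H, G 0 = 0 /\
  forall v (t : R), is_derive t 1 (fun t => dot (G t) v) (dot (F t) v).
Proof.
move=> cF.
have cd v : continuous (fun t => dot (F t) v) by move=> t; apply: cvg_dotl; exact: cF.
have h t : exists w, forall v, prim (fun t => dot (F t) v) t = dot w v.
  have [K K0 hK] := cont_bounded `|t| cF.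
  apply: (@Riesz _ (K * `|t|)) => [a u v|v].
    pose f s := prim (fun t => dot (F t) (a *: u + v)) s
        - (a * prim (fun t => dot (F t) u) s + prim (fun t => dot (F t) v) s).
    have fd (s : R) : is_derive s 1 f 0.
      have E : 0 = dot (F s) (a *: u + v) - (a * dot (F s) u + dot (F s) v).
        by rewrite dotDr dotZr subrr.
      rewrite E; apply: is_deriveB; first exact: prim_derive.
      apply: is_deriveD; last exact: prim_derive.
      exact: (@is_deriveZ R R R^o _ a s 1 _ (prim_derive _ (cd u))).
    have := deriv0_const fd t; rewrite /f !prim0 mulr0 addr0 subrr => /eqP.
    by rewrite subr_eq0 => /eqP.
  have hn s : `|s| <= `|t| -> `|dot (F s) v| <= K * `|v|.
    by move=> st; apply: le_trans (dot_le _ _) _; rewrite ler_wpM2r// hK.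
  have := ler_norm t; have := ler_norm (- t); rewrite normrN => h1 h2.
  have hp s := @prim_derive R (fun t => dot (F t) v) s (cd v).
  have hl s := @is_derive_lin R (K * `|v|) s.
  have [t0|t0] := leP 0 t.
    have := mono_norm t0 (fun s _ => hp s) (fun s _ => hl s).
    rewrite prim0 subr0 mulr0 subr0 (ger0_norm t0) mulrAC; apply => s /andP[s0 st].
    by apply: hn; rewrite (ger0_norm s0) (ger0_norm t0).
  have := mono_norm (ltW t0) (fun s _ => hp s) (fun s _ => hl s).
  rewrite prim0 sub0r normrN mulr0 sub0r -mulrN (ltr0_norm t0) mulrAC; apply => s /andP[s0 st].
  by apply: hn; rewrite (ler0_norm st) (ltr0_norm t0) lerN2.
have [G hG] := choice h; exists G; split.
  by apply: dot_eq_all => v; rewrite -hG prim0 dot0l.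
move=> v t; have -> : (fun t => dot (G t) v) = prim (fun t => dot (F t) v).
  by apply/funext => s; rewrite hG.
exact: prim_derive.
Qed.

(** Duality turns scalar mean value inequalities into a norm inequality, so the path need only be
    differentiable when paired with a dense set. *)
Lemma weak_mv D (z G : R -> H) (g g' : R -> R) (a b : R) : dn D -> a <= b ->
  (forall v (t : R), D v -> a <= t <= b -> is_derive t 1 (fun s => dot (z s) v) (dot (G t) v)) ->
  (forall t, a <= t <= b -> is_derive t 1 g (g' t)) ->
  (forall t, a <= t <= b -> `|G t| <= g' t) -> `|z b - z a| <= g b - g a.
Proof.
move=> hD ab hz hg hG; apply: (dual_bound hD).
  have := mono_le ab (fun t _ => is_derive_cst _ _ _ : is_derive t 1 (fun=> 0) 0) hg.
  by rewrite subrr; apply => t /hG; exact: le_trans.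
move=> v Dv; rewrite dotBl.
have hgv (t : R) : a <= t <= b -> is_derive t 1 (fun s => `|v| * g s) (`|v| * g' t).
  by move=> /hg h; exact: (@is_deriveZ R R R^o _ `|v| t 1 _ h).
have := mono_le ab (fun t => hz v t Dv) hgv; rewrite -mulrBr mulrC; apply => t /hG h.
by apply: le_trans (dot_le' _ _) _; rewrite mulrC ler_wpM2l.
Qed.

(** A vector is approached from the dense set, and the derivatives of the pairings converge
    uniformly on bounded times because [G] is bounded there. *)
Lemma weak_extend D (z G : R -> H) : dn D -> continuous G ->
  (forall v (t : R), D v -> is_derive t 1 (fun s => dot (z s) v) (dot (G t) v)) ->
  forall v (t : R), is_derive t 1 (fun s => dot (z s) v) (dot (G t) v).
Proof.
move=> hD cG hz v.
have h n : exists w, D w /\ `|v - w| <= 2^-1 ^+ n.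
  have e0 : 0 < (2^-1 : R) ^+ n by rewrite exprn_gt0.
  by have [w Dw vw] := hD v _ e0; exists w.
have [x hx] := choice h.
have hcv : x n @[n --> \oo] --> v.
  apply/cvgrPdist_le => e e0; have [n hn] := expn_small e0.
  exists n => // m /= nm; apply: le_trans (hx m).2 _; apply: le_trans hn.
  by rewrite ler_wiXn2l// ?invr_ge0// invf_le1//; lra.
apply: (@deriv_limit R (fun n t => dot (z t) (x n)) (fun n t => dot (G t) (x n))).
- by move=> n t; apply: hz; exact: (hx n).1.
- by move=> t; apply: cvg_dot => //; apply: cvg_cst.
- by move=> t; apply: cvg_dotl; exact: cG.
move=> T e e0; have [K K0 hK] := cont_bounded T cG.
have e1 : 0 < e / (K + 1) by rewrite divr_gt0// ltr_wpDl.
have /cvgrPdist_le /(_ _ e1) := hcv; apply: filterS => n hn t tT.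
rewrite -dotBr; apply: le_trans (dot_le _ _) _.
rewrite distrC; apply: (@le_trans _ _ ((K + 1) * (e / (K + 1)))).
  by apply: ler_pM => //; apply: le_trans (hK t tT) _; rewrite lerDl.
by rewrite mulrCA divff ?mulr1// gt_eqF// ltr_wpDl.
Qed.

(** A product rule for a continuous, weakly differentiable [z] and a strongly differentiable [x]:
    the increment is split so that the derivative of [z] is tested only on the fixed vector
    [x t]. *)
Lemma dot_derive (z : R -> H) (x : R -> H) (t d : R) (x' : H) :
  {for t, continuous z} ->
  is_derive t 1 (fun s => dot (z s) (x t)) d ->
  h^-1 *: (x (t + h) - x t) @[h --> 0^'] --> x' ->
  is_derive t 1 (fun s => dot (z s) (x s)) (d + dot (z t) x').
Proof.
move=> cz hd hx.
have [hd1 hd2] := hd.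
have c1 : h^-1 *: ((fun s => dot (z s) (x t)) (h *: 1 + t) - dot (z t) (x t)) @[h --> 0^'] --> d.
  by rewrite -hd2; exact: hd1.
have cz' : z (t + h) @[h --> 0^'] --> z t.
  have h1 : (fun h : R => t + h) @ (0 : R) --> t.
    rewrite -[X in _ --> X]addr0; apply: cvgD; [exact: cvg_cst|exact: cvg_id].
  apply: cvg_trans (cvg_comp _ _ h1 cz); apply: cvg_app; exact: cvg_within.
have c2 := cvg_dot _ cz' hx.
have c3 := cvgD c1 (c2 _).
have E : (fun h : R => h^-1 *: ((fun s => dot (z s) (x s)) (h *: 1 + t) - dot (z t) (x t))) =
   (fun h : R => h^-1 *: ((fun s => dot (z s) (x t)) (h *: 1 + t) - dot (z t) (x t))) \+
   (fun h => dot (z (t + h)) (h^-1 *: (x (t + h) - x t))).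
  apply/funext => h /=.
  have -> : h%:A + t = t + h by rewrite /GRing.scale /= mulr1 addrC.
  by rewrite dotZr dotBr /GRing.scale /=; gen_dots; move: h^-1 => k *; ring.
apply: DeriveDef.
  by rewrite /derivable E; apply/cvg_ex; exists (d + dot (z t) x'); exact: (c3 _ _).
by rewrite /derive E; apply: cvg_lim; [exact: Rhausdorff|exact: (c3 _ _)].
Qed.
End Hilbert.

(** * Smooth kernels and the fundamental lemma *)

Section smooth.
Context {R : realType}.
Implicit Types (f g phi : R -> R).

(** Existence of iterated derivatives is stated by recursion rather than through [derive1n], so that
    the closure properties are plain inductions. *)
Fixpoint Cn (n : nat) f : Prop :=
  if n is m.+1 then exists2 f', (forall x : R, is_derive x 1 f (f' x)) & Cn m f' else True.
Definition smooth f := forall n, Cn n f.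

Lemma derive1_of f f' : (forall x : R, is_derive x 1 f (f' x)) -> derive1 f = f'.
Proof. by move=> h; apply/funext => x; rewrite derive1E; case: (h x). Qed.

Lemma CnS n f : Cn n.+1 f -> Cn n f.
Proof.
elim: n f => [//|n IH] f [f' h1 h2]; exists f' => //; exact: IH.
Qed.
Lemma CnD n f g : Cn n f -> Cn n g -> Cn n (fun x => f x + g x).
Proof.
elim: n f g => [//|n IH] f g [f' f1 f2] [g' g1 g2].
exists (fun x => f' x + g' x); last exact: IH.
by move=> x; apply: is_deriveD.
Qed.
Lemma CnM n f g : Cn n f -> Cn n g -> Cn n (fun x => f x * g x).
Proof.
elim: n f g => [//|n IH] f g hf hg; have [f' f1 f2] := hf; have [g' g1 g2] := hg.
exists (fun x => f x * g' x + g x * f' x).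
  by move=> x; apply: is_deriveM.
by apply: CnD; apply: IH => //; exact: CnS.
Qed.
Lemma Cncst n (c : R) : Cn n (fun=> c).
Proof.
elim: n c => [//|n IH] c; exists (fun=> 0) => [x|]; [exact: is_derive_cst|exact: IH].
Qed.
Lemma is_derive_affine f (f' : R -> R) (c d x : R) : is_derive (c * x + d) 1 f (f' (c * x + d)) ->
  is_derive x 1 (fun x => f (c * x + d)) (c * f' (c * x + d)).
Proof.
move=> h.
have hl : is_derive x 1 (fun x : R => c * x + d) c.
  rewrite -[X in is_derive _ _ _ X]addr0; apply: is_deriveD; exact: is_derive_lin.
have := @is_derive1_comp R f (fun x : R => c * x + d) x _ _ h hl.
by move=> hh; apply: (is_derive_eq hh); rewrite mulrC.
Qed.
Lemma Cn_affine n f (c d : R) : Cn n f -> Cn n (fun x => f (c * x + d)).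
Proof.
elim: n f => [//|n IH] f [f' f1 f2].
exists (fun x => c * f' (c * x + d)); last by apply: CnM; [exact: Cncst|exact: IH].
by move=> x; apply: is_derive_affine.
Qed.
Lemma smooth_test f (M : R) : smooth f -> (forall x, M < `|x| -> f x = 0) -> test_function f.
Proof.
move=> sf h; split; last by exists M.
move=> n; move: (sf n.+1) => {sf h}; elim: n f => [|n IH] f.
  by move=> [f' f1 _] x; case: (f1 x).
move=> [f' f1 f2] x; rewrite /derive1n iterSr (derive1_of f1).
exact: IH.
Qed.
Lemma test_smooth f : test_function f -> smooth f.
Proof.
move=> [h _] n; elim: n f h => [//|n IH] f h; exists (derive1 f).
  by move=> x; rewrite derive1E; exact: (derivableP (h 0%N x)).
by apply: IH => m x; have := h m.+1 x; rewrite /derive1n iterSr.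
Qed.

(** The functions x^-m exp(-1/x), extended by 0 to the left. The derivative of one is a combination
    of two others, which makes all of them smooth. *)
Definition flat (m : nat) (x : R) : R := if 0 < x then x^-1 ^+ m * expR (- x^-1) else 0.

(** The exponential series at 1/x is bounded below by its term of order m + 1. *)
Lemma flat_le m x : 0 <= x -> flat m x <= (m.+1)`!%:R * x.
Proof.
rewrite /flat => x0; case: ifPn => [xp|_]; last by rewrite mulr_ge0.
have y0 : 0 <= x^-1 by rewrite invr_ge0.
have h : x^-1 ^+ m.+1 / (m.+1)`!%:R <= expR x^-1.
  by apply: le_trans (expR_ge1Dxn m y0); rewrite lerDr.
have fp : 0 < (m.+1)`!%:R :> R by rewrite ltr0n fact_gt0.
rewrite expRN ler_pdivrMr ?expR_gt0//.
have : x^-1 ^+ m.+1 <= (m.+1)`!%:R * expR x^-1 by rewrite mulrC -ler_pdivrMr.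
move=> /(ler_wpM2l x0); rewrite exprS mulrA divff ?gt_eqF// mul1r mulrCA mulrA mulrC.
by rewrite mulrC.
Qed.
Lemma flat_ge0 m x : 0 <= flat m x.
Proof. by rewrite /flat; case: ifP => // x0; rewrite mulr_ge0 ?expR_ge0// exprn_ge0// invr_ge0 ltW. Qed.

Lemma flat_derive m (x : R) : is_derive x 1 (flat m) (flat m.+2 x - m%:R * flat m.+1 x).
Proof.
have [x0|x0|->] := ltgtP x 0.
- have -> : flat m.+2 x - m%:R * flat m.+1 x = 0.
    by rewrite /flat ltNge (ltW x0) /= mulr0 subr0.
  have h0 : is_derive x 1 (fun=> 0 : R) 0 := is_derive_cst _ _ _.
  apply: (near_eq_is_derive _ h0); near=> y; rewrite /flat ltNge; case: leP => //= y0; exfalso.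
  have : y < 0 by near: y; exact: lt_nbhsl.
  by move=> /lt_trans /(_ y0); rewrite ltxx.
- apply: (@near_eq_is_derive _ _ _ (fun y : R => y^-1 ^+ m * expR (- y^-1))).
    near=> y; rewrite /flat; case: ifPn => //; rewrite -leNgt => y0; exfalso.
    have : 0 < y by near: y; exact: lt_nbhsr.
    by move=> /(le_lt_trans y0); rewrite ltxx.
  have xn : x != 0 by rewrite gt_eqF.
  have hV : is_derive x 1 (fun y : R => y^-1) (- x ^- 2).
    have := @is_deriveV R id x 1 1 xn (is_derive_id x 1).
    by move=> h; apply: (is_derive_eq h); rewrite /GRing.scale /= mulr1.
  have hX : is_derive x 1 (fun y : R => y^-1 ^+ m) (m%:R * x^-1 ^+ m.-1 * (- x ^- 2)).
    have hid := is_deriveX m (is_derive_id (x^-1) (1 : R)).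
    have E : (id ^+ m : R -> R) = (fun z : R => z ^+ m) by apply/funext => z; rewrite exprfctE.
    rewrite E in hid; have h := @is_derive1_comp R (fun z : R => z ^+ m) (fun y => y^-1) x _ _ hid hV.
    by apply: (is_derive_eq h); rewrite /GRing.scale /= mulr1 -mulr_natl.
  have hE : is_derive x 1 (fun y : R => expR (- y^-1)) (expR (- x^-1) * x ^- 2).
    have h := @is_derive1_comp R expR (fun y => - y^-1) x _ _ (is_derive_expR _) (is_deriveN hV).
    by apply: (is_derive_eq h); rewrite opprK.
  have h := is_deriveM hX hE; apply: (is_derive_eq h).
  rewrite /flat x0 /GRing.scale /= !exprVn.
  case: m {hX h} => [|m] /=; first by rewrite expr0 !mul0r !mulr0 addr0 subr0; field.
  by rewrite !exprS; field; rewrite ?expf_neq0 ?xn.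
have -> : flat m.+2 0 - m%:R * flat m.+1 0 = 0 :> R by rewrite /flat ltxx mulr0 subr0.
have f0 : flat m 0 = 0 by rewrite /flat ltxx.
(* At 0 the difference quotient of [flat m] is [flat m.+1] to the right and 0 to the left, hence
   O(h). *)
have c : h^-1 *: (flat m (h *: 1 + 0) - flat m 0) @[h --> (0:R)^'] --> (0 : R).
  apply/cvgrPdist_le => e e0; rewrite f0.
  have fp : 0 < (m.+2)`!%:R :> R by rewrite ltr0n fact_gt0.
  have e1 : 0 < e / (m.+2)`!%:R by rewrite divr_gt0.
  have : \forall h \near (0:R)^', `|h| <= e / (m.+2)`!%:R.
    by apply: dnbhs0_le.
  apply: filterS => h hh; rewrite /GRing.scale /= mulr1 addr0 subr0 sub0r normrN.
  have [h0|h0] := ltP 0 h; last by rewrite /flat ltNge h0 /= mulr0 normr0 ltW.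
  have -> : h^-1 * flat m h = flat m.+1 h by rewrite /flat h0 exprS mulrA.
  rewrite ger0_norm ?flat_ge0//; apply: le_trans (flat_le _ (ltW h0)) _.
  by move: hh; rewrite ger0_norm ?(ltW h0)// ler_pdivlMr// mulrC.
apply: DeriveDef; first by apply/cvg_ex; exists 0.
by apply: cvg_lim; [exact: Rhausdorff|exact: c].
Unshelve. all: by end_near.
Qed.

Lemma Cn_flat n m : Cn n (flat m).
Proof.
elim: n m => [//|n IH] m; exists (fun x => flat m.+2 x - m%:R * flat m.+1 x).
  by move=> x; exact: flat_derive.
have -> : (fun x => flat m.+2 x - m%:R * flat m.+1 x) =
  (fun x => flat m.+2 x + (- m%:R) * flat m.+1 x) by apply/funext => x; rewrite mulNr.
by apply: CnD => //; apply: CnM => //; exact: Cncst.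
Qed.

Definition bump0 (x : R) : R := flat 0 x * flat 0 (-1 * x + 1).
Lemma bump0_smooth : smooth bump0.
Proof. by move=> n; apply: CnM; [exact: Cn_flat|apply: Cn_affine; exact: Cn_flat]. Qed.
Lemma bump0_ge0 x : 0 <= bump0 x. Proof. by rewrite mulr_ge0 ?flat_ge0. Qed.
Lemma bump0_out x : x <= 0 \/ 1 <= x -> bump0 x = 0.
Proof.
rewrite /bump0 /flat => -[h|h]; first by rewrite ltNge h /= mul0r.
by rewrite [X in _ * X]ifF ?mulr0//; apply/negbTE; rewrite -leNgt; lra.
Qed.
Lemma bump0_gt0 x : 0 < x < 1 -> 0 < bump0 x.
Proof.
move=> /andP[h1 h2]; rewrite /bump0 /flat h1 ifT; last by lra.
by rewrite !expr0 !mul1r mulr_gt0 ?expR_gt0.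
Qed.
Lemma smooth_cont f : smooth f -> continuous f.
Proof. by move=> /(_ 1%N) [f' h _] x; exact: is_derive_cont (h x). Qed.

(** Otherwise the monotone primitive would vanish on [0, 1], and so would its derivative at 1/2,
    where [bump0] is positive. *)
Lemma prim_bump0_gt0 : 0 < prim bump0 1.
Proof.
have cb := smooth_cont bump0_smooth.
have pd t := @prim_derive R bump0 t cb.
have mono a b : a <= b -> prim bump0 a <= prim bump0 b.
  move=> ab; have := mono_le ab (fun t _ => is_derive_cst _ _ _ : is_derive t 1 (fun=> 0) 0) (fun t _ => pd t).
  by rewrite subrr subr_ge0; apply => t _; exact: bump0_ge0.
have p1 : 0 <= prim bump0 1 by have := mono 0 1 ler01; rewrite prim0.
rewrite lt_neqAle p1 andbT; apply/eqP => E.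
have z t : 0 <= t <= 1 -> prim bump0 t = 0.
  by move=> /andP[t0 t1]; apply/eqP; rewrite eq_le {1}E mono// -[X in X <= _](prim0 bump0) mono.
have h : 0 < (2^-1 : R) < 1 by apply/andP; split; lra.
have := bump0_gt0 h; suff -> : bump0 2^-1 = 0 by rewrite ltxx.
have d1 := pd 2^-1.
have d2 : is_derive (2^-1 : R) 1 (prim bump0) 0.
  have h0 : is_derive (2^-1 : R) 1 (fun=> 0 : R) 0 := is_derive_cst _ _ _.
  apply: (near_eq_is_derive _ h0); near=> y; apply/esym/z; apply/andP; split; apply: ltW; near: y.
    by apply: lt_nbhsr; lra.
  by apply: lt_nbhsl; lra.
have [_ <-] := d1; by have [_ ->] := d2.
Unshelve. all: by end_near.
Qed.

Definition eta (x : R) : R := (prim bump0 1)^-1 * bump0 x.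
Definition step (x : R) : R := (prim bump0 1)^-1 * prim bump0 x.
Lemma step_derive (x : R) : is_derive x 1 step (eta x).
Proof.
have h := prim_derive x (smooth_cont bump0_smooth).
exact: (@is_deriveZ R R R^o _ (prim bump0 1)^-1 x 1 _ h).
Qed.
Lemma eta_smooth : smooth eta.
Proof. by move=> n; apply: CnM; [exact: Cncst|exact: bump0_smooth]. Qed.
Lemma eta_ge0 x : 0 <= eta x.
Proof. by rewrite mulr_ge0 ?bump0_ge0// invr_ge0 ltW// prim_bump0_gt0. Qed.
Lemma eta_out x : x <= 0 \/ 1 <= x -> eta x = 0.
Proof. by move=> h; rewrite /eta bump0_out// mulr0. Qed.
Lemma step0 x : x <= 0 -> step x = 0.
Proof.
move=> x0; rewrite /step -[RHS](mulr0 (prim bump0 1)^-1); congr (_ * _).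
rewrite -(prim0 bump0); apply/esym/deriv0_cst => // t /andP[_ t0].
have := prim_derive t (smooth_cont bump0_smooth).
by rewrite bump0_out//; left.
Qed.
Lemma step1 x : 1 <= x -> step x = 1.
Proof.
move=> x1; have -> : step x = step 1.
  apply: deriv0_cst => // t /andP[t1 _].
  by have := step_derive t; rewrite eta_out//; right.
by rewrite /step mulVf// gt_eqF// prim_bump0_gt0.
Qed.
Lemma step_01 x : 0 <= step x <= 1.
Proof.
have mono a b : a <= b -> step a <= step b.
  move=> ab; have := mono_le ab (fun t _ => is_derive_cst _ _ _ : is_derive t 1 (fun=> 0) 0) (fun t _ => step_derive t).
  by rewrite subrr subr_ge0; apply => t _; exact: eta_ge0.
apply/andP; split.
  rewrite -(@step0 (Num.min x 0)) ?ge_min ?lexx ?orbT//.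
  by apply: mono; rewrite ge_min lexx.
rewrite -(@step1 (Num.max x 1)) ?le_max ?lexx ?orbT//.
by apply: mono; rewrite le_max lexx.
Qed.
Lemma eta_bounded : exists M : R, forall x, `|eta x| <= M.
Proof.
have [|c _ hc] := @EVT_max R eta 0 1 ler01.
  by apply: continuous_subspaceT => t; exact: (smooth_cont eta_smooth).
exists `|eta c| => x; rewrite (ger0_norm (eta_ge0 x)).
have [h|h] := leP 0 x; last by rewrite eta_out//; left; exact: ltW.
have [h1|h1] := leP x 1; last by rewrite eta_out//; right; exact: ltW.
by apply: le_trans (hc x _) (ler_norm _); rewrite in_itv /= h h1.
Qed.
End smooth.

(** * Fundamental lemma and weak derivatives on the line *)

Section weak_real.
Context {R : realType}.
Implicit Types (f g phi p q : R -> R).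
Local Notation mu := (@lebesgue_measure R).
Local Notation LI := (locally_integrable setT).

Definition wdR f g := [/\ LI f, LI g & forall phi, test_function phi ->
  \int[mu]_x (f x * derive1 phi x) = - \int[mu]_x (g x * phi x)].

Lemma LI_itv f (a b : R) : LI f -> mu.-integrable `[a, b] (EFin \o f).
Proof.
move=> [mf _ h]; apply/integrableP; split.
  by apply/measurable_EFinP; exact: measurable_funTS.
exact: (h _ (@subsetT _ _) (@segment_compact _ a b)).
Qed.

Lemma LIcst (c : R) : LI (fun=> c).
Proof.
split=> //; first exact: openT.
move=> K _ cK; have := @continuous_compact_integrable R (fun=> c) K cK.
by case/(_ (continuous_subspaceT (fun=> cvg_cst _)))/integrableP.
Qed.

Lemma LI_mul f p (M a b : R) : LI f -> measurable_fun setT p -> (forall x, `|p x| <= M) ->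
  (forall x, ~ (a <= x <= b) -> p x = 0) -> mu.-integrable setT (fun x => (f x * p x)%:E).
Proof.
move=> lf mp pM p0.
have M0 : 0 <= M by exact: le_trans (pM 0).
have h := LI_itv a b lf.
have h2 : mu.-integrable setT ((EFin \o (fun x => M * f x)) \_ `[a, b]).
  apply: (integrable_mkcond _ _).1 => //.
  have h3 : mu.-integrable `[a, b] (fun x => (M%:E * (f x)%:E)%E).
    by apply: integrableZl; [exact: measurable_itv|exact: LI_itv].
  exact: h3.
apply: (le_integrable measurableT _ _ h2).
  by apply/measurable_EFinP; apply: measurable_funM => //; case: lf.
move=> x _; rewrite patchE.
case: ifPn => [|xab].
  by move=> _; rewrite /= lee_fin !normrM [leRHS]mulrC ler_wpM2l// (le_trans (pM x))// ler_norm.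
rewrite p0 ?mulr0 ?normr0//.
by move=> h'; move: xab; rewrite notin_setE /= in_itv /= h'.
Qed.

Lemma Rint_restr (A : set R) p : measurable A -> (forall x, ~ A x -> p x = 0) ->
  \int[mu]_x p x = \int[mu]_(x in A) p x.
Proof.
move=> mA h; rewrite [RHS]Rintegral_mkcond; apply: eq_Rintegral => x _.
by rewrite patchE; case: ifPn => //; rewrite notin_setE => /h.
Qed.

Lemma Rint_FTC (F p : R -> R) (a b : R) : a < b -> (forall x : R, is_derive x 1 F (p x)) ->
  continuous p -> \int[mu]_(x in `[a, b]) p x = F b - F a.
Proof.
move=> ab hF cp; rewrite /Rintegral (@continuous_FTC2 _ p F a b ab) //.
- exact: continuous_subspaceT.
- split=> [x _||].
  + by case: (hF x).
  + by apply: cvg_at_right_filter; exact: is_derive_cont (hF a).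
  + by apply: cvg_at_left_filter; exact: is_derive_cont (hF b).
- by move=> x _; rewrite derive1E; case: (hF x).
Qed.

(** An approximate identity supported to the right of [c], in ]c, c + 1/(n + 1)[. Being one-sided,
    it makes its primitives [stp] converge everywhere to the indicator of ]c, +oo[. *)
Definition ker (n : nat) (c x : R) : R := n.+1%:R * eta (n.+1%:R * x + (- (n.+1%:R * c))).
Definition stp (n : nat) (c x : R) : R := step (n.+1%:R * x + (- (n.+1%:R * c))).
Lemma stp_derive n c (x : R) : is_derive x 1 (stp n c) (ker n c x).
Proof. by apply: is_derive_affine; exact: step_derive. Qed.
Lemma ker_smooth n c : smooth (ker n c).
Proof. by move=> m; apply: CnM; [exact: Cncst|apply: Cn_affine; exact: eta_smooth]. Qed.
Lemma ker_out n c x : ~ (c < x < c + n.+1%:R^-1) -> ker n c x = 0.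
Proof.
move=> h; rewrite /ker eta_out ?mulr0//.
have n0 : 0 < n.+1%:R :> R by [].
have [xc|cx] := leP x c; first by left; rewrite -mulrBr pmulr_rle0// subr_le0.
have [xc|cx'] := leP (c + n.+1%:R^-1) x; last by case: h; rewrite cx cx'.
by right; rewrite -mulrBr -ler_pdivrMl// mulr1 lerBrDl.
Qed.
Lemma ker_test n c : test_function (ker n c).
Proof.
apply: (smooth_test (M := `|c| + 1) (ker_smooth n c)) => x hx.
apply: ker_out => /andP[h1 h2].
have n1 : n.+1%:R^-1 <= 1 :> R by rewrite invf_le1// ler1n.
have := ler_norm c; have := ler_norm (- c); rewrite normrN => h3 h4.
have h5 : x <= c + 1 by apply: le_trans (ltW h2) _; rewrite lerD2l.
have : `|x| <= `|c| + 1 by clear n1 h2; rewrite ler_norml; apply/andP; split; lra.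
by move=> /(lt_le_trans hx); rewrite ltxx.
Qed.
Lemma ker_int n c : \int[mu]_x ker n c x = 1.
Proof.
transitivity (\int[mu]_(x in `[c, c + 1]) ker n c x).
  apply: Rint_restr => // x h; apply: ker_out => /andP[h1 h2]; apply: h.
  rewrite /= in_itv /= (ltW h1) /=.
  by apply: le_trans (ltW h2) _; rewrite lerD2l invf_le1// ler1n.
transitivity (stp n c (c + 1) - stp n c c).
  apply: Rint_FTC; first by rewrite ltrDl.
    by move=> x; exact: stp_derive.
  exact: smooth_cont (ker_smooth n c).
rewrite /stp step1 ?step0 ?subr0//; first by rewrite subrr.
by rewrite -mulrBr addrAC subrr add0r mulr1 ler1n.
Qed.
Lemma m_ker n c : measurable_fun setT (ker n c).
Proof. by apply: continuous_measurable_fun; exact: smooth_cont (ker_smooth n c). Qed.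

Lemma davg_bound f c (r : R) (A : set R) : LI f -> 0 < r -> measurable A -> A `<=` ball c r ->
  (\int[mu]_(x in A) `|(f x - f c)%:E| <= (2 * r)%:E * davg f c r)%E.
Proof.
move=> [mf _ _] r0 mA Ab.
have r2 : r *+ 2 != 0 by rewrite mulrn_eq0 /= gt_eqF.
rewrite /davg /iavg lebesgue_measure_ball; last exact: ltW.
rewrite inver (negbTE r2) muleA -EFinM.
have -> : 2 * r / (r *+ 2) = 1 by rewrite mulr_natl divff.
rewrite mul1e.
have -> : (\int[mu]_(y in ball c r) `|((center (f c) \o f) y)%:E| = \int[mu]_(x in ball c r) `|(f x - f c)%:E|)%E by [].
refine (@ge0_subset_integral _ _ _ mu A (ball c r) mA (measurable_ball c r) (fun x => `|(f x - f c)%:E|%E) _ _ Ab); last by [].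
by apply/measurable_EFinP; apply: measurableT_comp => //; apply: measurable_funTS;
  apply: measurable_funB.
Qed.

(** The kernel is at most (n + 1) M on a ball of radius 1/(n + 1), so the error is at most 2 M times
    the mean oscillation, which tends to 0 at a Lebesgue point. *)
Lemma ker_cvg f c : LI f -> lebesgue_pt f c ->
  \int[mu]_x (f x * ker n c x) @[n --> \oo] --> f c.
Proof.
move=> lf lp; have [M hM] := @eta_bounded R.
have M0 : 0 <= M by exact: le_trans (hM 0).
pose e n := M * 2 * fine (davg f c n.+1%:R^-1).
have dpos n : 0 < n.+1%:R^-1 :> R by rewrite invr_gt0.
have cdavg : davg f c n.+1%:R^-1 @[n --> \oo] --> 0%E.
  move/cvge_at_rightP: lp; apply; split=> //.
  exact: cvg_harmonic.
have ce : e n @[n --> \oo] --> (0 : R).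
  rewrite -(mulr0 (M * 2)); apply: cvgMr.
  by move/fine_cvgP: cdavg => [_].
have bnd n : davg f c n.+1%:R^-1 \is a fin_num -> `|\int[mu]_x (f x * ker n c x) - f c| <= e n.
  move=> fin; pose r : R := n.+1%:R^-1.
  have kM x : `|ker n c x| <= n.+1%:R * M.
    by rewrite normrM ger0_norm// ler_wpM2l.
  have kz x : ~ (c - 1 <= x <= c + 1) -> ker n c x = 0.
    move=> h; apply: ker_out => /andP[h1 h2]; apply: h.
    have h3 : x <= c + 1 by apply: le_trans (ltW h2) _; rewrite lerD2l invf_le1// ler1n.
    by rewrite h3 andbT; clear h2 h3; lra.
  have i1 := LI_mul lf (m_ker n c) kM kz.
  have i2 : mu.-integrable setT (fun x => (f c * ker n c x)%:E).
    exact: (LI_mul (LIcst (f c)) (m_ker n c) kM kz).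
  have -> : f c = \int[mu]_x (f c * ker n c x).
    rewrite RintegralZl ?ker_int ?mulr1//.
    have := LI_mul (LIcst 1) (m_ker n c) kM kz.
    by apply: eq_integrable => // x _; rewrite mul1r.
  rewrite -RintegralB//.
  have -> : \int[mu]_x (f x * ker n c x - f c * ker n c x) =
     \int[mu]_(x in ball c r) ((f x - f c) * ker n c x).
    transitivity (\int[mu]_x ((f x - f c) * ker n c x)).
      by apply: eq_Rintegral => x _; rewrite mulrBl.
    apply: Rint_restr; first exact: measurable_ball.
    move=> x h; rewrite ker_out ?mulr0// => /andP[h1 h2]; apply: h.
    have hh : `|c - x| < r.
      rewrite ltr_norml; apply/andP; split; first by rewrite ltrNl opprB ltrBlDl.
      by apply: (@lt_trans _ _ 0); [rewrite subr_lt0|exact: dpos].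
    exact: hh.
  have lbi := davg_bound lf (dpos n) (measurable_ball c r) (@subset_refl _ _).
  have mff : measurable_fun (ball c r) (fun x => (f x - f c)%:E).
    apply/measurable_EFinP; apply: measurable_funTS; apply: measurable_funB => //; by case: lf.
  have iB : mu.-integrable (ball c r) (fun x => (f x - f c)%:E).
    apply/integrableP; split=> //; apply: le_lt_trans lbi _.
    by rewrite -(fineK fin) -EFinM ltry.
  have iK : mu.-integrable (ball c r) (EFin \o (fun x => (f x - f c) * ker n c x)).
    have iB2 : mu.-integrable (ball c r) (fun x => ((n.+1%:R * M)%:E * (f x - f c)%:E)%E).
      by apply: integrableZl; [exact: measurable_ball|exact: iB].
    apply: (le_integrable _ _ _ iB2); first exact: measurable_ball.
      apply/measurable_EFinP; apply: measurable_funM.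
        exact/measurable_EFinP.
      by apply: measurable_funTS; exact: m_ker.
    move=> x _; rewrite /= lee_fin normrM [leRHS]normrM [leLHS]mulrC ler_wpM2r//.
    by apply: le_trans (kM x) _; rewrite ler_norm.
  apply: le_trans (le_normr_Rintegral _ iK) _; first exact: measurable_ball.
  rewrite -lee_fin /Rintegral fineK; last first.
    apply: integrable_fin_num; first exact: measurable_ball.
    by have /integrable_abse := iK.
  apply: (@le_trans _ _ (\int[mu]_(x in ball c r) ((n.+1%:R * M)%:E * `|(f x - f c)%:E|))%E).
    have mB : measurable_fun (ball c r) (fun x => `|((f x - f c) * ker n c x)%:E|%E).
      by apply: measurableT_comp => //; case/integrableP: iK.
    have mB2 : measurable_fun (ball c r) (fun x => ((n.+1%:R * M)%:E * `|(f x - f c)%:E|)%E).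
      by apply: emeasurable_funM => //; apply: measurableT_comp.
    apply: ge0_le_integral; first exact: measurable_ball;
      first [exact: mB|exact: mB2|move=> x _ //; (by rewrite mule_ge0// lee_fin mulr_ge0) ||
        by rewrite /= lee_fin normrM mulrC ler_wpM2r].
  rewrite ge0_integralZl//; last 3 first.
  - exact: measurable_ball.
  - exact: measurableT_comp.
  - by rewrite lee_fin mulr_ge0.
  apply: le_trans (lee_wpmul2l _ lbi) _; first by rewrite lee_fin mulr_ge0.
  rewrite -(fineK fin) -!EFinM lee_fin /e.
  have nr : n.+1%:R * r = 1 by rewrite divff.
  set d := fine _.
  have -> : n.+1%:R * M * (2 * r * d) = (n.+1%:R * r) * (M * 2 * d) by ring.
  by rewrite nr mul1r.
apply/cvgrPdist_le => eps eps0.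
move/cvgrPdist_le: ce => /(_ _ eps0); have [fin _] := (fine_cvgP _ _).1 cdavg.
move: fin; apply: filterS2 => n fin; rewrite sub0r normrN => h.
by rewrite distrC; apply: le_trans (bnd n fin) _; apply: le_trans (ler_norm _) h.
Qed.

(** At a Lebesgue point the value is the limit of the integrals against [ker], all of which
    vanish. *)
Lemma test_zero g : LI g -> (forall phi, test_function phi -> \int[mu]_x (g x * phi x) = 0) ->
  ae (fun x => g x = 0).
Proof.
move=> lg h; apply: aeS (lebesgue_differentiation lg) => x /(ker_cvg lg) hx.
have E : (fun n => \int[mu]_y (g y * ker n x y)) = (fun=> 0).
  by apply/funext => n; apply: h; exact: ker_test.
rewrite E in hx; apply: (cvg_unique _ hx); [exact: Rhausdorff|exact: cvg_cst].
Qed.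

(** The test functions [stp n a - stp n b] have derivative [ker n a - ker n b] and converge
    boundedly to the indicator of ]a, b]. The Lebesgue points identify the limit of the other
    side. *)
Lemma ftc_weak f g (a b : R) : wdR f g -> a < b -> lebesgue_pt f a -> lebesgue_pt f b ->
  f b - f a = \int[mu]_(x in `]a, b]) g x.
Proof.
move=> [lf lg h] ab la lb.
pose phi n x := stp n a x - stp n b x.
have dphi n (x : R) : is_derive x 1 (phi n) (ker n a x - ker n b x).
  by apply: is_deriveB; exact: stp_derive.
have kz n c x : x <= c -> stp n c x = 0.
  by move=> xc; rewrite /stp step0// -mulrBr pmulr_rle0// subr_le0.
have k1 n c x : c + n.+1%:R^-1 <= x -> stp n c x = 1.
  move=> xc; rewrite /stp step1// -mulrBr.
  have n0 : 0 < n.+1%:R :> R by [].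
  by rewrite -ler_pdivrMl// mulr1 lerBrDl.
have n1 n : n.+1%:R^-1 <= 1 :> R by rewrite invf_le1// ler1n.
have phi0 n x : ~ (a <= x <= b + 1) -> phi n x = 0.
  move=> hx; have [xa|xa] := leP x a; first by rewrite /phi !kz ?subrr//; lra.
  have [xb|xb] := leP x (b + 1); first by case: hx; rewrite (ltW xa).
  rewrite /phi !k1 ?subrr//; apply: le_trans (ltW xb).
    by rewrite lerD2l.
  by rewrite lerD// ltW.
have phi_smooth n : smooth (phi n).
  case=> [//|m]; exists (fun x => ker n a x - ker n b x) => //.
  have -> : (fun x => ker n a x - ker n b x) = (fun x => ker n a x + (-1) * ker n b x).
    by apply/funext => x; rewrite mulN1r.
  apply: CnD; first exact: ker_smooth.
  by apply: CnM; [exact: Cncst|exact: ker_smooth].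
have phi_test n : test_function (phi n).
  apply: (smooth_test (M := `|a| + `|b| + 1) (phi_smooth n)) => x hx; apply: phi0 => /andP[h1 h2].
  have := ler_norm b; have := ler_norm (- a); rewrite normrN => h3 h4.
  have : `|x| <= `|a| + `|b| + 1.
    by rewrite ler_norml; apply/andP; split; have := normr_ge0 a; have := normr_ge0 b; lra.
  by move=> /(lt_le_trans hx); rewrite ltxx.
have phi1 n x : `|phi n x| <= 1.
  have := step_01 (n.+1%:R * x + (- (n.+1%:R * a))); have := step_01 (n.+1%:R * x + (- (n.+1%:R * b))).
  by rewrite /phi /stp ler_norml => /andP[? ?] /andP[? ?]; apply/andP; split; lra.
have mphi n : measurable_fun setT (phi n).
  by apply: continuous_measurable_fun; exact: smooth_cont (phi_smooth n).
have lhs : \int[mu]_x (f x * derive1 (phi n) x) @[n --> \oo] --> f a - f b.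
  have E n : \int[mu]_x (f x * derive1 (phi n) x) =
     \int[mu]_x (f x * ker n a x) - \int[mu]_x (f x * ker n b x).
    have [M hM] := @eta_bounded R.
    have kM c x : `|ker n c x| <= n.+1%:R * M by rewrite normrM ger0_norm// ler_wpM2l.
    have kz' c x : ~ (c - 1 <= x <= c + 1) -> ker n c x = 0.
      move=> hx; apply: ker_out => /andP[h1 h2]; apply: hx.
      have h3 : x <= c + 1 by apply: le_trans (ltW h2) _; rewrite lerD2l.
      by rewrite h3 andbT; clear h2 h3; lra.
    rewrite -RintegralB//; [|exact: (LI_mul lf (m_ker n a) (kM a) (kz' a))
       |exact: (LI_mul lf (m_ker n b) (kM b) (kz' b))].
    apply: eq_Rintegral => x _; rewrite -mulrBr; congr (_ * _).
    by rewrite (derive1_of (dphi n)).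
  under eq_fun do rewrite E.
  by apply: cvgB; exact: ker_cvg.
have rhs : \int[mu]_x (g x * phi n x) @[n --> \oo] --> \int[mu]_(x in `]a, b]) g x.
  have mg : measurable_fun setT g by case: lg.
  have ic := LI_itv a (b + 1) lg.
  have [] := @dominated_convergence _ _ _ mu setT measurableT (fun n x => (g x * phi n x)%:E)
    ((EFin \o g) \_ `]a, b]) ((EFin \o (fun x => `|g x|)) \_ `[a, b + 1]).
  - by move=> n; apply/measurable_EFinP; apply: measurable_funM; [exact: mg|exact: mphi].
  - apply/(measurable_restrictT _ _).1 => //; apply/measurable_EFinP; exact: measurable_funTS.
  - apply: aeW => x _; rewrite patchE.
    case: ifPn => [|/negP]; rewrite inE /= in_itv /=.
      move=> /andP[ax xb]; apply: cvg_near_cst.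
      have xa0 : 0 < x - a by rewrite subr_gt0.
      have := near_infty_natSinv_lt (PosNum xa0); apply: filterS => n /= hn.
      by rewrite /phi (kz n b)// k1 ?subr0 ?mulr1// -lerBrDl ltW.
    move=> hx; apply: cvg_near_cst.
    have [xa|ax] := leP x a.
      by apply: nearW => n; rewrite /phi !kz ?subrr ?mulr0//; lra.
    have xb : b < x by rewrite ltNge; apply/negP => xb; apply: hx; rewrite ax.
    have xb0 : 0 < x - b by rewrite subr_gt0.
    have := near_infty_natSinv_lt (PosNum xb0); apply: filterS => n /= hn.
    rewrite /phi !k1 ?subrr ?mulr0// -lerBrDl; first exact: ltW.
    by apply: le_trans (ltW hn) _; rewrite lerB// ltW.
  - apply: (integrable_mkcond _ _).1 => //; exact: integrable_abse ic.
  - apply: aeW => x n _; rewrite patchE; case: ifPn => [_|/negP].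
      by rewrite /= lee_fin normrM ler_piMr.
    by rewrite inE /= in_itv /= => /phi0 ->; rewrite mulr0 normr0.
  move=> i1 _ h3; rewrite /Rintegral.
  have -> : (\int[mu]_(x in `]a, b]) (g x)%:E = \int[mu]_x ((EFin \o g) \_ `]a, b]) x)%E.
    by rewrite integral_mkcond.
  by apply: fine_cvg; rewrite fineK//; apply: integrable_fin_num.
have E : (fun n => \int[mu]_x (f x * derive1 (phi n) x)) = (fun n => - \int[mu]_x (g x * phi n x)).
  by apply/funext => n; exact: h.
rewrite E in lhs; have := cvgN rhs => rhs'.
have hh := cvg_unique (@Rhausdorff R) lhs (rhs' _).
by rewrite -[RHS]opprK -hh opprB.
Qed.
End weak_real.

(** * Translations and test functions *)

Section translation.
Context {R : realType}.
Local Notation H := (Hsp R).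
Local Notation mu := (@lebesgue_measure R).
Implicit Types (u v w f g : H) (phi : R -> R).
Hint Resolve L2h Cmh : core.

Definition shiftR (h : R) : R -> measurableTypeR R := fun x => x + h.

Lemma m_shift (h : R) : measurable_fun setT (shiftR h).
Proof. by apply: measurable_funD => //; exact: measurable_cst. Qed.

Lemma lebesgue_shift (h : R) (A : set R) : measurable A -> pushforward mu (shiftR h) A = mu A.
Proof.
move=> mA; apply/esym/lebesgue_measure_unique => //=; first exact: m_shift.
move=> _ X [[a b] _ <-]; rewrite /pushforward.
have -> : shiftR h @^-1` `]a, b] = `]a - h, b - h]%classic.
  by apply/seteqP; split=> x /=; rewrite /shiftR !in_itv /= ltrBlDr lerBrDr.
rewrite !lebesgue_measure_itv /= !lte_fin ltrD2r.
by case: ifP => // _; rewrite -!EFinB; congr (_%:E); ring.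
Qed.

Lemma ae_shift (h : R) (P : R -> Prop) : ae P -> ae (fun x => P (x + h)).
Proof.
move=> [A [mA A0 PA]]; exists (shiftR h @^-1` A); split.
- by rewrite -[X in measurable X]setTI; exact: m_shift.
- by have := lebesgue_shift h mA; rewrite /pushforward A0.
- by move=> x /= hx; apply: PA.
Qed.

Lemma int_shift (h : R) (p : R -> R) : measurable_fun setT p -> (forall x, 0 <= p x) ->
  (\int[mu]_x (p (x + h))%:E = \int[mu]_x (p x)%:E)%E.
Proof.
move=> mp p0.
have -> : (\int[mu]_x (p x)%:E = \int[pushforward mu (shiftR h)]_x (p x)%:E)%E.
  apply: eq_measure_integral => //=; first exact: m_shift.
  by move=> mS A mA _; apply/esym; apply: lebesgue_shift; exact: mA.
rewrite ge0_integral_pushforward//=.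
- exact: m_shift.
- exact/measurable_EFinP.
- by move=> y _; rewrite lee_fin.
Qed.

Lemma Cm_shift (h : R) (c : R -> R[i]) : Cmeasurable c -> Cmeasurable (fun x => c (x + h)).
Proof.
move=> [m1 m2]; split.
  exact: (measurableT_comp m1 (m_shift h)).
exact: (measurableT_comp m2 (m_shift h)).
Qed.

Lemma L2_shift (h : R) (c : R -> R[i]) : L2 c -> L2 (fun x => c (x + h)).
Proof.
move=> /L2P[mc ic]; apply/L2P; split; first exact: Cm_shift.
apply/integrableP; split.
  by apply/measurable_EFinP; apply: m_n2; exact: Cm_shift.
have ic2 : (\int[mu]_x (n2 (c x))%:E < +oo)%E.
  by case/integrableP: ic => _; under eq_integral do rewrite abse_EFin ger0_norm ?n2_ge0//.
under eq_integral do rewrite abse_EFin ger0_norm ?n2_ge0//.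
by rewrite (int_shift h (m_n2 mc)) // => x; exact: n2_ge0.
Qed.

Definition T (h : R) f : H := mk (fun x => f (x + h)).
Lemma TE h f : ae_equal (T h f) (fun x => f (x + h)).
Proof. by apply: mkE; apply: L2_shift. Qed.
Lemma TD h f g : T h (f + g) = T h f + T h g.
Proof.
apply: eqH; apply: aeS (aeI (aeI (TE h (f + g)) (ae_shift h (hD f g)))
  (aeI (hD (T h f) (T h g)) (aeI (TE h f) (TE h g)))) => x [[-> ->] [-> [-> ->]]].
by [].
Qed.
Lemma TZ h (a : R) f : T h (a *: f) = a *: T h f.
Proof.
by apply: eqH; apply: aeS (aeI (aeI (TE h (a *: f)) (ae_shift h (hZ a f)))
  (aeI (hZ a (T h f)) (TE h f))) => x [[-> ->] [-> ->]].
Qed.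
Lemma TN h f : T h (- f) = - T h f.
Proof. by rewrite -scaleN1r TZ scaleN1r. Qed.
Lemma TB h f g : T h (f - g) = T h f - T h g.
Proof. by rewrite TD TN. Qed.
Lemma TT h k f : T h (T k f) = T (h + k) f.
Proof.
apply: eqH; apply: aeS (aeI (aeI (TE h (T k f)) (ae_shift h (TE k f))) (TE (h + k) f))
  => x [[-> ->] ->].
by rewrite addrA.
Qed.
Lemma T0 f : T 0 f = f.
Proof. by apply: eqH; apply: aeS (TE 0 f) => x ->; rewrite addr0. Qed.
Lemma TJ h f : T h (J f) = J (T h f).
Proof.
by apply: eqH; apply: aeS (aeI (aeI (TE h (J f)) (ae_shift h (JE f)))
  (aeI (JE (T h f)) (TE h f))) => x [[-> ->] [-> ->]].
Qed.
Lemma Tcj h f : T h (cj f) = cj (T h f).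
Proof.
by apply: eqH; apply: aeS (aeI (aeI (TE h (cj f)) (ae_shift h (cjE f)))
  (aeI (cjE (T h f)) (TE h f))) => x [[-> ->] [-> ->]].
Qed.
Lemma nrmT h f : `|T h f| = `|f|.
Proof.
apply/eqP; rewrite -(eqrXn2 (n := 2))// !nrm_sqr !dotuu; apply/eqP; congr fine.
rewrite -(int_shift h (m_n2 (Cmh f))); last by move=> x; exact: n2_ge0.
apply: ae_eq_integral => //.
- by apply/measurable_EFinP; apply: m_n2.
- by apply/measurable_EFinP; apply: m_n2; exact: Cm_shift.
- by apply: aeS (TE h f) => x -> _.
Qed.
(** Polarisation reduces invariance of the pairing under a linear map to invariance of the norm. *)
Lemma dot_polar f g : dot f g = (`|f + g| ^+ 2 - `|f - g| ^+ 2) / 4.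
Proof.
rewrite !nrm_sqr !(dotBl, dotBr, dotDl, dotDr) (dotC g f).
by gen_dots; field.
Qed.
Lemma dotTT h f g : dot (T h f) (T h g) = dot f g.
Proof. by rewrite dot_polar -TD -TB !nrmT -dot_polar. Qed.
Lemma dotT h f g : dot (T h f) g = dot f (T (- h) g).
Proof. by rewrite -[in RHS](dotTT h) TT subrr T0. Qed.

Definition tm phi : H := mk (fun x => (phi x)%:C).
Definition oc (a b : R) : set R := [set x | a < x <= b].
Lemma ocE a b : oc a b = `]a, b]%classic.
Proof. by apply/seteqP; split=> x; rewrite /oc /= in_itv. Qed.
Lemma m_oc a b : measurable (oc a b). Proof. by rewrite ocE; exact: measurable_itv. Qed.
Definition ind (a b : R) : H := mk (fun x => (\1_(oc a b) x)%:C).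

Lemma test_cont phi : test_function phi -> continuous phi.
Proof. by move=> /test_smooth/smooth_cont. Qed.
Lemma m_test phi : test_function phi -> measurable_fun setT phi.
Proof. by move=> /test_cont; exact: continuous_measurable_fun. Qed.

Lemma L2ind (a b : R) : L2 (fun x => ((\1_(oc a b) x)%:C : R[i])).
Proof.
apply/L2P; split.
  by apply: CmC; apply: measurable_indic; exact: m_oc.
have mi : measurable_fun setT (\1_(oc a b) : R -> R) by apply: measurable_indic; exact: m_oc.
have i1 := @LI_mul R _ (\1_(oc a b)) 1 a b (LIcst 1) mi.
apply: eq_integrable (i1 _ _) => // [x _ /=|x|x h].
- by rewrite n2C indicE; case: (_ \in _); rewrite ?expr1n ?expr0n ?mulr1 ?mulr0.
- by rewrite indicE; case: (_ \in _); rewrite ?normr1 ?normr0.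
- rewrite indicE memNset// /oc /= => /andP[h1 h2]; apply: h; rewrite h2 ltW//.
Qed.
Lemma indE a b : ae_equal (ind a b) (fun x => (\1_(oc a b) x)%:C).
Proof. exact: mkE (L2ind a b). Qed.

Lemma L2_compact phi (M K : R) : measurable_fun setT phi -> (forall x, `|phi x| <= K) ->
  (forall x, M < `|x| -> phi x = 0) -> L2 (fun x => (phi x)%:C : R[i]).
Proof.
move=> mp hK hM; apply: (L2_le (K := K ^+ 2) _ (L2ind (- (`|M| + 1)) (`|M| + 1))).
  exact: CmC.
apply: aeW' => x; rewrite !n2C indicE.
case: (boolP (x \in _)) => [_|] /=.
  by rewrite expr1n mulr1 -real_normK ?num_real// ler_pXn2r ?nnegrE// (le_trans (normr_ge0 _) (hK 0)).
rewrite notin_setE /oc /= => h; rewrite hM ?expr0n ?mulr0//.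
rewrite ltNge; apply/negP => xM; apply: h.
have : `|x| <= `|M| by apply: le_trans xM (ler_norm _).
by rewrite ler_norml => /andP[h1 h2]; apply/andP; split; lra.
Qed.

Lemma test_bounded phi : test_function phi -> exists K : R, forall x, `|phi x| <= K.
Proof.
move=> tp; have [_ [M hM]] := tp.
have hMM : - (`|M| + 1) <= `|M| + 1 by have := normr_ge0 M; lra.
have [|c _ hc] := @EVT_max R (fun x => `|phi x|) (- (`|M| + 1)) (`|M| + 1) hMM.
  by apply: continuous_subspaceT => t; apply: cvg_norm; exact: (test_cont tp).
exists `|phi c| => x.
have [h|h] := leP `|x| (`|M| + 1); first by apply: hc; rewrite in_itv /= -ler_norml.
by rewrite hM ?normr0//; apply: lt_trans h; have := ler_norm M; lra.
Qed.
Lemma test_out phi (M x : R) : (forall x, M < `|x| -> phi x = 0) -> M < `|x| -> derive1 phi x = 0.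
Proof.
move=> hM Mx; rewrite derive1E.
have h0 : is_derive x 1 (fun=> 0 : R) 0 := is_derive_cst _ _ _.
suff [] : is_derive x 1 phi 0 by [].
apply: (near_eq_is_derive _ h0).
have : \forall y \near x, M < `|y|.
  have c : `|y| @[y --> x] --> `|x| by apply: cvg_norm; exact: cvg_id.
  exact: (cvgr_gt _ c).
by apply: filterS => y /hM ->.
Qed.
Lemma test_derive phi : test_function phi -> test_function (derive1 phi).
Proof.
move=> tp; have [h [M hM]] := tp; split.
  by move=> n x; have := h n.+1 x; rewrite /derive1n iterSr.
by exists M => x; exact: test_out.
Qed.
Lemma L2tm phi : test_function phi -> L2 (fun x => (phi x)%:C : R[i]).
Proof.
move=> tp; have [K hK] := test_bounded tp; have [_ [M hM]] := tp.
exact: (L2_compact (m_test tp) hK hM).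
Qed.
Lemma tmE phi : test_function phi -> ae_equal (tm phi) (fun x => (phi x)%:C).
Proof. by move=> tp; apply: mkE; exact: L2tm. Qed.

Lemma test_isd phi (x : R) : test_function phi -> is_derive x 1 phi (derive1 phi x).
Proof. by move=> [h _]; rewrite derive1E; exact: (derivableP (h 0%N x)). Qed.

Lemma dot_tm f phi : test_function phi -> dot f (tm phi) = \int[mu]_x (complex.Re (f x) * phi x).
Proof.
move=> tp; rewrite (dot_ae _ _ (ae_eq_refl f) (tmE tp))//; last by case: (L2tm tp).
by apply: eq_Rintegral => x _; rewrite /rdot !ReImE mulr0 addr0.
Qed.
Lemma dot_Jtm f phi : test_function phi -> dot f (J (tm phi)) = \int[mu]_x (complex.Im (f x) * phi x).
Proof.
move=> tp.
have e : ae_equal (J (tm phi)) (fun x => 'i * (phi x)%:C).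
  by apply: aeS2 (JE (tm phi)) (tmE tp) => x -> ->.
rewrite (dot_ae _ _ (ae_eq_refl f) e)//; last first.
  by apply: CmM; [exact: Cmcst|case: (L2tm tp)].
by apply: eq_Rintegral => x _; rewrite /rdot !ReImE; ring.
Qed.

Lemma LI_h f : locally_integrable setT (fun x => complex.Re (f x)) /\
  locally_integrable setT (fun x => complex.Im (f x)).
Proof.
have [m1 m2] := Cmh f.
have key (p : R -> R) : measurable_fun setT p -> (forall x, p x ^+ 2 <= n2 (f x)) ->
    locally_integrable setT p.
  move=> mp hp; split=> //; first exact: openT.
  move=> K _ cK; have mK := compact_measurable cK.
  have i1 : mu.-integrable K (fun x => (n2 (f x))%:E).
    by apply: (integrableS measurableT) => //; exact: L2_n2int.
  have i2 : mu.-integrable K (EFin \o cst 1).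
    apply: continuous_compact_integrable => //; apply: continuous_subspaceT.
    exact: cst_continuous.
  have i3 : mu.-integrable K (fun x => ((n2 (f x))%:E + 1%:E)%E).
    by apply: integrableD; [exact: mK|exact: i1|exact: i2].
  case/integrableP: i3 => _; apply: le_lt_trans; apply: ge0_le_integral => //.
  - by apply/measurable_EFinP; apply: measurableT_comp => //; exact: measurable_funTS.
  - apply: measurableT_comp => //; apply: emeasurable_funD => //.
    by apply/measurable_EFinP; apply: measurable_funTS; exact: m_n2.
  - move=> x _; rewrite /= lee_fin [leRHS]ger0_norm; last by rewrite addr_ge0// n2_ge0.
    have := n2_ge0 (f x); have := hp x; have := sqr_ge0 (`|p x| - 1); rewrite -[p x ^+ 2]real_normK ?num_real//.
    nra.
split.
  by apply: (key _ m1) => x; rewrite /n2 lerDl sqr_ge0.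
by apply: (key _ m2) => x; rewrite /n2 lerDr sqr_ge0.
Qed.

(** Real test functions and their multiples by i see the real and the imaginary part separately. *)
Lemma orth_test f : (forall phi, test_function phi -> dot f (tm phi) = 0 /\ dot f (J (tm phi)) = 0) ->
  f = 0.
Proof.
move=> h; have [l1 l2] := LI_h f.
have r0 : ae (fun x => complex.Re (f x) = 0).
  by apply: test_zero l1 _ => phi tp; rewrite -dot_tm//; exact: (h phi tp).1.
have i0 : ae (fun x => complex.Im (f x) = 0).
  by apply: test_zero l2 _ => phi tp; rewrite -dot_Jtm//; exact: (h phi tp).2.
by apply: eqH; apply: aeS3 r0 i0 (@h0 R) => x a b ->; apply: cplx_eq.
Qed.

Definition Dtest : set H := [set u | exists phi psi, [/\ test_function phi, test_function psi &
  u = tm phi + J (tm psi)]].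

Lemma testD (a : R) phi psi : test_function phi -> test_function psi ->
  test_function (fun x => a * phi x + psi x).
Proof.
move=> tp ts; have [_ [M hM]] := tp; have [_ [N hN]] := ts.
apply: (smooth_test (M := Num.max M N)).
  move=> n; apply: CnD; last exact: test_smooth.
  by apply: CnM; [exact: Cncst|exact: test_smooth].
by move=> x; rewrite gt_max => /andP[h1 h2]; rewrite hM// hN// mulr0 addr0.
Qed.
Lemma tmD (a : R) phi psi : test_function phi -> test_function psi ->
  tm (fun x => a * phi x + psi x) = a *: tm phi + tm psi.
Proof.
move=> tp ts; apply: eqH.
apply: aeS (aeI (aeI (tmE (testD a tp ts)) (hD (a *: tm phi) (tm psi)))
  (aeI (hZ a (tm phi)) (aeI (tmE tp) (tmE ts)))) => x [[-> ->] [-> [-> ->]]].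
by apply: cplx_eq; rewrite !ReImE; ring.
Qed.
Lemma test0 : test_function (fun=> 0 : R).
Proof. by apply: (smooth_test (M := 0)) => // n; exact: Cncst. Qed.
Lemma tm0 : tm (fun=> 0) = 0.
Proof.
by apply: eqH; apply: aeS2 (tmE test0) (@h0 R) => x -> ->.
Qed.

Lemma dense_test : dn Dtest.
Proof.
apply: dense_of_orth.
  split; first by exists (fun=> 0), (fun=> 0); split; [exact: test0..|rewrite tm0 J0 addr0].
  move=> a _ _ [p [q [tp tq ->]]] [p' [q' [tp' tq' ->]]].
  exists (fun x => a * p x + p' x), (fun x => a * q x + q' x); split; [exact: testD..|].
  by rewrite !tmD// JD JZ scalerDr addrACA.
move=> u h; apply: orth_test => phi tp; split; apply: h.
  by exists phi, (fun=> 0); split=> //; [exact: test0|rewrite tm0 J0 addr0].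
by exists (fun=> 0), phi; split=> //; [exact: test0|rewrite tm0 add0r].
Qed.

Lemma test_shift h phi : test_function phi -> test_function (fun x => phi (x + h)).
Proof.
move=> tp; have [_ [M hM]] := tp; apply: (smooth_test (M := M + `|h|)).
  move=> n; have := @Cn_affine R n phi 1 h (test_smooth tp n).
  by under eq_fun do rewrite mul1r.
move=> x hx; apply: hM.
have : `|x| <= `|x + h| + `|h| by rewrite -{1}(addrK h x); exact: ler_normB.
lra.
Qed.
Lemma T_tm h phi : test_function phi -> T h (tm phi) = tm (fun x => phi (x + h)).
Proof.
move=> tp; apply: eqH; apply: aeS (aeI (aeI (TE h (tm phi)) (ae_shift h (tmE tp)))
  (tmE (test_shift h tp))) => x [[-> ->] ->].
by [].
Qed.
Lemma derive1_shift h phi : test_function phi ->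
  derive1 (fun x => phi (x + h)) = (fun x => derive1 phi (x + h)).
Proof.
move=> tp; apply/derive1_of => x.
have := @is_derive_affine R phi (derive1 phi) 1 h x (test_isd _ tp).
by under eq_fun do rewrite mul1r; rewrite !mul1r.
Qed.

(** Taylor estimates of first and second order. Translations by at most 1 keep all functions inside
    [-A, A] with A = |M| + 2, and the indicator of that interval dominates them. *)
Lemma test_diff phi : test_function phi -> exists K : R, 0 <= K /\
  forall h : R, `|h| <= 1 -> `|T h (tm phi) - tm phi - h *: tm (derive1 phi)| <= K * h ^+ 2 /\
     `|T h (tm phi) - tm phi| <= K * `|h|.
Proof.
move=> tp; have td := test_derive tp; have tdd := test_derive td.
have [K1 hK1] := test_bounded td; have [K2 hK2] := test_bounded tdd.
have [_ [M hM]] := tp.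
have K10 : 0 <= K1 by exact: le_trans (hK1 0).
have K20 : 0 <= K2 by exact: le_trans (hK2 0).
pose A := `|M| + 2.
pose e := ind (- A) A.
have lip (p : R -> R) (L : R) : test_function p -> (forall x, `|derive1 p x| <= L) ->
    forall x h, `|p (x + h) - p x| <= L * `|h|.
  move=> tpp hL x h.
  have hl (s : R) := @is_derive_lin R L s.
  have hp (s : R) := test_isd s tpp.
  have [h0|h0] := leP 0 h.
    have xh : x <= x + h by rewrite lerDl.
    have := mono_norm xh (fun s _ => hp s) (fun s _ => hl s) (fun s _ => hL s).
    by rewrite -mulrBr addrAC subrr add0r (ger0_norm h0).
  have xh : x + h <= x by rewrite gerDl ltW.
  have := mono_norm xh (fun s _ => hp s) (fun s _ => hl s) (fun s _ => hL s).
  by rewrite -mulrBr opprD addrA subrr sub0r (ltr0_norm h0) distrC.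
have out x h : `|h| <= 1 -> ~ (- A < x <= A) -> phi (x + h) = 0 /\ phi x = 0 /\ derive1 phi x = 0.
  move=> h1 hx.
  have xA : A <= `|x|.
    rewrite leNgt; apply/negP; rewrite ltr_norml => /andP[a b]; apply: hx.
    by rewrite a ltW.
  have MM := ler_norm M.
  have x1 : M < `|x| by rewrite /A in xA; lra.
  have x2 : M < `|x + h|.
    have : `|x| <= `|x + h| + `|h| by rewrite -{1}(addrK h x); exact: ler_normB.
    by rewrite /A in xA; lra.
  split; first exact: hM.
  split; first exact: hM.
  by rewrite (test_out hM).
have hpA h : `|h| <= 1 -> forall x, n2 (((phi (x + h) - phi x - h * derive1 phi x)%:C : R[i])) <= (K2 * h ^+ 2) ^+ 2 * n2 (((\1_(oc (- A) A) x)%:C) : R[i]) /\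
   n2 (((phi (x + h) - phi x)%:C : R[i])) <= (K1 * `|h|) ^+ 2 * n2 (((\1_(oc (- A) A) x)%:C) : R[i]).
  move=> h1 x; rewrite !n2C indicE; case: (boolP (x \in _)) => [_|]; last first.
    rewrite notin_setE /oc /= => hx; have [-> [-> ->]] := out x h h1 hx.
    by rewrite mulr0 !subr0 expr0n !mulr0.
  have sq (a b : R) : `|a| <= b -> a ^+ 2 <= b ^+ 2.
    by move=> ab; rewrite -real_normK ?num_real// lerXn2r ?nnegrE// (le_trans (normr_ge0 _) ab).
  rewrite /= expr1n !mulr1; split; apply: sq; last exact: lip.
  have hd (y : R) : is_derive y 1 (fun z => phi z - derive1 phi x * z) (derive1 phi y - derive1 phi x).
    by apply: is_deriveB; [exact: test_isd|exact: is_derive_lin].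
  have hl (s : R) := @is_derive_lin R (K2 * `|h|) s.
  have bb y : `|y - x| <= `|h| -> `|derive1 phi y - derive1 phi x| <= K2 * `|h|.
    move=> yx; have := lip _ _ td hK2 x (y - x); rewrite (addrC x) subrK => /le_trans; apply.
    by rewrite ler_wpM2l.
  have E1 : phi (x + h) - phi x - h * derive1 phi x =
    (phi (x + h) - derive1 phi x * (x + h)) - (phi x - derive1 phi x * x) by ring.
  have E2 : K2 * h ^+ 2 = K2 * `|h| * `|h| by rewrite -mulrA -expr2 real_normK ?num_real.
  rewrite E1 E2; have [h0|h0] := leP 0 h.
    have xh : x <= x + h by rewrite lerDl.
    have hm := mono_norm xh (fun s _ => hd s) (fun s _ => hl s).
    have E3 : K2 * `|h| * (x + h) - K2 * `|h| * x = K2 * `|h| * h by ring.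
    rewrite E3 in hm; rewrite [X in _ <= _ * X](ger0_norm h0); apply: hm => y /andP[y1 y2]; apply: bb.
    by rewrite ger0_norm ?subr_ge0// (ger0_norm h0) lerBlDl.
  have xh : x + h <= x by rewrite gerDl ltW.
  have hm := mono_norm xh (fun s _ => hd s) (fun s _ => hl s).
  have E3 : K2 * `|h| * x - K2 * `|h| * (x + h) = K2 * `|h| * - h by ring.
  rewrite E3 in hm; rewrite distrC [X in _ <= _ * X](ltr0_norm h0); apply: hm => y /andP[y1 y2]; apply: bb.
  by rewrite ler0_norm ?subr_le0// (ltr0_norm h0); lra.
exists ((K1 + K2) * `|e|); split; first by rewrite mulr_ge0// addr_ge0.
move=> h h1; split.
  apply: (@le_trans _ _ (K2 * h ^+ 2 * `|e|)); last first.
    by rewrite mulrAC ler_wpM2r ?sqr_ge0// ler_wpM2r// lerDr.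
  apply: nrm_le_ae; first by rewrite mulr_ge0 ?sqr_ge0.
  apply: aeS (aeI (aeI (hB (T h (tm phi) - tm phi) (h *: tm (derive1 phi))) (hB (T h (tm phi)) (tm phi)))
    (aeI (aeI (hZ h (tm (derive1 phi))) (indE (- A) A))
    (aeI (aeI (TE h (tm phi)) (ae_shift h (tmE tp))) (aeI (tmE tp) (tmE td))))) =>
    x [[-> ->] [[-> ->] [[-> ->] [-> ->]]]].
  have [+ _] := hpA h h1 x; congr (n2 _ <= _).
  by apply: cplx_eq; rewrite !ReImE; ring.
apply: (@le_trans _ _ (K1 * `|h| * `|e|)); last first.
  by rewrite mulrAC ler_wpM2r// ler_wpM2r// lerDl.
apply: nrm_le_ae; first by rewrite mulr_ge0.
apply: aeS (aeI (aeI (hB (T h (tm phi)) (tm phi)) (indE (- A) A))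
    (aeI (aeI (TE h (tm phi)) (ae_shift h (tmE tp))) (tmE tp))) =>
    x [[-> ->] [[-> ->] ->]].
have [_ +] := hpA h h1 x; congr (n2 _ <= _).
by apply: cplx_eq; rewrite !ReImE; ring.
Qed.

(** Translations are isometries, so continuity at 0 on the dense set of test functions suffices. *)
Lemma T_cont f : continuous (fun h => T h f).
Proof.
suff h0 : T h f @[h --> (0:R)] --> f.
  move=> t; apply/cvgrPdist_le => e e0.
  move/cvgrPdist_le: h0 => /(_ e e0) h0.
  have c : (fun s : R => s - t) @ t --> (0 : R).
    by rewrite -(subrr t); apply: cvgB; [exact: cvg_id|exact: cvg_cst].
  have hs : nbhs t (fun s => `|f - T (s - t) f| <= e) by exact: (c _ h0).
  apply: filterS hs => s.
  by rewrite -[X in _ -> X <= _](nrmT (- t)) TB !TT addNr T0 (addrC (- t)).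
apply/cvgrPdist_le => e e0.
have e3 : 0 < e / 3 by rewrite divr_gt0.
have [_ [p [q [tp tq ->]]] fg] := dense_test f e3.
have [K1 [K10 hK1]] := test_diff tp; have [K2 [K20 hK2]] := test_diff tq.
have d0 : 0 < Num.min 1 (e / 3 / (K1 + K2 + 1)).
  by rewrite lt_min ltr01 /= divr_gt0// ltr_wpDl// addr_ge0.
have : \forall h \near (0:R), `|h| < Num.min 1 (e / 3 / (K1 + K2 + 1)).
  exact: nbhs0_lt.
apply: filterS => h; rewrite lt_min => /andP[h1 h2].
set g := tm p + J (tm q) in fg.
have E : f - T h f = (f - g) - T h (f - g) - (T h g - g).
  by rewrite TB !opprB addrAC (subrKA g) (subrKA (T h g)).
rewrite E; apply: le_trans (ler_normB _ _) _.
have n1 : `|f - g - T h (f - g)| <= e / 3 + e / 3.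
  by apply: le_trans (ler_normB _ _) _; rewrite nrmT lerD.
have n2 : `|T h g - g| <= e / 3.
  have -> : T h g - g = (T h (tm p) - tm p) + J (T h (tm q) - tm q).
    by rewrite /g TD TJ JB opprD addrACA.
  apply: le_trans (ler_normD _ _) _; rewrite nrmJ.
  apply: le_trans (lerD (hK1 h (ltW h1)).2 (hK2 h (ltW h1)).2) _.
  rewrite -mulrDl; apply: le_trans (_ : (K1 + K2 + 1) * `|h| <= _).
    by rewrite ler_wpM2r// lerDl.
  by rewrite -ler_pdivlMl 1?mulrC ?ltW// ltr_wpDl// addr_ge0.
by apply: le_trans (lerD n1 n2) _; rewrite le_eqVlt; apply/orP; left; apply/eqP; field.
Qed.
End translation.

(** * One-parameter unitary groups and generators *)

Section groups.
Context {R : realType}.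
Local Notation H := (Hsp R).
Implicit Types (u v w f g : H) (S : R -> H -> H).

Record grp S : Prop := Grp {
  grp_lin : forall t a u v, S t (a *: u + v) = a *: S t u + S t v;
  grp_nrm : forall t u, `|S t u| = `|u|;
  grp_0 : forall u, S 0 u = u;
  grp_add : forall t t' u, S (t + t') u = S t (S t' u);
  grp_cont : forall u, continuous (fun t => S t u) }.

Arguments grp_cont {S} _ u _ _ _.

(** The infinitesimal generator as a relation: its domain consists of the [f] that admit some
    [g]. *)
Record gen S f g : Prop := Gen { genE : h^-1 *: (S h f - f) @[h --> (0:R)^'] --> g }.
Arguments genE {S f g} _ _ _.

Section one.
Variables (S : R -> H -> H) (gS : grp S).

Lemma grpD t u v : S t (u + v) = S t u + S t v.
Proof. by have := grp_lin gS t 1 u v; rewrite !scale1r. Qed.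
Lemma grpz t : S t 0 = 0.
Proof. by have := grp_nrm gS t 0; rewrite normr0 => /eqP; rewrite normr_eq0 => /eqP. Qed.
Lemma grpZ t a u : S t (a *: u) = a *: S t u.
Proof. by have := grp_lin gS t a u 0; rewrite grpz !addr0. Qed.
Lemma grpN t u : S t (- u) = - S t u.
Proof. by rewrite -scaleN1r grpZ scaleN1r. Qed.
Lemma grpB t u v : S t (u - v) = S t u - S t v.
Proof. by rewrite grpD grpN. Qed.
Lemma grpK t u : S (- t) (S t u) = u.
Proof. by rewrite -(grp_add gS) addNr (grp_0 gS). Qed.
Lemma grpK' t u : S t (S (- t) u) = u.
Proof. by rewrite -(grp_add gS) subrr (grp_0 gS). Qed.
Lemma grp_dot t u v : dot (S t u) (S t v) = dot u v.
Proof. by rewrite dot_polar -grpD -grpB !(grp_nrm gS) -dot_polar. Qed.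
Lemma grp_adj t u v : dot (S t u) v = dot u (S (- t) v).
Proof. by rewrite -[in RHS](grp_dot t) grpK'. Qed.
Lemma grp_small u (e : R) : 0 < e -> exists2 d : R, 0 < d & forall h, `|h| <= d -> `|S h u - u| <= e.
Proof.
move=> e0; have /cvgrPdist_le/(_ _ e0) := grp_cont gS u (0:R).
rewrite (grp_0 gS) => -[d /= d0 hd]; exists (d / 2); first by rewrite divr_gt0.
move=> h hh; rewrite distrC; apply: hd; rewrite /= sub0r normrN.
by apply: le_lt_trans hh _; rewrite ltr_pdivrMr// ltr_pMr// ltr1n.
Qed.
Lemma genP f g : gen S f g <-> forall e : R, 0 < e -> exists2 d : R, 0 < d &
  forall h, `|h| <= d -> `|S h f - f - h *: g| <= e * `|h|.
Proof.
have key (h : R) : h != 0 -> `|g - h^-1 *: (S h f - f)| * `|h| = `|S h f - f - h *: g|.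
  move=> h0; rewrite mulrC -normrZ scalerBr scalerA divff// scale1r distrC //.
split=> [[/cvgrPdist_le hg] e e0|hg].
  have [d /= d0 hd] := hg e e0; exists (d / 2); first by rewrite divr_gt0.
  move=> h hh; have [->|h0] := eqVneq h 0.
    by rewrite (grp_0 gS) subrr scale0r subr0 !normr0 mulr0.
  rewrite -key// ler_wpM2r//; apply: hd => //=; rewrite sub0r normrN.
  by apply: le_lt_trans hh _; rewrite ltr_pdivrMr// ltr_pMr// ltr1n.
split; apply/cvgrPdist_le => e e0; have [d d0 hd] := hg e e0.
exists d => //= h /=; rewrite sub0r normrN => hh h0.
by rewrite -(ler_pM2r (x := `|h|)) ?normr_gt0// key//; apply: hd; exact: ltW.
Qed.
Lemma gen_uniq f g g' : gen S f g -> gen S f g' -> g = g'.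
Proof. by move=> [h] [h']; apply: (cvg_unique _ h h'). Qed.
Lemma gen_lin a f g f' g' : gen S f g -> gen S f' g' -> gen S (a *: f + f') (a *: g + g').
Proof.
move=> [h] [h']; have E : (fun h => h^-1 *: (S h (a *: f + f') - (a *: f + f'))) =
    (fun h => a *: (h^-1 *: (S h f - f)) + h^-1 *: (S h f' - f')).
  apply/funext => k; rewrite (grp_lin gS) scalerA (mulrC a) -scalerA -scalerDr; congr (_ *: _).
  by rewrite opprD addrACA scalerBr.
by split; rewrite E; apply: cvgD => //; apply: cvgZr.
Qed.
Lemma gen0 : gen S 0 0.
Proof.
split; under eq_fun do rewrite grpz subrr scaler0.
exact: cvg_cst.
Qed.
Lemma genZ a f g : gen S f g -> gen S (a *: f) (a *: g).
Proof. by move=> h; have := gen_lin a h gen0; rewrite !addr0. Qed.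
Lemma genD f g f' g' : gen S f g -> gen S f' g' -> gen S (f + f') (g + g').
Proof. by move=> h h'; have := gen_lin 1 h h'; rewrite !scale1r. Qed.
Lemma genN f g : gen S f g -> gen S (- f) (- g).
Proof. by move=> h; rewrite -!(scaleN1r f) -(scaleN1r g); exact: genZ. Qed.
Lemma genB f g f' g' : gen S f g -> gen S f' g' -> gen S (f - f') (g - g').
Proof. by move=> h h'; apply: genD => //; exact: genN. Qed.
Lemma gen_shift t f g : gen S f g -> h^-1 *: (S (t + h) f - S t f) @[h --> (0:R)^'] --> S t g.
Proof.
move=> [hg]; have E : (fun h => h^-1 *: (S (t + h) f - S t f)) = (fun h => S t (h^-1 *: (S h f - f))).
  by apply/funext => k; rewrite grpZ grpB (grp_add gS).
rewrite E; apply/cvgrPdist_le => e e0; move/cvgrPdist_le: hg => /(_ e e0).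
by apply: filterS => h; rewrite -grpB (grp_nrm gS).
Qed.
Arguments gen_shift t {f g} _ _ _.
Lemma gen_S t f g : gen S f g -> gen S (S t f) (S t g).
Proof.
move=> /(gen_shift t) h; split.
have -> : (fun k => k^-1 *: (S k (S t f) - S t f)) = (fun k => k^-1 *: (S (t + k) f - S t f)).
  by apply/funext => k; rewrite -(grp_add gS) (addrC k t).
exact: h.
Qed.
Lemma gen_dotd f g v (t : R) : gen S f g -> is_derive t 1 (fun s => dot (S s f) v) (dot (S t g) v).
Proof.
move=> hg.
have h0 : is_derive t 1 (fun s : R => dot v (S t f)) 0 := is_derive_cst _ _ _.
have := @dot_derive R (fun=> v) (fun s => S s f) t 0 (S t g) (@cvg_cst _ _ _ _ _) h0 (gen_shift t hg).
rewrite add0r dotC => h.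
have -> : (fun s => dot (S s f) v) = (fun s => dot v (S s f)) by apply/funext => s; rewrite dotC.
exact: h.
Qed.
(** Weak derivatives along a dense set suffice: the mean value inequality bounds
    [S h f - f - h *: g] by h times the oscillation of the orbit of [g] near 0. Negative [h] is
    reduced to positive by applying [S h]. *)
Lemma gen_mv D f g : dn D ->
  (forall v (t : R), D v -> is_derive t 1 (fun s => dot (S s f) v) (dot (S t g) v)) -> gen S f g.
Proof.
move=> hD hd; apply/genP => e e0; have e2 : 0 < e / 2 by rewrite divr_gt0.
have [d d0 hs] := grp_small g e2; exists d => //.
have pos h : 0 <= h -> `|h| <= d -> `|S h f - f - h *: g| <= e / 2 * h.
  move=> h0 hh.
  have h1 v (t : R) : D v -> 0 <= t <= h ->
      is_derive t 1 (fun s => dot (S s f - s *: g) v) (dot (S t g - g) v).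
    move=> Dv _; under eq_fun do rewrite dotBl dotZl mulrC.
    by rewrite dotBl; apply: is_deriveB; [exact: hd|exact: is_derive_lin].
  have h2 (t : R) : 0 <= t <= h -> is_derive t 1 (fun s : R => e / 2 * s) (e / 2).
    by move=> _; exact: is_derive_lin.
  have := weak_mv hD h0 h1 h2; rewrite mulr0 subr0 scale0r subr0 (grp_0 gS) addrAC; apply.
  move=> t /andP[t0 th]; apply: hs; apply: le_trans hh; by rewrite !ger0_norm.
move=> h hh; have [h0|h0] := leP 0 h.
  apply: le_trans (pos h h0 hh) _; rewrite (ger0_norm h0) ler_wpM2r//.
  by rewrite ler_pdivrMr// ler_peMr ?ltW// ltr1n.
have k0 : 0 <= - h by lra.
have hk : `|- h| <= d by rewrite normrN.
have E : S h f - f - h *: g = - S h (S (- h) f - f - (- h) *: g) + h *: (S h g - g).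
  rewrite grpB grpB grpK' grpZ scaleNr opprK opprD opprB scalerBr addrA addrNK //.
rewrite E; apply: le_trans (ler_normD _ _) _; rewrite normrN (grp_nrm gS) normrZ.
apply: le_trans (lerD (pos _ k0 hk) (ler_wpM2l (normr_ge0 h) (hs h hh))) _.
by rewrite (ltr0_norm h0); lra.
Qed.
(** The group is isometric, so the derivatives of the pairings converge uniformly in time; the
    generator is therefore a closed operator. *)
Lemma gen_closed (f_ g_ : nat -> H) f g : (forall n, gen S (f_ n) (g_ n)) ->
  f_ n @[n --> \oo] --> f -> g_ n @[n --> \oo] --> g -> gen S f g.
Proof.
move=> hg cf cg; apply: (@gen_mv setT).
  by move=> u e e0; exists u => //; rewrite subrr normr0 ltW.
move=> v t _; move: t.
apply: (@deriv_limit R (fun n s => dot (S s (f_ n)) v) (fun n s => dot (S s (g_ n)) v)).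
- by move=> n t; exact: gen_dotd.
- move=> t; apply: cvg_dotl; apply/cvgrPdist_le => e e0.
  move/cvgrPdist_le: cf => /(_ e e0); apply: filterS => n.
  by rewrite -grpB (grp_nrm gS).
- by move=> t; apply: cvg_dotl; exact: (grp_cont gS).
move=> T e e0; have e1 : 0 < e / (`|v| + 1) by rewrite divr_gt0// ltr_wpDl.
move/cvgrPdist_le: cg => /(_ _ e1); apply: filterS => n hn t _.
rewrite -dotBl -grpB; apply: le_trans (dot_le _ _) _; rewrite (grp_nrm gS) distrC.
apply: le_trans (ler_wpM2r (normr_ge0 _) hn) _.
by rewrite mulrAC ler_pdivrMr ?ltr_wpDl// ler_wpM2l ?(ltW e0)// ler_wpDr.
Qed.
(** The pairing of the two orbits is constant, and the product rule at time 0 gives the relation. *)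
Lemma gen_skew f g a b : gen S f g -> gen S a b -> dot g a = - dot f b.
Proof.
move=> hf ha.
have c0 : S s f @[s --> (0:R)] --> S 0 f by exact: (grp_cont gS).
have hd := @dot_derive R (fun s => S s f) (fun s => S s a) 0 _ _ c0 (gen_dotd (S 0 a) (0:R) hf) (gen_shift 0 ha).
have h0 : is_derive (0:R) 1 (fun s => dot (S s f) (S s a)) 0.
  under eq_fun do rewrite grp_dot.
  exact: is_derive_cst.
have [_ e1] := hd; have [_ e2] := h0.
by move: e1; rewrite e2 !(grp_0 gS) => e; lra.
Qed.
Lemma gen_J f g : (forall t u, S t (J u) = J (S t u)) -> gen S f g -> gen S (J f) (J g).
Proof.
move=> hJ /genP h; apply/genP => e e0; have [d d0 hd] := h e e0; exists d => // k hk.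
by rewrite hJ -JB -JZ -JB nrmJ; exact: hd.
Qed.
End one.

Lemma grp_rev S : grp S -> grp (fun t => S (- t)).
Proof.
move=> gS; split=> [t a u v|t u|u|t t' u|u].
- exact: grp_lin.
- exact: grp_nrm.
- by rewrite oppr0 grp_0.
- by rewrite opprD grp_add.
move=> t; apply: (@continuous_comp _ _ _ (fun t : R => - t) (fun t => S t u)).
  exact: opp_continuous.
exact: grp_cont.
Qed.
Lemma gen_rev S f g : grp S -> gen S f g -> gen (fun t => S (- t)) f (- g).
Proof.
move=> gS /(genP gS) h; apply/(genP (grp_rev gS)) => e e0; have [d d0 hd] := h e e0.
exists d => // k hk; have := hd (- k); rewrite !normrN => /(_ hk).
by rewrite scaleNr scalerN.
Qed.
(** A form of essential skew-adjointness: on a dense set stable under the group, the formal adjoint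
    relation already places [f] in the domain. The orbit of [f] is differentiated after the group
    has been moved to the core element. *)
Lemma gen_core S (C : H -> H -> Prop) f g : grp S -> (forall a b, C a b -> gen S a b) ->
  dn [set a | exists b, C a b] -> (forall a b t, C a b -> C (S t a) (S t b)) ->
  (forall a b, C a b -> dot f b = - dot g a) -> gen S f g.
Proof.
move=> gS hC hD CS hfg; apply: (gen_mv gS hD) => a t [b Cab].
have := gen_dotd (grp_rev gS) f t (gen_rev gS (hC _ _ Cab)).
under eq_fun do rewrite dotC -(grp_adj gS).
rewrite (grpN gS) dotNl dotC (hfg _ _ (CS _ _ (- t) Cab)) opprK => h.
by rewrite (grp_adj gS).
Qed.

Lemma rI_ex (S : R -> H -> H) f : exists G : R -> H, grp S -> G 0 = 0 /\
  forall v (t : R), is_derive t 1 (fun t => dot (G t) v) (dot (S t f) v).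
Proof.
have [gS|h] := pselect (grp S); last by exists (fun=> 0).
by have [G hG] := integral_exists (grp_cont gS f); exists G.
Qed.
(* rI S f h = int_0^h S(tau) f dtau *)
Definition rI S f := projT1 (cid (rI_ex S f)).
Lemma rI0 S f : grp S -> rI S f 0 = 0.
Proof. by rewrite /rI; case: cid => G hG /= /hG[]. Qed.
Lemma rI_d S f v (t : R) : grp S -> is_derive t 1 (fun t => dot (rI S f t) v) (dot (S t f) v).
Proof. by rewrite /rI; case: cid => G hG /= /hG[]. Qed.

Lemma deriv_eq (p q : R -> R) (d : R -> R) : (forall t : R, is_derive t 1 p (d t)) ->
  (forall t : R, is_derive t 1 q (d t)) -> p 0 = q 0 -> forall t, p t = q t.
Proof.
move=> hp hq e t; apply/eqP; rewrite -subr_eq0; apply/eqP.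
have hd (s : R) : is_derive s 1 (fun s => p s - q s) 0.
  by rewrite -(subrr (d s)); apply: is_deriveB.
by rewrite (deriv0_const hd t) e subrr.
Qed.
Lemma rI_uniq S f (G : R -> H) h : grp S -> G 0 = 0 ->
  (forall v (t : R), is_derive t 1 (fun t => dot (G t) v) (dot (S t f) v)) -> rI S f h = G h.
Proof.
move=> gS G0 hG; apply: dot_eq_all => v.
apply: (deriv_eq (fun t => rI_d f v t gS) (hG v)).
by rewrite rI0// G0.
Qed.
Lemma is_derive_shift (p : R -> R) (s d t : R) : is_derive (t + s) 1 p d -> is_derive t 1 (fun x => p (x + s)) d.
Proof.
move=> h; have := @is_derive_affine R p (fun=> d) 1 s t.
by rewrite !mul1r; under eq_fun do rewrite mul1r; apply.
Qed.
Lemma rI_S S f s h : grp S -> S s (rI S f h) = rI S f (h + s) - rI S f s.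
Proof.
move=> gS; apply: dot_eq_all => v; rewrite (grp_adj gS).
apply: (@deriv_eq (fun h => dot (rI S f h) (S (- s) v)) (fun h => dot (rI S f (h + s) - rI S f s) v)
  (fun h => dot (S (h + s) f) v)).
- move=> t; have := rI_d f (S (- s) v) t gS.
  by rewrite -(grp_adj gS) -(grp_add gS) addrC.
- move=> t; under eq_fun do rewrite dotBl.
  have h0 : is_derive t 1 (fun _ : R => dot (rI S f s) v) 0 := is_derive_cst _ _ _.
  rewrite -[X in is_derive _ _ _ X]subr0; apply: is_deriveB.
  exact: is_derive_shift (rI_d f v (t + s) gS).
by rewrite rI0// add0r subrr !dot0l.
Qed.
(** Averaging along the group lands in the domain: applying S(t) to the integral over [0, h] gives a
    difference of two integrals, whose derivative in t is explicit. *)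
Lemma rI_gen S f h : grp S -> gen S (rI S f h) (S h f - f).
Proof.
move=> gS; apply: (@gen_mv _ gS setT).
  by move=> u e e0; exists u => //; rewrite subrr normr0 ltW.
move=> v t _; under eq_fun do rewrite rI_S// dotBl (addrC h).
rewrite (grpB gS) -(grp_add gS) dotBl; apply: is_deriveB.
  exact: (@is_derive_shift (fun t => dot (rI S f t) v) h _ t (rI_d f v (t + h) gS)).
exact: rI_d.
Qed.
Lemma rI_of_gen S f g h : grp S -> gen S f g -> rI S g h = S h f - f.
Proof.
move=> gS hg; apply: (rI_uniq (G := fun h => S h f - f)) => //; first by rewrite (grp_0 gS) subrr.
move=> v t; under eq_fun do rewrite dotBl.
have h0 : is_derive t 1 (fun _ : R => dot f v) 0 := is_derive_cst _ _ _.
rewrite -[X in is_derive _ _ _ X]subr0; apply: is_deriveB; exact: gen_dotd.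
Qed.
Lemma rI_lim S f (e : R) : grp S -> 0 < e -> exists2 d : R, 0 < d &
  forall h, 0 < h <= d -> `|h^-1 *: rI S f h - f| <= e.
Proof.
move=> gS e0; have [d d0 hd] := grp_small gS f e0; exists d => // h /andP[h0 hdd].
rewrite -(ler_pM2l h0) -{1}(gtr0_norm h0) -normrZ scalerBr scalerA divff ?gt_eqF// scale1r.
have hD : dn (setT : set H) by move=> u k k0; exists u => //; rewrite subrr normr0 ltW.
have h1 v (t : R) : setT v -> 0 <= t <= h ->
      is_derive t 1 (fun s => dot (rI S f s - s *: f) v) (dot (S t f - f) v).
    move=> _ _; under eq_fun do rewrite dotBl dotZl mulrC.
    by rewrite dotBl; apply: is_deriveB; [exact: rI_d|exact: is_derive_lin].
have h2 (t : R) : 0 <= t <= h -> is_derive t 1 (fun s : R => e * s) e.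
    by move=> _; exact: is_derive_lin.
have := weak_mv hD (ltW h0) h1 h2; rewrite mulr0 !subr0 scale0r subr0 rI0// subr0 mulrC; apply.
move=> t /andP[t0 th]; apply: hd; rewrite ger0_norm//.
exact: le_trans th hdd.
Qed.
End groups.

(** * Sobolev spaces as domains of powers of the translation generator *)

Section weakd.
Context {R : realType}.
Local Notation H := (Hsp R).
Local Notation mu := (@lebesgue_measure R).
Implicit Types (u v w f g : H) (phi : R -> R).
Hint Resolve L2h Cmh : core.

Lemma grp_T : grp (@T R).
Proof.
split=> [t a u v|t u|u|t t' u|u].
- by rewrite TD TZ.
- exact: nrmT.
- exact: T0.
- by rewrite TT.
- exact: T_cont.
Qed.
(* The L^2 weak derivative is the generator of the translation group. *)
Definition wd f g := gen (@T R) f g.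
Definition D f : H := xget 0 [set g | wd f g].
Lemma DE f g : wd f g -> D f = g.
Proof.
move=> h; rewrite /D; case: xgetP => [y _ hy|/(_ g)/= []//].
exact: gen_uniq hy h.
Qed.
Lemma wd_tm phi : test_function phi -> wd (tm phi) (tm (derive1 phi)).
Proof.
move=> tp; have [K [K0 hK]] := test_diff tp; apply/(genP grp_T) => e e0.
have d0 : 0 < Num.min 1 (e / (K + 1)) by rewrite lt_min ltr01 /= divr_gt0// ltr_wpDl.
exists (Num.min 1 (e / (K + 1))) => // h; rewrite le_min => /andP[h1 h2].
apply: le_trans (hK h h1).1 _; rewrite -real_normK ?num_real// expr2 mulrA ler_wpM2r//.
apply: le_trans (_ : (K + 1) * `|h| <= _); first by rewrite ler_wpM2r// lerDl.
by rewrite -ler_pdivlMl ?ltr_wpDl// mulrC.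
Qed.
Lemma wd_J f g : wd f g -> wd (J f) (J g).
Proof. by apply: (gen_J grp_T) => t u; rewrite TJ. Qed.
Lemma wd_cj f g : wd f g -> wd (cj f) (cj g).
Proof.
move=> /(genP grp_T) h; apply/(genP grp_T) => e e0; have [d d0 hd] := h e e0; exists d => // k hk.
by rewrite Tcj -cjB -cjZ -cjB nrmcj; exact: hd.
Qed.
Definition Ctest (a b : H) := exists phi psi, [/\ test_function phi, test_function psi,
  a = tm phi + J (tm psi) & b = tm (derive1 phi) + J (tm (derive1 psi))].
Lemma Ctest_wd a b : Ctest a b -> wd a b.
Proof.
move=> [phi [psi [tp tq -> ->]]]; apply: (genD grp_T); first exact: wd_tm.
by apply: wd_J; exact: wd_tm.
Qed.
Lemma Ctest_T t a b : Ctest a b -> Ctest (T t a) (T t b).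
Proof.
move=> [phi [psi [tp tq -> ->]]]; exists (fun x => phi (x + t)), (fun x => psi (x + t)).
split; [exact: test_shift|exact: test_shift| |].
  by rewrite TD TJ !T_tm.
by rewrite TD TJ !T_tm ?derive1_shift//; exact: test_derive.
Qed.
Lemma dense_Ctest : dn [set a | exists b, Ctest a b].
Proof.
move=> u e e0; have [v [p [q [tp tq vE]]] uv] := dense_test u e0; exists v => //.
by exists (tm (derive1 p) + J (tm (derive1 q))), p, q.
Qed.
(** The test functions form a core stable under translations, so integration by parts against them
    characterises the generator. *)
Lemma wd_weak f g : wd f g <-> forall phi, test_function phi ->
  dot f (tm (derive1 phi)) = - dot g (tm phi) /\ dot f (J (tm (derive1 phi))) = - dot g (J (tm phi)).
Proof.
split=> [h phi tp|h].
  have s a b := gen_skew grp_T (f := f) (g := g) (a := a) (b := b) h.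
  by rewrite (s _ _ (wd_tm tp)) (s _ _ (wd_J (wd_tm tp))) !opprK.
apply: (gen_core (C := Ctest) grp_T); [exact: Ctest_wd|exact: dense_Ctest|by move=> a b t; exact: Ctest_T|].
move=> a b [p [q [tp tq -> ->]]]; rewrite !dotDr (h p tp).1 (h q tq).2.
by gen_dots; ring.
Qed.
Lemma wd_skew f g a b : wd f g -> wd a b -> dot g a = - dot f b.
Proof. exact: (gen_skew grp_T). Qed.
Lemma wd_lin a f g f' g' : wd f g -> wd f' g' -> wd (a *: f + f') (a *: g + g').
Proof. exact: (gen_lin grp_T). Qed.
Lemma wd_T t f g : wd f g -> wd (T t f) (T t g).
Proof. exact: (gen_S grp_T). Qed.
Lemma wd0 : wd 0 0. Proof. exact: (gen0 grp_T). Qed.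
Lemma wd_D f g f' g' : wd f g -> wd f' g' -> wd (f + f') (g + g').
Proof. exact: (genD grp_T). Qed.
Lemma wd_B f g f' g' : wd f g -> wd f' g' -> wd (f - f') (g - g').
Proof. exact: (genB grp_T). Qed.
Lemma wd_Z a f g : wd f g -> wd (a *: f) (a *: g).
Proof. exact: (genZ grp_T). Qed.

Fixpoint Hm (m : nat) f : Prop := if m is m'.+1 then wd f (D f) /\ Hm m' (D f) else True.
Fixpoint hn (m : nat) f : R := if m is m'.+1 then `|f| + hn m' (D f) else `|f|.

Lemma HmSP m f : Hm m.+1 f <-> exists2 g, wd f g & Hm m g.
Proof.
split=> [[h1 h2]|[g h1 h2]]; first by exists (D f).
by rewrite /= (DE h1).
Qed.
Lemma Hm_S m f : Hm m.+1 f -> Hm m f.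
Proof. by elim: m f => [//|m IH] f [h1 /IH h2]; split. Qed.
Lemma Hm_le m n f : (m <= n)%N -> Hm n f -> Hm m f.
Proof.
move=> /subnK <-; elim: (n - m)%N => [//|k IH] h; apply: IH.
exact: Hm_S.
Qed.
Lemma Hm_lin m a f g : Hm m f -> Hm m g -> Hm m (a *: f + g).
Proof.
elim: m f g => [//|m IH] f g [h1 h2] [h3 h4]; apply/HmSP.
by exists (a *: D f + D g); [exact: wd_lin|exact: IH].
Qed.
Lemma Hm0 m : Hm m 0.
Proof. by elim: m => [//|m IH]; apply/HmSP; exists 0 => //; exact: wd0. Qed.
Lemma HmZ m a f : Hm m f -> Hm m (a *: f).
Proof. by move=> h; rewrite -[_ *: _]addr0; apply: Hm_lin => //; exact: Hm0. Qed.
Lemma HmD m f g : Hm m f -> Hm m g -> Hm m (f + g).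
Proof. by move=> h h'; rewrite -[f]scale1r; apply: Hm_lin. Qed.
Lemma HmN m f : Hm m f -> Hm m (- f).
Proof. by move=> h; rewrite -scaleN1r; apply: HmZ. Qed.
Lemma HmB m f g : Hm m f -> Hm m g -> Hm m (f - g).
Proof. by move=> h h'; apply: HmD => //; exact: HmN. Qed.
Lemma HmJ m f : Hm m f -> Hm m (J f).
Proof.
by elim: m f => [//|m IH] f [h1 h2]; apply/HmSP; exists (J (D f)); [exact: wd_J|exact: IH].
Qed.
Lemma Hmcj m f : Hm m f -> Hm m (cj f).
Proof.
by elim: m f => [//|m IH] f [h1 h2]; apply/HmSP; exists (cj (D f)); [exact: wd_cj|exact: IH].
Qed.
Lemma HmT m t f : Hm m f -> Hm m (T t f).
Proof.
by elim: m f => [//|m IH] f [h1 h2]; apply/HmSP; exists (T t (D f)); [exact: wd_T|exact: IH].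
Qed.
Lemma D_lin a f g : Hm 1 f -> Hm 1 g -> D (a *: f + g) = a *: D f + D g.
Proof. by move=> [h _] [h' _]; apply: DE; exact: wd_lin. Qed.
Lemma DD f g : Hm 1 f -> Hm 1 g -> D (f + g) = D f + D g.
Proof. by move=> [h _] [h' _]; apply: DE; exact: wd_D. Qed.
Lemma DB f g : Hm 1 f -> Hm 1 g -> D (f - g) = D f - D g.
Proof. by move=> [h _] [h' _]; apply: DE; exact: wd_B. Qed.
Lemma DZ a f : Hm 1 f -> D (a *: f) = a *: D f.
Proof. by move=> [h _]; apply: DE; exact: wd_Z. Qed.
Lemma DJ f : Hm 1 f -> D (J f) = J (D f).
Proof. by move=> [h _]; apply: DE; exact: wd_J. Qed.
Lemma Dcj f : Hm 1 f -> D (cj f) = cj (D f).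
Proof. by move=> [h _]; apply: DE; exact: wd_cj. Qed.
Lemma DT t f : Hm 1 f -> D (T t f) = T t (D f).
Proof. by move=> [h _]; apply: DE; exact: wd_T. Qed.

Lemma hn_ge0 m f : 0 <= hn m f.
Proof. by elim: m f => [|m IH] f //=; rewrite addr_ge0. Qed.
Lemma Hm1 m f : Hm m.+1 f -> Hm 1 f.
Proof. by move=> [h _]. Qed.
Hint Resolve Hm1 : core.
Lemma hnD m f g : Hm m f -> Hm m g -> hn m (f + g) <= hn m f + hn m g.
Proof.
elim: m f g => [|m IH] f g; first by move=> _ _ /=; exact: ler_normD.
move=> hf hg /=; rewrite DD; [|exact: Hm1 hf|exact: Hm1 hg].
have := IH _ _ hf.2 hg.2; have := ler_normD f g; lra.
Qed.
Lemma hnZ m a f : Hm m f -> hn m (a *: f) = `|a| * hn m f.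
Proof.
elim: m f => [|m IH] f; first by move=> _ /=; rewrite normrZ.
by move=> hf /=; rewrite normrZ DZ ?IH ?mulrDr//; [exact: hf.2|exact: Hm1 hf].
Qed.
Lemma hnN m f : Hm m f -> hn m (- f) = hn m f.
Proof. by move=> h; rewrite -scaleN1r hnZ// normrN1 mul1r. Qed.
Lemma hnB m f g : Hm m f -> Hm m g -> hn m (f - g) <= hn m f + hn m g.
Proof. by move=> hf hg; rewrite -(hnN hg); apply: hnD => //; exact: HmN. Qed.
Lemma hnJ m f : Hm m f -> hn m (J f) = hn m f.
Proof.
elim: m f => [|m IH] f; first by move=> _ /=; rewrite nrmJ.
by move=> hf /=; rewrite nrmJ DJ ?IH//; [exact: hf.2|exact: Hm1 hf].
Qed.
Lemma hncj m f : Hm m f -> hn m (cj f) = hn m f.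
Proof.
elim: m f => [|m IH] f; first by move=> _ /=; rewrite nrmcj.
by move=> hf /=; rewrite nrmcj Dcj ?IH//; [exact: hf.2|exact: Hm1 hf].
Qed.
Lemma hnT m t f : Hm m f -> hn m (T t f) = hn m f.
Proof.
elim: m f => [|m IH] f; first by move=> _ /=; rewrite nrmT.
by move=> hf /=; rewrite nrmT DT ?IH//; [exact: hf.2|exact: Hm1 hf].
Qed.
Lemma hn0 m : hn m 0 = 0.
Proof. by have := @hnZ m 0 0 (Hm0 m); rewrite scale0r normr0 mul0r. Qed.
Lemma nrm_hn m f : `|f| <= hn m f.
Proof. by case: m => [|m] //=; rewrite lerDl hn_ge0. Qed.
Lemma hn_S m f : hn m f <= hn m.+1 f.
Proof. by elim: m f => [|m IH] f /=; rewrite ?lerDl// lerD2l; exact: IH. Qed.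
Lemma hn_le m n f : (m <= n)%N -> hn m f <= hn n f.
Proof.
move=> /subnK <-; elim: (n - m)%N => [//|k IH]; apply: le_trans IH _.
exact: hn_S.
Qed.
Lemma hn_dist m f g h : Hm m f -> Hm m g -> Hm m h -> hn m (f - h) <= hn m (f - g) + hn m (g - h).
Proof.
move=> hf hg hh; have -> : f - h = (f - g) + (g - h) by rewrite addrA subrK.
by apply: hnD; exact: HmB.
Qed.
Lemma hnBC m f g : Hm m f -> Hm m g -> hn m (f - g) = hn m (g - f).
Proof. by move=> hf hg; rewrite -[f - g]opprB hnN//; exact: HmB. Qed.
Lemma hn_tri m f g : Hm m f -> Hm m g -> hn m f <= hn m (f - g) + hn m g.
Proof. by move=> hf hg; rewrite -{1}(subrK g f); apply: hnD => //; exact: HmB. Qed.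

Definition Dn j f := iter j D f.
Lemma DnS j f : Dn j.+1 f = Dn j (D f). Proof. by rewrite /Dn iterSr. Qed.
Lemma Hm_Dn m j f : Hm (j + m) f -> Hm m (Dn j f).
Proof. by elim: j f => [//|j IH] f [h1 h2]; rewrite DnS; exact: IH. Qed.
Lemma Hm_wd m j f : (j < m)%N -> Hm m f -> wd (Dn j f) (Dn j.+1 f).
Proof.
move=> jm h; have : Hm 1 (Dn j f) by apply: Hm_Dn; rewrite addn1; exact: Hm_le h.
by case.
Qed.
Lemma Dn_hn m j f : (j <= m)%N -> `|Dn j f| <= hn m f.
Proof.
elim: j m f => [|j IH] m f; first by move=> _; exact: nrm_hn.
by case: m => // m jm; rewrite DnS; apply: le_trans (IH m _ jm) _; rewrite /= lerDr.
Qed.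
Lemma hn_sum m f : hn m f = \sum_(j < m.+1) `|Dn j f|.
Proof.
elim: m f => [|m IH] f; first by rewrite big_ord1.
rewrite big_ord_recl /= IH; congr (_ + _); apply: eq_bigr => i _.
by rewrite -DnS.
Qed.
Lemma hn_bound m f (K : R) : (forall j, (j <= m)%N -> `|Dn j f| <= K) -> hn m f <= m.+1%:R * K.
Proof.
move=> h; rewrite hn_sum; apply: le_trans (ler_sum _ (_ : forall i : 'I_m.+1, true -> _ <= K)) _.
  by move=> i _; apply: h; rewrite -ltnS.
by rewrite sumr_const card_ord mulr_natl.
Qed.
Lemma Dn_lin m j a f g : (j <= m)%N -> Hm m f -> Hm m g -> Dn j (a *: f + g) = a *: Dn j f + Dn j g.
Proof.
elim: j m f g => [//|j IH] [//|m] f g jm hf hg; rewrite !DnS D_lin; [|exact: Hm1 hf|exact: Hm1 hg].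
by apply: (IH m) => //; [exact: hf.2|exact: hg.2].
Qed.

Definition limT (p : R -> R) := forall e : R, 0 < e -> exists T0 : R, forall t, T0 <= t -> p t <= e.

(** Derivatives converge along integer times, and closedness of the generator identifies the limit
    of the derivatives with the derivative of the limit. *)
Lemma Hm_complete m (f_ : R -> H) : (forall t, Hm m (f_ t)) ->
  (forall e : R, 0 < e -> exists T0 : R, forall s t, T0 <= s -> T0 <= t -> hn m (f_ s - f_ t) <= e) ->
  exists2 f, Hm m f & limT (fun t => hn m (f_ t - f)).
Proof.
have nat_ge (T0 : R) : exists N, forall n, (N <= n)%N -> T0 <= n%:R.
  exists (Num.truncn `|T0|).+1 => n hn.
  apply: le_trans (ler_norm _) _; apply: le_trans (ltW (truncnS_gt _)) _.
  by rewrite ler_nat.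
have base (g_ : R -> H) : (forall e : R, 0 < e -> exists T0 : R, forall s t, T0 <= s -> T0 <= t -> `|g_ s - g_ t| <= e) ->
   exists2 g, limT (fun t => `|g_ t - g|) & g_ n%:R @[n --> \oo] --> g.
  move=> hc.
  have cc : cvg (g_ n%:R @[n --> \oo]).
    apply: cauchy_cvg; apply: cauchy_exP => e e0.
    have e2 : 0 < e / 2 by rewrite divr_gt0.
    have [T0 hT] := hc _ e2; have [N hN] := nat_ge T0.
    exists (g_ N%:R); exists N => // n /= Nn; rewrite -ball_normE /=.
    apply: le_lt_trans (hT _ _ (hN _ (leqnn _)) (hN _ Nn)) _.
    by rewrite ltr_pdivrMr// ltr_pMr// ltr1n.
  exists (lim (g_ n%:R @[n --> \oo])) => // e e0.
  have e2 : 0 < e / 2 by rewrite divr_gt0.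
  have [T0 hT] := hc _ e2; exists T0 => t Tt.
  have [N hN] := nat_ge T0.
  move/cvgrPdist_le: cc => /(_ _ e2) [M _ hM].
  pose n := maxn N M.
  have h1 := hT t n%:R Tt (hN n (leq_maxl _ _)).
  have h2 := hM n (leq_maxr _ _).
  rewrite -[g_ t](subrK (g_ n%:R)) -addrA; apply: le_trans (ler_normD _ _) _.
  by rewrite distrC in h2; move: h1 h2 => /= h1 h2; lra.
elim: m f_ => [|m IH] f_ hH hc.
  by have [g h1 _] := base f_ hc; exists g.
have b1 : forall e : R, 0 < e -> exists T0 : R, forall s t, T0 <= s -> T0 <= t -> `|f_ s - f_ t| <= e.
  move=> e e0; have [T0 h] := hc e e0; exists T0 => s t h1 h2.
  exact: le_trans (nrm_hn m.+1 _) (h s t h1 h2).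
have b2 : forall e : R, 0 < e -> exists T0 : R, forall s t, T0 <= s -> T0 <= t -> hn m (D (f_ s) - D (f_ t)) <= e.
  move=> e e0; have [T0 h] := hc e e0; exists T0 => s t h1 h2.
  apply: le_trans (h s t h1 h2); rewrite /= DB ?lerDr//; exact: Hm1 (hH _).
have [g Hg lg] := IH (fun t => D (f_ t)) (fun t => (hH t).2) b2.
have [f lf cf] := base f_ b1.
have b3 : forall e : R, 0 < e -> exists T0 : R, forall s t, T0 <= s -> T0 <= t -> `|D (f_ s) - D (f_ t)| <= e.
  move=> e e0; have [T0 h] := b2 e e0; exists T0 => s t h1 h2.
  exact: le_trans (nrm_hn m _) (h s t h1 h2).
have [g' lg' cg] := base (fun t => D (f_ t)) b3.
have gg : g' = g.
  apply/eqP; rewrite -subr_eq0 -normr_le0; apply/ler_addgt0Pr => e e0; rewrite add0r.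
  have e2 : 0 < e / 2 by rewrite divr_gt0.
  have [T1 h1] := lg' _ e2; have [T2 h2] := lg _ e2.
  pose t := Num.max T1 T2.
  have k1 : `|D (f_ t) - g'| <= e / 2 by apply: h1; rewrite le_max lexx.
  have k2 : `|D (f_ t) - g| <= e / 2.
    by apply: le_trans (nrm_hn m _) _; apply: h2; rewrite le_max lexx orbT.
  have -> : g' - g = - (D (f_ t) - g') + (D (f_ t) - g) by rewrite opprB addrA subrK.
  by apply: le_trans (ler_normD _ _) _; rewrite normrN; lra.
have wfg : wd f g.
  rewrite -gg; apply: (@gen_closed _ _ grp_T (fun n => f_ n%:R) (fun n => D (f_ n%:R)) f g') => // n.
  exact: (hH _).1.
have Hf : Hm m.+1 f by apply/HmSP; exists g.
exists f => // e e0; have e2 : 0 < e / 2 by rewrite divr_gt0.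
have [T1 h1] := lf _ e2; have [T2 h2] := lg _ e2.
exists (Num.max T1 T2) => t; rewrite ge_max => /andP[k1 k2].
rewrite /= DB; [|exact: Hm1 (hH t)|exact: Hm1 Hf].
by rewrite (DE wfg); have := h1 t k1; have := h2 t k2; lra.
Qed.

Lemma D_interp f : Hm 2 f -> `|D f| ^+ 2 <= `|f| * `|D (D f)|.
Proof.
move=> [h1 [h2 _]]; rewrite nrm_sqr (wd_skew h1 h2) -dotNr.
by apply: le_trans (dot_le' _ _) _; rewrite normrN.
Qed.

(** Averages over translations gain one derivative, since the derivative of such an average is a
    difference of translates. *)
Lemma reg_Hm m f h : Hm m f -> Hm m.+1 (rI (@T R) f h).
Proof.
elim: m f => [|m IH] f hf; apply/HmSP; exists (T h f - f) => //; try exact: (rI_gen _ _ grp_T).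
by apply: HmB => //; exact: HmT.
Qed.
(** The averaging length is 1/t, so that convergence is expressed at infinity as in [limT].
    Averaging commutes with differentiation, which gives the induction on the order. *)
Lemma reg_lim m f : Hm m f -> limT (fun t => hn m ((t^-1)^-1 *: rI (@T R) f t^-1 - f)).
Proof.
have inv (d : R) : 0 < d -> forall t, d^-1 <= t -> 0 < t^-1 <= d.
  move=> d0 t dt; have t0 : 0 < t by apply: lt_le_trans dt; rewrite invr_gt0.
  by rewrite invr_gt0 t0 /= -[leRHS]invrK lef_pV2// ?posrE ?invr_gt0.
elim: m f => [|m IH] f hf e e0.
  have [d d0 hd] := rI_lim f grp_T e0; exists d^-1 => t dt.
  by apply: hd; exact: inv.
have e2 : 0 < e / 2 by rewrite divr_gt0.
have [T1 h1] := IH _ hf.2 _ e2; have [d d0 hd] := rI_lim f grp_T e2.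
exists (Num.max d^-1 T1) => t; rewrite ge_max => /andP[t1 t2].
have H1 : Hm 1 (rI (@T R) f t^-1) by exact: (@reg_Hm 0).
rewrite /= DB; [|exact: HmZ|exact: Hm1 hf].
rewrite DZ// (DE (rI_gen f t^-1 grp_T)) -(rI_of_gen t^-1 grp_T hf.1).
by have := hd _ (inv _ d0 _ t1); have := h1 t t2; lra.
Qed.
Lemma Hm_dense m f (e : R) : Hm m f -> 0 < e -> exists2 g, Hm m.+1 g & hn m (g - f) <= e.
Proof.
move=> hf e0; have [T0 h] := reg_lim hf e0; exists ((T0^-1)^-1 *: rI (@T R) f T0^-1).
  by apply: HmZ; exact: reg_Hm.
exact: h.
Qed.
Lemma Dn_test m : dn [set a | Hm m a].
Proof.
move=> u e e0; have [v [p [q [tp tq vE]]] uv] := dense_test u e0; exists v => //=.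
suff key (r : R -> R) : test_function r -> Hm m (tm r).
  by rewrite vE; apply: HmD; [exact: key|apply: HmJ; exact: key].
elim: m r => [//|m IH] r tr; apply/HmSP; exists (tm (derive1 r)); first exact: wd_tm.
by apply: IH; exact: test_derive.
Qed.
Lemma Dn_skew j f a : Hm j f -> Hm j a -> dot (Dn j f) a = (-1) ^+ j * dot f (Dn j a).
Proof.
elim: j f a => [|j IH] f a hf ha; first by rewrite expr0 mul1r.
have hDj : Hm j (D f) by exact: hf.2.
rewrite DnS IH//; last exact: Hm_S.
have h1 : Hm 1 (Dn j a) by apply: Hm_Dn; rewrite addn1.
by rewrite (wd_skew hf.1 h1.1) exprS mulrN mulN1r mulNr.
Qed.
(** The path is differentiable only when paired in L^2, so the j derivatives are moved onto smooth
    test vectors before the scalar mean value inequality is used. *)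
Lemma mv_Dn j (z P : R -> H) (g g' : R -> R) (a b : R) : a <= b ->
  (forall v (t : R), a <= t <= b -> is_derive t 1 (fun s => dot (z s) v) (dot (P t) v)) ->
  (forall t, a <= t <= b -> Hm j (z t)) -> (forall t, a <= t <= b -> Hm j (P t)) ->
  (forall t, a <= t <= b -> is_derive t 1 g (g' t)) ->
  (forall t, a <= t <= b -> `|Dn j (P t)| <= g' t) -> `|Dn j (z b - z a)| <= g b - g a.
Proof.
move=> ab hz Hz HP hg hb.
have aa : a <= a <= b by rewrite lexx.
have bb : a <= b <= b by rewrite ab lexx.
have hbnd : forall v, Hm j v -> dot (z b - z a) (Dn j v) * (-1) ^+ j <= (g b - g a) * `|v|.
  move=> v hv.
  have d1 (t : R) : a <= t <= b -> is_derive t 1 (fun s => (-1) ^+ j * dot (z s) (Dn j v)) ((-1) ^+ j * dot (P t) (Dn j v)).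
    by move=> ht; exact: (@is_deriveZ R R R^o _ _ t 1 _ (hz (Dn j v) t ht)).
  have d2 (t : R) : a <= t <= b -> is_derive t 1 (fun s => `|v| * g s) (`|v| * g' t).
    by move=> /hg h; exact: (@is_deriveZ R R R^o _ `|v| t 1 _ h).
  have := mono_le ab d1 d2; rewrite -!mulrBr -dotBl mulrC (mulrC `|v|); apply=> t ht.
  rewrite -Dn_skew//; last exact: HP.
  by apply: le_trans (dot_le' _ _) _; rewrite mulrC ler_wpM2l// hb.
apply: (dual_bound (Dn_test j)).
  have := mono_le ab (fun t _ => is_derive_cst _ _ _ : is_derive t 1 (fun=> 0) 0) hg.
  by rewrite subrr; apply => t /hb; exact: le_trans.
move=> v hv; rewrite Dn_skew//; last by apply: HmB; [exact: Hz|exact: Hz].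
by rewrite mulrC; exact: hbnd.
Qed.
End weakd.
Global Hint Resolve Hm1 : core.

(** * Bounded multipliers and the nonlinearity *)

Section products.
Context {R : realType}.
Local Notation H := (Hsp R).
Local Notation mu := (@lebesgue_measure R).
Local Notation cmod := (@ComplexField.Normc.normc R).
Implicit Types (u v w f g : H) (phi : R -> R) (c d : R -> R[i]).
Hint Resolve L2h Cmh : core.

Lemma bd_ge0 K c : bd K c -> 0 <= K. Proof. by case. Qed.
Lemma bdHae K c f : bd K c -> ae_equal f c -> bd K f.
Proof. by move=> hb e; apply: (bd_ae _ (ae_eq_sym e) hb); exact: Cmh. Qed.
Lemma bdHD K K' f g : bd K f -> bd K' g -> bd (K + K') (f + g : H).
Proof. by move=> h h'; apply: bdHae (bdD h h') (hD f g). Qed.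
Lemma bdHZ K a f : bd K f -> bd (`|a| * K) (a *: f : H).
Proof.
move=> h; have := bdM (bdcst a%:C) h.
have -> : cmod a%:C = `|a| by rewrite normc_sqrt n2C sqrtr_sqr.
by move=> h'; apply: bdHae h' (hZ a f).
Qed.
Lemma bdHN K f : bd K f -> bd K (- f : H).
Proof. by move=> h; have := bdHZ (-1) h; rewrite normrN1 mul1r scaleN1r. Qed.
Lemma bdHB K K' f g : bd K f -> bd K' g -> bd (K + K') (f - g : H).
Proof. by move=> h h'; apply: bdHD => //; exact: bdHN. Qed.
Lemma bdHcj K f : bd K f -> bd K (cj f : H).
Proof. by move=> h; apply: bdHae (bdJ h) (cjE f). Qed.
Lemma bdH0 : bd 0 (0 : H).
Proof.
split=> //; apply: aeS (@h0 R) => x ->.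
by rewrite n20 expr0n.
Qed.
Lemma bdHT K t f : bd K f -> bd K (T t f : H).
Proof.
move=> [m K0 h]; have hb : bd K (fun x => f (x + t)).
  by split=> //; [exact: Cm_shift|exact: ae_shift h].
exact: bdHae hb (TE t f).
Qed.

(** A mean value inequality in the sup norm for a path that is differentiable only weakly in L^2.
    The functions bounded by a K form a convex set, so a scalar inequality for one well chosen
    functional is enough. *)
Lemma bd_mv (p P : R -> H) (a K : R) : 0 < a ->
  (forall v (t : R), 0 <= t <= a -> is_derive t 1 (fun s => dot (p s) v) (dot (P t) v)) ->
  p 0 = 0 -> (forall t, 0 <= t <= a -> bd K (P t)) -> bd (a * K) (p a).
Proof.
move=> a0 hd p0 hP.
have K0 : 0 <= K by apply: (bd_ge0 (hP 0 _)); rewrite lexx ltW.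
set c := a * K; have c0 : 0 <= c by rewrite mulr_ge0 ?(ltW a0).
(* e = p(a) - (nearest point of the ball of radius c); pairing with e separates. *)
pose k x : R := if n2 (p a x) <= c ^+ 2 then 0 else 1 - c / Num.sqrt (n2 (p a x)).
have k01 x : 0 <= k x <= 1.
  rewrite /k; case: ifPn; first by rewrite lexx ler01.
  rewrite -ltNge => h; have s0 : c < Num.sqrt (n2 (p a x)).
    by rewrite -(ger0_norm c0) -sqrtr_sqr ltr_sqrt// (le_lt_trans _ h)// sqr_ge0.
  have s1 : 0 < Num.sqrt (n2 (p a x)) by exact: le_lt_trans s0.
  by rewrite subr_ge0 ler_pdivrMr// mul1r (ltW s0) lerBlDr lerDl divr_ge0// ltW.
have mn : measurable_fun setT (fun x => n2 (p a x)) by exact: m_n2.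
have mk_ : measurable_fun setT k.
  apply: measurable_fun_ifT.
  - by apply: measurable_fun_ler => //; exact: measurable_cst.
  - exact: measurable_cst.
  - apply: measurable_funB; first exact: measurable_cst.
    apply: measurable_funM; first exact: measurable_cst.
    have -> : (fun x => (Num.sqrt (n2 (p a x)))^-1) = (fun x => powR (Num.sqrt (n2 (p a x))) (-1)).
      by apply/funext => x; rewrite powR_inv1 ?sqrtr_ge0.
    have ms : measurable_fun setT (fun x => Num.sqrt (n2 (p a x))).
      by apply: measurableT_comp mn; apply: continuous_measurable_fun; exact: sqrt_continuous.
    exact: (measurableT_comp (@measurable_powR R (-1)) ms).
have bk : bd 1 (fun x => (k x)%:C).
  split; [exact: (CmC mk_)|by []|].
  apply: aeW' => x; rewrite n2C expr1n; have /andP[h1 h2] := k01 x.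
  by rewrite expr_le1.
pose e := mulf (fun x => (k x)%:C) (p a).
have eE := mulfE (p a) bk.
(* The pointwise separation: in the direction of the defect, a times any value bounded by K does not
   exceed the nearest point of the ball. *)
have key y x : n2 y <= K ^+ 2 -> rdot (a%:C * y) ((k x)%:C * p a x) <= rdot (p a x) ((k x)%:C * p a x) - n2 ((k x)%:C * p a x).
  move=> hy; set q := p a x.
  have -> : rdot q ((k x)%:C * q) - n2 ((k x)%:C * q) = k x * (1 - k x) * n2 q.
    by rewrite /rdot /n2 !ReImE; ring.
  have -> : rdot (a%:C * y) ((k x)%:C * q) = a * k x * rdot y q by rewrite /rdot !ReImE; ring.
  rewrite /k; case: ifPn => [_|]; first by rewrite mulr0 !mul0r.
  rewrite -/q -ltNge => h; set s := Num.sqrt (n2 q).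
  have ss : s ^+ 2 = n2 q by rewrite sqr_sqrtr ?n2_ge0.
  have s0 : c < s by rewrite -(ger0_norm c0) -sqrtr_sqr ltr_sqrt// (le_lt_trans _ h)// sqr_ge0.
  have s1 : 0 < s by exact: le_lt_trans s0.
  have -> : (1 - c / s) * (1 - (1 - c / s)) * n2 q = (1 - c / s) * (c * s).
    by rewrite -ss; field; rewrite gt_eqF.
  have k0 : 0 <= 1 - c / s by rewrite subr_ge0 ler_pdivrMr// mul1r ltW.
  have -> : a * (1 - c / s) * rdot y q = (1 - c / s) * (a * rdot y q) by ring.
  rewrite ler_wpM2l// /c -mulrA ler_pM2l//.
  apply: le_trans (ler_norm _) _; rewrite -(ler_pXn2r (n := 2))// ?nnegrE ?mulr_ge0 ?(ltW s1)//.
  rewrite real_normK ?num_real// exprMn ss.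
  apply: le_trans (_ : n2 y * n2 q <= _); last by rewrite ler_wpM2r// n2_ge0.
  have := sqr_ge0 (complex.Re y * complex.Im q - complex.Im y * complex.Re q).
  rewrite /rdot /n2; lra.
have dle t : 0 <= t <= a -> a * dot (P t) e <= dot (p a) e - dot e e.
  move=> /hP[mP _ hb].
  have -> : a * dot (P t) e = dot (a *: P t) e by rewrite dotZl.
  have -> : dot (p a) e - dot e e = dot (p a - e) e by rewrite dotBl.
  rewrite -subr_ge0 -dotBl dotE; apply: fine_ge0.
  have -> : (\int[mu]_x (rdot ((p a - e - a *: P t : H) x) (e x))%:E =
             \int[mu]_x (Num.max 0 (rdot ((p a - e - a *: P t : H) x) (e x)))%:E)%E.
    have mr : measurable_fun setT (fun x => rdot ((p a - e - a *: P t : H) x) (e x)) by exact: m_rdot.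
    apply: ae_eq_integral => //.
    - exact/measurable_EFinP.
    - apply/measurable_EFinP; apply: measurable_maxr => //; exact: measurable_cst.
    apply: aeS (aeI (aeI (hB (p a - e) (a *: P t)) (hB (p a) e)) (aeI (aeI eE (hZ a (P t))) hb)) =>
      x [[e1 e2] [[e3 e4] hbx]] _.
    congr (_%:E); rewrite e1 e2 e4 (max_idPr _)//; have := key _ x hbx; rewrite e3 /rdot /n2 !ReImE; lra.
  by apply: integral_ge0 => x _; rewrite lee_fin le_max lexx.
have aa : 0 <= a by exact: ltW.
have hm := mono_le aa (fun t ht => hd e t ht)
   (fun t _ => is_derive_lin ((dot (p a) e - dot e e) / a) t).
have : dot (p a) e - dot (p 0) e <= (dot (p a) e - dot e e) / a * a - (dot (p a) e - dot e e) / a * 0.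
  by apply: hm => t ht; rewrite ler_pdivlMr// mulrC; exact: dle.
rewrite p0 dot0l mulr0 !subr0 divfK ?gt_eqF// => h.
have e0 : e = 0 by apply: dot_eq0; apply/eqP; rewrite eq_le dot_ge0 andbT; lra.
split=> //; apply: aeS (aeI eE (@h0 R)) => x [e1 e2].
move: e1; rewrite -/e e0 e2 /k; case: ifPn => // h1 h2.
exfalso; move: h1; rewrite -ltNge => h1.
set s := Num.sqrt (n2 (p a x)) in h2.
have s0 : c < s by rewrite -(ger0_norm c0) -sqrtr_sqr ltr_sqrt// (le_lt_trans _ h1)// sqr_ge0.
have s1 : 0 < s by exact: le_lt_trans s0.
have : n2 ((1 - c / s)%:C * p a x) = 0 by rewrite -h2 n20.
rewrite n2M n2C => /eqP; rewrite mulf_eq0 sqrf_eq0 subr_eq0 => /orP[/eqP h3|/eqP h3].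
  have : s = c by rewrite -[LHS]mul1r h3 divfK ?gt_eqF.
  by move=> h4; rewrite h4 ltxx in s0.
by move: h1; rewrite h3 ltNge sqr_ge0.
Qed.

Lemma wd_dotT f g v (t : R) : wd f g -> is_derive t 1 (fun s => dot (T s f) v) (dot (T t g) v).
Proof. exact: (gen_dotd (@grp_T R)). Qed.

Lemma bd_lip f g (h K : R) : wd f g -> bd K g -> 0 < h -> bd (h * K) (T h f - f : H).
Proof.
move=> hf hg h0; apply: (bd_mv (p := fun s => T s f - f) (P := fun s => T s g)) => //.
- move=> v t _; under eq_fun do rewrite dotBl.
  have hc : is_derive t 1 (fun _ : R => dot f v) 0 := is_derive_cst _ _ _.
  by rewrite -[X in is_derive _ _ _ X]subr0; apply: is_deriveB; exact: wd_dotT.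
- by rewrite T0 subrr.
- by move=> t _; exact: bdHT.
Qed.
(** Landau's inequality: h g is T_h f - f minus a second-order remainder, and two applications of
    the sup norm mean value bound make that remainder at most h (h B). *)
Lemma landau f g k (h A B : R) : wd f g -> wd g k -> bd A f -> bd B k -> 0 < h ->
  bd (2 * A / h + h * B) g.
Proof.
move=> hf hg hA hB h0.
have h1 : bd (h * (h * B)) (T h f - f - h *: g : H).
  apply: (bd_mv (p := fun s => T s f - f - s *: g) (P := fun s => T s g - g)) => //.
  - move=> v t _; under eq_fun do rewrite dotBl dotBl dotZl mulrC.
    have hc : is_derive t 1 (fun _ : R => dot f v) 0 := is_derive_cst _ _ _.
    rewrite dotBl; apply: is_deriveB; last exact: is_derive_lin.
    by rewrite -[X in is_derive _ _ _ X]subr0; apply: is_deriveB; exact: wd_dotT.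
  - by rewrite T0 subrr scale0r subr0.
  - move=> t /andP[t0 th]; have [tz|tz] := eqVneq t 0.
      rewrite tz T0 subrr; apply: bd_le bdH0; rewrite mulr_ge0 ?(ltW h0)//; exact: bd_ge0 hB.
    apply: bd_le (bd_lip hg hB _); last by rewrite lt_neqAle eq_sym tz.
    by rewrite ler_wpM2r// (bd_ge0 hB).
have h2 : bd (A + A + h * (h * B)) (T h f - f - (T h f - f - h *: g) : H).
  by apply: bdHB => //; apply: bdHB => //; exact: bdHT.
have E : T h f - f - (T h f - f - h *: g) = h *: g by rewrite opprB addrC subrK.
have := bdHZ h^-1 h2; rewrite E scalerA mulVf ?gt_eqF// scale1r; apply: bd_le.
rewrite gtr0_norm ?invr_gt0// le_eqVlt; apply/orP; left; apply/eqP; field.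
by rewrite gt_eqF.
Qed.

Lemma nrm_ind a b : a < b -> `|ind a b : H| ^+ 2 = b - a.
Proof.
move=> ab; rewrite nrm_sqr (dot_ae _ _ (indE a b) (indE a b)); [|by case: (L2ind a b)..].
rewrite (_ : (fun x => _) = (fun x => \1_(oc a b) x : R)); last first.
  apply/funext => x; rewrite /rdot !ReImE indicE; case: (_ \in _) => /=; ring.
have mo := @m_oc R a b.
rewrite /Rintegral integral_indic//.
rewrite setIT; transitivity (fine (mu (`]a, b]%classic))); first by rewrite ocE.
by rewrite lebesgue_measure_itv /= lte_fin ab -EFinB.
Qed.
Lemma dot_ind g a b : dot g (ind a b) = \int[mu]_(x in `]a, b]) complex.Re (g x).
Proof.
rewrite (dot_ae _ _ (ae_eq_refl g) (indE a b)) //; last by case: (L2ind a b).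
rewrite (Rint_restr (A := `]a, b]%classic))//.
  apply: eq_Rintegral => x; rewrite inE -ocE => hx; rewrite /rdot !ReImE indicE mem_set//=; ring.
by move=> x hx; rewrite /rdot !ReImE indicE memNset ?mulr0 ?addr0// ocE.
Qed.
Lemma wd_wdR f g : wd f g -> wdR (fun x => complex.Re (f x)) (fun x => complex.Re (g x)).
Proof.
move=> /wd_weak h; split; [exact: (LI_h f).1|exact: (LI_h g).1|] => phi tp.
by have [+ _] := h phi tp; rewrite !dot_tm//; exact: test_derive.
Qed.
(** The one-dimensional Sobolev embedding. At a Lebesgue point b, Re f(b) - Re f(x) <= |g| for
    almost every x in ]b - 1, b], by the fundamental theorem and Cauchy-Schwarz; averaging over that
    interval gives the bound. *)
Lemma sup_Re f g : wd f g -> ae (fun x => complex.Re (f x) <= `|f| + `|g|).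
Proof.
move=> hf; have hw := wd_wdR hf; have [lf _ _] := hw.
apply: aeS (lebesgue_differentiation lf) => b hb.
pose e := ind (b - 1) b.
have e1 : `|e| ^+ 2 = 1 by rewrite nrm_ind; lra.
have en : `|e| = 1 by apply/eqP; rewrite -(eqrXn2 (n := 2))// e1 expr1n.
have hle : dot ((complex.Re (f b) - `|g|) *: e - f) e <= 0.
  rewrite -oppr_ge0 -dotNl dotE; apply: fine_ge0.
  pose G x := rdot ((- ((complex.Re (f b) - `|g|) *: e - f) : H) x) (e x).
  suff : (0 <= \int[mu]_x (G x)%:E)%E by [].
  have mG : measurable_fun setT G by exact: m_rdot.
  have -> : (\int[mu]_x (G x)%:E = \int[mu]_x (Num.max 0 (G x))%:E)%E.
    apply: ae_eq_integral => //.
    - exact/measurable_EFinP.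
    - apply/measurable_EFinP; apply: measurable_maxr => //; exact: measurable_cst.
    apply: aeS (aeI (aeI (hN ((complex.Re (f b) - `|g|) *: e - f)) (hB ((complex.Re (f b) - `|g|) *: e) f))
      (aeI (aeI (hZ (complex.Re (f b) - `|g|) e) (indE (b - 1) b)) (lebesgue_differentiation lf))) =>
      x [[e2 e3] [[e4 e5] hx]] _.
    congr (_%:E); rewrite (max_idPr _)// /G e2 e3 e4 /e e5 indicE.
    case: (boolP (x \in _)) => [|_] /=; last by rewrite /rdot !ReImE !mulr0 addr0.
    rewrite inE /oc /= => /andP[x1 x2].
    have : complex.Re (f b) - complex.Re (f x) <= `|g|.
      move: x2; rewrite le_eqVlt => /orP[/eqP->|xb]; first by rewrite subrr.
      rewrite (ftc_weak hw xb hx hb) -dot_ind; apply: le_trans (dot_le' _ _) _.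
      rewrite ler_piMr// -(ler_pXn2r (n := 2))// ?nnegrE// nrm_ind// expr1n; lra.
    rewrite /rdot !ReImE; lra.
  by apply: integral_ge0 => x _; rewrite lee_fin le_max lexx.
rewrite dotBl dotZl -nrm_sqr e1 in hle.
have := dot_le' f e; rewrite en; lra.
Qed.
(** [sup_Re] for f, i f, -f and -i f bounds the real and the imaginary part, and the factor 2
    absorbs sqrt 2. *)
Lemma bd_sup f g : wd f g -> bd (2 * (`|f| + `|g|)) f.
Proof.
move=> hf; split; [exact: Cmh|by rewrite mulr_ge0// addr_ge0|].
have h1 := sup_Re hf.
have h2 := sup_Re (gen_J (@grp_T R) (fun t u => TJ t u) hf).
have h3 := sup_Re (genN (@grp_T R) hf).
have h4 := sup_Re (genN (@grp_T R) (gen_J (@grp_T R) (fun t u => TJ t u) hf)).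
apply: aeS (aeI (aeI h1 h2) (aeI (aeI h3 h4) (aeI (JE f) (aeI (hN f) (hN (J f)))))) =>
  x [[a1 a2] [[a3 a4] [e1 [e2 e3]]]].
move: a2 a3 a4; rewrite e2 e3 e1 !normrN !nrmJ !ReImE /n2.
set p := complex.Re _; set q := complex.Im _; set M := _ + _ in a1 * => a2 a3 a4.
have M0 : 0 <= M by rewrite addr_ge0.
have pM : `|p| <= M by rewrite ler_norml; apply/andP; split; lra.
have qM : `|q| <= M by rewrite ler_norml; apply/andP; split; lra.
have sq (z : R) : `|z| <= M -> z ^+ 2 <= M ^+ 2.
  by move=> hz; rewrite -real_normK ?num_real// ler_pXn2r ?nnegrE.
by have := sq p pM; have := sq q qM; rewrite exprMn; have := sqr_ge0 M; lra.
Qed.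
End products.

Ltac hring := apply: dot_eq_all => ?; rewrite ?(dotBl, dotDl, dotNl, dotZl, dot0l); gen_dots; try ring.

(** * Product rule, the algebra H^m and the nonlinearity *)

Section products2.
Context {R : realType}.
Local Notation H := (Hsp R).
Local Notation mu := (@lebesgue_measure R).
Local Notation cmod := (@ComplexField.Normc.normc R).
Implicit Types (u v w f g : H) (phi : R -> R) (c d : R -> R[i]).
Hint Resolve L2h Cmh : core.

Lemma mulfC f g : mulf f g = mulf g f.
Proof. by congr mk; apply/funext => x; rewrite mulrC. Qed.
Lemma bd_mulf A B c f : bd A c -> bd B f -> bd (A * B) (mulf c f : H).
Proof. by move=> hA hB; apply: bdHae (bdM hA hB) (mulfE f hA). Qed.
Lemma mulfA A B c f g : bd A c -> bd B f -> mulf c (mulf f g) = mulf (mulf c f) g.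
Proof.
move=> hA hB; rewrite (mulf_comp g hA hB); apply: (mulf_ae g (bdM hA hB)); first exact: Cmh.
exact: ae_eq_sym (mulfE f hA).
Qed.
Lemma mulfDl A B c d f : bd A c -> bd B d -> mulf (fun x => c x + d x) f = mulf c f + mulf d f.
Proof.
move=> hA hB; apply: eqH; apply: aeS (aeI (mulfE f (bdD hA hB)) (aeI (hD (mulf c f) (mulf d f))
  (aeI (mulfE f hA) (mulfE f hB)))) => x [-> [-> [-> ->]]].
by rewrite mulrDl.
Qed.
Lemma Tmulf A f g h : bd A f -> T h (mulf f g) = mulf (T h f) (T h g).
Proof.
move=> hA; apply: eqH; apply: aeS (aeI (aeI (TE h (mulf f g)) (ae_shift h (mulfE g hA)))
  (aeI (mulfE (T h g) (bdHT h hA)) (aeI (TE h f) (TE h g)))) => x [[-> ->] [-> [-> ->]]].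
by [].
Qed.

(** The increment splits into two first-order remainders and h (T_h f - f) g'. The last term is
    small because T_h f - f is small in H^1, hence in the sup norm. *)
Lemma wd_mulf f f' g g' : wd f f' -> wd g g' -> wd (mulf f g) (mulf f' g + mulf f g').
Proof.
move=> hf hg; have bf := bd_sup hf; have bg := bd_sup hg.
set A := 2 * _ in bf; set B := 2 * _ in bg.
have A0 := bd_ge0 bf; have B0 := bd_ge0 bg.
apply/(genP (@grp_T R)) => e e0.
pose k := A + B + `|g'| + 1.
have k0 : 0 < k by rewrite /k ltr_wpDl// !addr_ge0.
have ek : 0 < e / k / 4 by rewrite !divr_gt0.
have [d1 d10 h1] := (genP (@grp_T R) f f').1 hf _ ek.
have [d2 d20 h2] := (genP (@grp_T R) g g').1 hg _ ek.
have [d3 d30 h3] := grp_small (@grp_T R) f ek.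
have [d4 d40 h4] := grp_small (@grp_T R) f' ek.
have dd : 0 < Num.min (Num.min d1 d2) (Num.min d3 d4).
  by have [|] := leP d1 d2; have [|] := leP d3 d4; rewrite lt_min; move=> *; apply/andP; split.
exists (Num.min (Num.min d1 d2) (Num.min d3 d4)) => // h; rewrite !le_min => /andP[/andP[l1 l2] /andP[l3 l4]].
have bTf : bd A (T h f : H) by exact: bdHT.
have bd3 : bd (2 * (e / k / 4 + e / k / 4)) (T h f - f : H).
  apply: bd_le (bd_sup (wd_B (wd_T h hf) hf)).
  by rewrite ler_pM2l// lerD// ?h3// h4.
have E : T h (mulf f g) - mulf f g - h *: (mulf f' g + mulf f g') =
   mulf (T h f) (T h g - g - h *: g') + mulf g (T h f - f - h *: f') + h *: mulf (T h f - f : H) g'.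
  rewrite (Tmulf g h bf) (mulfB _ _ bTf) (mulfB _ _ bTf) (mulfB _ _ bg) (mulfB _ _ bg) !(mulfZ _ _ bTf)
    !(mulfZ _ _ bg) (mulfC f' g) (mulfC g (T h f)) (mulfC g f).
  have -> : mulf (T h f - f : H) g' = mulf (T h f) g' - mulf f g'.
    apply: eqH; apply: aeS (aeI (aeI (mulfE g' bd3) (hB (mulf (T h f) g') (mulf f g')))
      (aeI (aeI (mulfE g' bTf) (mulfE g' bf)) (hB (T h f) f))) => x [[-> ->] [[-> ->] ->]].
    by rewrite mulrBl.
  hring.
rewrite E; apply: le_trans (ler_normD _ _) _; rewrite normrZ.
apply: le_trans (lerD (ler_normD _ _) (lexx _)) _.
have n1 := le_trans (mulf_le (T h g - g - h *: g') bTf) (ler_wpM2l A0 (h2 h l2)).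
have n2 := le_trans (mulf_le (T h f - f - h *: f') bg) (ler_wpM2l B0 (h1 h l1)).
have n3 := ler_wpM2l (normr_ge0 h) (mulf_le g' bd3).
apply: le_trans (lerD (lerD n1 n2) n3) _.
have -> : A * (e / k / 4 * `|h|) + B * (e / k / 4 * `|h|) + `|h| * (2 * (e / k / 4 + e / k / 4) * `|g'|) =
  (A / 4 + B / 4 + `|g'|) * (e / k) * `|h| by field; rewrite gt_eqF.
rewrite ler_wpM2r// mulrCA ler_piMr// ?(ltW e0)// ler_pdivrMr// mul1r /k.
have := normr_ge0 g'; lra.
Qed.

(* [c'] acts as a derivative of the multiplier [c]: stated through the product
   rule on L^2, so that [c] itself need not be square integrable. *)
Definition md c c' := forall f g, wd f g -> wd (mulf c f) (mulf c' f + mulf c g).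
Lemma mulf0l f : mulf (fun=> 0) f = 0.
Proof. by apply: eqH; apply: aeS (aeI (mulfE f (bdcst 0)) (@h0 R)) => x [-> ->]; rewrite mul0r. Qed.
Lemma mulf0 A c : bd A c -> mulf c 0 = 0.
Proof. by move=> h; have := mulfZ 0 0 h; rewrite !scale0r. Qed.
Lemma mulf1 f : mulf (fun=> 1) f = f.
Proof. by apply: eqH; apply: aeS (mulfE f (bdcst 1)) => x ->; rewrite mul1r. Qed.
Lemma mulf_real a f : mulf (fun=> a%:C) f = a *: f.
Proof. by []. Qed.

(** A multiplier [c 0] with its successive derivatives up to order m under one common bound, a
    derivative being understood through the product rule [md]. *)
Definition chain m (c : nat -> R -> R[i]) (K : R) := (forall j, (j <= m)%N -> bd K (c j)) /\
  (forall j, (j < m)%N -> md (c j) (c j.+1)).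
Lemma Hm_md m (c : nat -> R -> R[i]) K f : chain m c K -> Hm m f -> Hm m (mulf (c 0%N) f) /\ hn m (mulf (c 0%N) f) <= 2 ^+ m * K * hn m f.
Proof.
elim: m c f => [|m IH] c f [hb hc] hf.
  by split=> //=; rewrite expr0 mul1r; apply: mulf_le; exact: hb.
have K0 : 0 <= K := bd_ge0 (hb 0%N isT).
have hw := hc 0%N isT _ _ hf.1.
have c1 : chain m (fun j => c j.+1) K by split=> j jm; [exact: hb|exact: hc].
have c2 : chain m c K by split=> j jm; [apply: hb; exact: leqW|apply: hc; exact: ltnW].
have [H1 b1] := IH _ f c1 (Hm_S hf); have [H2 b2] := IH _ _ c2 hf.2.
split; first by apply/HmSP; exists (mulf (c 1%N) f + mulf (c 0%N) (D f)) => //; exact: HmD.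
rewrite /= (DE hw); apply: le_trans (lerD (mulf_le f (hb 0%N isT)) (hnD H1 H2)) _.
apply: le_trans (lerD (lexx _) (lerD b1 b2)) _.
have := nrm_hn m f; have := hn_ge0 m f; have := hn_ge0 m (D f).
have h2 : 1 <= 2 ^+ m :> R by rewrite exprn_ege1// ler1n.
have hS : hn m f <= `|f| + hn m (D f) by exact: hn_S.
have a0 : 0 <= 2 ^+ m * K by rewrite mulr_ge0// exprn_ge0.
have aK : K <= 2 ^+ m * K by rewrite ler_peMl.
move=> p1 p2 p3.
have -> X : 2 ^+ m.+1 * K * X = 2 * (2 ^+ m * K * X) by rewrite exprS; ring.
move: a0 aK; set a := 2 ^+ m * K => a0 aK.
have q1 : a * hn m f <= a * (`|f| + hn m (D f)) by rewrite ler_wpM2l.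
have q2 : K * `|f| <= a * `|f| by rewrite ler_wpM2r.
lra.
Qed.

Lemma bd_hn m f : (0 < m)%N -> Hm m f -> bd (2 * hn m f) f.
Proof.
case: m => // m _ [h _]; apply: bd_le (bd_sup h); rewrite ler_pM2l//= lerD2l.
exact: nrm_hn.
Qed.
(** H^1 embeds in the bounded functions, which settles order 1; the product rule reduces each
    further order to products at the order below. *)
Lemma Hm_mulf m : (0 < m)%N -> exists2 C : R, 0 <= C & forall f g, Hm m f -> Hm m g ->
  Hm m (mulf f g) /\ hn m (mulf f g) <= C * hn m f * hn m g.
Proof.
case: m => // m _; elim: m => [|m [C C0 IH]].
  exists 6 => // f g hf hg; have bf := bd_hn (ltn0Sn 0) hf; have bg := bd_hn (ltn0Sn 0) hg.
  have hw := wd_mulf hf.1 hg.1.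
  split; first by apply/HmSP; exists (mulf (D f) g + mulf f (D g)).
  rewrite [hn 1 (mulf _ _)]/= (DE hw).
  apply: le_trans (lerD (mulf_le g bf) (ler_normD _ _)) _; rewrite (mulfC (D f) g).
  apply: le_trans (lerD (lexx _) (lerD (mulf_le (D f) bg) (mulf_le (D g) bf))) _.
  have := hn_ge0 1 f; have := hn_ge0 1 g.
  have : `|g| <= hn 1 g by rewrite /= lerDl.
  have : `|D g| <= hn 1 g by rewrite /= lerDr.
  have : `|D f| <= hn 1 f by rewrite /= lerDr.
  nra.
exists (2 + 2 * C) => [|f g hf hg]; first by rewrite addr_ge0// mulr_ge0.
have bf := bd_hn (ltn0Sn _) hf.
have hw := wd_mulf hf.1 hg.1.
have [H1 b1] := IH _ _ hf.2 (Hm_S hg); have [H2 b2] := IH _ _ (Hm_S hf) hg.2.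
split; first by apply/HmSP; exists (mulf (D f) g + mulf f (D g)) => //; exact: HmD.
rewrite [hn _ (mulf _ _)]/= (DE hw) -/(hn m.+1 _).
apply: le_trans (lerD (mulf_le g bf) (hnD H1 H2)) _.
apply: le_trans (lerD (lexx _) (lerD b1 b2)) _.
have := hn_ge0 m.+2 f; have := hn_ge0 m.+2 g.
have g1 := nrm_hn m.+2 g.
have g2 := hn_S m.+1 g; have f2 := hn_S m.+1 f.
have g3 : hn m.+1 (D g) <= hn m.+2 g by rewrite [leRHS]/= lerDr.
have f3 : hn m.+1 (D f) <= hn m.+2 f by rewrite [leRHS]/= lerDr.
have := hn_ge0 m.+1 f; have := hn_ge0 m.+1 g; have := hn_ge0 m.+1 (D f); have := hn_ge0 m.+1 (D g).
move: g1 g2 f2 g3 f3; set a := hn m.+2 f; set b := hn m.+2 g.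
set a1 := hn m.+1 f; set b1' := hn m.+1 g; set a2 := hn m.+1 (D f); set b2' := hn m.+1 (D g).
move=> g1 g2 f2 g3 f3 p1 p2 p3 p4 p5 p6.
have q1 : a2 * b1' <= a * b by rewrite ler_pM.
have q2 : a1 * b2' <= a * b by rewrite ler_pM.
have q3 : a * `|g| <= a * b by rewrite ler_wpM2l.
rewrite -mulrA -(mulrA C) -(mulrA C).
have := ler_wpM2l C0 q1; have := ler_wpM2l C0 q2; rewrite -(mulrA (2 + _)); lra.
Qed.

Definition qq u := mulf u (cj u).
(* The nonlinearity |u|^(2k) u, as a product that stays in the algebra H^1. *)
Definition it k u := iter k (mulf (qq u)) u.
Definition NL (lam : R) k u := lam *: it k u.
Lemma mulfBl A B c d f : bd A c -> bd B d -> mulf (fun x => c x - d x) f = mulf c f - mulf d f.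
Proof.
move=> hA hB.
have hNd : bd B (fun x => - d x).
  have := bdM (bdcst (-1)) hB; rewrite normc_sqrt /n2 /= => h.
  case: hB => m B0 hb; split=> //; first exact: CmN.
  by apply: aeS hb => x; rewrite /n2 !ReImE !sqrrN.
rewrite (mulfDl f hA hNd); congr (_ + _); apply: eqH.
by apply: aeS (aeI (mulfE f hNd) (aeI (hN (mulf d f)) (mulfE f hB))) => x [-> [-> ->]]; rewrite mulNr.
Qed.

Lemma qq_Hm m : (0 < m)%N -> exists2 C : R, 0 <= C & forall u, Hm m u -> Hm m (qq u) /\ hn m (qq u) <= C * hn m u ^+ 2.
Proof.
move=> m0; have [C C0 h] := Hm_mulf m0; exists C => // u hu.
have [h1 h2] := h _ _ hu (Hmcj hu); split=> //.
by apply: le_trans h2 _; rewrite hncj// expr2 mulrA.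
Qed.
Lemma mulf_diff m u u' v v' : (0 < m)%N -> Hm m u -> Hm m u' -> Hm m v -> Hm m v' ->
  mulf u v - mulf u' v' = mulf (u - u' : H) v + mulf u' (v - v').
Proof.
move=> m0 hu hu' hv hv'; have bu := bd_hn m0 hu; have bu' := bd_hn m0 hu'.
rewrite (mulfB _ _ bu').
have -> : mulf (u - u' : H) v = mulf u v - mulf u' v; last by hring.
rewrite -(mulfBl v bu bu'); apply: eqH.
have bd1 := bdHB bu bu'.
have E := hB u u'.
rewrite (@mulf_ae _ _ _ (fun x => u x - u' x) v bd1 _ E); first exact: ae_eq_refl.
by case: (bdHB bu bu') => [_ _ _]; apply: CmD => //; apply: CmN.
Qed.
(** Maps that are bounded and Lipschitz on a ball of H^m are stable under products; [mulip] records
    this and the powers follow by induction. *)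
Lemma it_lip m k (B : R) : (0 < m)%N -> 0 <= B -> exists2 L : R, 0 <= L & forall u v, Hm m u -> Hm m v ->
  hn m u <= B -> hn m v <= B -> Hm m (it k u) /\ hn m (it k u - it k v) <= L * hn m (u - v).
Proof.
move=> m0 B0; have [C C0 hC] := Hm_mulf m0.
have mulip (P Q : H -> H) (LP LQ BP BQ : R) : 0 <= LP -> 0 <= LQ -> 0 <= BP -> 0 <= BQ ->
  (forall u, Hm m u -> hn m u <= B -> (Hm m (P u) /\ hn m (P u) <= BP) /\ Hm m (Q u) /\ hn m (Q u) <= BQ) ->
  (forall u v, Hm m u -> Hm m v -> hn m u <= B -> hn m v <= B ->
    hn m (P u - P v) <= LP * hn m (u - v) /\ hn m (Q u - Q v) <= LQ * hn m (u - v)) ->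
  (forall u, Hm m u -> hn m u <= B -> Hm m (mulf (P u) (Q u)) /\ hn m (mulf (P u) (Q u)) <= C * BP * BQ) /\
  forall u v, Hm m u -> Hm m v -> hn m u <= B -> hn m v <= B ->
    hn m (mulf (P u) (Q u) - mulf (P v) (Q v)) <= (C * LP * BQ + C * BP * LQ) * hn m (u - v).
  move=> LP0 LQ0 BP0 BQ0 hb hl; split=> [u hu uB|u v hu hv uB vB].
    have [[p1 p2] [q1 q2]] := hb u hu uB; have [h1 h2] := hC _ _ p1 q1; split=> //.
    apply: le_trans h2 _; apply: ler_pM => //; rewrite ?mulr_ge0 ?hn_ge0//.
    by rewrite ler_wpM2l.
  have [[p1 p2] [q1 q2]] := hb u hu uB; have [[p3 p4] [q3 q4]] := hb v hv vB.
  have [l1 l2] := hl u v hu hv uB vB.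
  rewrite (mulf_diff m0 p1 p3 q1 q3).
  have [a1 a2] := hC _ _ (HmB p1 p3) q1; have [b1 b2] := hC _ _ p3 (HmB q1 q3).
  apply: le_trans (hnD a1 b1) _; rewrite mulrDl; apply: lerD.
    apply: le_trans a2 _.
    have -> : C * LP * BQ * hn m (u - v) = C * (LP * hn m (u - v)) * BQ by ring.
    by apply: ler_pM => //; rewrite ?mulr_ge0 ?hn_ge0// ler_wpM2l.
  by apply: le_trans b2 _; rewrite -!mulrA ler_wpM2l// ler_pM// ?hn_ge0.
have Hc u : Hm m u -> Hm m (cj u) by exact: Hmcj.
have [qb ql] := mulip (fun u => u) (fun u => cj u) 1 1 B B ler01 ler01 B0 B0
  (fun u hu uB => conj (conj hu uB) (conj (Hc u hu) (eq_ind_r (fun z => z <= B) uB (hncj hu))))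
  (fun u v hu hv uB vB => conj (eq_ind_r (fun z => hn m (u - v) <= z) (lexx _) (mul1r _))
     (eq_ind_r (fun z => hn m (cj u - cj v) <= z) (eq_ind _ (fun z => hn m z <= _) (eq_ind_r (fun z => z <= _) (lexx _) (hncj (HmB hu hv))) _ (cjB u v)) (mul1r _))).
suff [L [P [L0 P0 hL hP]]] : exists L P : R, [/\ 0 <= L, 0 <= P,
   forall u v, Hm m u -> Hm m v -> hn m u <= B -> hn m v <= B -> hn m (it k u - it k v) <= L * hn m (u - v) &
   forall u, Hm m u -> hn m u <= B -> Hm m (it k u) /\ hn m (it k u) <= P].
  by exists L => // u v hu hv uB vB; split; [exact: (hP u hu uB).1|exact: hL].
elim: k => [|k [L [P [L0 P0 hL hP]]]].
  by exists 1, B; split=> // u v hu hv _ _; rewrite mul1r.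
set LQ := C * 1 * B + C * B * 1 in ql; set BQ := C * B * B in qb.
have LQ0 : 0 <= LQ by rewrite addr_ge0// !mulr_ge0.
have BQ0 : 0 <= BQ by rewrite !mulr_ge0.
have [rb rl] := mulip qq (it k) LQ L BQ P LQ0 L0 BQ0 P0
  (fun u hu uB => conj (qb u hu uB) (hP u hu uB))
  (fun u v hu hv uB vB => conj (ql u v hu hv uB vB) (hL u v hu hv uB vB)).
exists (C * LQ * P + C * BQ * L), (C * BQ * P); split=> //.
  by rewrite addr_ge0// !mulr_ge0.
by rewrite !mulr_ge0.
Qed.
End products2.

(** * Schroedinger groups *)

Section mdweak.
Context {R : realType}.
Local Notation H := (Hsp R).
Local Notation mu := (@lebesgue_measure R).
Implicit Types (u v w f g : H) (phi : R -> R) (c d : R -> R[i]).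
Hint Resolve L2h Cmh : core.

Lemma test_mul phi psi : test_function phi -> test_function psi -> test_function (fun x => phi x * psi x).
Proof.
move=> tp tq; have [_ [M hM]] := tp; apply: (smooth_test (M := M)).
  by move=> n; apply: CnM; exact: test_smooth.
by move=> x /hM ->; rewrite mul0r.
Qed.
Lemma derive1_mul phi psi : test_function phi -> test_function psi ->
  derive1 (fun x => phi x * psi x) = fun x => phi x * derive1 psi x + derive1 phi x * psi x.
Proof.
move=> tp tq; apply/derive1_of => x.
have := is_deriveM (test_isd x tp) (test_isd x tq).
by rewrite /GRing.scale /= (mulrC (psi x)).
Qed.
Lemma LI_test (V : R -> R) phi : locally_integrable setT V -> test_function phi ->
  mu.-integrable setT (EFin \o (fun x => V x * phi x)).
Proof.
move=> lV tp; have [K hK] := test_bounded tp; have [_ [M hM]] := tp.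
apply: (LI_mul (M := K) (a := - `|M|) (b := `|M|) lV (m_test tp) hK) => x hx; apply: hM.
rewrite ltNge; apply/negP => xM; apply: hx; rewrite -ler_norml.
exact: le_trans xM (ler_norm _).
Qed.
Lemma dot_mul_tm (V : R -> R) K phi psi : bd K (toC V) -> test_function phi -> test_function psi ->
  dot (mulf (toC V) (tm psi)) (tm phi) = \int[mu]_x (V x * (psi x * phi x)) /\
  dot (mulf (toC V) (tm psi)) (J (tm phi)) = 0.
Proof.
move=> hV tp tq.
have e1 : ae_equal (mulf (toC V) (tm psi)) (fun x => (V x)%:C * (psi x)%:C).
  by apply: aeS2 (mulfE (tm psi) hV) (tmE tq) => x -> ->.
have m1 : Cmeasurable (fun x => (V x)%:C * (psi x)%:C).
  by apply: CmM; [case: hV|case: (L2tm tq)].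
have e2 : ae_equal (J (tm phi)) (fun x => 'i * (phi x)%:C).
  by apply: aeS2 (JE (tm phi)) (tmE tp) => x -> ->.
split.
  rewrite (dot_ae _ _ e1 (tmE tp))//; last by case: (L2tm tp).
  by apply: eq_Rintegral => x _; rewrite /rdot !ReImE; ring.
rewrite (dot_ae _ _ e1 e2)//; last by apply: CmM; [exact: Cmcst|case: (L2tm tp)].
transitivity (\int[mu]_(x in setT) (0 : R)); last by rewrite Rintegral_cst// mul0r.
by apply: eq_Rintegral => x _; rewrite /rdot !ReImE; ring.
Qed.
Lemma dot_mulf_real (V : R -> R) K u v : bd K (toC V) -> dot (mulf (toC V) u) v = dot u (mulf (toC V) v).
Proof.
move=> hV; rewrite (dot_mulf u v hV); congr (dot u (mk _)); apply/funext => x.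
by rewrite /toC; congr (_ * _); apply: cplx_eq; rewrite !ReImE ?oppr0.
Qed.
(** On test functions the product rule is the weak derivative of V tested on a product of two test
    functions. The core criterion extends it, the real multiplier being moved to the test side. *)
Lemma md_weak (V W : R -> R) K K' : wdR V W -> bd K (toC V) -> bd K' (toC W) -> md (toC V) (toC W).
Proof.
move=> [lV lW hw] bV bW.
have st psi : test_function psi -> wd (mulf (toC V) (tm psi)) (mulf (toC W) (tm psi) + mulf (toC V) (tm (derive1 psi))).
  move=> tq; have tq' := test_derive tq; apply/wd_weak => phi tp; have tp' := test_derive tp.
  rewrite !dotDl (dot_mul_tm bV tp' tq).1 (dot_mul_tm bV tp' tq).2 (dot_mul_tm bW tp tq).1 (dot_mul_tm bW tp tq).2
    (dot_mul_tm bV tp tq').1 (dot_mul_tm bV tp tq').2 addr0 oppr0; split=> //.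
  have := hw _ (test_mul tq tp); rewrite derive1_mul// => h.
  rewrite opprD -h.
  under [X in _ = X - _]eq_Rintegral do rewrite mulrDr.
  rewrite RintegralD//; first by rewrite addrK.
    by apply: LI_test => //; exact: test_mul.
  by apply: LI_test => //; exact: test_mul.
move=> f g fg; apply: (gen_core (C := @Ctest R) (@grp_T R)).
- exact: Ctest_wd.
- exact: dense_Ctest.
- by move=> a b t; exact: Ctest_T.
move=> a b [p [q [tp tq -> ->]]].
have h := wd_D (st p tp) (wd_J (st q tq)).
have := wd_skew fg h.
rewrite !dotDl !dotDr JD !dotDr.
rewrite -!(mulfJ _ bV) -!(mulfJ _ bW) !(dot_mulf_real _ _ bV) !(dot_mulf_real _ _ bW).
by gen_dots; lra.
Qed.

Lemma Tmulf_cont c K w : bd K c -> continuous (fun t => T t (mulf c (T (- t) w))).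
Proof.
move=> bc t; apply/cvgrPdist_le => e e0.
have e1 : 0 < e / 2 / (K + 1) by rewrite !divr_gt0// ltr_wpDl// (bd_ge0 bc).
have e2 : 0 < e / 2 by rewrite divr_gt0.
have [d1 d10 h1] := grp_small (grp_rev (@grp_T R)) (T (- t) w) e1.
have [d2 d20 h2] := grp_small (@grp_T R) (T t (mulf c (T (- t) w))) e2.
have d0 : 0 < Num.min d1 d2 by have [|] := leP d1 d2.
have : \forall s \near t, `|s - t| <= Num.min d1 d2.
  exists (Num.min d1 d2) => //= s; rewrite distrC; exact: ltW.
apply: filterS => s; rewrite le_min => /andP[l1 l2].
have -> : T t (mulf c (T (- t) w)) - T s (mulf c (T (- s) w)) =
  - (T (s - t) (T t (mulf c (T (- t) w))) - T t (mulf c (T (- t) w))) - T s (mulf c (T (- (s - t)) (T (- t) w) - T (- t) w)).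
  rewrite !TT subrK (mulfB _ _ bc) TB opprB.
  have -> : - (s - t) + - t = - s by ring.
  by hring.
apply: le_trans (ler_normB _ _) _; rewrite normrN nrmT.
apply: le_trans (lerD (h2 _ l2) (mulf_le _ bc)) _.
apply: le_trans (lerD (lexx _) (ler_wpM2l (bd_ge0 bc) (h1 _ l1))) _.
have -> : e = e / 2 + e / 2 by field.
rewrite lerD//; first by lra.
rewrite mulrA ler_pdivrMr ?ltr_wpDl ?(bd_ge0 bc)//.
have := bd_ge0 bc; nra.
Qed.
Lemma dnT : dn (setT : set H).
Proof. by move=> u e e0; exists u => //; rewrite subrr normr0 ltW. Qed.

(** T_t c T_(-t) is multiplication by the translate of c, so its derivative in t involves c' and no
    derivative of w. *)
Lemma Tmulf_derive c c' K K' w v (t : R) : bd K c -> bd K' c' -> md c c' -> Hm 1 w ->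
  is_derive t 1 (fun t => dot (T t (mulf c (T (- t) w))) v) (dot (T t (mulf c' (T (- t) w))) v).
Proof.
move=> bc bc' hm [hw _]; apply: (@weak_extend R [set a | Hm 1 a] (fun t => T t (mulf c (T (- t) w))) (fun t => T t (mulf c' (T (- t) w))) (Dn_test 1)).
  exact: Tmulf_cont bc'.
move=> {}v {}t [hv _].
under eq_fun do rewrite (grp_adj (@grp_T R)).
have gr := grp_rev (@grp_T R).
have hx := @gen_shift R _ gr t _ _ (gen_rev (@grp_T R) hv).
have cz : {for t, continuous (fun s => mulf c (T (- s) w))}.
  apply/cvgrPdist_le => e e0.
  have e1 : 0 < e / (K + 1) by rewrite divr_gt0// ltr_wpDl// (bd_ge0 bc).
  have /cvgrPdist_le/(_ _ e1) := @grp_cont R _ gr w t.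
  apply: filterS => s hs; rewrite -(mulfB _ _ bc); apply: le_trans (mulf_le _ bc) _.
  apply: le_trans (ler_wpM2l (bd_ge0 bc) hs) _.
  rewrite mulrA ler_pdivrMr ?ltr_wpDl ?(bd_ge0 bc)//.
  have := bd_ge0 bc; nra.
have dz : is_derive t 1 (fun s => dot (mulf c (T (- s) w)) (T (- t) v)) (dot (mulf c (T (- t) (- D w))) (T (- t) v)).
  under eq_fun do rewrite (dot_mulf _ _ bc).
  rewrite (dot_mulf _ _ bc).
  exact: (gen_dotd gr _ t (gen_rev (@grp_T R) hw)).
have := @dot_derive R (fun s => mulf c (T (- s) w)) (fun s => T (- s) v) t _ _ cz dz hx; rewrite (grp_adj (@grp_T R)).
have := wd_skew (hm _ _ (wd_T (- t) hw)) (wd_T (- t) hv).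
rewrite !TN (mulfN _ bc) dotDl dotNl dotNr => E.
suff -> : - dot (mulf c (T (- t) (D w))) (T (- t) v) + - dot (mulf c (T (- t) w)) (T (- t) (D v)) =
  dot (mulf c' (T (- t) w)) (T (- t) v) by [].
by move: E; gen_dots; lra.
Qed.
(** The commutator of a translation with the potential costs a derivative of [c] and none of [w];
    hence the chain is one order longer than the regularity of [w]. *)
Lemma comm_md m (c : nat -> R -> R[i]) K w (h : R) : (0 < m)%N -> chain m.+1 c K -> Hm m w -> 0 <= h ->
  hn m (T h (mulf (c 0%N) (T (- h) w)) - mulf (c 0%N) w) <= m.+1%:R * (2 ^+ m * K * hn m w * h).
Proof.
move=> m0 [hb hc] hw h0.
have ch0 : chain m c K by split=> j jm; [apply: hb; exact: leqW|apply: hc; exact: ltnW].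
have ch1 : chain m (fun j => c j.+1) K by split=> j jm; [exact: hb|exact: hc].
have w1 : Hm 1 w by exact: Hm_le hw.
apply: hn_bound => j jm.
pose z t := T t (mulf (c 0%N) (T (- t) w)); pose P t := T t (mulf (c 1%N) (T (- t) w)).
have z0 : z 0 = mulf (c 0%N) w by rewrite /z oppr0 !T0.
rewrite -/(z h) -z0.
have := @mv_Dn R j z P (fun s => 2 ^+ m * K * hn m w * s) (fun=> 2 ^+ m * K * hn m w) 0 h h0.
rewrite mulr0 subr0; apply.
- move=> v t _; exact: Tmulf_derive (hb 0%N isT) (hb 1%N isT) (hc 0%N isT) w1.
- by move=> t _; apply: Hm_le jm _; apply: HmT; apply: (Hm_md ch0 _).1; exact: HmT.
- by move=> t _; apply: Hm_le jm _; apply: HmT; apply: (Hm_md ch1 _).1; exact: HmT.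
- by move=> t _; exact: is_derive_lin.
move=> t _; apply: le_trans (Dn_hn _ jm) _.
have [h1 h2] := Hm_md ch1 (HmT (- t) hw).
by rewrite /P (hnT _ h1); apply: le_trans h2 _; rewrite (hnT _ hw).
Qed.
End mdweak.

(** * Sobolev bounds and continuity for a Schroedinger group *)

Section schrodinger.
Context {R : realType}.
Local Notation H := (Hsp R).
Implicit Types (u v w f g : H) (S : R -> H -> H).

Record schr S (c0 : R -> R[i]) : Prop := Schr {
  schr_grp : grp S;
  schr_J : forall t g, S t (J g) = J (S t g);
  schr_gen : forall g h, gen S g h <-> Hm 2 g /\ h = J (D (D g) + mulf c0 g) }.

Lemma Jinj u v : J u = J v -> u = v.
Proof. by move=> h; rewrite -[u]opprK -[v]opprK -!JJ h. Qed.

(** The averages [rI] of [u] are one order smoother and converge in H^m. Their images are Cauchy in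
    H^m, and the L^2 bound identifies the limit as [A u]. *)
Lemma ext_density m (A : H -> H) (C C0 : R) : (forall u v, A (u - v) = A u - A v) -> 0 <= C -> 0 <= C0 ->
  (forall u, `|A u| <= C0 * `|u|) ->
  (forall u, Hm m.+1 u -> Hm m (A u) /\ hn m (A u) <= C * hn m u) ->
  forall u, Hm m u -> Hm m (A u) /\ hn m (A u) <= C * hn m u.
Proof.
move=> AB C_ge0 C0_ge0 hA h u hu.
pose r t := (t^-1)^-1 *: rI (@T R) u t^-1.
have rl := reg_lim hu.
have rH t : Hm m.+1 (r t) by apply: HmZ; exact: reg_Hm.
have rHm t : Hm m (r t) by exact: Hm_S.
have hd t : hn m (r t - u) = hn m (u - r t) by apply: hnBC.
have [t|e e0|f Hf lf] := @Hm_complete R m (fun t => A (r t)); first exact: (h _ (rH t)).1.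
  have e1 : 0 < e / (2 * (C + 1)) by rewrite divr_gt0// mulr_gt0// ltr_wpDl.
  have [T0 hT] := rl _ e1; exists T0 => s t Ts Tt.
  rewrite -AB; apply: le_trans (h _ (HmB (rH s) (rH t))).2 _.
  apply: le_trans (ler_wpM2l C_ge0 (hn_dist (rHm s) hu (rHm t))) _.
  rewrite -hd; apply: le_trans (ler_wpM2l C_ge0 (lerD (hT s Ts) (hT t Tt))) _.
  have -> : e / (2 * (C + 1)) + e / (2 * (C + 1)) = e / (C + 1) by field; rewrite gt_eqF// ltr_wpDl.
  by rewrite mulrA ler_pdivrMr ?ltr_wpDl//; nra.
have fA : f = A u.
  apply/eqP; rewrite -subr_eq0 -normr_le0; apply/ler_addgt0Pr => e e0; rewrite add0r.
  have e1 : 0 < e / (2 * (C0 + 1)) by rewrite divr_gt0// mulr_gt0// ltr_wpDl.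
  have e2 : 0 < e / 2 by rewrite divr_gt0.
  have [T1 h1] := lf _ e2; have [T2 h2] := rl _ e1; pose t := Num.max T1 T2.
  have k1 := le_trans (nrm_hn m _) (h1 t _); have k2 := le_trans (nrm_hn m _) (h2 t _).
  have -> : f - A u = - (A (r t) - f) + A (r t - u) by rewrite AB opprB addrA subrK.
  apply: le_trans (ler_normD _ _) _; rewrite normrN.
  apply: le_trans (lerD (k1 _) (hA _)) _; first by rewrite le_max lexx.
  apply: le_trans (lerD (lexx _) (ler_wpM2l C0_ge0 (k2 _))) _; first by rewrite le_max lexx orbT.
  rewrite [leRHS](_ : e = e / 2 + e / 2); last by field.
  rewrite lerD2l mulrA ler_pdivrMr ?mulr_gt0 ?ltr_wpDl//.
  have -> : e / 2 * (2 * (C0 + 1)) = e * (C0 + 1) by field.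
  nra.
rewrite -fA; split=> //; apply/ler_addgt0Pr => e e0.
have e1 : 0 < e / (2 * (C + 1)) by rewrite divr_gt0// mulr_gt0// ltr_wpDl.
have e2 : 0 < e / 2 by rewrite divr_gt0.
have [T1 h1] := lf _ e2; have [T2 h2] := rl _ e1; pose t := Num.max T1 T2.
have k1 : hn m (A (r t) - f) <= e / 2 by apply: h1; rewrite le_max lexx.
have k2 : hn m (r t - u) <= e / (2 * (C + 1)) by apply: h2; rewrite le_max lexx orbT.
have HA := (h _ (rH t)).1.
apply: le_trans (hn_tri Hf HA) _; rewrite hnBC//.
apply: le_trans (lerD k1 (h _ (rH t)).2) _.
apply: le_trans (lerD (lexx _) (ler_wpM2l C_ge0 (hn_tri (rHm t) hu))) _.
have := ler_wpM2l C_ge0 k2.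
have : C * (e / (2 * (C + 1))) <= e / 2.
  rewrite mulrA ler_pdivrMr ?mulr_gt0 ?ltr_wpDl//.
  have -> : e / 2 * (2 * (C + 1)) = e * (C + 1) by field.
  nra.
by rewrite mulrDr; lra.
Qed.

Section group_regularity.
Variables (S : R -> H -> H) (c0 : R -> R) (K : R).
Let c := toC c0.
Hypotheses (hS : schr S c) (bc : bd K c).
Let gS := schr_grp hS.
Definition Bop g := D (D g) + mulf c g.

Lemma S_H2 t g : Hm 2 g -> Hm 2 (S t g) /\ Bop (S t g) = S t (Bop g).
Proof.
move=> hg; have : gen S g (J (Bop g)) by apply/(schr_gen hS).
move/(gen_S gS t)/(schr_gen hS) => [h1]; rewrite (schr_J hS) => /Jinj h2.
by split.
Qed.
Lemma B_quad g : Hm 2 g -> `|D g| ^+ 2 = dot (mulf c g) g - dot (Bop g) g.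
Proof.
move=> [h1 [h2 _]]; rewrite nrm_sqr (wd_skew h1 h2) /Bop dotDl (dotC (D (D g))).
by gen_dots; ring.
Qed.
(** The quadratic form (Bop g, g) is conserved and equals -|D g|^2 up to K |g|^2. This makes sense
    on H^2 and is extended to H^1 by density. *)
Lemma S_H1 : exists2 C : R, 0 <= C & forall t g, Hm 1 g -> Hm 1 (S t g) /\ hn 1 (S t g) <= C * hn 1 g.
Proof.
have K0 := bd_ge0 bc.
have C0 : 0 <= 2 * K + 2 by lra.
exists (2 * K + 2) => // t; apply: (@ext_density 1 _ (2 * K + 2) 1) => //.
- by move=> u v; rewrite (grpB gS).
- by move=> u; rewrite (grp_nrm gS) mul1r.
move=> g hg; have [h1 h2] := S_H2 t hg; split; first exact: Hm_S.
have e1 := B_quad hg; have := B_quad h1; rewrite h2 (grp_dot gS) => e2.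
have : `|D (S t g)| ^+ 2 <= (`|D g| + (2 * K + 1) * `|g|) ^+ 2.
  have q1 : dot (mulf c (S t g)) (S t g) <= K * `|g| ^+ 2.
    apply: le_trans (dot_le' _ _) _; rewrite (grp_nrm gS) expr2 mulrA ler_wpM2r//.
    by apply: le_trans (mulf_le _ bc) _; rewrite (grp_nrm gS).
  have q2 : - dot (mulf c g) g <= K * `|g| ^+ 2.
    apply: le_trans (ler_norm _) _; rewrite normrN; apply: le_trans (dot_le _ _) _.
    by rewrite expr2 mulrA ler_wpM2r//; exact: mulf_le.
  have a0 := normr_ge0 g; have b0 := normr_ge0 (D g); move: e1 e2 q1 q2; gen_dots.
  have p1 : 2 * K * `|g| ^+ 2 <= (2 * K + 1) ^+ 2 * `|g| ^+ 2 by rewrite ler_wpM2r ?sqr_ge0//; nra.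
  have p2 : 0 <= `|D g| * ((2 * K + 1) * `|g|) by rewrite !mulr_ge0// addr_ge0// mulr_ge0.
  by rewrite sqrrD exprMn mulr2n => *; lra.
rewrite ler_pXn2r ?nnegrE ?addr_ge0 ?mulr_ge0 ?addr_ge0 ?mulr_ge0// => q.
rewrite /= (grp_nrm gS); have := normr_ge0 g; have := normr_ge0 (D g); nra.
Qed.
Variable (cc : nat -> R -> R[i]).
Hypothesis cc0 : cc 0%N = c.
(** [Bop] commutes with the group, so D^2 S g = S (Bop g) - c S g lifts a bound at order m to order
    m + 2, with only m derivatives of the potential. *)
Lemma S_Hm m : chain m.-2 cc K -> exists2 C : R, 0 <= C & forall t g, Hm m g -> Hm m (S t g) /\ hn m (S t g) <= C * hn m g.
Proof.
elim/ltn_ind: m => -[|[|m]] IH hch.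
- by exists 1 => // t g _; split=> //=; rewrite (grp_nrm gS) mul1r.
- exact: S_H1.
have [C1 C10 h1] := S_H1.
have hm2 : chain m.-2 cc K.
  by case: hch => a b; split=> j jm; [apply: a; lia|apply: b; lia].
have [C C0 h] := IH m (leqW (ltnSn m)) hm2.
pose A := 2 ^+ m * K.
have A0 : 0 <= A by rewrite mulr_ge0 ?exprn_ge0// (bd_ge0 bc).
exists (C1 + C * (1 + A) + A * C) => [|t g hg]; first by apply: addr_ge0; [apply: addr_ge0 => //; apply: mulr_ge0 => //; apply: addr_ge0|apply: mulr_ge0].
have g2 : Hm 2 g by exact: Hm_le hg.
have gm : Hm m g by apply: Hm_le hg; lia.
have ddm : Hm m (D (D g)) by case: hg => _ [].
have [s1 s2] := S_H2 t g2.
have [v1 v2] := Hm_md hch gm.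
have HB : Hm m (Bop g) by apply: HmD => //; rewrite -cc0.
have [b1 b2] := h t _ HB.
have [e1 e2] := h t _ gm.
have [f1 f2] := Hm_md hch e1.
have E : D (D (S t g)) = S t (Bop g) - mulf (cc 0%N) (S t g) by rewrite -s2 /Bop cc0 addrK.
have Hdd : Hm m (D (D (S t g))) by rewrite E; exact: HmB.
split; first by case: s1 => q1 [q2 _]; split.
have [_ d2] := h1 t g (Hm_le (ltn0Sn m.+1) hg).
have -> : hn m.+2 (S t g) = hn 1 (S t g) + hn m (D (D (S t g))) by rewrite /= addrA.
rewrite E; apply: le_trans (lerD d2 (hnB b1 f1)) _.
apply: le_trans (lerD (lexx _) (lerD b2 f2)) _.
have l1 : hn 1 g <= hn m.+2 g by exact: hn_le.
have l2 : hn m g <= hn m.+2 g by apply: hn_le; lia.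
have l3 : hn m (Bop g) <= (1 + A) * hn m.+2 g.
  apply: le_trans (hnD ddm _) _; first by rewrite -cc0.
  rewrite -cc0 mulrDl mul1r lerD//; last by apply: le_trans v2 _; rewrite ler_wpM2l.
  by rewrite /= addrA lerDr addr_ge0.
rewrite -addrA mulrDl lerD//; first by rewrite ler_wpM2l.
rewrite mulrDl lerD//; first by rewrite -mulrA ler_wpM2l.
by rewrite -/A -mulrA ler_wpM2l//; apply: le_trans e2 _; rewrite ler_wpM2l.
Qed.
Lemma S_cont_dense m : (exists2 C : R, 0 <= C & forall t g, Hm m g -> Hm m (S t g) /\ hn m (S t g) <= C * hn m g) ->
  (forall g, Hm m.+1 g -> forall e : R, 0 < e -> exists2 d : R, 0 < d & forall h, `|h| <= d -> hn m (S h g - g) <= e) ->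
  forall g, Hm m g -> forall e : R, 0 < e -> exists2 d : R, 0 < d & forall h, `|h| <= d -> hn m (S h g - g) <= e.
Proof.
move=> [C C0 hb] hd g hg e e0.
have e1 : 0 < e / (2 * (C + 1)) by rewrite divr_gt0// mulr_gt0// ltr_wpDl.
have e2 : 0 < e / 2 by rewrite divr_gt0.
have [k hk kg] := Hm_dense hg e1; have [d d0 hdd] := hd k hk _ e2; exists d => // h hh.
have km := Hm_S hk.
have -> : S h g - g = (S h k - k) + (k - g) - S h (k - g) by rewrite (grpB gS); hring.
have [s1 s2] := hb h _ (HmB km hg); have [t1 t2] := hb h _ km.
apply: le_trans (hnB (HmD (HmB t1 km) (HmB km hg)) s1) _.
apply: le_trans (lerD (hnD (HmB t1 km) (HmB km hg)) s2) _.
have := hdd h hh; have := ler_wpM2l C0 kg.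
have : (1 + C) * (e / (2 * (C + 1))) <= e / 2.
  rewrite mulrA ler_pdivrMr ?mulr_gt0 ?ltr_wpDl//.
  have -> : e / 2 * (2 * (C + 1)) = e * (C + 1) by field.
  nra.
lra.
Qed.
(** At order 1, |D f|^2 <= |f| |D^2 f| interpolates between continuity in L^2 and boundedness in
    H^2; higher orders are reached two at a time through [Bop]. *)
Lemma S_Hm_cont m : chain m.-2 cc K -> forall g, Hm m g ->
  forall e : R, 0 < e -> exists2 d : R, 0 < d & forall h, `|h| <= d -> hn m (S h g - g) <= e.
Proof.
have h1 : forall g, Hm 1 g -> forall e : R, 0 < e -> exists2 d : R, 0 < d & forall h, `|h| <= d -> hn 1 (S h g - g) <= e.
  apply: (S_cont_dense S_H1) => g hg e e0.
  have [|C C0 hb] := @S_Hm 2.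
    by split=> // j; rewrite leqn0 => /eqP ->; rewrite cc0.
  pose M := (C + 1) * hn 2 g + 1.
  have M0 : 0 < M by rewrite ltr_wpDl// mulr_ge0 ?hn_ge0// addr_ge0.
  (* Smallness at the level (e / 2)^2 / M in L^2 makes the interpolated derivative at most e / 2. *)
  pose k := Num.min (e / 2) ((e / 2) ^+ 2 / M).
  have k0 : 0 < k by rewrite lt_min !divr_gt0// exprn_gt0// divr_gt0.
  have [d d0 hd] := grp_small gS g k0; exists d => // h hh.
  have [s1 s2] := hb h g hg; have H2 := HmB s1 hg.
  have := hd h hh; rewrite le_min => /andP[l1 l2].
  have := D_interp H2.
  have l3 : `|D (D (S h g - g))| <= M.
    apply: le_trans (_ : hn 2 (S h g - g) <= _).
      by rewrite /= addrA lerDr addr_ge0.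
    apply: le_trans (hnB s1 hg) _; rewrite /M; lra.
  have l4 : `|S h g - g| * `|D (D (S h g - g))| <= (e / 2) ^+ 2.
    apply: le_trans (ler_pM (normr_ge0 _) (normr_ge0 _) l2 l3) _.
    by rewrite divfK// gt_eqF.
  move=> /le_trans/(_ l4); rewrite ler_pXn2r ?nnegrE ?divr_ge0 ?(ltW e0)// => l5.
  by rewrite /=; lra.
elim/ltn_ind: m => -[|[|m]] IH hch g hg e e0.
- exact: grp_small.
- exact: h1.
have hm2 : chain m.-2 cc K.
  by case: hch => a b; split=> j jm; [apply: a; lia|apply: b; lia].
have [C C0 hb] := S_Hm hm2.
have g2 : Hm 2 g by exact: Hm_le hg.
have gm : Hm m g by apply: Hm_le hg; lia.
have ddm : Hm m (D (D g)) by case: hg => _ [].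
have HB : Hm m (Bop g) by apply: HmD => //; rewrite -cc0; exact: (Hm_md hch gm).1.
pose A := 2 ^+ m * K.
have A0 : 0 <= A by rewrite mulr_ge0 ?exprn_ge0// (bd_ge0 bc).
have e3 : 0 < e / 3 by rewrite divr_gt0.
have e4 : 0 < e / 3 / (A + 1) by rewrite !divr_gt0// ltr_wpDl.
have [d1 d10 k1] := h1 g (Hm_le (ltn0Sn m.+1) hg) _ e3.
have [d2 d20 k2] := IH m (leqW (ltnSn m)) hm2 _ HB _ e3.
have [d3 d30 k3] := IH m (leqW (ltnSn m)) hm2 _ gm _ e4.
exists (Num.min d1 (Num.min d2 d3)).
  by have [|] := leP d2 d3 => _; rewrite lt_min d10.
move=> h; rewrite !le_min => /andP[q1 /andP[q2 q3]].
have [s1 s2] := S_H2 h g2.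
have -> : hn m.+2 (S h g - g) = hn 1 (S h g - g) + hn m (D (D (S h g - g))) by rewrite /= addrA.
have E : D (D (S h g - g)) = (S h (Bop g) - Bop g) - mulf (cc 0%N) (S h g - g).
  have sd : Hm 1 (D (S h g)) by case: s1.
  have gd : Hm 1 (D g) by case: g2.
  rewrite DB ?DB//; [|exact: Hm1 s1|exact: Hm1 g2].
  by rewrite -s2 /Bop cc0 (mulfB _ _ bc); hring.
have hg' := (hb h g gm).1.
have [f1 f2] := Hm_md hch (HmB hg' gm).
rewrite E; apply: le_trans (lerD (k1 h q1) (hnB (HmB (hb h _ HB).1 HB) f1)) _.
apply: le_trans (lerD (lexx _) (lerD (k2 h q2) f2)) _.
have := ler_wpM2l A0 (k3 h q3).
have : A * (e / 3 / (A + 1)) <= e / 3.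
  by rewrite mulrA ler_pdivrMr ?ltr_wpDl//; nra.
rewrite -/A; lra.
Qed.
End group_regularity.
End schrodinger.

(** * Persistence of regularity *)

Section dq.
Context {R : realType}.
Local Notation H := (Hsp R).
Implicit Types (u v w f g : H) (S : R -> H -> H).

(** The supremum Y of p over P is finite by the a priori bound, and the second hypothesis at Y reads
    Y <= A + Y / 2. The resulting bound is independent of [Y0]. *)
Lemma absorb (P : set R) (p : R -> R) (A Y0 : R) : (forall t, P t -> p t <= Y0) ->
  (forall Y, (forall t, P t -> p t <= Y) -> forall t, P t -> p t <= A + Y / 2) ->
  forall t, P t -> p t <= 2 * A.
Proof.
move=> h0 h t Pt.
have hs : has_sup [set p t | t in P].
  by split; [exists (p t), t|exists Y0 => _ [s Ps <-]; exact: h0].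
have ub s : P s -> p s <= sup [set p t | t in P].
  by move=> Ps; apply: ub_le_sup; [exact: hs.2|exists s].
have := h _ ub; set Y := sup _ => h1.
have : Y <= A + Y / 2 by apply: ge_sup; [exact: hs.1|move=> _ [s Ps <-]; exact: h1].
by have := ub t Pt; rewrite -/Y; lra.
Qed.

(** Difference quotients at steps 1/(n + 1) are bounded and converge when paired with H^1. By
    density they converge weakly, and the Riesz theorem represents the limit, which is the
    derivative. *)
Lemma dq0 f (K : R) : 0 <= K -> (forall h, 0 < h <= 1 -> `|h^-1 *: (T h f - f)| <= K) ->
  exists2 g, wd f g & `|g| <= K.
Proof.
move=> K0 hK.
pose a v n : R := dot (n.+1%:R *: (T n.+1%:R^-1 f - f)) v.
have nK n : `|n.+1%:R *: (T n.+1%:R^-1 f - f)| <= K.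
  have := hK n.+1%:R^-1; rewrite invrK; apply.
  by rewrite invr_gt0 ltr0n /= invf_le1 ?ltr0n// ler1n.
have c1 v : Hm 1 v -> a v n @[n --> \oo] --> - dot f (D v).
  move=> [hv _].
  have e1 n : a v n = dot f (n.+1%:R *: (T (- n.+1%:R^-1) v - v)).
    by rewrite /a dotZl dotZr dotBl dotBr dotT.
  under eq_fun do rewrite e1.
  have -> : - dot f (D v) = dot f (- D v) by rewrite dotNr.
  have [hg] := gen_rev (@grp_T R) hv.
  apply: (@cvg_dot R _ _ _ (fun=> f)); first exact: cvg_cst.
  have cn : (fun n => n.+1%:R^-1 : R) @ \oo --> (0:R)^'.
    move=> A [d /= d0 hd]; have := near_infty_natSinv_lt (PosNum d0); apply: filterS => n /= hn.
    apply: hd => /=; last by rewrite gt_eqF// invr_gt0.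
    by rewrite sub0r normrN ger0_norm ?invr_ge0.
  have := cvg_comp _ _ cn hg; apply: cvg_trans.
  by apply: near_eq_cvg; apply: nearW => n /=; rewrite invrK.
have cau v : cvg (a v n @[n --> \oo]).
  apply: cauchy_cvg; apply: cauchy_exP => e e0.
  have e1 : 0 < e / (4 * (K + 1)) by rewrite divr_gt0// mulr_gt0// ltr_wpDl.
  have [w hw vw] := Dn_test 1 v e1.
  have e2 : 0 < e / 4 by rewrite divr_gt0.
  have /cvgrPdist_le/(_ _ e2) [N _ hN] := c1 w hw.
  exists (- dot f (D w)); exists N => // n Nn; rewrite -ball_normE /=.
  have h1 := hN n Nn.
  have h2 : `|a v n - a w n| <= e / 4.
    rewrite /a -dotBr; apply: le_trans (dot_le _ _) _.
    apply: le_trans (ler_pM (normr_ge0 _) (normr_ge0 _) (nK n) vw) _.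
    rewrite mulrA ler_pdivrMr ?mulr_gt0 ?ltr_wpDl//.
    have -> : e / 4 * (4 * (K + 1)) = e * (K + 1) by field.
    nra.
  move: h1 h2; rewrite !ler_norml ltr_norml => /andP[? ?] /andP[? ?]; apply/andP; split; lra.
pose l v := lim (a v n @[n --> \oo]).
have lc v : a v n @[n --> \oo] --> l v by exact: cau.
have [g hg] : exists w, forall v, l v = dot w v.
  apply: (@Riesz R l K) => [b u v|v].
    apply: (cvg_unique (@Rhausdorff R) (lc _)).
    have -> : a (b *: u + v) = (fun n => b * a u n + a v n).
      by apply/funext => n; rewrite /a dotDr dotZr.
    by apply: cvgD; [apply: cvgMr|]; exact: lc.
  have hc : `|a v n| @[n --> \oo] --> `|l v| by apply: cvg_norm; exact: lc.
  apply: (cvgr_to_le hc); apply: nearW => n; apply: le_trans (dot_le _ _) _.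
  by rewrite ler_wpM2r.
exists g; last first.
  apply: (dual_bound dnT K0) => v _; rewrite -hg.
  apply: (cvgr_to_le (lc v)); apply: nearW => n; apply: le_trans (dot_le' _ _) _.
  by rewrite ler_wpM2r.
have key v : Hm 1 v -> dot f (D v) = - dot g v.
  move=> hv; have := cvg_unique (@Rhausdorff R) (c1 v hv) (lc v).
  by rewrite hg => <-; rewrite opprK.
apply: (gen_core (C := @Ctest R) (@grp_T R)).
- exact: Ctest_wd.
- exact: dense_Ctest.
- by move=> b c t; exact: Ctest_T.
move=> b c /Ctest_wd hbc; rewrite -key; last by apply/HmSP; exists c.
by rewrite (DE hbc).
Qed.
Lemma dqm m f (K : R) : 0 <= K -> Hm m f -> (forall h, 0 < h <= 1 -> hn m (h^-1 *: (T h f - f)) <= K) ->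
  Hm m.+1 f /\ hn m.+1 f <= hn m f + K.
Proof.
move=> K0; elim: m f => [|m IH] f hf hK.
  have [g fg gK] := dq0 K0 hK; split; first by apply/HmSP; exists g.
  by rewrite /= (DE fg) lerD2l.
have h1 : Hm 1 f by exact: Hm1 hf.
have [h|i1 i2] := IH (D f) hf.2.
  move=> hh; apply: le_trans (hK h hh).
  rewrite [leRHS]/= DZ; last by apply: HmB => //; exact: HmT.
  by rewrite DB ?DT// ?lerDr//; exact: HmT.
split; first by split=> //; exact: hf.1.
by rewrite [leLHS]/= -/(hn m.+1 (D f)) [hn m.+1 f]/= -addrA lerD2l.
Qed.

Definition contH m (p : R -> H) := (forall t, Hm m (p t)) /\
  forall t (e : R), 0 < e -> exists2 d : R, 0 < d & forall s, `|s - t| <= d -> hn m (p s - p t) <= e.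
Lemma contH_le m n p : (m <= n)%N -> contH n p -> contH m p.
Proof.
move=> mn [h1 h2]; split=> [t|t e e0]; first exact: Hm_le mn (h1 t).
have [d d0 hd] := h2 t e e0; exists d => // s hs; apply: le_trans (hd s hs).
exact: hn_le.
Qed.
Lemma contH0 p : contH 0 p <-> continuous p.
Proof.
split=> [[_ h] t|h].
  apply/cvgrPdist_le => e e0; have [d d0 hd] := h t e e0; exists d => //= s /= hs.
  by rewrite distrC; apply: hd; rewrite distrC; exact: ltW.
split=> // t e e0; have /cvgrPdist_le/(_ _ e0) [d /= d0 hd] := h t.
exists (d / 2); first by rewrite divr_gt0.
move=> s hs; rewrite distrC; apply: hd => /=; rewrite distrC; apply: le_lt_trans hs _.
by rewrite ltr_pdivrMr// ltr_pMr// ltr1n.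
Qed.
Lemma contH_continuous m p : contH m p -> continuous p.
Proof. by move=> h; apply/contH0; exact: contH_le h. Qed.
Lemma contH_bounded m p (T0 : R) : contH m p -> exists2 B : R, 0 <= B & forall t, `|t| <= T0 -> hn m (p t) <= B.
Proof.
move=> [h1 h2]; have [T00|T00] := leP 0 T0; last first.
  by exists 0 => // t ht; have := le_lt_trans ht T00; rewrite normr_lt0.
have TT : - T0 <= T0 by lra.
have [|c _ hc] := @EVT_max R (fun t => hn m (p t)) (- T0) T0 TT.
  apply: continuous_subspaceT => t; apply/cvgrPdist_le => e e0.
  have [d d0 hd] := h2 t e e0; exists d => //= s /= hs'; have hs : `|s - t| <= d by rewrite distrC ltW.
  have k1 := hn_tri (h1 t) (h1 s); have k2 := hn_tri (h1 s) (h1 t).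
  by rewrite hnBC// in k1; have := hd s hs; rewrite ler_norml => ?; apply/andP; split; lra.
exists (hn m (p c)); first exact: hn_ge0.
by move=> t; rewrite ler_norml => ht; apply: hc.
Qed.
Lemma S_joint S (g : R -> H) : grp S -> continuous g -> continuous (fun t => S (- t) (g t)).
Proof.
move=> gS cg t; apply/cvgrPdist_le => e e0; have e2 : 0 < e / 2 by rewrite divr_gt0.
have /cvgrPdist_le/(_ _ e2) h1 := cg t.
have /cvgrPdist_le/(_ _ e2) h2 := @grp_cont R _ (grp_rev gS) (g t) t.
apply: filterS2 h1 h2 => s h1 h2.
have -> : S (- t) (g t) - S (- s) (g s) = (S (- t) (g t) - S (- s) (g t)) + S (- s) (g t - g s).
  by rewrite (grpB gS); hring.
apply: le_trans (ler_normD _ _) _; rewrite (grp_nrm gS); move: h1 h2 => /= h1 h2; lra.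
Qed.
Lemma lip_cont (p : R -> H) (A : H -> H) (C : R) : 0 <= C -> (forall u v, `|A u - A v| <= C * `|u - v|) ->
  continuous p -> continuous (fun t => A (p t)).
Proof.
move=> C0 hA cp t; apply/cvgrPdist_le => e e0.
have e1 : 0 < e / (C + 1) by rewrite divr_gt0// ltr_wpDl.
have /cvgrPdist_le/(_ _ e1) := cp t; apply: filterS => s hs.
apply: le_trans (hA _ _) _; apply: le_trans (ler_wpM2l C0 hs) _.
by rewrite mulrA ler_pdivrMr ?ltr_wpDl//; nra.
Qed.
Lemma J_cont (p : R -> H) : continuous p -> continuous (fun t => J (p t)).
Proof. by apply: (@lip_cont p (@J R) 1) => // u v; rewrite -JB nrmJ mul1r. Qed.

Lemma NL_lip m lam k (B : R) : (0 < m)%N -> 0 <= B -> exists2 L : R, 0 <= L & forall u v, Hm m u -> Hm m v ->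
  hn m u <= B -> hn m v <= B -> Hm m (NL lam k u) /\ hn m (NL lam k u - NL lam k v) <= L * hn m (u - v).
Proof.
move=> m0 B0; have [L L0 h] := @it_lip R m k B m0 B0.
exists (`|lam| * L); first by rewrite mulr_ge0.
move=> u v hu hv uB vB; have [h1 h2] := h u v hu hv uB vB; have [h3 _] := h v v hv hv vB vB.
rewrite /NL -scalerBr; split; first exact: HmZ.
rewrite hnZ; last exact: HmB.
by rewrite -mulrA ler_wpM2l.
Qed.
Lemma it0 k : it k (0 : H) = 0.
Proof.
elim: k => [//|k IH]; rewrite /it iterS -/(it k 0) IH.
exact: mulf0 (bd_mulf (@bdH0 R) (bdHcj (@bdH0 R))).
Qed.
Lemma NL0 lam k : NL lam k (0 : H) = 0.
Proof. by rewrite /NL it0 scaler0. Qed.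
Lemma NL_bound m lam k (B : R) : (0 < m)%N -> 0 <= B -> exists2 L : R, 0 <= L & forall u, Hm m u ->
  hn m u <= B -> Hm m (NL lam k u) /\ hn m (NL lam k u) <= L.
Proof.
move=> m0 B0; have [L L0 h] := NL_lip lam k m0 B0; exists (L * B); first by rewrite mulr_ge0.
move=> u hu uB; have [h1 h2] := h u 0 hu (Hm0 m) uB (eq_ind_r (fun z => z <= B) B0 (hn0 m)).
by split=> //; move: h2; rewrite NL0 !subr0 => /le_trans; apply; rewrite ler_wpM2l.
Qed.
Lemma contH_NL m lam k p : (0 < m)%N -> contH m p -> contH m (fun t => NL lam k (p t)).
Proof.
move=> m0 hp; have [h1 h2] := hp; split=> [t|t e e0].
  have [L _ h] := NL_bound lam k m0 (hn_ge0 m (p t)).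
  exact: (h _ (h1 t) (lexx _)).1.
have [d1 d10 hd1] := h2 t 1 ltr01.
have B0 : 0 <= hn m (p t) + 1 by rewrite addr_ge0 ?hn_ge0.
have [L L0 h] := NL_lip lam k m0 B0.
have e1 : 0 < e / (L + 1) by rewrite divr_gt0// ltr_wpDl.
have [d2 d20 hd2] := h2 t _ e1.
exists (Num.min d1 d2); first by have [|] := leP d1 d2.
move=> s; rewrite le_min => /andP[s1 s2].
have b1 : hn m (p s) <= hn m (p t) + 1.
  by apply: le_trans (hn_tri (h1 s) (h1 t)) _; rewrite addrC lerD2l; exact: hd1.
have b2 : hn m (p t) <= hn m (p t) + 1 by rewrite lerDl.
apply: le_trans (h _ _ (h1 s) (h1 t) b1 b2).2 _.
apply: le_trans (ler_wpM2l L0 (hd2 s s2)) _.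
by rewrite mulrA ler_pdivrMr ?ltr_wpDl//; nra.
Qed.
Lemma T_NL m lam k h u : (0 < m)%N -> Hm m u -> T h (NL lam k u) = NL lam k (T h u).
Proof.
move=> m0 hu; rewrite /NL TZ; congr (_ *: _).
have [C C0 hC] := @qq_Hm R m m0.
have bq := bd_hn m0 (hC u hu).1.
elim: k => [//|k IH]; rewrite /it !iterS -/(it k u) -/(it k (T h u)) (Tmulf _ _ bq) IH.
by congr (mulf _ _); rewrite /qq (Tmulf _ _ (bd_hn m0 hu)) Tcj.
Qed.
End dq.

(** * Gain of one derivative along the nonlinear flow *)

Section persistence.
Context {R : realType}.
Local Notation H := (Hsp R).
Implicit Types (v w f g : H).
Variables (S : R -> H -> H) (c0 : R -> R) (K : R) (lam : R) (k : nat) (u : R -> H).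
Variable (cc : nat -> R -> R[i]).
Let c := toC c0.
Hypotheses (hS : schr S c) (bc : bd K c) (cc0 : cc 0%N = c).
Hypothesis uH1 : contH 1 u.
Let N t := NL lam k (u t).
Hypothesis uD : forall v (t : R), is_derive t 1 (fun t => dot (S (- t) (u t)) v) (dot (J (S (- t) (N t))) v).
Let gS := schr_grp hS.
Local Notation B := (Bop c0).

Lemma N_cont : continuous N.
Proof. by apply: (@contH_continuous _ 1); exact: contH_NL. Qed.
Lemma z_cont : continuous (fun t => S (- t) (u t)).
Proof. by apply: S_joint gS _; exact: contH_continuous uH1. Qed.
Lemma gen_B g : Hm 2 g -> gen S g (J (B g)).
Proof. by move=> hg; apply/(schr_gen hS). Qed.
(** The interaction picture is undone by testing with the moving vector S(-t) psi, whose own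
    derivative supplies the linear term. *)
Lemma WS_u psi (t : R) : Hm 2 psi ->
  is_derive t 1 (fun t => dot (u t) psi) (dot (J (N t)) psi - dot (u t) (J (B psi))).
Proof.
move=> hp.
have hx := @gen_shift R _ (grp_rev gS) t _ _ (gen_rev gS (gen_B hp)).
have := @dot_derive R (fun t => S (- t) (u t)) (fun t => S (- t) psi) t _ _ (@z_cont t) (uD (S (- t) psi) t) hx.
under eq_fun do rewrite (grp_dot gS).
by rewrite -(schr_J hS) !(grp_dot gS) dotNr.
Qed.
Lemma S_H2' t g : Hm 2 g -> Hm 2 (S t g) /\ B (S t g) = S t (B g).
Proof. exact: (S_H2 hS). Qed.

Definition dqu (h t : R) := h^-1 *: (T h (u t) - u t).
(** The source in the linear equation satisfied by the difference quotient [dqu]: the commutator of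
    the translation with the potential plus the increment of the nonlinearity, both divided by h. *)
Definition dG (h t : R) := h^-1 *: (T h (mulf c (u t)) - mulf c (T h (u t)) + (T h (N t) - N t)).
Lemma WS_dqu h psi (t : R) : Hm 2 psi ->
  is_derive t 1 (fun t => dot (dqu h t) psi) (dot (J (dG h t)) psi - dot (dqu h t) (J (B psi))).
Proof.
move=> hp; have hp' := HmT (- h) hp.
have := is_deriveB (WS_u t hp') (WS_u t hp) => h1.
have h2 := @is_deriveZ R R R^o _ h^-1 t 1 _ h1.
have -> : (fun t => dot (dqu h t) psi) = (h^-1 \*: ((fun t => dot (u t) (T (- h) psi)) - (fun t => dot (u t) psi)) : R -> R).
  by apply/funext => s; rewrite /dqu dotZl dotBl dotT.
apply: (is_derive_eq h2).
have B1 : B (T (- h) psi) = T (- h) (B psi) - T (- h) (mulf c psi) + mulf c (T (- h) psi).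
  have p1 : Hm 1 psi by exact: Hm_le hp.
  have p2 : Hm 1 (D psi) by case: hp.
  by rewrite /Bop (DT _ p1) (DT _ p2) !TD addrK.
have XJ y : mulf c (J y) = J (mulf c y) by exact: (mulfJ y bc).
have e1 : dot (T h (mulf c (u t))) (J psi) = dot (u t) (J (mulf c (T (- h) psi))).
  by rewrite dotT (dot_mulf_real _ _ bc) TJ XJ.
have e2 : dot (mulf c (T h (u t))) (J psi) = dot (u t) (J (T (- h) (mulf c psi))).
  by rewrite (dot_mulf_real _ _ bc) XJ dotT TJ.
have e3 : dot (T h (N t)) (J psi) = dot (N t) (J (T (- h) psi)) by rewrite dotT TJ.
have e4 : dot (T h (u t)) (J (B psi)) = dot (u t) (J (T (- h) (B psi))) by rewrite dotT TJ.
rewrite B1 /dG /dqu; move: e4; move: (B psi) => Bp e4; move: e3; move: (N t) => Nt e3.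
rewrite /GRing.scale /= !dotJl !(JD, JN) !(dotZl, dotDl, dotDr, dotNr, dotNl) e1 e2 e3 e4.
by gen_dots; ring.
Qed.

Lemma dG_cont h : continuous (dG h).
Proof.
have cu : continuous u := contH_continuous uH1.
have K0 := bd_ge0 bc.
have cX (p : R -> H) : continuous p -> continuous (fun t => mulf c (p t)).
  by apply: (@lip_cont R p (mulf c) K) => // x y; rewrite -(mulfB _ _ bc); exact: mulf_le.
have cT (p : R -> H) : continuous p -> continuous (fun t => T h (p t)).
  by apply: (@lip_cont R p (T h) 1) => // x y; rewrite -TB nrmT mul1r.
have cB (p q : R -> H) : continuous p -> continuous q -> continuous (fun t => p t - q t).
  by move=> hp hq t; apply: cvgB; [exact: hp|exact: hq].
apply: (@lip_cont R (fun t => T h (mulf c (u t)) - mulf c (T h (u t)) + (T h (N t) - N t)) (fun x => h^-1 *: x) `|h^-1|) => //.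
  by move=> x y; rewrite -scalerBr normrZ.
move=> t; apply: cvgD.
  by apply: cB; [apply: cT; exact: cX|apply: cX; exact: cT].
by apply: cB; [apply: cT; exact: N_cont|exact: N_cont].
Qed.
Definition dy h t := S (- t) (dqu h t).
Lemma dqu_cont h : continuous (dqu h).
Proof.
have cu : continuous u := contH_continuous uH1.
apply: (@lip_cont R u (fun x => h^-1 *: (T h x - x)) (`|h^-1| * 2)) => //.
move=> x y; rewrite -scalerBr normrZ -mulrA ler_wpM2l//.
have -> : T h x - x - (T h y - y) = T h (x - y) - (x - y) by rewrite TB; hring.
by apply: le_trans (ler_normB _ _) _; rewrite nrmT mulrDl mul1r.
Qed.
Lemma dy_D h v (t : R) : is_derive t 1 (fun t => dot (dy h t) v) (dot (J (S (- t) (dG h t))) v).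
Proof.
apply: (@weak_extend R [set a | Hm 2 a] (dy h) (fun t => J (S (- t) (dG h t))) (Dn_test 2)).
  by apply: J_cont; apply: S_joint gS _; exact: dG_cont.
move=> {}v {}t hv; have [s1 s2] := S_H2' t hv.
have hx := @gen_shift R _ gS t _ _ (gen_B hv).
have := @dot_derive R (dqu h) (fun t => S t v) t _ _ (@dqu_cont h t) (WS_dqu h t s1) hx.
have E : (fun s => dot (dqu h s) (S s v)) = (fun s => dot (dy h s) v).
  by apply/funext => s; rewrite /dy (grp_adj gS) opprK.
rewrite E; congr (is_derive _ _ _ _).
rewrite s2 -(schr_J hS) subrK -(schr_J hS) (grp_adj gS) opprK //.
Qed.

Variable m : nat.
Hypotheses (m0 : (0 < m)%N) (hch : chain m.+1 cc K) (um : contH m u) (u0 : Hm m.+1 (u 0)).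
Let chm : chain m.-2 cc K.
Proof. by case: hch => a b; split=> j jm; [apply: a; lia|apply: b; lia]. Qed.
Let chm1 : chain m.+1.-2 cc K.
Proof. by case: hch => a b; split=> j jm; [apply: a; lia|apply: b; lia]. Qed.
Let chm0 : chain m cc K.
Proof. by case: hch => a b; split=> j jm; [apply: a; lia|apply: b; lia]. Qed.

Lemma dqu_Hm h t : Hm m (dqu h t).
Proof. by apply: HmZ; apply: HmB; [apply: HmT|]; exact: um.1. Qed.
(** The point is uniformity in h. On a time window of length [de] the Duhamel estimate closes by
    absorption, since the source is affine in the norm of the quotient; finitely many windows
    counted from time 0 cover [-T0, T0]. *)
Lemma dy_bound (T0 : R) : 0 <= T0 -> exists2 M : R, 0 <= M & forall h t, 0 < h <= 1 -> `|t| <= T0 -> hn m (dy h t) <= M.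
Proof.
move=> T00; have [Bd B0 hB] := contH_bounded T0 um.
have [C C0 hC] := S_Hm hS bc cc0 chm.
have [L L0 hL] := NL_lip lam k m0 B0.
pose a := m.+1%:R * (2 ^+ m * K * Bd).
have a0 : 0 <= a by rewrite !mulr_ge0 ?exprn_ge0// (bd_ge0 bc).
pose q := m.+1%:R * C * L * C.
have q0 : 0 <= q by rewrite !mulr_ge0.
(* The window length for which the feedback term [q * de * Y] is at most Y / 2. *)
pose de := (2 * (q + 1))^-1.
have de0 : 0 < de by rewrite invr_gt0 mulr_gt0// ltr_wpDl.
have dyH h t : Hm m (dy h t) by apply: (hC _ _ (dqu_Hm h t)).1.
(* The commutator is bounded by [comm_md] and the nonlinear increment by the local Lipschitz
   estimate. *)
have dGb h t : 0 < h -> `|t| <= T0 -> Hm m (dG h t) /\ hn m (dG h t) <= a + L * hn m (dqu h t).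
  move=> h0 ht; have ut := um.1 t; have uT := HmT h ut.
  have b1 := hB t ht; have b2 : hn m (T h (u t)) <= Bd by rewrite hnT.
  have [n1 n2] := hL _ _ uT ut b2 b1; have [n3 _] := hL _ _ ut ut b1 b1.
  have [m1 _] := Hm_md chm0 ut; have [m2 _] := Hm_md chm0 uT.
  have := comm_md m0 hch uT (ltW h0); rewrite TT addNr (grp_0 (@grp_T R)) => q1.
  have E : dG h t = h^-1 *: (T h (mulf (cc 0%N) (u t)) - mulf (cc 0%N) (T h (u t))) + h^-1 *: (NL lam k (T h (u t)) - NL lam k (u t)).
    by rewrite /dG /N (T_NL _ _ _ m0 ut) cc0 scalerDr.
  have H1 := HmB (HmT h m1) m2; have H2 := HmB n1 n3.
  rewrite E; split; first by apply: HmD; exact: HmZ.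
  apply: le_trans (hnD (HmZ _ H1) (HmZ _ H2)) _; rewrite (hnZ _ H1) (hnZ _ H2).
  rewrite gtr0_norm ?invr_gt0//; apply: lerD.
    rewrite ler_pdivrMl//; apply: le_trans q1 _; rewrite (hnT _ ut).
    have -> : h * a = m.+1%:R * (2 ^+ m * K * Bd * h) by rewrite /a; ring.
    by rewrite ler_wpM2l// ler_wpM2r ?(ltW h0)// ler_wpM2l// mulr_ge0 ?exprn_ge0// (bd_ge0 bc).
  rewrite ler_pdivrMl//; apply: le_trans n2 _.
  rewrite /dqu hnZ; last exact: HmB.
  by rewrite gtr0_norm ?invr_gt0// mulrCA mulVKf// gt_eqF.
have dqy h t : hn m (dqu h t) <= C * hn m (dy h t).
  by have := (hC t _ (dyH h t)).2; rewrite /dy (grpK' gS).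
have step h e t : 0 < h <= 1 -> `|e| <= T0 -> `|t| <= T0 -> `|t - e| <= de ->
    hn m (dy h t) <= 2 * (hn m (dy h e) + m.+1%:R * C * a * de).
  move=> /andP[h0 h1] he ht hte.
  apply: (@absorb R [set t | `|t| <= T0 /\ `|t - e| <= de] (fun t => hn m (dy h t)) _ (C * (h^-1 * (2 * Bd)))) => //.
    move=> s [hs _]; apply: le_trans (hC _ _ (dqu_Hm h s)).2 _; rewrite ler_wpM2l//.
    rewrite /dqu hnZ; last by apply: HmB; [apply: HmT|]; exact: um.1.
    rewrite gtr0_norm ?invr_gt0// ler_wpM2l ?invr_ge0 ?(ltW h0)//.
    apply: le_trans (hnB (HmT h (um.1 s)) (um.1 s)) _; rewrite (hnT _ (um.1 s)).
    have := hB s hs; lra.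
  move=> Y hY s [hs hse].
  have Y0 : 0 <= Y by apply: le_trans (hY t _); [exact: hn_ge0|split].
  pose M := C * (a + L * (C * Y)).
  have M0 : 0 <= M by rewrite !mulr_ge0// addr_ge0// !mulr_ge0.
  have mv x y : x <= y -> `|x| <= T0 -> `|y| <= T0 -> `|x - e| <= de -> `|y - e| <= de ->
     hn m (dy h y - dy h x) <= m.+1%:R * (M * (y - x)).
    move=> xy xT yT xe ye; apply: hn_bound => j jm; rewrite mulrBr.
    have btw (w : R) : x <= w <= y -> `|w| <= T0 /\ `|w - e| <= de.
      move: xT yT xe ye; rewrite !ler_norml => /andP[? ?] /andP[? ?] /andP[? ?] /andP[? ?] /andP[? ?].
      by split; apply/andP; split; lra.
    apply: (@mv_Dn R j (dy h) (fun t => J (S (- t) (dG h t))) (fun s => M * s) (fun=> M) x y xy).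
    - by move=> v w _; exact: dy_D.
    - by move=> w _; apply: Hm_le jm _.
    - by move=> w /btw[w1 w2]; apply: Hm_le jm _; apply: HmJ; apply: (hC _ _ (dGb h w h0 w1).1).1.
    - by move=> w _; exact: is_derive_lin.
    move=> w /btw[w1 w2]; have [g1 g2] := dGb h w h0 w1; have [g3 g4] := hC (- w) _ g1.
    apply: le_trans (Dn_hn _ jm) _; rewrite (hnJ g3); apply: le_trans g4 _.
    rewrite ler_wpM2l//; apply: le_trans g2 _; rewrite lerD2l ler_wpM2l//.
    by apply: le_trans (dqy _ _) _; rewrite ler_wpM2l// hY.
  have ee : `|e - e| <= de by rewrite subrr normr0 ltW.
  have bnd : hn m (dy h s - dy h e) <= m.+1%:R * (M * de).
    have [es|se] := leP e s.
      apply: le_trans (mv _ _ es he hs ee hse) _; rewrite !ler_wpM2l//.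
      by rewrite -(ger0_norm (_ : 0 <= s - e))// subr_ge0.
    rewrite hnBC//; apply: le_trans (mv _ _ (ltW se) hs he hse ee) _; rewrite !ler_wpM2l//.
    by rewrite -(ger0_norm (_ : 0 <= e - s)) 1?distrC// subr_ge0 ltW.
  apply: le_trans (hn_tri (dyH h s) (dyH h e)) _; apply: le_trans (lerD bnd (lexx _)) _.
  have -> : m.+1%:R * (M * de) = m.+1%:R * C * a * de + q * de * Y by rewrite /M /q; ring.
  have : q * de * Y <= 2^-1 * Y.
    rewrite ler_wpM2r// /de ler_pdivrMr ?mulr_gt0 ?ltr_wpDl//.
    have -> : 2^-1 * (2 * (q + 1)) = q + 1 by field.
    by rewrite lerDl.
  lra.
(* At time 0 the quotient is controlled by the additional derivative of the datum, uniformly in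
   h. *)
have [M00 M00' hM0] : exists2 M0 : R, 0 <= M0 & forall h, 0 < h <= 1 -> hn m (dy h 0) <= M0.
  exists (hn m.+1 (u 0)); first exact: hn_ge0.
  move=> h /andP[h0 h1]; rewrite /dy oppr0 (grp_0 gS).
  have lem n f : Hm n.+1 f -> hn n (h^-1 *: (T h f - f)) <= hn n (D f).
    have b0 (g : H) : Hm 1 g -> `|h^-1 *: (T h g - g)| <= `|D g|.
      move=> [hg _]; rewrite normrZ gtr0_norm ?invr_gt0// ler_pdivrMl//.
      have h1' v (t : R) : setT v -> 0 <= t <= h ->
        is_derive t 1 (fun s => dot (T s g) v) (dot (T t (D g)) v) by move=> _ _; exact: wd_dotT.
      have h2 (t : R) : 0 <= t <= h -> is_derive t 1 (fun s : R => `|D g| * s) `|D g| by move=> _; exact: is_derive_lin.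
      have := weak_mv dnT (ltW h0) h1' h2; rewrite (grp_0 (@grp_T R)) mulr0 subr0 mulrC; apply=> t _.
      by rewrite nrmT.
    elim: n f => [|n IH] f hf; first by exact: b0.
    have f1 : Hm 1 f by exact: Hm1 hf.
    rewrite [leLHS]/= DZ; last by apply: HmB => //; exact: HmT.
    rewrite DB//; last exact: HmT.
    by rewrite DT// [leRHS]/= lerD//; [exact: b0|apply: IH; exact: hf.2].
  by apply: le_trans (lem _ _ u0) _; rewrite /= lerDr.
have ind n : exists2 M : R, 0 <= M & forall h t, 0 < h <= 1 -> `|t| <= T0 -> `|t| <= n%:R * de -> hn m (dy h t) <= M.
  elim: n => [|n [M M0 IH]].
    exists M00 => // h t hh _; rewrite mul0r normr_le0 => /eqP ->; exact: hM0.
  exists (2 * (M + m.+1%:R * C * a * de)).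
    have de0' := ltW de0.
    by apply: mulr_ge0 => //; apply: addr_ge0 => //; apply: mulr_ge0 => //; apply: mulr_ge0 => //; apply: mulr_ge0.
  (* This intermediate time lies in the range already treated, within distance [de] of [t]. *)
  move=> h t hh tT tn; pose e := t * (n%:R / n.+1%:R).
  have n1 : 0 < n.+1%:R :> R by [].
  have nn0 : 0 <= n%:R / n.+1%:R :> R by exact: divr_ge0.
  have nn1 : n%:R / n.+1%:R <= 1 :> R by rewrite ler_pdivrMr// mul1r ler_nat.
  have eE : `|e| = `|t| * (n%:R / n.+1%:R) by rewrite normrM [`|n%:R / _|]ger0_norm.
  have eT : `|e| <= T0.
    rewrite eE; apply: le_trans tT; by rewrite ler_piMr.
  have en : `|e| <= n%:R * de.
    rewrite eE mulrA ler_pdivrMr//; move: tn; have : 0 <= n%:R :> R by [].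
    move=> x0 x1; have := ler_wpM2l x0 x1; rewrite mulrC; lra.
  have te : `|t - e| <= de.
    have -> : t - e = t / n.+1%:R.
      rewrite /e; have -> : n%:R = n.+1%:R - 1 :> R by rewrite -addn1 natrD addrK.
      by field; rewrite gt_eqF.
    rewrite normrM [`|_^-1|]ger0_norm ?invr_ge0// ler_pdivrMr// mulrC //.
  apply: le_trans (step h e t hh eT tT te) _; rewrite ler_pM2l// lerD2r.
  exact: IH.
pose n := (Num.truncn (T0 / de)).+1.
have [M M0 hM] := ind n; exists M => // h t hh ht; apply: hM => //.
apply: le_trans ht _; rewrite -ler_pdivrMr//; exact: ltW (truncnS_gt _).
Qed.

(** Bounded difference quotients give the extra derivative. Continuity in H^(m+1) then comes from
    the Lipschitz bound on S(-t) u(t) and the strong continuity of the group in that norm. *)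
Lemma persist : contH m.+1 u.
Proof.
have [C C0 hC] := S_Hm hS bc cc0 chm.
have [C1 C10 hC1] := S_Hm hS bc cc0 chm1.
have bnd (T0 : R) : 0 <= T0 -> exists2 B : R, 0 <= B & forall t, `|t| <= T0 -> Hm m.+1 (u t) /\ hn m.+1 (u t) <= B.
  move=> T00; have [M M0 hM] := dy_bound T00; have [B0 B00 hB] := contH_bounded T0 um.
  exists (B0 + C * M); first by rewrite addr_ge0// mulr_ge0.
  move=> t ht; have [|||h1 h2] := @dqm R m (u t) (C * M); [by rewrite mulr_ge0|exact: um.1| |].
    move=> h hh; have := (hC t _ (hC (- t) _ (dqu_Hm h t)).1).2.
    rewrite (grpK' gS) => /le_trans; apply; rewrite ler_wpM2l//; exact: hM.
  by split=> //; apply: le_trans h2 _; rewrite lerD2r hB.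
have uH t : Hm m.+1 (u t) by have [B0 _ h] := bnd _ (normr_ge0 t); exact: (h t (lexx _)).1.
split=> // t e e0.
pose T0 := `|t| + 1.
have T00 : 0 <= T0 by rewrite addr_ge0.
have [B0 B00 hB] := bnd T0 T00.
have [L L0 hL] := NL_bound lam k (ltn0Sn m) B00.
pose z t := S (- t) (u t).
have zH t' : Hm m.+1 (z t') by exact: (hC1 _ _ (uH t')).1.
have lip x y : x <= y -> `|x| <= T0 -> `|y| <= T0 -> hn m.+1 (z y - z x) <= m.+2%:R * (C1 * L * (y - x)).
  move=> xy xT yT; apply: hn_bound => j jm; rewrite mulrBr.
  have btw (w : R) : x <= w <= y -> `|w| <= T0.
    move: xT yT; rewrite !ler_norml => /andP[? ?] /andP[? ?] /andP[? ?]; apply/andP; split; lra.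
  apply: (@mv_Dn R j z (fun t => J (S (- t) (N t))) (fun s => C1 * L * s) (fun=> C1 * L) x y xy).
  - by move=> w _; apply: Hm_le jm _.
  - by move=> w /btw w1; apply: Hm_le jm _; apply: HmJ; apply: (hC1 _ _ (hL _ (uH w) (hB w w1).2).1).1.
  - by move=> w _; exact: is_derive_lin.
  move=> w /btw w1; have [g1 g2] := hL _ (uH w) (hB w w1).2; have [g3 g4] := hC1 (- w) _ g1.
  apply: le_trans (Dn_hn _ jm) _; rewrite (hnJ g3); apply: le_trans g4 _.
  by rewrite ler_wpM2l.
have e2 : 0 < e / 2 by rewrite divr_gt0.
pose A := C1 * (m.+2%:R * (C1 * L)).
have A0 : 0 <= A by rewrite !mulr_ge0.
have e3 : 0 < e / 2 / (A + 1) by rewrite !divr_gt0// ltr_wpDl.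
have [d d0 hd] := S_Hm_cont hS bc cc0 chm1 (uH t) e2.
exists (Num.min 1 (Num.min d (e / 2 / (A + 1)))).
  by have [_|_] := leP d (e / 2 / (A + 1)); rewrite lt_min ltr01.
move=> s; rewrite !le_min => /andP[s1 /andP[s2 s3]].
have tT : `|t| <= T0 by rewrite lerDl.
have sT : `|s| <= T0.
  have h3 : `|s| <= `|s - t| + `|t| by rewrite -{1}(subrK t s) ler_normD.
  by apply: le_trans h3 _; rewrite /T0 addrC lerD2l.
have zz : hn m.+1 (z s - z t) <= m.+2%:R * (C1 * L * `|s - t|).
  have [ts|st] := leP t s.
    by rewrite ger0_norm ?subr_ge0//; exact: lip.
  have -> : `|s - t| = t - s by rewrite distrC ger0_norm// subr_ge0 ltW.
  by rewrite hnBC//; apply: lip => //; exact: ltW.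
have E : u s - u t = S s (z s - z t) + (S (s - t) (u t) - u t).
  by rewrite (grpB gS) /z (grpK' gS) (grp_add gS) addrA subrK.
have [g1 g2] := hC1 s _ (HmB (zH s) (zH t)).
rewrite E; apply: le_trans (hnD g1 (HmB (hC1 _ _ (uH t)).1 (uH t))) _.
apply: le_trans (lerD g2 (hd _ s2)) _.
apply: le_trans (lerD (ler_wpM2l C10 zz) (lexx _)) _.
have -> : C1 * (m.+2%:R * (C1 * L * `|s - t|)) = A * `|s - t| by rewrite /A; ring.
have := ler_wpM2l A0 s3.
have : A * (e / 2 / (A + 1)) <= e / 2.
  by rewrite mulrA ler_pdivrMr ?ltr_wpDl//; nra.
lra.
Qed.
End persistence.
Lemma persistence_Hs (R : realType) (S : R -> Hsp R -> Hsp R) (c0 : R -> R) (K lam : R) k (u : R -> Hsp R) (cc : nat -> R -> R[i]) s :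
  schr S (toC c0) -> bd K (toC c0) -> cc 0%N = toC c0 -> contH 1 u ->
  (forall v (t : R), is_derive t 1 (fun t => dot (S (- t) (u t)) v) (dot (J (S (- t) (NL lam k (u t)))) v)) ->
  (0 < s)%N -> chain s cc K -> Hm s (u 0) -> contH s u.
Proof.
move=> hS bc e u1 uD; case: s => // s _ hch hu.
suff : forall m, (m <= s)%N -> contH m.+1 u by apply.
elim=> [//|m IH] ms; apply: (persist hS bc e u1 uD) => //.
- by case: hch => a b; split=> j jm; [apply: a; lia|apply: b; lia].
- by apply: IH; exact: ltnW.
- by apply: Hm_le hu.
Qed.

(** * Uniform bounds from the decay hypothesis *)

Section graded.
Context {R : realType}.
Local Notation H := (Hsp R).
Implicit Types (u v w f g : H).

(** The sup norm of D^j f is at most a b^j for j <= m: a scale in which each derivative costs a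
    factor b, and which is stable under products. *)
Fixpoint Gs (m : nat) (b a : R) f : Prop :=
  if m is m'.+1 then [/\ bd a f, wd f (D f) & Gs m' b (a * b) (D f)] else bd a f.
Lemma Gs_bd m b a f : Gs m b a f -> bd a f.
Proof. by case: m => [|m] //= []. Qed.
Lemma Gs_S m b a f : Gs m.+1 b a f -> Gs m b a f.
Proof.
elim: m a f => [|m IH] a f; first by case.
by move=> [h1 h2 h3]; split=> //; exact: IH.
Qed.
Lemma Gs_add m b a a' f g : Gs m b a f -> Gs m b a' g -> Gs m b (a + a') (f + g).
Proof.
elim: m a a' f g => [|m IH] a a' f g; first exact: bdHD.
move=> [h1 h2 h3] [k1 k2 k3]; have w := wd_D h2 k2; split; [exact: bdHD|by rewrite (DE w)|].
by rewrite (DE w) mulrDl; exact: IH.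
Qed.
Lemma Gs_cj m b a f : Gs m b a f -> Gs m b a (cj f).
Proof.
elim: m a f => [|m IH] a f; first exact: bdHcj.
move=> [h1 h2 h3]; have w := wd_cj h2; split; [exact: bdHcj|by rewrite (DE w)|].
by rewrite (DE w); exact: IH.
Qed.
Lemma Gs_mul m b a a' f g : 0 <= b -> Gs m b a f -> Gs m b a' g -> Gs m b (2 ^+ m * (a * a')) (mulf f g).
Proof.
move=> b0; elim: m a a' f g => [|m IH] a a' f g.
  by rewrite expr0 mul1r; exact: bd_mulf.
move=> [h1 h2 h3] [k1 k2 k3]; have w := wd_mulf h2 k2.
have aa : 0 <= a * a' by rewrite mulr_ge0 ?(bd_ge0 h1) ?(bd_ge0 k1).
split; [|by rewrite (DE w)|].
  by apply: bd_le (bd_mulf h1 k1); rewrite ler_peMl// exprn_ege1// ler1n.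
rewrite (DE w) (_ : 2 ^+ m.+1 * (a * a') * b = 2 ^+ m * (a * b * a') + 2 ^+ m * (a * (a' * b))).
  apply: Gs_add; apply: IH => //; [exact: (@Gs_S m b a' g)|exact: (@Gs_S m b a f)].
by rewrite exprS; ring.
Qed.
(** A mixed Leibniz estimate: [f] is measured in the scale of [Gs], [g] in L^2, and only the top
    derivative of [g] carries the possibly large bound N. *)
Lemma mulL m b a (C0 N : R) f g : 1 <= b -> 0 <= C0 -> 0 <= N -> Gs m b a f -> Hm m g ->
  (forall i, (i < m)%N -> `|Dn i g| <= C0) -> `|Dn m g| <= N ->
  Hm m (mulf f g) /\ `|Dn m (mulf f g)| <= 4 ^+ m * a * (C0 * b ^+ m + N).
Proof.
move=> b1 C00; have b0 : 0 <= b by lra.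
elim: m a N f g => [|m IH] a N f g N0 hf hg hl hN.
  split=> //; apply: le_trans (mulf_le _ hf) _; rewrite expr0 mul1r mulr1 ler_wpM2l ?(bd_ge0 hf)//.
  by apply: le_trans hN _; rewrite lerDr.
have hfS := Gs_S hf; have [h1 h2 h3] := hf; have a0 := bd_ge0 h1.
have w := wd_mulf h2 hg.1.
have [p1 p2] := IH _ C0 _ g C00 h3 (Hm_S hg) (fun i im => hl i (ltnW im)) (hl m (ltnSn m)).
have [||q1 q2] := IH _ N _ (D g) N0 hfS hg.2; [by move=> i im; rewrite -DnS; exact: hl|by rewrite -DnS|].
split; first by apply/HmSP; exists (mulf (D f) g + mulf f (D g)) => //; exact: HmD.
rewrite DnS (DE w) -[mulf (D f) g]scale1r (Dn_lin _ (leqnn m))// scale1r.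
apply: le_trans (ler_normD _ _) _; apply: le_trans (lerD p2 q2) _.
have k0 : 0 <= 4 ^+ m * a by rewrite mulr_ge0// exprn_ge0.
have bm : 1 <= b ^+ m by rewrite exprn_ege1.
have e1 : b * (C0 * b ^+ m + C0) <= 2 * (C0 * b ^+ m.+1).
  have : b * C0 <= C0 * b ^+ m.+1.
    by rewrite exprS (mulrC b C0) ler_wpM2l// ler_peMr// ltW//; lra.
  by rewrite exprS; lra.
have e2 : C0 * b ^+ m + N <= C0 * b ^+ m.+1 + N.
  by rewrite lerD2r ler_wpM2l// exprS ler_peMl// exprn_ge0.
have e3 := ler_wpM2l k0 e1; have e4 := ler_wpM2l k0 e2.
have e5 : 0 <= 4 ^+ m * a * (C0 * b ^+ m.+1) by rewrite !mulr_ge0 ?exprn_ge0.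
have e6 : 0 <= 4 ^+ m * a * N by rewrite !mulr_ge0 ?exprn_ge0.
rewrite (exprS 4); lra.
Qed.

Lemma it_Gs m k : exists2 c : R, 0 <= c & forall b a u, 1 <= b -> Gs m b a u -> Gs m b (c * a ^+ (2 * k).+1) (it k u).
Proof.
elim: k => [|k [c c0 IH]]; first by exists 1 => // b a u _; rewrite muln0 expr1 mul1r.
exists (2 ^+ m * (2 ^+ m * c)); first by rewrite !mulr_ge0 ?exprn_ge0.
move=> b a u b1 hu; have b0 : 0 <= b by lra.
have := Gs_mul b0 (Gs_mul b0 hu (Gs_cj hu)) (IH b a u b1 hu).
rewrite /it iterS; congr (Gs _ _ _ _).
by rewrite mulnS !add2n -[(2 * k).+3]/(2 + (2 * k).+1)%N exprD; ring.
Qed.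
(** One derivative falls on a factor [u] or [cj u], or is passed to the smaller power. Isolating it
    leaves one factor to be measured in L^2 while the others are measured in the sup norm. *)
Lemma D_it k u : Hm 1 u -> Hm 1 (it k.+1 u) /\
  D (it k.+1 u) = mulf (mulf (it k u) (cj u)) (D u) + mulf (mulf (it k u) u) (cj (D u)) + mulf (qq u) (D (it k u)).
Proof.
move=> hu; have bu := bd_hn (ltn0Sn 0) hu; have hc := Hmcj hu; have bcj := bd_hn (ltn0Sn 0) hc.
have wq := wd_mulf hu.1 hc.1.
have Hq : Hm 1 (qq u) by apply/HmSP; exists (mulf (D u) (cj u) + mulf u (D (cj u))).
have Hk : Hm 1 (it k u).
  elim: k => [//|k IH]; rewrite /it iterS; apply/HmSP.
  by exists (mulf (D (qq u)) (it k u) + mulf (qq u) (D (it k u))) => //; exact: wd_mulf Hq.1 IH.1.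
have bk := bd_hn (ltn0Sn 0) Hk.
have w := wd_mulf Hq.1 Hk.1.
split; first by apply/HmSP; exists (mulf (D (qq u)) (it k u) + mulf (qq u) (D (it k u))).
rewrite /it iterS (DE w) (DE wq) -/(it k u) (Dcj hu); congr (_ + _).
rewrite mulfC (mulfD _ _ bk) (mulfC (D u)) (mulfA _ bk bcj) (mulfA _ bk bu) //.
Qed.
(** The prefactor [P] collects the factors |u|^2 split off at each step, which is what the induction
    on k requires. *)
Lemma D_it_bound m k : exists2 c : R, 0 <= c & forall b a aP (C0 N : R) P u, 1 <= b -> 0 <= C0 -> 0 <= N ->
  Gs m b aP P -> Gs m b a u -> Hm m.+1 u -> (forall i, (i < m)%N -> `|Dn i (D u)| <= C0) -> `|Dn m (D u)| <= N ->
  Hm m (mulf P (D (it k u))) /\ `|Dn m (mulf P (D (it k u)))| <= c * aP * a ^+ (2 * k) * (C0 * b ^+ m + N).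
Proof.
elim: k => [|k [c c0 IH]].
  exists (4 ^+ m); first by rewrite exprn_ge0.
  move=> b a aP C0 N P u b1 C00 N0 hP hu hD h1 h2; rewrite muln0 expr0 mulr1.
  exact: (mulL b1 C00 N0 hP hD.2 h1 h2).
have [ck ck0 hk] := it_Gs m k.
pose M := 2 ^+ m * 2 ^+ m * ck * 4 ^+ m * 2 + c * 2 ^+ m * 2 ^+ m.
exists M; first by rewrite addr_ge0// !mulr_ge0 ?exprn_ge0.
move=> b a aP C0 N P u b1 C00 N0 hP hu hD h1 h2.
have b0 : 0 <= b by lra.
have u1 : Hm 1 u by exact: Hm1 hD.
have hc := Gs_cj hu; have hi := hk b a u b1 hu.
have g1 := Gs_mul b0 hP (Gs_mul b0 hi hc); have g2 := Gs_mul b0 hP (Gs_mul b0 hi hu).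
have g3 := Gs_mul b0 hP (Gs_mul b0 hu hc).
have bP := Gs_bd hP; have bu := Gs_bd hu; have bcj := Gs_bd hc; have bi := Gs_bd hi.
have [r1 r2] := mulL b1 C00 N0 g1 hD.2 h1 h2.
have cD : Hm m (cj (D u)) by apply: Hmcj; exact: hD.2.
have Dcjn i f : Hm i f -> `|Dn i (cj f)| = `|Dn i f|.
  elim: i f => [|i IHi] f hf; first by rewrite /= nrmcj.
  by rewrite !DnS Dcj ?IHi//; [exact: hf.2|exact: Hm1 hf].
have [||s1 s2] := mulL b1 C00 N0 g2 cD.
- by move=> i im; rewrite Dcjn; [exact: h1|exact: Hm_le (ltnW im) hD.2].
- by rewrite Dcjn//; exact: hD.2.
have [t1 t2] := IH b a _ C0 N _ u b1 C00 N0 g3 hu hD h1 h2.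
have E : mulf P (D (it k.+1 u)) = mulf (mulf P (mulf (it k u) (cj u))) (D u) + mulf (mulf P (mulf (it k u) u)) (cj (D u))
   + mulf (mulf P (mulf u (cj u))) (D (it k u)).
  rewrite (D_it k u1).2 !(mulfD _ _ bP) (mulfA _ bP (bd_mulf bi bcj)) (mulfA _ bP (bd_mulf bi bu)).
  by rewrite (mulfA _ bP (bd_mulf bu bcj)).
rewrite E; split; first by apply: HmD => //; exact: HmD.
rewrite -[_ + mulf _ (cj _)]scale1r (Dn_lin _ (leqnn m))//; last exact: HmD.
rewrite scale1r -[mulf _ (D u)]scale1r (Dn_lin _ (leqnn m))// scale1r.
apply: le_trans (ler_normD _ _) _; apply: le_trans (lerD (ler_normD _ _) (lexx _)) _.
apply: le_trans (lerD (lerD r2 s2) t2) _; rewrite le_eqVlt; apply/orP; left; apply/eqP.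
have -> : a ^+ (2 * k.+1) = a ^+ (2 * k) * a ^+ 2 by rewrite -exprD mulnS addnC.
by rewrite /M exprS; ring.
Qed.

(** The sup norm analogue of [absorb]: iteration from any finite bound halves the excess over 2 X,
    and finitely many steps bring that excess below X. *)
Lemma bd_absorb f (X Y0 : R) : 0 < X -> bd Y0 f -> (forall Y, bd Y f -> bd (X + Y / 2) f) -> bd (3 * X) f.
Proof.
move=> X0 h0 h; have Y00 := bd_ge0 h0.
have hn n : bd (2 * X + Y0 * 2^-1 ^+ n) f.
  elim: n => [|n IH]; first by apply: bd_le h0; rewrite expr0 mulr1 lerDr mulr_ge0// ltW.
  by apply: bd_le (h _ IH); rewrite exprS; lra.
have e0 : 0 < X / (Y0 + 1) by rewrite divr_gt0// ltr_wpDl.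
have [n en] := expn_small e0; apply: bd_le (hn n).
have := ler_wpM2l Y00 en.
have : Y0 * (X / (Y0 + 1)) <= X by rewrite mulrA ler_pdivrMr ?ltr_wpDl//; nra.
lra.
Qed.
(** Intermediate derivatives are interpolated in the sup norm at a free scale b. In the induction
    the derivative just below the top is bounded in terms of itself by Landau's inequality, and
    absorbed. *)
Lemma landau_chain m : exists2 C : R, 1 <= C & forall b a d f, 0 < b -> 0 < a -> Hm m.+1 f -> bd a f -> bd d (Dn m f) ->
  forall j, (j <= m)%N -> bd (C * (a + d / b ^+ m) * b ^+ j) (Dn j f).
Proof.
elim: m => [|m [C C1 IH]].
  exists 1 => // b a d f b0 a0 _ ha hd j; rewrite leqn0 => /eqP ->.
  by apply: bd_le ha; rewrite !expr0 mulr1 mul1r divr1 lerDl (bd_ge0 hd).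
have C0 : 0 <= C by lra.
exists (C * (12 * C) + 3 * C) => [|b a d f b0 a0 hf ha hd j]; first by nra.
have d0 := bd_ge0 hd; have bm : 0 < b ^+ m.+1 by rewrite exprn_gt0.
have [X1 X1E] : exists X1, X1 = a + d / b ^+ m.+1 by eexists.
rewrite -X1E.
have X10 : 0 < X1 by rewrite X1E ltr_wpDr// divr_ge0// ltW.
rewrite leq_eqVlt => /orP[/eqP ->|].
  apply: bd_le hd; apply: le_trans (_ : X1 * b ^+ m.+1 <= _).
    by rewrite X1E mulrDl divfK ?gt_eqF// lerDr mulr_ge0// ltW.
  by rewrite ler_wpM2r ?(ltW bm)// ler_peMl ?(ltW X10)//; nra.
case: m IH hf hd bm X1E => [|m] IH hf hd bm X1E.
  rewrite ltnS leqn0 => /eqP ->; apply: bd_le ha; rewrite expr0 mulr1.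
  apply: le_trans (_ : X1 <= _); first by rewrite X1E lerDl divr_ge0// ltW.
  by rewrite ler_peMl ?(ltW X10)//; nra.
have bmm : 0 < b ^+ m.+1 by rewrite exprn_gt0.
have hS : Hm m.+2 f by exact: Hm_S.
have w1 : wd (Dn m f) (Dn m.+1 f) by apply: Hm_wd hf; lia.
have w2 : wd (Dn m.+1 f) (Dn m.+2 f) by apply: Hm_wd hf; lia.
pose X := a * b ^+ m.+1 / 2 + 4 * C * d / b.
have X0 : 0 < X by rewrite ltr_pwDl// ?divr_gt0 ?mulr_gt0// divr_ge0 ?mulr_ge0// ltW.
have hb : bd (3 * X) (Dn m.+1 f).
  apply: (bd_absorb X0 (bd_sup w2)) => Y hY.
  (* The step 4 C / b in Landau's inequality produces exactly the Y / 2 that [bd_absorb] expects. *)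
  have h0 : 0 < 4 * C / b by rewrite divr_gt0// mulr_gt0//; lra.
  apply: bd_le (landau w1 w2 (IH b a Y f b0 a0 hS ha hY m (leqnSn m)) hd h0).
  rewrite le_eqVlt; apply/orP; left; apply/eqP; rewrite /X exprS.
  have Cp : 0 < C by lra.
  have bm0 : 0 < b ^+ m by rewrite exprn_gt0.
  by field; rewrite !gt_eqF.
move=> jm; apply: bd_le (IH b a _ f b0 a0 hS ha hb j jm).
rewrite ler_wpM2r ?exprn_ge0 ?(ltW b0)//.
have -> : a + 3 * X / b ^+ m.+1 = a + 3 / 2 * a + 12 * C * (d / b ^+ m.+2).
  rewrite /X (exprS _ m.+1); field; rewrite !gt_eqF//.
rewrite X1E; set y := d / _.
have y0 : 0 <= y by rewrite divr_ge0// ltW// exprn_gt0.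
have : C * a <= C * C * a by rewrite -mulrA ler_peMl// mulr_ge0// ltW.
have : 0 <= C * y by rewrite mulr_ge0.
nra.
Qed.
Lemma GsP m b a f : (forall j, (j <= m)%N -> bd (a * b ^+ j) (Dn j f)) -> Hm m f -> Gs m b a f.
Proof.
elim: m a f => [|m IH] a f h hf; first by have := h 0%N isT; rewrite expr0 mulr1.
split; [by have := h 0%N isT; rewrite expr0 mulr1|exact: hf.1|].
by apply: IH hf.2 => j jm; have := h j.+1 jm; rewrite DnS exprS mulrA.
Qed.
End graded.

(** * Decay of the nonlinearity and bounds uniform in time *)

Section uniform.
Context {R : realType}.
Local Notation H := (Hsp R).
Implicit Types (v w f g : H).

(** The scale satisfies b^m = N sqrt t, so that the interpolated bound on D^j u is (M / sqrt t) b^j.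
    The 2k small factors give at most M^(2k) / t^2, and the distributed derivatives at most (C0 + 1)
    N sqrt t. *)
Lemma NL_decay m k (lam A : R) : (2 <= k)%N -> 0 < A -> forall C0, 0 <= C0 -> exists2 La : R, 0 <= La & forall (t N : R) (u : H), 1 <= t -> 1 <= N ->
  Hm m.+1 u -> bd (A / Num.sqrt t) u -> hn m u <= C0 -> hn m.+1 u <= N ->
  Hm m.+1 (NL lam k u) /\ `|Dn m.+1 (NL lam k u)| <= La * N / (t * Num.sqrt t).
Proof.
case: k => // k k2 A0 C0 C00.
have [C C1 hC] := @landau_chain R m; have [c c0 hc] := @D_it_bound R m k; have [ck ck0 hk] := @it_Gs R m k.
pose M := C * (A + 2).
have M0 : 0 < M by rewrite mulr_gt0//; lra.
pose c2 := 4 ^+ m * (2 ^+ m * ck) * 2 + c * 2 ^+ m.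
have c20 : 0 <= c2 by rewrite addr_ge0// !mulr_ge0 ?exprn_ge0.
exists (`|lam| * c2 * M ^+ (2 * k.+1) * (C0 + 1)).
  by apply: mulr_ge0; [apply: mulr_ge0; [apply: mulr_ge0|apply: exprn_ge0; exact: ltW]|apply: addr_ge0].
move=> t N u t1 N1 hu hb hC0 hN.
have t0 : 0 < t by lra.
have [q qE] : exists q, q = Num.sqrt t by eexists.
rewrite -qE in hb *; have q0 : 0 < q by rewrite qE sqrtr_gt0.
have qq_ : q * q = t by rewrite qE -expr2 sqr_sqrtr// ltW.
have q1 : 1 <= q by rewrite qE -sqrtr1 ler_sqrt//; lra.
(* For m = 0 nothing is interpolated and b = 1 serves. *)
have [b b1 bm] : exists2 b : R, 1 <= b & (0 < m)%N -> b ^+ m = N * q.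
  case: (posnP m) => [->|m0]; first by exists 1.
  have Nq : 1 <= N * q by nra.
  have Nq0 : 0 <= N * q by lra.
  exists ((N * q) `^ m%:R^-1).
    by rewrite -[leLHS](powRr0 (N * q)) ler_powR.
  have mn : m%:R != 0 :> R by rewrite pnatr_eq0 -lt0n.
  move=> _; rewrite -powR_mulrn; last exact: powR_ge0.
  by rewrite -powRrM (mulVf mn) powRr1.
have b0 : 0 < b by lra.
have bN : b ^+ m <= N * q.
  case: (posnP m) => [->|m0]; last by rewrite bm.
  by rewrite expr0; nra.
have wDm : wd (Dn m u) (Dn m.+1 u) by apply: Hm_wd hu.
have bDm : bd (2 * N) (Dn m u).
  apply: bd_le (bd_sup wDm); rewrite ler_pM2l//; apply: le_trans hN.
  rewrite hn_sum big_ord_recr /= big_ord_recr /= lerD2r lerDr.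
  by apply: sumr_ge0.
have hG : Gs m b (M / q) u.
  have Aq : 0 < A / q by rewrite divr_gt0.
  case: (posnP m) => [m0|m0].
    subst m; apply: bd_le hb; rewrite ler_pM2r ?invr_gt0// /M; nra.
  apply: GsP (Hm_S hu) => j jm.
  apply: bd_le (hC b (A / q) (2 * N) u b0 Aq hu hb bDm j jm).
  rewrite ler_wpM2r ?exprn_ge0 ?(ltW b0)// bm// /M le_eqVlt; apply/orP; left; apply/eqP; field.
  by rewrite !gt_eqF//; lra.
have u1 : Hm 1 u by exact: Hm1 hu.
have DC0 i : (i < m)%N -> `|Dn i (D u)| <= C0.
  by move=> im; rewrite -DnS; apply: le_trans hC0; exact: Dn_hn.
have DN : `|Dn m (D u)| <= N by rewrite -DnS; apply: le_trans hN; exact: Dn_hn.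
have N0 : 0 <= N by lra.
have hc' := Gs_cj hG; have hi := hk b _ u b1 hG; have b0' := ltW b0.
have [r1 r2] := mulL b1 C00 N0 (Gs_mul b0' hi hc') hu.2 DC0 DN.
have cD : Hm m (cj (D u)) by apply: Hmcj; exact: hu.2.
have Dcjn i f : Hm i f -> `|Dn i (cj f)| = `|Dn i f|.
  elim: i f => [|i IHi] f hf; first by rewrite /= nrmcj.
  by rewrite !DnS Dcj ?IHi//; [exact: hf.2|exact: Hm1 hf].
have [||s1 s2] := mulL b1 C00 N0 (Gs_mul b0' hi hG) cD.
- by move=> i im; rewrite Dcjn; [exact: DC0|exact: Hm_le (ltnW im) hu.2].
- by rewrite Dcjn//; exact: hu.2.
have [p1 p2] := hc b _ _ C0 N _ u b1 C00 N0 (Gs_mul b0' hG hc') hG hu DC0 DN.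
have [e1 e2] := D_it k u1.
have HD : Hm m (D (it k.+1 u)) by rewrite e2; apply: HmD => //; exact: HmD.
have Hi : Hm m.+1 (it k.+1 u) by split=> //; exact: e1.1.
split; first exact: HmZ.
rewrite /NL DnS (DZ _ e1) -[_ *: _]addr0 (Dn_lin _ (leqnn m) HD (Hm0 m)).
have -> : Dn m (0 : H) = 0.
  by elim: (m) => [//|n IHn]; rewrite DnS (DE (wd0)).
rewrite addr0 normrZ e2.
rewrite -[_ + mulf _ (cj _)]scale1r (Dn_lin _ (leqnn m))//; last exact: HmD.
rewrite scale1r -[mulf _ (D u)]scale1r (Dn_lin _ (leqnn m))// scale1r.
have S1 : C0 * b ^+ m + N <= (C0 + 1) * (N * q).
  have := ler_wpM2l C00 bN; have : N <= N * q by rewrite ler_peMr.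
  lra.
have x0 : 0 <= M / q by rewrite divr_ge0// ltW.
have S2 : `|Dn m (mulf (mulf (it k u) (cj u)) (D u)) + Dn m (mulf (mulf (it k u) u) (cj (D u))) + Dn m (mulf (qq u) (D (it k u)))| <=
   c2 * (M / q) ^+ (2 * k.+1) * (C0 * b ^+ m + N).
  apply: le_trans (ler_normD _ _) _; apply: le_trans (lerD (ler_normD _ _) (lexx _)) _.
  apply: le_trans (lerD (lerD r2 s2) p2) _; rewrite le_eqVlt; apply/orP; left; apply/eqP.
  have -> : (M / q) ^+ (2 * k.+1) = (M / q) ^+ (2 * k) * (M / q) ^+ 2 by rewrite -exprD mulnS addnC.
  by rewrite /c2 exprS; ring.
apply: le_trans (ler_wpM2l (normr_ge0 lam) S2) _.
(* This is where k >= 2 enters: the exponent is at least 4. *)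
have S3 : (M / q) ^+ (2 * k.+1) <= M ^+ (2 * k.+1) / (t * t).
  rewrite expr_div_n ler_pM2l ?exprn_gt0// lef_pV2 ?posrE ?mulr_gt0 ?exprn_gt0//.
  have -> : t * t = q ^+ 4 by rewrite -qq_; ring.
  by apply: ler_weXn2l => //; rewrite -[4%N]/(2 * 2)%N leq_mul2l.
have M0' := ltW M0; have t0' := ltW t0.
have S4 : 0 <= M ^+ (2 * k.+1) / (t * t) by apply: divr_ge0; [exact: exprn_ge0|exact: mulr_ge0].
apply: le_trans (_ : `|lam| * (c2 * (M ^+ (2 * k.+1) / (t * t)) * ((C0 + 1) * (N * q))) <= _).
  apply: ler_wpM2l => //; apply: ler_pM => //.
  - by apply: mulr_ge0 => //; exact: exprn_ge0.
  - by rewrite addr_ge0// mulr_ge0// exprn_ge0.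
  - exact: ler_wpM2l.
rewrite le_eqVlt; apply/orP; left; apply/eqP; rewrite -!qq_; field.
by rewrite gt_eqF.
Qed.

(** In L^2 no derivative is distributed, and the 2k factors 1 / sqrt t alone suffice, as 2k >= 3. *)
Lemma NL_decay0 k (lam A : R) : (2 <= k)%N -> 0 < A -> exists2 La : R, 0 <= La & forall (t N : R) (u : H), 1 <= t -> 1 <= N ->
  bd (A / Num.sqrt t) u -> `|u| <= N -> `|NL lam k u| <= La * N / (t * Num.sqrt t).
Proof.
move=> k2 A0; exists (`|lam| * A ^+ (2 * k)); first by rewrite mulr_ge0// exprn_ge0// ltW.
move=> t N u t1 N1 hb hN; have t0 : 0 < t by lra.
have [q qE] : exists q, q = Num.sqrt t by eexists.
rewrite -qE in hb *; have q0 : 0 < q by rewrite qE sqrtr_gt0.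
have qq_ : q * q = t by rewrite qE -expr2 sqr_sqrtr// ltW.
have q1 : 1 <= q by rewrite qE -sqrtr1 ler_sqrt//; lra.
have bq : bd ((A / q) ^+ 2) (qq u) by rewrite expr2; exact: bd_mulf hb (bdHcj hb).
have hi : `|it k u| <= (A / q) ^+ (2 * k) * `|u|.
  elim: (k) => [|n IH]; first by rewrite muln0 expr0 mul1r.
  rewrite /it iterS -/(it n u); apply: le_trans (mulf_le _ bq) _.
  by rewrite mulnS exprD -mulrA ler_wpM2l// sqr_ge0.
rewrite /NL normrZ -!mulrA ler_wpM2l//; apply: le_trans hi _.
have N0 : 0 <= N by lra.
have A0' := ltW A0; have q0' := ltW q0.
apply: le_trans (_ : A ^+ (2 * k) / q ^+ 3 * N <= _); last first.
  by rewrite -qq_ le_eqVlt; apply/orP; left; apply/eqP; field; rewrite gt_eqF.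
apply: ler_pM => //; first by rewrite exprn_ge0// divr_ge0.
rewrite expr_div_n ler_pM2l ?exprn_gt0// lef_pV2 ?posrE ?exprn_gt0//.
by apply: ler_weXn2l => //; apply: leq_trans (_ : 2 * 2 <= _)%N => //; rewrite leq_mul2l.
Qed.
Lemma sqrtV_d (M t : R) : 0 < t -> is_derive t 1 (fun s : R => - (2 * M) * (Num.sqrt s)^-1) (M / (t * Num.sqrt t)).
Proof.
move=> t0; have s0 : 0 < Num.sqrt t by rewrite sqrtr_gt0.
have h := is_deriveV (lt0r_neq0 s0) (is_derive1_sqrt t0).
have h2 := @is_deriveZ R R R^o _ (- (2 * M)) t 1 _ h; apply: (is_derive_eq h2).
rewrite /GRing.scale /= -[X in _ = _ / (X * _)](sqr_sqrtr (ltW t0)).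
by field; rewrite gt_eqF.
Qed.

Section solution.
Variables (S : R -> H -> H) (c0 : R -> R) (K : R) (lam : R) (k : nat) (u : R -> H) (cc : nat -> R -> R[i]) (s : nat) (A : R).
Hypotheses (hS : schr S (toC c0)) (bc : bd K (toC c0)) (cc0 : cc 0%N = toC c0) (hch : chain s cc K).
Hypotheses (k2 : (2 <= k)%N) (A0 : 0 < A) (hA : forall t, 1 <= t -> bd (A / Num.sqrt t) (u t)).
Hypothesis us : contH s u.
Hypothesis uD : forall v (t : R), is_derive t 1 (fun t => dot (S (- t) (u t)) v) (dot (J (S (- t) (NL lam k (u t)))) v).
Let gS := schr_grp hS.
Let z t := S (- t) (u t).

Lemma S_Hm_s m : (m <= s)%N -> exists2 C : R, 0 <= C & forall t g, Hm m g -> Hm m (S t g) /\ hn m (S t g) <= C * hn m g.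
Proof.
move=> ms; apply: (S_Hm hS bc cc0); case: hch => a b.
by split=> j jm; [apply: a|apply: b]; apply: leq_trans ms; rewrite ?(leq_trans jm)// -?subn2 ?leq_subr//; apply: leq_trans jm (leq_subr _ _).
Qed.
(** The integral of t^(-3/2) from a to infinity is 2 / sqrt a. *)
Lemma z_mv m : (m <= s)%N -> exists2 C : R, 0 <= C & forall (a b La : R), 1 <= a -> a <= b -> 0 <= La ->
  (forall t, a <= t <= b -> Hm m (NL lam k (u t)) /\ hn m (NL lam k (u t)) <= La / (t * Num.sqrt t)) ->
  hn m (z b - z a) <= C * La / Num.sqrt a.
Proof.
move=> ms; have [C C0 hC] := S_Hm_s ms; exists (m.+1%:R * C * 2); first by rewrite !mulr_ge0.
move=> a b La a1 ab La0 h.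
have a0 : 0 < a by lra.
have sa : 0 < Num.sqrt a by rewrite sqrtr_gt0.
have sb : 0 < Num.sqrt b by rewrite sqrtr_gt0; lra.
apply: le_trans (_ : m.+1%:R * (2 * (C * La) / Num.sqrt a) <= _); last first.
  by rewrite le_eqVlt; apply/orP; left; apply/eqP; field; rewrite gt_eqF.
apply: hn_bound => j jm.
have := @mv_Dn R j z (fun t => J (S (- t) (NL lam k (u t)))) (fun s => - (2 * (C * La)) * (Num.sqrt s)^-1) (fun t => C * La / (t * Num.sqrt t)) a b ab (fun v t _ => uD v t) => hmv.
apply: (le_trans (hmv _ _ _ _)).
- by move=> t _; apply: Hm_le jm _; apply: (hC _ _ _).1; exact: Hm_le ms (us.1 t).
- by move=> t ht; apply: Hm_le jm _; apply: HmJ; exact: (hC _ _ (h t ht).1).1.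
- by move=> t /andP[ta _]; apply: sqrtV_d; lra.
- move=> t ht; have [h1 h2] := h t ht; have [h3 h4] := hC (- t) _ h1.
  apply: le_trans (Dn_hn _ jm) _; rewrite (hnJ h3); apply: le_trans h4 _.
  by rewrite -mulrA ler_wpM2l.
have : 0 <= (Num.sqrt b)^-1 by rewrite invr_ge0 ltW.
have : 0 <= C * La by rewrite mulr_ge0.
nra.
Qed.
(** From the time T0 = q^2 on, the tail factor 1 / q makes the nonlinear contribution at most 1 + Y
    / 2, which is absorbed. On [0, T0] continuity bounds the norm. *)
Lemma bound_step m : (m <= s)%N -> (exists2 La : R, 0 <= La & forall t N, 1 <= t -> 1 <= N -> hn m (u t) <= N ->
    Hm m (NL lam k (u t)) /\ hn m (NL lam k (u t)) <= La * N / (t * Num.sqrt t)) ->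
  exists2 C : R, 0 <= C & forall t, 0 <= t -> hn m (u t) <= C.
Proof.
move=> ms [La La0 hLa]; have um := contH_le ms us.
have [C C0 hC] := S_Hm_s ms; have [D0 D00 hD] := z_mv ms.
pose q := 2 * C * D0 * La + 1.
have q0 : 0 < q by rewrite ltr_wpDl// !mulr_ge0.
pose T0 := q ^+ 2.
have q1 : 1 <= q by rewrite lerDr !mulr_ge0.
have T01 : 1 <= T0 by rewrite exprn_ege1.
have sT : Num.sqrt T0 = q by rewrite sqrtr_sqr gtr0_norm.
have [B B0 hB] := contH_bounded T0 um.
pose A' := C * (C * B) + 1.
have A'0 : 0 <= A' by rewrite addr_ge0// !mulr_ge0.
have zm t : Hm m (z t) by exact: (hC _ _ (um.1 t)).1.
have uz t : u t = S t (z t) by rewrite /z (grpK' gS).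
have large t1 : forall t, T0 <= t <= t1 -> hn m (u t) <= 2 * A'.
  have [B1 B10 hB1] := contH_bounded t1 um.
  apply: (@absorb R [set t | T0 <= t <= t1] (fun t => hn m (u t)) A' B1).
    by move=> t /= /andP[h1 h2]; apply: hB1; rewrite ger0_norm//; lra.
  move=> Y hY t /= ht; have /andP[t1' t2'] := ht.
  have Y0 : 0 <= Y by apply: le_trans (hY t ht); exact: hn_ge0.
  have hz : hn m (z t - z T0) <= D0 * (La * (1 + Y)) / Num.sqrt T0.
    apply: hD => //; first by rewrite mulr_ge0// addr_ge0.
    move=> w /andP[w1 w2]; apply: hLa; [lra|lra|].
    apply: le_trans (hY w _) _; first by rewrite /= w1/=; lra.
    lra.
  have hzT : hn m (z T0) <= C * B.
    apply: le_trans (hC _ _ (um.1 _)).2 _; rewrite ler_wpM2l// hB// ger0_norm//; lra.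
  have h1 : hn m (u t) <= C * (C * B + D0 * (La * (1 + Y)) / q).
    rewrite uz; apply: le_trans (hC _ _ (zm t)).2 _; rewrite ler_wpM2l//.
    by apply: le_trans (hn_tri (zm t) (zm T0)) _; rewrite addrC -sT lerD.
  apply: le_trans h1 _; rewrite mulrDr /A' -addrA lerD2l.
  have -> : C * (D0 * (La * (1 + Y)) / q) = (C * D0 * La) * (1 + Y) / q by field; rewrite gt_eqF.
  rewrite ler_pdivrMr// /q.
  have : 0 <= C * D0 * La by rewrite !mulr_ge0.
  nra.
exists (2 * A' + B); first by rewrite addr_ge0// mulr_ge0.
move=> t t0; have [tT|Tt] := leP t T0.
  by apply: le_trans (hB t _) _; rewrite ?ger0_norm// lerDr mulr_ge0.
by apply: le_trans (large t t _) _; rewrite ?(ltW Tt) ?lexx// lerDl.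
Qed.

(** Induction on the order: the uniform bound at order m is the [C0] of [NL_decay] at order m +
    1. *)
Lemma uniform_bound m : (m <= s)%N -> (exists2 C : R, 0 <= C & forall t, 0 <= t -> hn m (u t) <= C) /\
  (exists2 La : R, 0 <= La & forall t, 1 <= t -> Hm m (NL lam k (u t)) /\ hn m (NL lam k (u t)) <= La / (t * Num.sqrt t)).
Proof.
have fin n : (n <= s)%N -> (exists2 La : R, 0 <= La & forall t N, 1 <= t -> 1 <= N -> hn n (u t) <= N ->
    Hm n (NL lam k (u t)) /\ hn n (NL lam k (u t)) <= La * N / (t * Num.sqrt t)) ->
   (exists2 C : R, 0 <= C & forall t, 0 <= t -> hn n (u t) <= C) /\
  (exists2 La : R, 0 <= La & forall t, 1 <= t -> Hm n (NL lam k (u t)) /\ hn n (NL lam k (u t)) <= La / (t * Num.sqrt t)).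
  move=> ns hLa; have [C C0 hC] := bound_step ns hLa; split; first by exists C.
  have [La La0 h] := hLa; exists (La * (C + 1)); first by rewrite mulr_ge0// addr_ge0.
  move=> t t1; apply: h => //; first by lra.
  by apply: le_trans (hC t _) _; lra.
elim: m => [|m IH] ms.
  apply: fin => //; have [La La0 h] := NL_decay0 lam k2 A0; exists La => // t N t1 N1 hN.
  by split=> //; apply: h => //; exact: hA.
have [[C C0 hC] [L1 L10 h1]] := IH (ltnW ms).
apply: fin => //; have [La La0 h] := @NL_decay m k lam A k2 A0 C C0.
exists (L1 + La); first by rewrite addr_ge0.
move=> t N t1 N1 hN; have um : Hm m.+1 (u t) by exact: Hm_le ms (us.1 t).
have t0 : 0 <= t by lra.
have [a1 a2] := h t N (u t) t1 N1 um (hA t1) (hC t t0) hN.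
split=> //; have -> : hn m.+1 (NL lam k (u t)) = hn m (NL lam k (u t)) + `|Dn m.+1 (NL lam k (u t))|.
  by rewrite !hn_sum big_ord_recr.
have q0 : 0 <= (t * Num.sqrt t)^-1 by rewrite invr_ge0 mulr_ge0// sqrtr_ge0.
rewrite mulrDl mulrDl lerD//; apply: le_trans (h1 t t1).2 _.
by rewrite ler_wpM2r// ler_peMr.
Qed.
End solution.
End uniform.

(** * Scattering in Sobolev spaces *)

Section free.
Context {R : realType}.
Local Notation H := (Hsp R).
Implicit Types (v w f g : H).
Variables (S0 : R -> H -> H).
Hypothesis hS0 : schr S0 (toC (fun=> 0)).
Let gS := schr_grp hS0.

Lemma b00 : bd 0 (toC (fun=> 0 : R)).
Proof. by split=> //; apply: aeW' => x; rewrite n2C expr0n. Qed.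
Lemma gen_free g : Hm 2 g -> gen S0 g (J (D (D g))).
Proof.
by move=> hg; apply/(schr_gen hS0); split=> //; rewrite (_ : toC _ = fun=> 0) ?mulf0l ?addr0.
Qed.
Lemma free_H2 t g : Hm 2 g -> Hm 2 (S0 t g) /\ D (D (S0 t g)) = S0 t (D (D g)).
Proof.
move=> hg; have /(gen_S gS t)/(schr_gen hS0)[h1 h2] := gen_free hg; split=> //.
move: h2; rewrite (schr_J hS0) => /Jinj ->.
by rewrite (_ : toC _ = fun=> 0) ?mulf0l ?addr0.
Qed.
Lemma DD_sym (a b : H) : Hm 2 a -> Hm 2 b -> dot (D (D a)) b = dot a (D (D b)).
Proof.
move=> [a1 [a2 _]] [b1 [b2 _]].
by rewrite (wd_skew a2 b1) (wd_skew a1 b2) opprK.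
Qed.
Lemma eq_dense (D0 : set H) (P Q : H -> H) (C1 C2 : R) : dn D0 -> 0 <= C1 -> 0 <= C2 ->
  (forall x y, `|P x - P y| <= C1 * `|x - y|) -> (forall x y, `|Q x - Q y| <= C2 * `|x - y|) ->
  (forall x, D0 x -> P x = Q x) -> forall x, P x = Q x.
Proof.
move=> hD C10 C20 hP hQ h x; apply/eqP; rewrite -subr_eq0 -normr_le0; apply/ler_addgt0Pr => e e0; rewrite add0r.
have e1 : 0 < e / (C1 + C2 + 1) by rewrite divr_gt0// ltr_wpDl// addr_ge0.
have [y Dy xy] := hD x _ e1.
have -> : P x - Q x = (P x - P y) - (Q x - Q y) by rewrite (h y Dy); hring.
apply: le_trans (ler_normB _ _) _; apply: le_trans (lerD (hP _ _) (hQ _ _)) _.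
rewrite -mulrDl; apply: le_trans (ler_wpM2l (addr_ge0 C10 C20) xy) _.
by rewrite mulrA ler_pdivrMr ?ltr_wpDl ?addr_ge0//; nra.
Qed.
(** The pairing of [S0 s x] with the translate of [S0 s v] has zero derivative in s, because D^2 is
    symmetric and commutes with translations and with i. *)
Lemma free_T t h g : T h (S0 t g) = S0 t (T h g).
Proof.
suff E x : S0 (- t) (T h (S0 t x)) = T h x.
  by have := congr1 (S0 t) (E g); rewrite (grpK' gS).
move: x; apply: (@eq_dense [set a | Hm 2 a] _ _ 1 1 (Dn_test 2)) => //.
- by move=> x y; rewrite -(grpB gS) (grp_nrm gS) -TB nrmT -(grpB gS) (grp_nrm gS) mul1r.
- by move=> x y; rewrite -TB nrmT mul1r.
move=> x hx; apply: (dot_eq_dense (Dn_test 2)) => v hv.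
pose F s := dot (S0 s x) (T (- h) (S0 s v)).
have F0 (s : R) : is_derive s 1 F 0.
  have [a1 a2] := free_H2 s hx; have [b1 b2] := free_H2 s hv.
  have hxx : k^-1 *: (T (- h) (S0 (s + k) v) - T (- h) (S0 s v)) @[k --> (0:R)^'] --> T (- h) (S0 s (J (D (D v)))).
    have := @gen_shift R _ gS s _ _ (gen_free hv) => /cvgrPdist_le hc.
    apply/cvgrPdist_le => e e0; have := hc e e0; apply: filterS => k.
    by rewrite -TB -TZ -TB nrmT.
  have cz : {for s, continuous (fun s => S0 s x)} by exact: (grp_cont gS).
  have := @dot_derive R (fun s => S0 s x) (fun s => T (- h) (S0 s v)) s _ _ cz (gen_dotd gS _ s (gen_free hx)) hxx.
  congr (is_derive _ _ _ _).
  rewrite !(schr_J hS0) -a2 -b2 TJ dotJl.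
  have b3 : Hm 1 (S0 s v) by exact: Hm_le b1.
  have b4 : Hm 1 (D (S0 s v)) by case: b1.
  rewrite -(DT _ b4) -(DT _ b3); have Hc := HmT (- h) b1.
  have c1 : Hm 1 (T (- h) (S0 s v)) by exact: Hm_le Hc.
  have c2' : Hm 1 (D (T (- h) (S0 s v))) by case: Hc.
  have e : dot (D (D (S0 s x))) (J (T (- h) (S0 s v))) = dot (S0 s x) (J (D (D (T (- h) (S0 s v))))).
    by rewrite DD_sym//; [rewrite (DJ c1) (DJ c2')|exact: HmJ].
  by rewrite e addNr.
by have := deriv0_const F0 t; rewrite /F !(grp_0 gS) => E; rewrite (grp_adj gS) opprK !dotT.
Qed.
Lemma free_wd t f g : wd f g -> wd (S0 t f) (S0 t g).
Proof.
move=> /(genP (@grp_T R)) h; apply/(genP (@grp_T R)) => e e0; have [d d0 hd] := h e e0; exists d => // k hk.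
by rewrite free_T -(grpB gS) -(grpZ gS) -(grpB gS) (grp_nrm gS); exact: hd.
Qed.
Lemma free_D t f : Hm 1 f -> D (S0 t f) = S0 t (D f).
Proof. by move=> [h _]; apply: DE; exact: free_wd. Qed.
Lemma free_Hm m t f : Hm m f -> Hm m (S0 t f).
Proof.
elim: m f => [//|m IH] f [h1 h2]; apply/HmSP; exists (S0 t (D f)); [exact: free_wd|exact: IH].
Qed.
Lemma free_hn m t f : Hm m f -> hn m (S0 t f) = hn m f.
Proof.
elim: m f => [|m IH] f; first by move=> _ /=; rewrite (grp_nrm gS).
by move=> hf /=; rewrite (grp_nrm gS) free_D ?IH//; [exact: hf.2|exact: Hm1 hf].
Qed.
Lemma free_Dn m j t f : (j <= m)%N -> Hm m f -> Dn j (S0 t f) = S0 t (Dn j f).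
Proof.
elim: j m f => [//|j IH] [//|m] f jm hf; rewrite !DnS free_D; last exact: Hm1 hf.
by apply: (IH m) => //; exact: hf.2.
Qed.
End free.

(** * Wave operators in Sobolev norms *)

Section scattering.
Context {R : realType}.
Local Notation H := (Hsp R).
Implicit Types (v w f g : H).
(** Induction on the order, starting from |D f|^2 <= |f| |D^2 f| split with a small parameter d. *)
Lemma interp m (e : R) : 0 < e -> exists2 C : R, 0 <= C & forall f, Hm m.+1 f -> hn m f <= C * `|f| + e * hn m.+1 f.
Proof.
elim: m e => [|m IH] e e0.
  exists 1 => // f _; rewrite mul1r [hn 0 f]/= lerDl mulr_ge0 ?hn_ge0//; exact: ltW.
have e2 : 0 < e / 2 by rewrite divr_gt0.
have [C C0 h] := IH _ e2.
pose d := e / 2 / (C + 1).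
have d0 : 0 < d by rewrite divr_gt0// ltr_wpDl.
exists (1 + C / d); first by rewrite addr_ge0// divr_ge0// ltW.
move=> f hf; have hD := h _ hf.2.
have f2 : Hm 2 f by exact: Hm_le hf.
have dd : `|D f| <= `|f| / d + d * `|D (D f)|.
  have x0 : 0 <= `|f| / d by rewrite divr_ge0// ltW.
  have y0 : 0 <= d * `|D (D f)| by rewrite mulr_ge0// ltW.
  rewrite -(ler_pXn2r (n := 2))// ?nnegrE ?addr_ge0//.
  apply: le_trans (D_interp f2) _.
  have -> : `|f| * `|D (D f)| = (`|f| / d) * (d * `|D (D f)|) by field; rewrite gt_eqF.
  move: x0 y0; set x := _ / d; set y := d * _; nra.
have l1 : `|D (D f)| <= hn m.+2 f.
  by rewrite /= ; have := nrm_hn m (D (D f)); have := normr_ge0 f; have := normr_ge0 (D f); lra.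
have l2 : hn m.+1 (D f) <= hn m.+2 f by rewrite [leRHS]/= lerDr.
have Cd : C * d <= e / 2 by rewrite /d mulrA ler_pdivrMr ?ltr_wpDl//; nra.
rewrite [hn m.+1 f]/=.
have h1 := ler_wpM2l C0 dd; have h2 := ler_wpM2l (ltW e2) l2.
have h3 : C * d * `|D (D f)| <= e / 2 * hn m.+2 f by apply: ler_pM => //; apply: mulr_ge0 => //; exact: ltW.
have -> : (1 + C / d) * `|f| = `|f| + C * (`|f| / d) by field; rewrite gt_eqF.
lra.
Qed.

Variables (S S0 : R -> H -> H) (c0 : R -> R) (K : R) (lam : R) (k : nat) (u : R -> H) (cc : nat -> R -> R[i]) (s : nat) (A : R).
Hypotheses (hS : schr S (toC c0)) (bc : bd K (toC c0)) (cc0 : cc 0%N = toC c0) (hch : chain s cc K).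
Hypothesis hS0 : schr S0 (toC (fun=> 0)).
Hypothesis hsc : forall g, exists gp, limT (fun t => `|S t g - S0 t gp|).
Let gS := schr_grp hS.
Let gS0 := schr_grp hS0.
Let h g t := S0 (- t) (S t g).

Lemma h_lin g g' t : h (g - g') t = h g t - h g' t.
Proof. by rewrite /h (grpB gS) (grpB gS0). Qed.
Lemma h_bound m : (m <= s.+1)%N -> exists2 C : R, 0 <= C & forall t g, Hm m g -> Hm m (h g t) /\ hn m (h g t) <= C * hn m g.
Proof.
move=> ms; have [|C C0 hC] := S_Hm hS bc cc0 (m := m).
  case: hch => a b; split=> j jm; [apply: a|apply: b]; move: ms jm; case: m => [|[|m]] //=; rewrite ?ltnS.
  - by rewrite leqn0 => _ /eqP ->.
  - by rewrite leqn0 => _ /eqP ->.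
  - by move=> ms jm; apply: leq_trans jm (ltnW ms).
  - by move=> ms jm; apply: leq_trans jm (ltnW ms).
exists C => // t g hg; have [h1 h2] := hC t g hg; split; first exact: (free_Hm hS0).
by rewrite /h (free_hn hS0).
Qed.
(** Interpolation loses one derivative, so data in H^(s+1) come first, and density with the uniform
    bound of S0(-t) S(t) on H^s gives the rest. The bound at order s + 1 is available because it
    involves only s - 1 derivatives of the potential. *)
Lemma wave_Hs g : Hm s g -> exists2 gp, Hm s gp & limT (fun t => hn s (S t g - S0 t gp)).
Proof.
move=> hg; have [C C0 hC] := h_bound (leqnSn s); have [C1 C10 hC1] := h_bound (leqnn s.+1).
have smooth_case g' : Hm s.+1 g' -> forall e : R, 0 < e -> exists T0 : R, forall a b, T0 <= a -> T0 <= b -> hn s (h g' a - h g' b) <= e.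
  move=> hg' e e0; pose B := 2 * (C1 * hn s.+1 g') + 1.
  have B0 : 0 < B by rewrite ltr_wpDl// !mulr_ge0// hn_ge0.
  have e1 : 0 < e / 2 / B by rewrite !divr_gt0.
  have [Ce Ce0 hi] := @interp s _ e1.
  have [gp hgp] := hsc g'.
  have e2 : 0 < e / 4 / (Ce + 1) by rewrite !divr_gt0// ltr_wpDl.
  have [T0 hT] := hgp _ e2; exists T0 => a b Ta Tb.
  have near t : T0 <= t -> `|h g' t - gp| <= e / 4 / (Ce + 1).
    by move=> /hT; rewrite -(grp_nrm gS0 (- t)) (grpB gS0) (grpK gS0).
  have Ha := hC1 a _ hg'; have Hb := hC1 b _ hg'.
  apply: le_trans (hi _ (HmB Ha.1 Hb.1)) _.
  have l1 : `|h g' a - h g' b| <= 2 * (e / 4 / (Ce + 1)).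
    have -> : h g' a - h g' b = (h g' a - gp) - (h g' b - gp) by hring.
    by apply: le_trans (ler_normB _ _) _; have := near a Ta; have := near b Tb; lra.
  have l2 : hn s.+1 (h g' a - h g' b) <= B.
    by apply: le_trans (hnB Ha.1 Hb.1) _; rewrite /B; have := Ha.2; have := Hb.2; lra.
  have k1 := ler_wpM2l Ce0 l1; have k2 := ler_wpM2l (ltW e1) l2.
  have k3 : Ce * (2 * (e / 4 / (Ce + 1))) <= e / 2.
    have -> : Ce * (2 * (e / 4 / (Ce + 1))) = Ce * (e / 2) / (Ce + 1) by field; rewrite gt_eqF// ltr_wpDl.
    by rewrite ler_pdivrMr ?ltr_wpDl//; nra.
  have k4 : e / 2 / B * B = e / 2 by rewrite divfK// gt_eqF.
  lra.
have [|e e0|gp Hgp lgp] := @Hm_complete R s (h g).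
- by move=> t; exact: (hC t g hg).1.
- have e1 : 0 < e / 4 / (C + 1) by rewrite !divr_gt0// ltr_wpDl.
  have e2 : 0 < e / 2 by rewrite divr_gt0.
  have [g' hg' gg'] := Hm_dense hg e1; have [T0 hT] := smooth_case g' hg' _ e2; exists T0 => a b Ta Tb.
  have hgS := Hm_S hg'.
  have E t : h g t = h g' t - h (g' - g) t by rewrite h_lin; hring.
  have -> : h g a - h g b = (h g' a - h g' b) - (h (g' - g) a - h (g' - g) b) by rewrite (E a) (E b); hring.
  have Ha := hC a _ (HmB hgS hg); have Hb := hC b _ (HmB hgS hg).
  have Ha' := hC a _ hgS; have Hb' := hC b _ hgS.
  apply: le_trans (hnB (HmB Ha'.1 Hb'.1) (HmB Ha.1 Hb.1)) _.
  have k1 := hT a b Ta Tb; have k2 := hnB Ha.1 Hb.1.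
  have k3 := ler_wpM2l C0 gg'.
  have k4 : C * (e / 4 / (C + 1)) <= e / 4 by rewrite mulrA ler_pdivrMr ?ltr_wpDl//; nra.
  have := Ha.2; have := Hb.2; lra.
exists gp => // e e0; have [T0 hT] := lgp e e0; exists T0 => t Tt.
have := hT t Tt; rewrite -(free_hn hS0 t) ?(grpB gS0) /h ?(grpK' gS0)//.
by apply: HmB => //; exact: (hC t g hg).1.
Qed.

Hypotheses (k2 : (2 <= k)%N) (A0 : 0 < A) (hA : forall t, 1 <= t -> bd (A / Num.sqrt t) (u t)).
Hypothesis us : contH s u.
Hypothesis uD : forall v (t : R), is_derive t 1 (fun t => dot (S (- t) (u t)) v) (dot (J (S (- t) (NL lam k (u t)))) v).

Lemma scattering_Hs : exists2 fp, Hm s fp & limT (fun t => hn s (u t - S0 t fp)).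
Proof.
have [C C0 hC] := S_Hm_s hS bc cc0 hch (leqnn s).
have [_ [La La0 hLa]] := uniform_bound hS bc cc0 hch k2 A0 hA us uD (leqnn s).
have [D0 D00 hD] := z_mv hS bc cc0 hch us uD (leqnn s).
pose z t := S (- t) (u t).
have Hz t : Hm s (z t) by exact: (hC _ _ (us.1 t)).1.
have [//|e e0|zi Hzi lzi] := @Hm_complete R s z.
  (* Past the time q^2 the tail D0 La / sqrt a is at most e. *)
  pose q := D0 * La / e + 1.
  have q1 : 1 <= q by rewrite lerDr divr_ge0 ?mulr_ge0// ltW.
  have q0 : 0 < q by lra.
  have key a b : q ^+ 2 <= a -> a <= b -> hn s (z b - z a) <= e.
    move=> qa ab; have a1 : 1 <= a by apply: le_trans qa; rewrite exprn_ege1.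
    have sa : q <= Num.sqrt a by rewrite -(gtr0_norm q0) -sqrtr_sqr ler_wsqrtr.
    apply: le_trans (hD a b La a1 ab La0 _) _.
      by move=> t /andP[at_ _]; apply: hLa; lra.
    rewrite ler_pdivrMr; last exact: lt_le_trans sa.
    apply: le_trans (_ : e * q <= _); last by rewrite ler_pM2l.
    by rewrite /q mulrDr mulr1 mulrCA divff ?gt_eqF// mulr1 lerDl ltW.
  exists (q ^+ 2) => a b qa qb; have [ab|ba] := leP a b.
    by rewrite hnBC//; exact: key.
  by apply: key => //; exact: ltW.
have [fp Hfp lfp] := wave_Hs Hzi; exists fp => // e e0.
have e1 : 0 < e / 2 / (C + 1) by rewrite !divr_gt0// ltr_wpDl.
have e2 : 0 < e / 2 by rewrite divr_gt0.
have [T1 h1] := lzi _ e1; have [T2 h2] := lfp _ e2.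
exists (Num.max T1 T2) => t; rewrite ge_max => /andP[t1 t2].
have E : u t - S0 t fp = S t (z t - zi) + (S t zi - S0 t fp).
  by rewrite (grpB gS) /z (grpK' gS) addrA subrK.
have [a1 a2] := hC t _ (HmB (Hz t) Hzi).
rewrite E; apply: le_trans (hnD a1 (HmB (hC t _ Hzi).1 (free_Hm hS0 t Hfp))) _.
have k1 := ler_wpM2l C0 (h1 t t1); have k2' := h2 t t2.
have k4 : C * (e / 2 / (C + 1)) <= e / 2 by rewrite mulrA ler_pdivrMr ?ltr_wpDl//; nra.
lra.
Qed.
End scattering.

(** * Bounded approximations of the weights and their evolution *)

Section weights.
Context {R : realType}.
Local Notation H := (Hsp R).
Local Notation mu := (@lebesgue_measure R).
Implicit Types (v f g : H) (phi q : R -> R).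
Hint Resolve L2h Cmh : core.

Lemma wdR_C1 (p q : R -> R) : (forall x : R, is_derive x 1 p (q x)) -> continuous q -> wdR p q.
Proof.
move=> hp cq.
have cp : continuous p by move=> x; apply: is_derive_cont (hp x).
have LIc (r : R -> R) : continuous r -> locally_integrable setT r.
  move=> cr; split; [exact: continuous_measurable_fun|exact: openT|] => Kc _ cK.
  have := @continuous_compact_integrable R r Kc cK.
  by case/(_ (continuous_subspaceT cr))/integrableP.
split; [exact: LIc|exact: LIc|] => phi tp.
have td := test_derive tp.
have i1 := LI_test (LIc p cp) td; have i2 := LI_test (LIc q cq) tp.
apply/eqP; rewrite -addr_eq0 -RintegralD//; apply/eqP.
have [_ [M hM]] := tp.
pose N := `|M| + 1.
have out x : ~ (- N <= x <= N) -> phi x = 0 /\ derive1 phi x = 0.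
  move=> hx; have : M < `|x|.
    rewrite ltNge; apply/negP => xM; apply: hx; rewrite -ler_norml /N.
    by have := ler_norm M; lra.
  by move=> Mx; split; [exact: hM|exact: test_out hM Mx].
rewrite (Rint_restr (A := `[- N, N]%classic))//; last first.
  move=> x /= hx; have [|-> ->] := out x; last by rewrite !mulr0 addr0.
  by move=> hx'; apply: hx; rewrite in_itv.
have N0 : 0 < N by rewrite ltr_wpDl.
have NN : - N < N by lra.
have FT1 (x : R) : is_derive x 1 (fun x => p x * phi x) (p x * derive1 phi x + q x * phi x).
  have := is_deriveM (hp x) (test_isd x tp).
  by rewrite /GRing.scale /= (mulrC (phi x)).
have FT2 : continuous (fun x => p x * derive1 phi x + q x * phi x).
  move=> x; apply: cvgD; apply: cvgM.
  - exact: cp.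
  - exact: (test_cont td).
  - exact: cq.
  - exact: (test_cont tp).
rewrite (Rint_FTC NN FT1 FT2).
have zN x : N <= `|x| -> phi x = 0 by move=> Nx; apply: hM; rewrite /N in Nx; have := ler_norm M; lra.
by rewrite !zN ?mulr0 ?subrr// ?normrN ger0_norm// ltW.
Qed.

(** For e > 0 the weight is bounded; its derivative is at most 1 in modulus uniformly in e, and its
    modulus increases to |x| as e decreases to 0. *)
Definition wt (e x : R) : R := x / (1 + e * x ^+ 2).
Definition wt' (e x : R) : R := (1 - e * x ^+ 2) / (1 + e * x ^+ 2) ^+ 2.
Lemma den_gt0 (e x : R) : 0 <= e -> 0 < 1 + e * x ^+ 2.
Proof. by move=> e0; rewrite ltr_pwDl// mulr_ge0// sqr_ge0. Qed.
Lemma wt_d (e x : R) : 0 <= e -> is_derive x 1 (wt e) (wt' e x).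
Proof.
move=> e0; have d0 := den_gt0 x e0.
have h1 : is_derive x 1 (fun x => 1 + e * x ^+ 2) (2 * e * x).
  have hid := is_derive_id x (1 : R).
  have h2 := is_deriveX 2 hid.
  have h3 := @is_deriveZ R R R^o _ e x 1 _ h2.
  have h4 : is_derive x 1 (fun x : R => e * x ^+ 2) (2 * e * x).
    by apply: (is_derive_eq h3); rewrite /GRing.scale /=; ring.
  by rewrite -[2 * e * x]add0r; apply: is_deriveD.
have h5 := is_deriveM (is_derive_id x (1 : R)) (@is_deriveV R (fun x => 1 + e * x ^+ 2) x _ 1 (lt0r_neq0 d0) h1).
apply: (is_derive_eq h5); rewrite /GRing.scale /= /wt'; field.
by rewrite gt_eqF.
Qed.
Lemma wt_cont (e : R) : 0 <= e -> continuous (wt e).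
Proof. by move=> e0 x; exact: is_derive_cont (wt_d x e0). Qed.
Lemma wt'_cont (e : R) : 0 <= e -> continuous (wt' e).
Proof.
move=> e0 x; have d0 := den_gt0 x e0.
have cX : {for x, continuous (fun x : R => e * x ^+ 2)}.
  by apply: cvgMr; apply: exprn_continuous.
apply: cvgM; first by apply: cvgB => //; exact: cvg_cst.
apply: cvgV; first by rewrite expf_neq0// gt_eqF.
apply: (@continuous_comp _ _ _ (fun x : R => 1 + e * x ^+ 2) (fun y : R => y ^+ 2)); last exact: exprn_continuous.
by apply: cvgD => //; exact: cvg_cst.
Qed.
Lemma wt'_le1 (e x : R) : 0 <= e -> `|wt' e x| <= 1.
Proof.
move=> e0; have d0 := den_gt0 x e0.
rewrite /wt' normrM normfV (gtr0_norm (exprn_gt0 2 d0)) ler_pdivrMr ?exprn_gt0// mul1r.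
have y0 : 0 <= e * x ^+ 2 by rewrite mulr_ge0// sqr_ge0.
move: y0; set y := e * _ => y0; rewrite ler_norml; apply/andP; split; nra.
Qed.
Lemma wt_bound (e x : R) : 0 < e <= 1 -> `|wt e x| <= e^-1.
Proof.
move=> /andP[e0 e1]; have d0 := den_gt0 x (ltW e0).
rewrite /wt normrM normfV (gtr0_norm d0) ler_pdivrMr// ler_pdivlMl//.
have := real_normK (num_real x); have := normr_ge0 x; set y := `|x| => y0 <-.
have := sqr_ge0 (y - 1); nra.
Qed.
Lemma wt_le (e x : R) : 0 <= e -> `|wt e x| <= `|x|.
Proof.
move=> e0; have d0 := den_gt0 x e0.
rewrite /wt normrM normfV (gtr0_norm d0) ler_pdivrMr// ler_peMr//.
by rewrite lerDl mulr_ge0// sqr_ge0.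
Qed.

Definition wp (e : R) n : R -> R[i] := toC (fun x => wt e x ^+ n).
Definition wp' (e : R) n : R -> R[i] := toC (fun x => n%:R * wt e x ^+ n.-1 * wt' e x).
Lemma bd_real (q : R -> R) (K : R) : measurable_fun setT q -> 0 <= K -> (forall x, `|q x| <= K) -> bd K (toC q).
Proof.
move=> mq K0 h; split; [exact: (CmC mq)|by []|].
apply: aeW' => x; rewrite n2C -real_normK ?num_real// ler_pXn2r ?nnegrE//.
Qed.
Variable e : R.
Hypothesis e01 : 0 < e <= 1.
Let e0 : 0 <= e. Proof. by case/andP: e01 => /ltW. Qed.
Let ei0 : 0 <= e^-1. Proof. by rewrite invr_ge0. Qed.
Lemma wtn_cont n : continuous (fun x => wt e x ^+ n).
Proof.
move=> x; apply: (@continuous_comp _ _ _ (wt e) (fun y : R => y ^+ n)); first exact: wt_cont.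
exact: exprn_continuous.
Qed.
Lemma wpn_cont n : continuous (fun x => n%:R * wt e x ^+ n.-1 * wt' e x).
Proof.
move=> x; apply: cvgM; last exact: wt'_cont.
by apply: cvgMr; exact: wtn_cont.
Qed.
Lemma bd_wp n : bd (e^-1 ^+ n) (wp e n).
Proof.
apply: bd_real; [apply: continuous_measurable_fun; exact: wtn_cont|exact: exprn_ge0|] => x.
by rewrite normrX lerXn2r ?nnegrE// wt_bound.
Qed.
Lemma bd_wp' n : bd (n%:R * e^-1 ^+ n.-1) (wp' e n).
Proof.
apply: bd_real; [apply: continuous_measurable_fun; exact: wpn_cont|by rewrite mulr_ge0// exprn_ge0|] => x.
have b1 : `|wt e x ^+ n.-1| <= e^-1 ^+ n.-1 by rewrite normrX lerXn2r ?nnegrE// wt_bound.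
have b2 := wt'_le1 x e0.
rewrite normrM (normrM n%:R) normr_nat; apply: le_trans (ler_wpM2l _ b2) _; first by rewrite mulr_ge0.
by rewrite mulr1 ler_wpM2l.
Qed.
Lemma md_wp n : md (wp e n) (wp' e n).
Proof.
apply: (md_weak _ (bd_wp n) (bd_wp' n)); apply: wdR_C1; last exact: wpn_cont.
move=> x; case: n => [|n].
  rewrite (_ : (fun x => _) = fun=> 1); last by apply/funext => y; rewrite expr0.
  rewrite !mul0r; exact: is_derive_cst.
have h1 : is_derive x 1 (fun x => wt e x ^+ n.+1) (n.+1%:R * wt e x ^+ n * wt' e x).
  have -> : (fun x => wt e x ^+ n.+1) = wt e ^+ n.+1 by rewrite exprfctE.
  apply: (is_derive_eq (is_deriveX n.+1 (wt_d x e0))).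
  by rewrite /GRing.scale /= ?mulr_natl.
exact: h1.
Qed.
Lemma bd_wt' : bd 1 (toC (wt' e)).
Proof.
apply: bd_real => //; first by apply: continuous_measurable_fun; exact: wt'_cont.
by move=> x; exact: wt'_le1.
Qed.
Lemma wp_comp a b f : mulf (wp e a) (mulf (wp e b) f) = mulf (wp e (a + b)) f.
Proof.
rewrite (mulf_comp f (bd_wp a) (bd_wp b)); congr (mulf _ f); apply/funext => x.
by rewrite /wp /toC exprD; apply: cplx_eq; rewrite !ReImE; ring.
Qed.
Lemma wp'_comp a b f : mulf (wp' e (a + b).+1) f = (a + b).+1%:R *: mulf (wp e a) (mulf (toC (wt' e)) (mulf (wp e b) f)).
Proof.
rewrite (mulf_comp f bd_wt' (bd_wp b)) (mulf_comp f (bd_wp a) (bdM bd_wt' (bd_wp b))).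
rewrite -mulf_real (mulf_comp f (bdcst _) (bdM (bd_wp a) (bdM bd_wt' (bd_wp b)))).
congr (mulf _ f); apply/funext => x.
by rewrite /wp' /wp /toC /= exprD; apply: cplx_eq; rewrite !ReImE; ring.
Qed.
Lemma wp_sym n f g : dot (mulf (wp e n) f) g = dot f (mulf (wp e n) g).
Proof. exact: dot_mulf_real (bd_wp n). Qed.
Lemma wp_J n f : mulf (wp e n) (J f) = J (mulf (wp e n) f).
Proof. exact: mulfJ (bd_wp n). Qed.
Lemma wp0 f : mulf (wp e 0) f = f.
Proof. by rewrite (_ : wp e 0 = fun=> 1) ?mulf1//; apply/funext => x; rewrite /wp /toC expr0. Qed.
Lemma wp_sqr n f : `|mulf (wp e n) f| ^+ 2 = dot f (mulf (wp e (n + n)) f).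
Proof. by rewrite nrm_sqr wp_sym wp_comp. Qed.

Lemma dot_real_ge0 (q : R -> R) K f : bd K (toC q) -> (forall x, 0 <= q x) -> 0 <= dot (mulf (toC q) f) f.
Proof.
move=> bq q0; have mq : Cmeasurable (fun x => toC q x * f x) by apply: CmM => //; case: bq.
rewrite (dot_ae _ _ (mulfE f bq) (ae_eq_refl f))//.
apply: fine_ge0; apply: integral_ge0 => x _; rewrite lee_fin.
have -> : rdot (toC q x * f x) (f x) = q x * n2 (f x) by rewrite /rdot /n2 /toC !ReImE; ring.
by rewrite mulr_ge0// n2_ge0.
Qed.
(** Where |w| <= sg the weight is at most sg^p, and elsewhere sg^-2 w^2 >= 1. The pointwise
    inequality is integrated as positivity of the multiplier [q]. *)
Lemma wp_low p (sg : R) f : 0 < sg ->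
  `|mulf (wp e p) f| <= sg ^+ p * `|f| + sg ^- 2 * `|mulf (wp e p.+2) f|.
Proof.
move=> s0; pose a := sg ^+ (p + p); pose b := (sg ^- 2) ^+ 2.
have a0 : 0 <= a by rewrite exprn_ge0// ltW.
have b0 : 0 <= b by rewrite sqr_ge0.
pose q x : R := a + b * wt e x ^+ (p.+2 + p.+2) - wt e x ^+ (p + p).
have cq : continuous q.
  move=> x; apply: cvgB; last exact: wtn_cont.
  by apply: cvgD; [exact: cvg_cst|apply: cvgMr; exact: wtn_cont].
have q0 x : 0 <= q x.
  rewrite /q subr_ge0; have := real_normK (num_real (wt e x)).
  rewrite !addnn -!muln2 ![(_ * 2)%N]mulnC !exprM /a /b addnn -muln2 mulnC exprM => <-.
  have w0 := normr_ge0 (wt e x); move: w0; set w := `|wt e x| => w0.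
  have [ws|sw] := leP w sg.
    apply: le_trans (_ : (sg ^+ 2) ^+ p <= _); last by rewrite lerDl mulr_ge0 ?sqr_ge0// exprn_ge0// sqr_ge0.
    by rewrite lerXn2r ?nnegrE ?sqr_ge0// lerXn2r ?nnegrE// ltW.
  have wp_ : 0 < w by exact: lt_trans sw.
  apply: le_trans (_ : (sg ^- 2) ^+ 2 * (w ^+ 2) ^+ p.+2 <= _); last by rewrite lerDr exprn_ge0// sqr_ge0.
  have -> : (w ^+ 2) ^+ p.+2 = w ^+ 4 * (w ^+ 2) ^+ p by rewrite !exprS; ring.
  rewrite mulrA ler_peMl// ?exprn_ge0 ?sqr_ge0//.
  rewrite exprVn -exprM mulrC ler_pdivlMr ?exprn_gt0// mul1r.
  by rewrite lerXn2r ?nnegrE// ltW.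
pose K := a + b * e^-1 ^+ (p.+2 + p.+2) + e^-1 ^+ (p + p).
have bq : bd K (toC q).
  apply: bd_real; first exact: continuous_measurable_fun.
    by apply: addr_ge0; [apply: addr_ge0 => //; apply: mulr_ge0 => //|]; exact: exprn_ge0.
  move=> x; have b1 n : `|wt e x ^+ n| <= e^-1 ^+ n by rewrite normrX lerXn2r ?nnegrE// wt_bound.
  apply: le_trans (ler_normB _ _) _; apply: lerD => //.
  apply: le_trans (ler_normD _ _) _; apply: lerD; first by rewrite ger0_norm.
  by rewrite normrM (ger0_norm b0) ler_wpM2l.
have := dot_real_ge0 f bq q0.
have bc n := bd_wp n.
have -> : mulf (toC q) f = a *: f + b *: mulf (wp e (p.+2 + p.+2)) f - mulf (wp e (p + p)) f.
  rewrite -!mulf_real (mulf_comp f (bdcst _) (bc _)).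
  rewrite -(mulfDl f (bdcst _) (bdM (bdcst _) (bc _))) -(mulfBl f (bdD (bdcst _) (bdM (bdcst _) (bc _))) (bc _)).
  congr (mulf _ f); apply/funext => x; rewrite /q /wp /toC.
  by apply: cplx_eq; rewrite !ReImE; ring.
rewrite dotBl dotDl !dotZl !(dotC (mulf _ _)) -!wp_sqr -nrm_sqr => h.
have s2 : 0 <= sg ^- 2 by rewrite invr_ge0 sqr_ge0.
rewrite -(ler_pXn2r (n := 2))// ?nnegrE ?addr_ge0 ?mulr_ge0 ?exprn_ge0 ?(ltW s0)//.
have aE : a = (sg ^+ p) ^+ 2 by rewrite -exprM muln2 -addnn.
have : 0 <= sg ^+ p * `|f| * (sg ^- 2 * `|mulf (wp e p.+2) f|) by rewrite !mulr_ge0 ?exprn_ge0// ltW.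
rewrite sqrrD !exprMn -aE -/b mulr2n; lra.
Qed.
End weights.

(** * Almost convex finite sequences *)

Section sequences.
Context {R : realType}.
(** The slopes r_j / j from the origin increase, in the form (j + 1) r_j <= j r_(j+1), so the sign
    at the right end propagates downwards. *)
Lemma convex_seq (s : nat) (r : nat -> R) : (forall j, (0 < j < s)%N -> r j <= (r j.-1 + r j.+1) / 2) ->
  r 0%N = 0 -> r s = 0 -> forall j, (j <= s)%N -> r j <= 0.
Proof.
move=> h r0 rs.
have st j : (j < s)%N -> j.+1%:R * r j <= j%:R * r j.+1.
  elim: j => [|j IH] js; first by rewrite r0 mulr0 mul0r.
  have n0 : 0 <= j%:R :> R by [].
  have h2 := IH (ltnW js); have h1 : r j.+1 <= (r j + r j.+2) / 2 by apply: (h j.+1); rewrite js.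
  have h3 := ler_wpM2l (addr_ge0 n0 ler01) h1.
  rewrite -[j.+2%:R]natr1 -[j.+1%:R]natr1; rewrite -natr1 in h2.
  move: h2 h3; set n := j%:R; set a := r j; set b := r j.+1; set c := r j.+2.
  have -> : (n + 1) * ((a + c) / 2) = ((n + 1) * a + (n + 1) * c) / 2 by field.
  have -> : (n + 1 + 1) * b = n * b + b + b by ring.
  have -> : (n + 1) * b = n * b + b by ring.
  set p := _ * a; set q := n * b; set w := _ * c => *; lra.
move=> j /subnKC; move: (s - j)%N => n; elim: n j => [|n IH] j jn.
  by rewrite addn0 in jn; rewrite jn rs.
have js : (j < s)%N by rewrite -jn -addSnnS leq_addr.
have := IH j.+1; rewrite addSnnS => /(_ jn) h1.
have := st j js; have : 0 < j.+1%:R :> R by [].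
have : 0 <= j%:R :> R by [].
set a := j%:R; set b := j.+1%:R => a0 b0 h2.
have : a * r j.+1 <= 0 by rewrite mulr_ge0_le0.
move=> h3; rewrite -(pmulr_rle0 _ b0); lra.
Qed.
(** The sequence is compared with the chord from a_0 to a_s plus the parabola eta j (s - j), whose
    second difference compensates the defect. The defect involves the sum of the a_j, which is
    absorbed for small e. *)
Lemma almost_convex (s : nat) (ep : R) : (0 < s)%N -> 0 < ep -> exists2 e0 : R, 0 < e0 &
  forall (e X : R) (a : nat -> R), 0 <= e <= e0 -> 0 <= X -> (forall j, 0 <= a j) ->
  (forall j, (0 < j < s)%N -> a j <= (a j.-1 + a j.+1) / 2 + e * (a j.-1 + X)) ->
  a 1%N <= (1 - s%:R^-1 + ep) * a 0%N + (s%:R^-1 + ep) * a s + ep * X.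
Proof.
move=> s0 ep0; have sp : 0 < s%:R :> R by rewrite ltr0n.
pose n : R := s.+1%:R; have n0 : 0 < n by [].
have s2n : (s%:R : R) ^+ 2 <= n ^+ 2 by rewrite lerXn2r ?nnegrE// ler_nat.
have dp : 0 < Num.min (n ^+ 3 * 2)^-1 (ep / (n ^+ 2 * 4)).
  by rewrite lt_min invr_gt0 !divr_gt0 ?mulr_gt0 ?exprn_gt0.
(* The first bound lets the sum [Sg] be absorbed, the second makes the parabola at j = 1 at most
   [ep] times the data. *)
exists (Num.min (n ^+ 3 * 2)^-1 (ep / (n ^+ 2 * 4))) => // e X a /andP[e0]; rewrite le_min => /andP[e1 e2] X0 a0 h.
pose Sg := \sum_(j < s.+1) a j.
have aS j : (j <= s)%N -> a j <= Sg.
  move=> js; rewrite /Sg (bigD1 (Ordinal (js : (j < s.+1)%N)))//= lerDl.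
  by apply: sumr_ge0 => i _.
have Sg0 : 0 <= Sg by apply: sumr_ge0 => i _.
pose eta := e * (Sg + X).
have eta0 : 0 <= eta by rewrite mulr_ge0// addr_ge0.
pose l j : R := (1 - j%:R / s%:R) * a 0%N + j%:R / s%:R * a s + eta * (j%:R * (s%:R - j%:R)).
have hl j : (j <= s)%N -> a j <= l j.
  move=> js; rewrite -subr_le0; apply: (@convex_seq s (fun j => a j - l j)) js.
  - move=> [//|i] /andP[_ is_]; have := h i.+1; rewrite is_ /= => /(_ isT).
    have : e * (a i + X) <= eta by rewrite ler_wpM2l// lerD2r aS// ltnW// ltnW.
    have -> : l i.+1 = (l i + l i.+2) / 2 + eta.
      by rewrite /l -!natr1; field; rewrite gt_eqF.
    lra.
  - by rewrite /l !mul0r mulr0 !addr0 subr0 mul1r subrr.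
  - by rewrite /l divff ?gt_eqF// !subrr mul0r !mulr0 add0r addr0 mul1r subrr.
have l1 j : (j <= s)%N -> l j <= a 0%N + a s + eta * n ^+ 2.
  move=> js; have j1 : j%:R / s%:R <= 1 :> R by rewrite ler_pdivrMr// mul1r ler_nat.
  have j0 : 0 <= j%:R / s%:R :> R by rewrite divr_ge0// ltW.
  have jj0 : 0 <= j%:R :> R by [].
  have jj1 : j%:R <= s%:R :> R by rewrite ler_nat.
  have q : j%:R * (s%:R - j%:R) <= n ^+ 2 :> R by apply: le_trans s2n; rewrite expr2; nra.
  rewrite /l; apply: lerD; last by rewrite ler_wpM2l.
  have := a0 0%N; have := a0 s; move: j1 j0; set y := _ / _; nra.
have hS : Sg <= n * (a 0%N + a s + eta * n ^+ 2).
  apply: le_trans (ler_sum _ (_ : forall i : 'I_s.+1, true -> _ <= a 0%N + a s + eta * n ^+ 2)) _.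
    move=> i _; have js : (i <= s)%N by rewrite -ltnS ltn_ord.
    exact: le_trans (hl i js) (l1 i js).
  by rewrite sumr_const card_ord mulr_natl.
have k1 : eta * n ^+ 3 <= (Sg + X) / 2.
  have en : e * n ^+ 3 <= 2^-1.
    apply: le_trans (ler_wpM2r (exprn_ge0 3 (ltW n0)) e1) _.
    by rewrite le_eqVlt; apply/orP; left; apply/eqP; field; rewrite gt_eqF.
  have -> : eta * n ^+ 3 = (Sg + X) * (e * n ^+ 3) by rewrite /eta; ring.
  by rewrite ler_wpM2l ?addr_ge0.
have n1 : 1 <= n by rewrite ler1n.
have hS2 : Sg <= 2 * n * (a 0%N + a s) + X.
  have E : n * (a 0%N + a s + eta * n ^+ 2) = n * (a 0%N + a s) + eta * n ^+ 3 by ring.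
  rewrite E in hS; have E2 : 2 * n * (a 0%N + a s) = 2 * (n * (a 0%N + a s)) by ring.
  by rewrite E2; move: hS k1; set p := n * _ => *; lra.
have k2 : eta * n <= ep * (a 0%N + a s + X).
  apply: le_trans (_ : ep / (n ^+ 2 * 4) * (Sg + X) * n <= _).
    by rewrite ler_wpM2r ?(ltW n0)// ler_wpM2r// addr_ge0.
  have -> : ep / (n ^+ 2 * 4) * (Sg + X) * n = ep * ((Sg + X) / (4 * n)) by field; rewrite gt_eqF.
  rewrite ler_wpM2l ?(ltW ep0)// ler_pdivrMr ?mulr_gt0//.
  have := a0 0%N; have := a0 s; nra.
apply: le_trans (hl 1%N s0) _.
have : l 1%N <= (1 - s%:R^-1) * a 0%N + s%:R^-1 * a s + eta * n.
  have hh : s%:R - 1 <= n by rewrite /n -natr1; lra.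
  by rewrite /l mul1r mul1r lerD2l ler_wpM2l.
have := a0 0%N; have := a0 s; lra.
Qed.
End sequences.

(** * Evolution of the weighted norm *)

Section evolution.
Context {R : realType}.
Local Notation H := (Hsp R).
Local Notation mu := (@lebesgue_measure R).
Implicit Types (v f g : H).
Hint Resolve L2h Cmh : core.

Lemma itE k (K : R) (u : H) : bd K u -> ae_equal (it k u) (fun x => ((n2 (u x)) ^+ k)%:C * u x).
Proof.
move=> bu; have bcj := bdHcj bu.
elim: k => [|k IH].
  by apply: aeW' => x; rewrite expr0 mul1r.
have bq := bd_mulf bu bcj.
rewrite /it iterS -/(it k u).
apply: aeS (aeI (aeI (mulfE (it k u) bq) IH) (aeI (mulfE (cj u) bu) (cjE u))) => x [[-> ->] [-> ->]].
by rewrite exprS; apply: cplx_eq; rewrite !ReImE /n2; ring.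
Qed.

Section Zderiv.
Variables (S : R -> H -> H) (c0 : R -> R) (K : R) (lam : R) (k : nat) (u : R -> H).
Hypotheses (hS : schr S (toC c0)) (bc : bd K (toC c0)).
Hypothesis uH1 : contH 1 u.
Hypothesis uD : forall v (t : R), is_derive t 1 (fun t => dot (S (- t) (u t)) v) (dot (J (S (- t) (NL lam k (u t)))) v).
(** The right-hand side of the equation in H^1 form: one of the two derivatives of u has been moved
    to the test vector, so that both need only lie in H^1. *)
Let F (t : R) (psi : H) : R := dot (J (NL lam k (u t) + mulf (toC c0) (u t))) psi + dot (D (u t)) (J (D psi)).

Lemma WS_F psi (t : R) : Hm 2 psi -> is_derive t 1 (fun t => dot (u t) psi) (F t psi).
Proof.
move=> hp; have := WS_u hS uH1 uD t hp; congr (is_derive _ _ _ _).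
have [p1 [p2 _]] := hp.
rewrite /F JD /Bop JD dotDl dotDr -(mulfJ _ bc) -(dot_mulf_real _ _ bc) !dotJl.
have -> : dot (u t) (J (D (D psi))) = - dot (D (u t)) (J (D psi)).
  by rewrite (wd_skew (uH1.1 t).1 (wd_J p2)) opprK.
by gen_dots; ring.
Qed.
Lemma F_lin t a b : Hm 1 a -> Hm 1 b -> F t (a - b) = F t a - F t b.
Proof. by move=> ha hb; rewrite /F DB// JB !dotBr; gen_dots; ring. Qed.
Lemma F_bound (T0 : R) : exists2 C : R, 0 <= C & forall t psi, `|t| <= T0 -> `|F t psi| <= C * hn 1 psi.
Proof.
have [B B0 hB] := contH_bounded T0 uH1.
have [B' B'0 hB'] := contH_bounded T0 (contH_NL lam k (ltn0Sn 0) uH1).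
exists (B' + K * B + B); first by rewrite !addr_ge0// mulr_ge0// (bd_ge0 bc).
move=> t psi ht; have b1 := hB t ht; have b2 := hB' t ht.
have n1 : `|u t| <= B by apply: le_trans b1; rewrite /= lerDl.
have n2 : `|D (u t)| <= B by apply: le_trans b1; rewrite /= lerDr.
have n3 : `|NL lam k (u t)| <= B' by apply: le_trans b2; rewrite /= lerDl.
apply: le_trans (ler_normD _ _) _.
apply: le_trans (lerD (dot_le _ _) (dot_le _ _)) _; rewrite !nrmJ.
have q1 : `|NL lam k (u t) + mulf (toC c0) (u t)| <= B' + K * B.
  apply: le_trans (ler_normD _ _) _; apply: lerD => //.
  by apply: le_trans (mulf_le _ bc) _; rewrite ler_wpM2l// (bd_ge0 bc).
rewrite [in X in _ <= X]mulrDl; apply: lerD.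
  by apply: ler_pM => //=; rewrite lerDl.
by apply: ler_pM => //=; rewrite lerDr.
Qed.
Lemma F_cont psi : continuous (F ^~ psi).
Proof.
move=> t; rewrite /F; have hN := contH_continuous (contH_NL lam k (ltn0Sn 0) uH1).
have hu := contH_continuous uH1.
have hX : continuous (fun t => mulf (toC c0) (u t)).
  by apply: (@lip_cont R u (mulf (toC c0)) K (bd_ge0 bc)) => // x y; rewrite -(mulfB _ _ bc); exact: mulf_le.
have hDu : continuous (fun t => D (u t)).
  apply/contH0; split=> // t0 e e0; have [d d0 hd] := uH1.2 t0 e e0; exists d => // s hs.
  apply: le_trans (hd s hs); rewrite [leRHS]/= DB; [by rewrite /= lerDr|exact: uH1.1|exact: uH1.1].
apply: cvgD; apply: cvg_dotl; last exact: hDu.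
apply: J_cont => t1; apply: cvgD; [exact: hN|exact: hX].
Qed.
(** The test vector is approached in H^1 from H^2, and the derivatives converge uniformly on bounded
    times by [F_bound]. *)
Lemma WS_H1 psi (t : R) : Hm 1 psi -> is_derive t 1 (fun t => dot (u t) psi) (F t psi).
Proof.
move=> hp; have [g hg] : exists g : nat -> H, forall n, Hm 2 (g n) /\ hn 1 (g n - psi) <= 2^-1 ^+ n.
  have h n : exists g, Hm 2 g /\ hn 1 (g - psi) <= 2^-1 ^+ n.
    have e0 : 0 < (2^-1 : R) ^+ n by rewrite exprn_gt0.
    by have [g h1 h2] := Hm_dense hp e0; exists g.
  by have [g hg] := choice h; exists g.
move: t; apply: (@deriv_limit R (fun n t => dot (u t) (g n)) (fun n t => F t (g n))).
- by move=> n t; apply: WS_F; exact: (hg n).1.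
- move=> t; apply: (@cvg_dot R _ _ _ (fun=> u t)); first exact: cvg_cst.
  apply/cvgrPdist_le => e e0; have [n0 hn0] := expn_small e0; exists n0 => // n /= nn.
  rewrite distrC; apply: le_trans (nrm_hn 1 _) _; apply: le_trans (hg n).2 _; apply: le_trans hn0.
  by apply: ler_wiXn2l => //; lra.
- exact: F_cont.
move=> T0 e e0; have [C C0 hC] := F_bound T0.
have e1 : 0 < e / (C + 1) by rewrite divr_gt0// ltr_wpDl.
have [n0 hn0] := expn_small e1; exists n0 => // n /= nn t ht.
rewrite -F_lin//; last exact: Hm_S (hg n).1.
apply: le_trans (hC t _ ht) _.
have q : hn 1 (g n - psi) <= e / (C + 1).
  by apply: le_trans (hg n).2 _; apply: le_trans hn0; apply: ler_wiXn2l => //; lra.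
apply: le_trans (ler_wpM2l C0 q) _; by rewrite mulrA ler_pdivrMr ?ltr_wpDl//; nra.
Qed.
Lemma is_derive_est (f : R -> R) (t d : R) : (forall e : R, 0 < e -> exists2 r : R, 0 < r &
   forall s, `|s - t| <= r -> `|f s - f t - d * (s - t)| <= e * `|s - t|) -> is_derive t 1 f d.
Proof.
move=> h; suff hc : h^-1 *: ((f \o shift t) (h *: (1 : R)) - f t) @[h --> (0:R)^'] --> d.
  by split; [apply/cvg_ex; exists d|exact: (cvg_lim (@Rhausdorff R) hc)].
apply/cvgrPdist_le => e e0; have [r r0 hr] := h e e0.
exists r => //= y /=; rewrite sub0r normrN => kr k0.
have := hr (y + t); rewrite addrK => /(_ (ltW kr)) => hk.
rewrite /GRing.scale /= mulr1 -(ler_pM2r (_ : 0 < `|y|)) ?normr_gt0// -normrM mulrBl mulrAC mulVf// mul1r distrC.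
exact: hk.
Qed.
Variables (q q' : R -> R) (Kq Kq' : R).
Hypotheses (bq : bd Kq (toC q)) (bq' : bd Kq' (toC q')) (mq : md (toC q) (toC q')).
Lemma Q_Hm v : Hm 1 v -> Hm 1 (mulf (toC q) v) /\ hn 1 (mulf (toC q) v) <= (Kq + Kq') * hn 1 v.
Proof.
move=> [hv _]; have w := mq hv; split; first by apply/HmSP; exists (mulf (toC q') v + mulf (toC q) (D v)).
rewrite /= (DE w); apply: le_trans (lerD (mulf_le _ bq) (ler_normD _ _)) _.
apply: le_trans (lerD (lexx _) (lerD (mulf_le _ bq') (mulf_le _ bq))) _.
have := bd_ge0 bq; have := bd_ge0 bq'; have := normr_ge0 v; have := normr_ge0 (D v); nra.
Qed.
Lemma dot_J_real (r : R -> R) Kr (x : H) : bd Kr (toC r) -> dot x (J (mulf (toC r) x)) = 0.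
Proof.
move=> br; have := dotJl x (mulf (toC r) x).
by rewrite -(dot_mulf_real _ _ br) (mulfJ _ br) dotC => h; lra.
Qed.
Lemma dot_J2 (r r' : R -> R) Kr Kr' (x : H) : bd Kr (toC r) -> bd Kr' (toC r') ->
  dot (J (mulf (toC r) x)) (mulf (toC r') x) = 0.
Proof.
move=> br br'; rewrite -(mulfJ _ br) (dot_mulf_real _ _ br) (mulf_comp _ br br') dotJl.
have E : (fun y => toC r y * toC r' y) = toC (fun y => r y * r' y).
  by apply/funext => y; rewrite /toC; apply: cplx_eq; rewrite !ReImE; ring.
have bb := bdM br br'; rewrite E in bb *.
by rewrite (dot_J_real x bb) oppr0.
Qed.
Lemma it_real (x : H) : Hm 1 x -> exists r : R -> R, exists2 Kr, bd Kr (toC r) & it k x = mulf (toC r) x.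
Proof.
move=> hx; have bx := bd_hn (ltn0Sn 0) hx; have [_ B0 hB] := bx; set B := 2 * _ in bx B0 hB.
have br : bd (B ^+ 2 ^+ k) (toC (fun y => n2 (x y) ^+ k)).
  split; [apply: CmC|by rewrite !exprn_ge0|].
    by apply: measurable_funX; exact: m_n2.
  apply: aeS hB => y hy; rewrite n2C lerXn2r ?nnegrE ?exprn_ge0 ?sqr_ge0 ?n2_ge0//.
  by rewrite lerXn2r ?nnegrE ?sqr_ge0 ?n2_ge0.
exists (fun y => n2 (x y) ^+ k), (B ^+ 2 ^+ k) => //; apply: eqH.
by apply: aeS (aeI (itE k bx) (mulfE x br)) => y [-> ->].
Qed.
(** A real multiple of u pairs to zero with i times another real multiple of u, so the potential and
    the nonlinearity drop out and only the derivative of the weight remains. *)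
Lemma F_Q t : F t (mulf (toC q) (u t)) = dot (D (u t)) (J (mulf (toC q') (u t))).
Proof.
have [hv _] := uH1.1 t; rewrite /F (DE (mq hv)) !JD dotDr dotDl (dot_J_real _ bq).
rewrite (dot_J2 _ bc bq); have [r [Kr br E]] := it_real (uH1.1 t).
by rewrite /NL E JZ dotZl (dot_J2 _ br bq) mulr0 !addr0 add0r.
Qed.
Lemma mv_real (f f' : R -> R) (t d e r : R) : (forall x : R, is_derive x 1 f (f' x)) ->
  (forall x, `|x - t| <= r -> `|f' x - d| <= e) -> forall y, `|y - t| <= r -> `|f y - f t - d * (y - t)| <= e * `|y - t|.
Proof.
move=> hf h y yr.
have h1 (x : R) : is_derive x 1 (fun x => f x - d * x) (f' x - d) by apply: is_deriveB; exact: is_derive_lin.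
have h2 (x : R) : is_derive x 1 (fun x => e * x) e by exact: is_derive_lin.
have E : f y - f t - d * (y - t) = (f y - d * y) - (f t - d * t) by ring.
rewrite E; have [ty|yt] := leP t y.
  rewrite [X in _ <= _ * X]ger0_norm ?subr_ge0// mulrBr.
  apply: mono_norm ty (fun x _ => h1 x) (fun x _ => h2 x) _ => x /andP[x1 x2]; apply: h.
  by apply: le_trans yr; rewrite !ger0_norm ?subr_ge0 ?lerD2r// (le_trans x1).
have -> : `|y - t| = t - y by rewrite distrC ger0_norm// subr_ge0 ltW.
rewrite distrC mulrBr.
apply: mono_norm (ltW yt) (fun x _ => h1 x) (fun x _ => h2 x) _ => x /andP[x1 x2]; apply: h.
by move: yr; rewrite !ler_norml => /andP[? ?]; apply/andP; split; lra.
Qed.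
(** As u is only weakly differentiable, the increment of the quadratic quantity is rewritten by
    symmetry as the increment of u paired with the fixed vector q u(y) + q u(t), to which the mean
    value inequality applies. *)
Lemma Zd (t : R) : is_derive t 1 (fun t => dot (u t) (mulf (toC q) (u t)))
   (2 * dot (D (u t)) (J (mulf (toC q') (u t)))).
Proof.
apply: is_derive_est => e e0.
have [C C0 hC] := F_bound (`|t| + 1).
have Kq0 := bd_ge0 bq; have Kq'0 := bd_ge0 bq'.
pose A := C * (Kq + Kq').
have A0 : 0 <= A by rewrite mulr_ge0// addr_ge0.
have e1 : 0 < e / 2 / (A + 1) by rewrite !divr_gt0// ltr_wpDl.
have e2 : 0 < e / 2 by rewrite divr_gt0.
have [d1 d10 hd1] := uH1.2 t _ e1.
pose psi0 := mulf (toC q) (u t) + mulf (toC q) (u t).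
have Hq v (hv : Hm 1 v) := (Q_Hm hv).1.
have Hp0 : Hm 1 psi0 by apply: HmD; exact: Hq (uH1.1 t).
have /cvgrPdist_le/(_ _ e2)[d2 /= d20 hd2] := @F_cont psi0 t.
pose r := Num.min 1 (Num.min d1 (d2 / 2)).
have r0 : 0 < r.
  have d22 : 0 < d2 / 2 by rewrite divr_gt0.
  by rewrite /r; have [_|_] := leP d1 (d2 / 2); rewrite lt_min ltr01.
exists r => // y yr.
pose psi := mulf (toC q) (u y) + mulf (toC q) (u t).
have Hp : Hm 1 psi by apply: HmD; exact: Hq (uH1.1 _).
have E : dot (u y) (mulf (toC q) (u y)) - dot (u t) (mulf (toC q) (u t)) = dot (u y) psi - dot (u t) psi.
  rewrite /psi !dotDr -(dot_mulf_real (u t) (u y) bq) (dotC (mulf _ (u t))); gen_dots; ring.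
have Ed : 2 * dot (D (u t)) (J (mulf (toC q') (u t))) = F t psi0.
  rewrite -F_Q; have := F_lin t Hp0 (Hq _ (uH1.1 t)); rewrite /psi0 addrK => h.
  by move: h; set x := F t _ => h; lra.
rewrite E Ed.
apply: (@mv_real (fun t => dot (u t) psi) (fun t => F t psi) t (F t psi0) e r) => //.
  by move=> x; exact: WS_H1.
move=> x; rewrite /r !le_min => /andP[x1 /andP[x2 x3]].
have xT : `|x| <= `|t| + 1.
  have h3 : `|x| <= `|x - t| + `|t| by rewrite -{1}(subrK t x) ler_normD.
  by apply: le_trans h3 _; rewrite addrC lerD2l.
have -> : F x psi - F t psi0 = F x (psi - psi0) + (F x psi0 - F t psi0).
  by rewrite F_lin// addrA subrK.
apply: le_trans (ler_normD _ _) _.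
have E2 : psi - psi0 = mulf (toC q) (u y - u t) by rewrite (mulfB _ _ bq) /psi /psi0; hring.
have yd1 : `|y - t| <= d1 by move: yr; rewrite /r !le_min => /andP[_ /andP[]].
have k1 : `|F x (psi - psi0)| <= A * (e / 2 / (A + 1)).
  apply: le_trans (hC x _ xT) _; rewrite E2 /A -mulrA ler_wpM2l//.
  apply: le_trans (Q_Hm (HmB (uH1.1 y) (uH1.1 t))).2 _.
  by rewrite ler_wpM2l ?addr_ge0// hd1.
have k2 : `|F x psi0 - F t psi0| <= e / 2.
  rewrite distrC; apply: hd2 => /=; rewrite distrC; apply: le_lt_trans x3 _.
  by rewrite ltr_pdivrMr// ltr_pMr// ltr1n.
have k3 : A * (e / 2 / (A + 1)) <= e / 2 by rewrite mulrA ler_pdivrMr ?ltr_wpDl//; nra.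
lra.
Qed.
End Zderiv.

(** Integration by parts in the integral of w^(2p+2) |D v|^2; the derivative of the weight gives the
    lower-order term because |w'| <= 1. *)
Lemma weighted_interp (e : R) p (v : H) : 0 < e <= 1 -> Hm 2 v ->
  `|mulf (wp e p.+1) (D v)| ^+ 2 <= `|mulf (wp e p.+2) v| * `|mulf (wp e p) (D (D v))| +
    2 * p.+1%:R * `|mulf (wp e p) v| * `|mulf (wp e p.+1) (D v)|.
Proof.
move=> e01 [h1 [h2 _]].
have w := md_wp e01 (p + p.+1).+1 h2.
have := wd_skew w h1; rewrite dotDl (wp'_comp e01) dotZl.
have -> : dot (mulf (wp e (p + p.+1).+1) (D v)) (D v) = `|mulf (wp e p.+1) (D v)| ^+ 2.
  by rewrite (wp_sqr e01) dotC addSn.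
have -> : dot (mulf (wp e (p + p.+1).+1) (D (D v))) v = dot (mulf (wp e p) (D (D v))) (mulf (wp e p.+2) v).
  by rewrite -(wp_sym e01) (wp_comp e01); congr (dot (mulf (wp e _) _) _); lia.
rewrite (wp_sym e01); set A := `|_ (D v)|.
set X := dot (mulf (toC _) _) _; set Y := dot (mulf (wp e p) _) _ => E.
have x1 : `|X| <= A * `|mulf (wp e p) v|.
  apply: le_trans (dot_le _ _) _; rewrite ler_wpM2r//.
  by have := mulf_le (mulf (wp e p.+1) (D v)) (bd_wt' e01); rewrite mul1r.
have y1 : `|Y| <= `|mulf (wp e p.+2) v| * `|mulf (wp e p) (D (D v))| by rewrite mulrC; exact: dot_le.
have n0 : 0 <= (p + p.+1).+1%:R :> R by [].
have nE : (p + p.+1).+1%:R = 2 * p.+1%:R :> R by rewrite -natrM; congr (_%:R); lia.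
have := ler_wpM2l n0 x1; have := ler_norm (- X); have := ler_norm (- Y); rewrite !normrN nE => a1 a2 a3.
have a4 := ler_wpM2l n0 a2; rewrite nE in a4.
have -> : A ^+ 2 = 2 * p.+1%:R * - X - Y by rewrite nE in E; lra.
have -> : 2 * p.+1%:R * `|mulf (wp e p) v| * A = 2 * p.+1%:R * (A * `|mulf (wp e p) v|) by ring.
lra.
Qed.
Lemma amgm_abs (x y z c : R) : 0 <= x -> 0 <= y -> 0 <= z -> 0 <= c -> x ^+ 2 <= y * z + c * x -> x <= (y + z) / 2 + c.
Proof.
move=> x0 y0 z0 c0 h; rewrite leNgt; apply/negP => hx.
have h1 : ((y + z) / 2) ^+ 2 >= y * z by have := sqr_ge0 (y - z); nra.
have h2 : (y + z) / 2 <= x - c by lra.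
have h3 : 0 <= (y + z) / 2 by lra.
have : x ^+ 2 - c * x = x * (x - c) by ring.
nra.
Qed.
(** The numbers sg^j |w^(s-j) D^j u| are almost convex with defect 2 s / sg: [weighted_interp] and
    the arithmetic-geometric mean give the average of the neighbours, and [wp_low] bounds the
    defect. *)
Lemma n1_bound (s : nat) (ep : R) : (0 < s)%N -> 0 < ep -> exists2 sg0 : R, 1 <= sg0 & forall (e sg B d : R) (u : H),
  0 < e <= 1 -> sg0 <= sg -> Hm s u -> hn s u <= B -> `|Dn s u| <= d ->
  sg * `|mulf (wp e s.-1) (D u)| <= (1 - s%:R^-1 + ep) * `|mulf (wp e s) u| + sg ^+ s * ((s%:R^-1 + ep) * d + ep * B).
Proof.
move=> s0 ep0; have [e0 e00 h] := almost_convex s0 ep0.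
have sp : 0 < s%:R :> R by rewrite ltr0n.
exists (2 * s%:R / e0 + 1); first by rewrite lerDr divr_ge0 ?mulr_ge0// ltW.
move=> e sg B d u e01 hsg hu hB hd.
have q0 : 0 <= 2 * s%:R / e0 by rewrite divr_ge0 ?mulr_ge0// ltW.
have sg0 : 0 < sg by lra.
have B0 : 0 <= B by apply: le_trans hB; exact: hn_ge0.
pose a j := sg ^+ j * `|mulf (wp e (s - j)) (Dn j u)|.
have := h (2 * s%:R / sg) (sg ^+ s * B) a.
have -> : a 1%N = sg * `|mulf (wp e s.-1) (D u)| by rewrite /a expr1 subn1.
have -> : a 0%N = `|mulf (wp e s) u| by rewrite /a expr0 mul1r subn0.
have aS : a s = sg ^+ s * `|Dn s u| by rewrite /a subnn wp0.
move=> /(_ _ _ _ _) hh.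
apply: le_trans (hh _ _ _ _) _.
- rewrite divr_ge0 ?mulr_ge0 ?(ltW sg0)//=.
  by rewrite ler_pdivrMr// -ler_pdivrMl// mulrC; lra.
- by rewrite mulr_ge0// exprn_ge0// ltW.
- by move=> j; rewrite mulr_ge0// exprn_ge0// ltW.
- move=> [//|j] /andP[_ js]; rewrite [j.+1.-1]/=.
  have [p sE] : exists p, s = (j + p.+2)%N.
    by exists (s - j.+2)%N; rewrite -addSnnS -addSnnS addnC subnK.
  have Hj : Hm 2 (Dn j u) by apply: Hm_Dn; apply: Hm_le hu; rewrite sE leq_add2l.
  have e1 : (s - j)%N = p.+2 by rewrite sE addKn.
  have e2 : (s - j.+1)%N = p.+1 by rewrite subnS e1.
  have e3 : (s - j.+2)%N = p by rewrite subnS e2.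
  have hp : p.+1%:R <= s%:R :> R by rewrite ler_nat sE addnS ltnS; apply: leq_trans (leq_addl _ _).
  have := weighted_interp p e01 Hj; have := wp_low e01 p (Dn j u) sg0.
  rewrite /a e1 e2 e3 /=.
  have hDj : `|Dn j u| <= B by apply: le_trans hB; apply: Dn_hn; exact: ltnW (ltnW js).
  rewrite -/(Dn j u).
  set A := `|mulf (wp e p.+1) _|; set X := `|mulf (wp e p.+2) _|; set Y := `|mulf (wp e p) (D (D _))|.
  set L := `|mulf (wp e p) (Dn j u)| => hL hA.
  pose c := 2 * p.+1%:R * (sg ^+ j.+1 * L).
  have L0 : 0 <= L by exact: normr_ge0.
  have A0' : 0 <= A by exact: normr_ge0.
  have X0' : 0 <= X by exact: normr_ge0.
  have Y0' : 0 <= Y by exact: normr_ge0.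
  have g1 n : 0 <= sg ^+ n by rewrite exprn_ge0// ltW.
  have c0 : 0 <= c by rewrite !mulr_ge0.
  have k1 : sg ^+ j.+1 * A <= (sg ^+ j * X + sg ^+ j.+2 * Y) / 2 + c.
    apply: amgm_abs; [exact: mulr_ge0|exact: mulr_ge0|exact: mulr_ge0|by []|].
    have -> : (sg ^+ j.+1 * A) ^+ 2 = (sg ^+ j * sg ^+ j.+2) * A ^+ 2 by rewrite !exprS; ring.
    apply: le_trans (ler_wpM2l (mulr_ge0 (g1 _) (g1 _)) hA) _.
    rewrite le_eqVlt; apply/orP; left; apply/eqP; rewrite /c !exprS; ring.
  apply: le_trans k1 _; rewrite lerD2l /c.
  apply: le_trans (_ : 2 * s%:R * (sg ^+ j.+1 * (sg ^+ p * B + sg ^- 2 * X)) <= _).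
    apply: ler_pM; rewrite ?mulr_ge0//.
      by rewrite ler_wpM2l.
    rewrite ler_wpM2l//; apply: le_trans hL _; rewrite lerD2r ler_wpM2l//.
  rewrite le_eqVlt; apply/orP; left; apply/eqP; rewrite sE (exprD sg) !exprS; field.
  by rewrite gt_eqF.
have pe : 0 <= s%:R^-1 + ep by rewrite addr_ge0 ?invr_ge0 ?(ltW sp) ?(ltW ep0).
rewrite aS -addrA lerD2l mulrDr; apply: lerD; last by rewrite mulrCA.
rewrite mulrCA; apply: ler_wpM2l; first by rewrite exprn_ge0// ltW.
exact: ler_wpM2l.
Qed.

Lemma shift_pow_d (c : R) n (t : R) : is_derive t 1 (fun t : R => (2 * (t + c)) ^+ n.+1) (2 * n.+1%:R * (2 * (t + c)) ^+ n).
Proof.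
have h1 : is_derive t 1 (fun t : R => 2 * (t + c)) 2.
  have -> : (fun t : R => 2 * (t + c)) = (fun t => 2 * t + 2 * c) by apply/funext => y; ring.
  rewrite -[X in is_derive _ _ _ X]addr0; apply: is_deriveD; exact: is_derive_lin.
have -> : (fun t : R => (2 * (t + c)) ^+ n.+1) = (fun t : R => 2 * (t + c)) ^+ n.+1 by rewrite exprfctE.
apply: (is_derive_eq (is_deriveX n.+1 h1)).
by rewrite /GRing.scale /=; ring.
Qed.
(* f (t + c)^(-r) is nonincreasing. *)
Lemma barrier (f f' : R -> R) (c r a b : R) : 0 < a + c -> a <= b ->
  (forall t, a <= t <= b -> is_derive t 1 f (f' t)) -> (forall t, a <= t <= b -> f' t <= r / (t + c) * f t) ->
  f a <= 0 -> f b <= 0.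
Proof.
move=> ac ab hf hf' fa.
have tc t : a <= t <= b -> 0 < t + c by move=> /andP[h _]; apply: lt_le_trans ac _; rewrite lerD2r.
have hp (t : R) : a <= t <= b -> is_derive t 1 (fun t => (t + c) `^ (- r)) (- r * (t + c) `^ (- r - 1)).
  by move=> /tc h; apply: (@is_derive_shift R (fun y => y `^ (- r)) c); exact: is_derive1_powR.
have hg (t : R) : a <= t <= b -> is_derive t 1 (fun t => f t * (t + c) `^ (- r)) (f t * (- r * (t + c) `^ (- r - 1)) + f' t * (t + c) `^ (- r)).
  move=> ht; apply: (is_derive_eq (is_deriveM (hf t ht) (hp t ht))).
  by rewrite /GRing.scale /= (mulrC (_ `^ _)).
have := mono_le ab hg (fun t _ => is_derive_cst _ _ _ : is_derive t 1 (fun=> 0) 0).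
rewrite subrr => /(_ _) h.
have : f b * (b + c) `^ (- r) - f a * (a + c) `^ (- r) <= 0.
  apply: h => t ht; have t0 := tc t ht; have p0 : 0 < (t + c) `^ (- r) by exact: powR_gt0.
  have -> : (t + c) `^ (- r - 1) = (t + c) `^ (- r) / (t + c).
    by rewrite powRB ?powRr1 ?(ltW t0)//; apply/implyP => _; rewrite gt_eqF.
  have := ler_wpM2r (ltW p0) (hf' t ht).
  have -> : f t * (- r * ((t + c) `^ (- r) / (t + c))) = - (r / (t + c) * f t * (t + c) `^ (- r)) by field; rewrite gt_eqF.
  lra.
have pa : 0 < (a + c) `^ (- r) by apply: powR_gt0.
have pb : 0 < (b + c) `^ (- r) by apply: powR_gt0; apply: tc; rewrite ab lexx.
have : f a * (a + c) `^ (- r) <= 0 by rewrite mulr_le0_ge0// ltW.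
move=> h1 h2; rewrite -(pmulr_lle0 _ pb); lra.
Qed.

(** * A barrier for the weighted norm *)

Section phase.
Variables (S : R -> H -> H) (c0 : R -> R) (K : R) (lam : R) (k : nat) (u : R -> H).
Hypotheses (hS : schr S (toC c0)) (bc : bd K (toC c0)).
Hypothesis uH1 : contH 1 u.
Hypothesis uD : forall v (t : R), is_derive t 1 (fun t => dot (S (- t) (u t)) v) (dot (J (S (- t) (NL lam k (u t)))) v).
(** With x = |w^(s-1) D u| and y = |w^s u|, the derivative of y^2 is at most 4 s x y, and [n1_bound]
    at sg = 2 (t + c) bounds sg x by th y + (1 - th) L sg^s. Hence y^2 - L^2 sg^(2s) satisfies the
    hypothesis of [barrier]. The shift [c] may depend on M but must not depend on e, which later
    tends to 0. *)
Lemma phase (s : nat) (T0 d eta B M : R) : (0 < s)%N -> 0 <= T0 -> 0 <= d -> 0 < eta -> 0 <= B -> 0 <= M ->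
  (forall t, T0 <= t -> [/\ Hm s (u t), hn s (u t) <= B & `|Dn s (u t)| <= d]) ->
  exists2 c : R, 0 < c & forall e, 0 < e <= 1 -> `|mulf (wp e s) (u T0)| ^+ 2 <= M -> forall t, T0 <= t ->
    `|mulf (wp e s) (u t)| ^+ 2 <= (d + eta) ^+ 2 * (2 * (t + c)) ^+ (s + s).
Proof.
move=> s0 T00 d0 eta0 B0 M0 hu.
have sp : 0 < s%:R :> R by rewrite ltr0n.
have s1 : 1 <= s%:R :> R by rewrite ler1n.
(* Chosen so that the losses [ep] in [n1_bound], scaled by s, are paid by the margin [eta]; this is
   [kap]. *)
pose de := eta / (2 * d + B + 2 * eta).
have den0 : 0 < 2 * d + B + 2 * eta by rewrite ltr_wpDl ?addr_ge0 ?mulr_ge0// mulr_gt0.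
have de0 : 0 < de by rewrite divr_gt0.
have de1 : de <= 2^-1 by rewrite /de ler_pdivrMr//; lra.
pose ep := de / s%:R; have ep0 : 0 < ep by rewrite divr_gt0.
pose th := 1 - s%:R^-1 + ep.
pose L := d + eta; have L0 : 0 < L by rewrite ltr_wpDl.
have kap : (s%:R^-1 + ep) * d + ep * B <= (1 - th) * L.
  have -> : (1 - th) * L = s%:R^-1 * ((1 - de) * L) by rewrite /th /ep; ring.
  have -> : (s%:R^-1 + ep) * d + ep * B = s%:R^-1 * ((1 + de) * d + de * B) by rewrite /ep; ring.
  rewrite ler_wpM2l ?invr_ge0 ?(ltW sp)// /L.
  have : de * (2 * d + B + 2 * eta) = eta by rewrite /de divfK// gt_eqF.
  have : 0 <= de * eta by rewrite mulr_ge0// ltW.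
  lra.
have th1 : 0 <= 1 - th.
  have -> : 1 - th = s%:R^-1 * (1 - de) by rewrite /th /ep; ring.
  by rewrite mulr_ge0 ?invr_ge0 ?(ltW sp)//; lra.
have [sg0 sg01 hn1] := n1_bound s0 ep0.
(* The first term makes sg large enough for [n1_bound], the second makes the barrier exceed M at
   time T0. *)
pose c := sg0 + M / L ^+ 2.
have ML : 0 <= M / L ^+ 2 by rewrite divr_ge0// sqr_ge0.
have c0' : 0 < c by rewrite /c; lra.
exists c => // e e01 hM b Tb.
pose Z t := dot (u t) (mulf (wp e (s + s)) (u t)).
have ZE t : Z t = `|mulf (wp e s) (u t)| ^+ 2 by rewrite (wp_sqr e01).
rewrite -ZE; rewrite -ZE in hM.
pose Y t := L ^+ 2 * (2 * (t + c)) ^+ (s + s).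
have [n nE] : exists n, (s + s)%N = n.+1 by exists (s + s).-1; rewrite prednK// addn_gt0 s0.
have [m mE] : exists m, s = m.+1 by exists s.-1; rewrite prednK.
suff : Z b - Y b <= 0 by rewrite subr_le0.
have Zder (t : R) := Zd hS bc uH1 uD (bd_wp e01 (s + s)) (bd_wp' e01 (s + s)) (md_wp e01 (s + s)) t.
have Yder (t : R) : is_derive t 1 Y (L ^+ 2 * (2 * (s + s)%:R * (2 * (t + c)) ^+ (s + s).-1)).
  rewrite /Y nE; exact: (@is_deriveZ R R R^o _ (L ^+ 2) t 1 _ (shift_pow_d c n t)).
have Tc : 0 < T0 + c by rewrite ltr_wpDl.
apply: (@barrier (fun t => Z t - Y t) (fun t => 2 * dot (D (u t)) (J (mulf (wp' e (s + s)) (u t))) - L ^+ 2 * (2 * (s + s)%:R * (2 * (t + c)) ^+ (s + s).-1)) c (s%:R * (1 + th)) T0 b Tc Tb).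
- move=> t /andP[Tt _]; have [h1 h2 h3] := hu t Tt.
  have t0 : 0 <= t by lra.
  set sg := 2 * (t + c); have sgc : sg0 <= sg by rewrite /sg /c; lra.
  have sgp : 0 < sg by lra.
  have n1 := hn1 e sg B d (u t) e01 sgc h1 h2 h3.
  set y := `|mulf (wp e s) (u t)|; have y0 : 0 <= y by exact: normr_ge0.
  set x := `|mulf (wp e s.-1) (D (u t))| in n1; have x0 : 0 <= x by exact: normr_ge0.
  have Zb : 2 * dot (D (u t)) (J (mulf (wp' e (s + s)) (u t))) <= 4 * s%:R * (x * y).
    have -> : mulf (wp' e (s + s)) (u t) = (s + s)%:R *: mulf (wp e s.-1) (mulf (toC (wt' e)) (mulf (wp e s) (u t))).
      by rewrite mE addSn -(wp'_comp e01) /=.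
    rewrite JZ dotZr -(wp_J e01) -(wp_sym e01) natrD.
    have q1 : `|J (mulf (toC (wt' e)) (mulf (wp e s) (u t)))| <= y.
      by rewrite nrmJ; have := mulf_le (mulf (wp e s) (u t)) (bd_wt' e01); rewrite mul1r.
    have q2 := le_trans (dot_le' (mulf (wp e s.-1) (D (u t))) _) (ler_wpM2l x0 q1).
    have := ler_wpM2l (ltW sp) q2; lra.
  rewrite ZE -/y.
  have sgs : 0 < sg ^+ s by rewrite exprn_gt0.
  have am : sg ^+ s * ((1 - th) * L) * y <= (1 - th) / 2 * (y ^+ 2 + Y t).
    rewrite /Y -/sg exprD; have := sqr_ge0 (y - L * sg ^+ s) => h.
    have -> : sg ^+ s * ((1 - th) * L) * y = (1 - th) * (L * sg ^+ s * y) by ring.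
    have -> : (1 - th) / 2 * (y ^+ 2 + L ^+ 2 * (sg ^+ s * sg ^+ s)) = (1 - th) * ((y ^+ 2 + (L * sg ^+ s) ^+ 2) / 2) by field.
    by rewrite ler_wpM2l//; move: h; rewrite sqrrB mulr2n; set p := y ^+ 2; set q := (L * _) ^+ 2; rewrite mulrC; lra.
  have k1 : sg * x * y <= th * y ^+ 2 + (1 - th) / 2 * (y ^+ 2 + Y t).
    apply: le_trans (ler_wpM2r y0 n1) _; rewrite mulrDl expr2 mulrA lerD2l.
    apply: le_trans am; rewrite ler_wpM2r// ler_wpM2l ?(ltW sgs)//.
  have YE : L ^+ 2 * (2 * (s + s)%:R * sg ^+ (s + s).-1) = 4 * s%:R / sg * Y t.
    have nR : n.+1%:R = s%:R + s%:R :> R by rewrite -nE natrD.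
    rewrite /Y -/sg nE [n.+1.-1]/= nR (exprS sg n).
    move: (sg ^+ n) => w; clear - sgp; move: sg sgp => g gp.
    by field; rewrite gt_eqF.
  rewrite YE; apply: le_trans (lerB Zb (lexx _)) _.
  have -> : s%:R * (1 + th) / (t + c) * (y ^+ 2 - Y t) = 4 * s%:R / sg * ((1 + th) / 2 * (y ^+ 2 - Y t)).
    by rewrite /sg; field; rewrite gt_eqF// ltr_wpDl.
  have -> : 4 * s%:R * (x * y) = 4 * s%:R / sg * (sg * x * y) by field; rewrite gt_eqF.
  rewrite -mulrBr; apply: ler_wpM2l.
    by apply: divr_ge0; [exact: mulr_ge0 _ (ltW sp)|exact: ltW].
  by move: k1; set p := sg * x * y; set w := y ^+ 2; set q := Y t => k1; lra.
rewrite subr_le0; apply: le_trans hM _; rewrite /Y.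
rewrite mulrC -ler_pdivrMr ?exprn_gt0//.
have c1 : M / L ^+ 2 <= 2 * (T0 + c) by rewrite /c; lra.
apply: le_trans c1 _; rewrite nE exprS ler_peMr ?exprn_ege1//; rewrite /c; lra.
Qed.
End phase.

(** * Passage between bounded weights and moments *)

Lemma wt_cvg x : wt n.+1%:R^-1 x @[n --> \oo] --> (x : R).
Proof.
have h : 1 + n.+1%:R^-1 * x ^+ 2 @[n --> \oo] --> (1 + 0 * x ^+ 2 : R).
  apply: cvgD; first exact: cvg_cst.
  by apply: cvgMl; exact: cvg_harmonic.
rewrite mul0r addr0 in h.
have h2 : (1 + n.+1%:R^-1 * x ^+ 2)^-1 @[n --> \oo] --> (1 : R)^-1.
  by apply: cvgV h; exact: oner_neq0.
have h3 : x * (1 + n.+1%:R^-1 * x ^+ 2)^-1 @[n --> \oo] --> x * 1^-1 by apply: cvgMr; exact: h2.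
by rewrite invr1 mulr1 in h3.
Qed.
(** Monotone convergence along e = 1/(n + 1), as the even powers of the weight increase to those of
    x. *)
Lemma weight_limit s f (M : R) : 0 <= M -> (forall e, 0 < e <= 1 -> `|mulf (wp e s) f| ^+ 2 <= M) ->
  (\int[mu]_x (x ^+ (2 * s) * n2 (f x))%:E <= M%:E)%E.
Proof.
move=> M0 h; pose e n : R := n.+1%:R^-1.
have e01 n : 0 < e n <= 1 by rewrite invr_gt0 ltr0n /= invf_le1 ?ltr0n// ler1n.
have mf n : measurable_fun setT (fun x => wt (e n) x ^+ (2 * s) * n2 (f x)).
  apply: measurable_funM; last exact: m_n2.
  by apply: continuous_measurable_fun; apply: wtn_cont.
have ge0 n x : 0 <= wt (e n) x ^+ (2 * s) * n2 (f x).
  by rewrite mulr_ge0 ?n2_ge0// exprM exprn_ge0// sqr_ge0.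
have Ib n : (\int[mu]_x (wt (e n) x ^+ (2 * s) * n2 (f x))%:E <= M%:E)%E.
  have l2 := bdL2 f (bd_wp (e01 n) s).
  have := h _ (e01 n); rewrite nrm_sqr (dot_ae _ _ (mulfE f (bd_wp (e01 n) s)) (mulfE f (bd_wp (e01 n) s))); [|by case: l2..].
  have E : (fun x => rdot (wp (e n) s x * f x) (wp (e n) s x * f x)) = (fun x => wt (e n) x ^+ (2 * s) * n2 (f x)).
    apply/funext => x; rewrite /rdot /wp /toC /n2 !ReImE mul2n -addnn exprD; ring.
  rewrite E /Rintegral => hM; rewrite -lee_fin in hM.
  have i1 := L2_n2int l2.
  have E2 x : n2 (wp (e n) s x * f x) = wt (e n) x ^+ (2 * s) * n2 (f x).
    by rewrite n2M n2C -exprM mulnC.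
  have i2 : mu.-integrable setT (fun x => (wt (e n) x ^+ (2 * s) * n2 (f x))%:E).
    have -> : (fun x => (wt (e n) x ^+ (2 * s) * n2 (f x))%:E) = (fun x => (n2 (wp (e n) s x * f x))%:E).
      by apply/funext => x; rewrite E2.
    exact: i1.
  by rewrite fineK in hM; [exact: hM|exact: integrable_fin_num].
have cv x : (wt (e n) x ^+ (2 * s) * n2 (f x))%:E @[n --> \oo] --> (x ^+ (2 * s) * n2 (f x))%:E.
  apply: cvg_EFin; first exact: nearW.
  apply: cvgMl; have := @wt_cvg x => hx.
  exact: (cvg_comp _ _ hx (@exprn_continuous R (2 * s) x)).
have nd x : {homo (fun n => (wt (e n) x ^+ (2 * s) * n2 (f x))%:E) : n m / (n <= m)%N >-> (n <= m)%E}.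
  move=> n m nm; rewrite lee_fin ler_wpM2r ?n2_ge0// !exprM lerXn2r ?nnegrE ?sqr_ge0//.
  have em : e m <= e n by rewrite /e lef_pV2 ?posrE// ler_nat.
  have [/andP[n0 _] /andP[m0 _]] := (e01 n, e01 m).
  have dn := den_gt0 x (ltW n0); have dm := den_gt0 x (ltW m0).
  rewrite /wt !expr_div_n ler_wpM2l ?sqr_ge0// lef_pV2 ?posrE ?exprn_gt0//.
  by rewrite lerXn2r ?nnegrE ?(ltW dn) ?(ltW dm)// lerD2l ler_wpM2r ?sqr_ge0.
have mc := @cvg_monotone_convergence _ _ R mu setT measurableT (fun n x => (wt (e n) x ^+ (2 * s) * n2 (f x))%:E).
have := mc (fun n => (measurable_EFinP _ _).2 (mf n)) (fun n x _ => ge0 n x) (fun x _ => nd x).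
have -> : (\int[mu]_x (x ^+ (2 * s) * n2 (f x))%:E = \int[mu]_x limn (fun n => (wt (e n) x ^+ (2 * s) * n2 (f x))%:E))%E.
  by apply: eq_integral => x _; apply/esym; apply: cvg_lim; [exact: ereal_hausdorff|exact: cv].
move=> hc; apply: (cvge_to_le hc); exact: nearW.
Qed.
Lemma weight_le e s f (M : R) : 0 < e <= 1 -> (\int[mu]_x (x ^+ (2 * s) * n2 (f x))%:E <= M%:E)%E ->
  `|mulf (wp e s) f| ^+ 2 <= M.
Proof.
move=> e01 h; have [e0 _] := andP e01.
have l2 := bdL2 f (bd_wp e01 s).
rewrite nrm_sqr (dot_ae _ _ (mulfE f (bd_wp e01 s)) (mulfE f (bd_wp e01 s))); [|by case: l2..].
have E : (fun x => rdot (wp e s x * f x) (wp e s x * f x)) = (fun x => wt e x ^+ (2 * s) * n2 (f x)).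
  apply/funext => x; rewrite /rdot /wp /toC /n2 !ReImE mul2n -addnn exprD; ring.
rewrite E /Rintegral.
have le1 : (\int[mu]_x (wt e x ^+ (2 * s) * n2 (f x))%:E <= \int[mu]_x (x ^+ (2 * s) * n2 (f x))%:E)%E.
  apply: ae_le_integral.
  - apply: measurable_funM; last exact: m_n2.
    by apply: continuous_measurable_fun; apply: wtn_cont.
  - by apply: measurable_funM; [apply: continuous_measurable_fun; exact: exprn_continuous|exact: m_n2].
  - by move=> x; rewrite mulr_ge0 ?n2_ge0// exprM exprn_ge0// sqr_ge0.
  - by move=> x; rewrite mulr_ge0 ?n2_ge0// exprM exprn_ge0// sqr_ge0.
  apply: aeW' => x; rewrite ler_wpM2r ?n2_ge0// !exprM lerXn2r ?nnegrE ?sqr_ge0//.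
  rewrite -[leLHS]real_normK ?num_real// -[leRHS]real_normK ?num_real// lerXn2r ?nnegrE//.
  by apply: wt_le; exact: ltW.
have le2 := le_trans le1 h.
have ge0 : (0 <= \int[mu]_x (wt e x ^+ (2 * s) * n2 (f x))%:E)%E.
  by apply: integral_ge0 => x _; rewrite lee_fin mulr_ge0 ?n2_ge0// exprM exprn_ge0// sqr_ge0.
rewrite -lee_fin fineK// ge0_fin_numE//; exact: le_lt_trans le2 (ltry _).
Qed.
End evolution.

(** * Lower bound for the asymptotic moment *)

Section lower.
Context {R : realType}.
Local Notation H := (Hsp R).
Local Notation mu := (@lebesgue_measure R).
Implicit Types (v f g a b : H).
Hint Resolve L2h Cmh : core.

(** Meaningful when x f is square integrable, which is proved wherever it is needed; [mk] returns
    the zero class otherwise. *)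
Definition Xm f : H := mk (fun x => x%:C * f x).

Lemma test_X (p : R -> R) : test_function p -> test_function (fun x => x * p x).
Proof.
move=> tp; have [_ [M hM]] := tp; apply: (smooth_test (M := M)).
  move=> n; apply: CnM; last exact: test_smooth.
  by case: n => [//|n]; exists (fun=> 1) => [x0|]; [exact: is_derive_id|exact: Cncst].
by move=> x /hM ->; rewrite mulr0.
Qed.
Lemma Dtest_X a : Dtest a -> Dtest (Xm a) /\ ae_equal (Xm a) (fun x => x%:C * a x).
Proof.
move=> [p [q [tp tq ->]]].
have tX : Dtest (tm (fun x => x * p x) + J (tm (fun x => x * q x))).
  by exists (fun x => x * p x), (fun x => x * q x); split=> //; exact: test_X.
have e1 : ae_equal (tm (fun x => x * p x) + J (tm (fun x => x * q x)) : H) (fun x => x%:C * (tm p + J (tm q) : H) x).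
  apply: aeS (aeI (aeI (hD (tm (fun x => x * p x)) (J (tm (fun x => x * q x)))) (hD (tm p) (J (tm q))))
    (aeI (aeI (JE (tm (fun x => x * q x))) (JE (tm q))) (aeI (aeI (tmE (test_X tp)) (tmE (test_X tq)))
     (aeI (tmE tp) (tmE tq))))) => x [[-> ->] [[-> ->] [[-> ->] [-> ->]]]].
  by apply: cplx_eq; rewrite !ReImE; ring.
have l2 : L2 (fun x => x%:C * (tm p + J (tm q) : H) x).
  apply: (L2_ae _ (L2h _) e1); apply: CmM => //; apply: CmC.
  by apply: continuous_measurable_fun => x; exact: cvg_id.
have E : Xm (tm p + J (tm q)) = tm (fun x => x * p x) + J (tm (fun x => x * q x)).
  by apply: eqH; apply: ae_eq_trans (mkE l2) _; exact: ae_eq_sym e1.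
by rewrite E.
Qed.
Lemma Dtest_D a : Dtest a -> wd a (D a) /\ Dtest (D a).
Proof.
move=> [p [q [tp tq ->]]].
have h := Ctest_wd (ex_intro _ p (ex_intro _ q (And4 tp tq erefl erefl))).
rewrite (DE h); split=> //.
by exists (derive1 p), (derive1 q); split=> //; exact: test_derive.
Qed.
Lemma Dtest_Hm m a : Dtest a -> Hm m a.
Proof. by elim: m a => [//|m IH] a /Dtest_D[h1 h2]; split=> //; exact: IH. Qed.
Lemma Dtest_lin (r : R) a b : Dtest a -> Dtest b -> Dtest (r *: a + b).
Proof.
move=> [p [q [tp tq ->]]] [p' [q' [tp' tq' ->]]].
exists (fun x => r * p x + p' x), (fun x => r * q x + q' x); split; [exact: testD..|].
by rewrite !tmD// JD JZ scalerDr addrACA.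
Qed.
Lemma Dtest0 : Dtest (0 : H).
Proof. by exists (fun=> 0), (fun=> 0); split; [exact: test0..|rewrite tm0 J0 addr0]. Qed.
Lemma Dtest_Z (r : R) a : Dtest a -> Dtest (r *: a).
Proof. by move=> h; rewrite -[_ *: _]addr0; apply: Dtest_lin => //; exact: Dtest0. Qed.
Lemma Dtest_J a : Dtest a -> Dtest (J a).
Proof.
move=> [p [q [tp tq ->]]]; exists (fun x => -1 * q x + 0), p; split=> //.
  by apply: (@testD R (-1) q (fun=> 0)) => //; exact: test0.
by rewrite JD JJ (@tmD R (-1) q (fun=> 0))//; [rewrite tm0 addr0 scaleN1r addrC|exact: test0].
Qed.
Lemma Xm_lin (r : R) a b : Dtest a -> Dtest b -> Xm (r *: a + b) = r *: Xm a + Xm b.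
Proof.
move=> ta tb; apply: eqH.
apply: aeS (aeI (aeI (Dtest_X (Dtest_lin r ta tb)).2 (hD (r *: a) b)) (aeI (hZ r a) (aeI (aeI (hD (r *: Xm a) (Xm b))
  (hZ r (Xm a))) (aeI (Dtest_X ta).2 (Dtest_X tb).2)))) => x [[-> ->] [-> [[-> ->] [-> ->]]]].
by apply: cplx_eq; rewrite !ReImE; ring.
Qed.
Lemma iterX_Dtest n a : Dtest a -> Dtest (iter n Xm a).
Proof. by move=> ta; elim: n => [//|n IH]; rewrite iterS; exact: (Dtest_X IH).1. Qed.
Lemma iterXE n a : Dtest a -> ae_equal (iter n Xm a) (fun x => (x ^+ n)%:C * a x).
Proof.
move=> ta; elim: n => [|n IH].
  by apply: aeW' => x; rewrite expr0 mul1r.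
rewrite iterS; apply: aeS (aeI (Dtest_X (iterX_Dtest n ta)).2 IH) => x [-> ->].
by rewrite exprS; apply: cplx_eq; rewrite !ReImE; ring.
Qed.
Lemma wp_test e n a : 0 < e <= 1 -> Dtest a -> `|mulf (wp e n) a| <= `|iter n Xm a|.
Proof.
move=> e01 ta; have [e0 _] := andP e01; rewrite -[leRHS]mul1r; apply: nrm_le_ae => //.
apply: aeS (aeI (mulfE a (bd_wp e01 n)) (iterXE n ta)) => x [-> ->].
rewrite !n2M /wp /toC !n2C expr1n mul1r ler_wpM2r ?n2_ge0//.
rewrite -[leLHS]real_normK ?num_real// -[leRHS]real_normK ?num_real// !normrX lerXn2r ?nnegrE ?exprn_ge0//.
by rewrite lerXn2r ?nnegrE// wt_le// ltW.
Qed.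

Variable S0 : R -> H -> H.
Hypothesis hS0 : schr S0 (toC (fun=> 0)).
Let gS := schr_grp hS0.

Lemma free_small m a (e : R) : Hm m a -> 0 < e -> exists2 d : R, 0 < d & forall h, `|h| <= d -> hn m (S0 h a - a) <= e.
Proof.
elim: m a e => [|m IH] a e ha e0; first exact: grp_small.
have e2 : 0 < e / 2 by rewrite divr_gt0.
have [d1 d10 h1] := grp_small gS a e2; have [d2 d20 h2] := IH _ _ ha.2 e2.
exists (Num.min d1 d2); first by have [|] := leP d1 d2.
move=> h; rewrite le_min => /andP[k1 k2].
have a1 : Hm 1 a by exact: Hm1 ha.
rewrite /= DB//; last exact: free_Hm.
by rewrite (free_D hS0)//; have := h1 h k1; have := h2 h k2; lra.
Qed.
Lemma free_contH m a : Hm m a -> contH m (fun t => S0 t a).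
Proof.
move=> ha; split=> [t|t e e0]; first exact: free_Hm.
have [d d0 hd] := free_small ha e0; exists d => // s hs.
have -> : S0 s a - S0 t a = S0 t (S0 (s - t) a - a) by rewrite (grpB gS) -(grp_add gS) (addrC t (s - t)) subrK.
rewrite (free_hn hS0); first exact: hd.
by apply: HmB => //; exact: free_Hm.
Qed.
Lemma free_uD a k v (t : R) : is_derive t 1 (fun t => dot (S0 (- t) (S0 t a)) v) (dot (J (S0 (- t) (NL 0 k (S0 t a)))) v).
Proof.
rewrite /NL scale0r (grpz gS) J0 dot0l.
have -> : (fun t => dot (S0 (- t) (S0 t a)) v) = fun=> dot a v by apply/funext => s; rewrite (grpK gS).
exact: is_derive_cst.
Qed.
(** The free evolution solves the equation with [lam] = 0 and zero potential, so [phase] applies to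
    it from time 0, where a test function has finite moments. *)
Lemma free_weight s a (t0 : R) : (0 < s)%N -> Dtest a -> 0 <= t0 -> exists2 B : R, 0 <= B & forall t, 0 <= t <= t0 ->
  (\int[mu]_x (x ^+ (2 * s) * n2 (S0 t a x))%:E <= (B ^+ 2)%:E)%E.
Proof.
move=> s0 ta t00; have ha := Dtest_Hm s ta; have h1 := Dtest_Hm 1 ta.
have hB : forall t, 0 <= t -> [/\ Hm s (S0 t a), hn s (S0 t a) <= hn s a & `|Dn s (S0 t a)| <= hn s a].
  move=> t _; split; [exact: free_Hm|by rewrite (free_hn hS0)|].
  by rewrite -(free_hn hS0 t ha); apply: Dn_hn (leqnn s); exact: free_Hm.
have [c c0 hc] := @phase R S0 (fun=> 0) 0 0 2 (fun t => S0 t a) hS0 (@b00 R) (free_contH h1) (free_uD a 2) s 0 (hn s a) 1 (hn s a) (`|iter s Xm a| ^+ 2) s0 (lexx 0) (hn_ge0 _ _) ltr01 (hn_ge0 _ _) (sqr_ge0 _) hB.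
have nn := hn_ge0 s a.
have c2 : 0 <= 2 * (t0 + c) by rewrite mulr_ge0// addr_ge0// ltW.
exists ((hn s a + 1) * (2 * (t0 + c)) ^+ s); first by rewrite mulr_ge0 ?exprn_ge0// addr_ge0.
move=> t /andP[t1 t2]; apply: weight_limit; first exact: sqr_ge0.
move=> e e01; apply: le_trans (hc e e01 _ t t1) _.
  by rewrite (grp_0 gS) lerXn2r ?nnegrE//; exact: wp_test.
rewrite [leRHS]exprMn ler_wpM2l ?sqr_ge0// -exprM muln2 -addnn lerXn2r ?nnegrE//.
  by rewrite mulr_ge0// addr_ge0// ltW.
by rewrite ler_pM2l// lerD2r.
Qed.
Lemma m_weight s f : measurable_fun setT (fun x : R => x ^+ (2 * s) * n2 (f x)).
Proof.
by apply: measurable_funM; [apply: continuous_measurable_fun; exact: exprn_continuous|exact: m_n2].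
Qed.
Lemma errw s f g (C B : R) : 0 <= C -> 0 <= B -> (\int[mu]_x (x ^+ (2 * s) * n2 (f x))%:E <= (B ^+ 2)%:E)%E ->
  ae (fun x => n2 (g x) <= C ^+ 2 * (x ^+ (2 * s) * n2 (f x))) -> `|g| <= C * B.
Proof.
move=> C0 B0 hB hg; rewrite -(ler_pXn2r (n := 2))// ?nnegrE ?mulr_ge0// nrm_sqr dotuu.
have mf := m_weight s f.
have f0 (x : R) : 0 <= x ^+ (2 * s) * n2 (f x) by rewrite mulr_ge0 ?n2_ge0// exprM exprn_ge0// sqr_ge0.
have h1 : (\int[mu]_x (n2 (g x))%:E <= (C ^+ 2 * B ^+ 2)%:E)%E.
  apply: le_trans (_ : (\int[mu]_x (C ^+ 2 * (x ^+ (2 * s) * n2 (f x)))%:E <= _)%E).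
    apply: ae_le_integral => //.
    - exact: m_n2.
    - by apply: measurable_funM => //; exact: measurable_cst.
    - by move=> x; exact: n2_ge0.
    - by move=> x; rewrite mulr_ge0 ?sqr_ge0.
  under eq_integral do rewrite EFinM.
  rewrite ge0_integralZl_EFin//.
  - by rewrite (EFinM (C ^+ 2) (B ^+ 2)) lee_wpmul2l// lee_fin sqr_ge0.
  - by move=> x _; rewrite lee_fin.
  - exact/measurable_EFinP.
  - exact: sqr_ge0.
have fin : (\int[mu]_x (n2 (g x))%:E)%E \is a fin_num.
  rewrite ge0_fin_numE; first exact: le_lt_trans h1 (ltry _).
  by apply: integral_ge0 => x _; rewrite lee_fin n2_ge0.
by rewrite exprMn -lee_fin /Rintegral fineK.
Qed.
Lemma n2_pow s (x : R) z : n2 ((x ^+ s)%:C * z) = x ^+ (2 * s) * n2 z.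
Proof. by rewrite n2M n2C -exprM mulnC. Qed.
Lemma weight_L2 s f (B : R) : 0 <= B -> (\int[mu]_x (x ^+ (2 * s) * n2 (f x))%:E <= (B ^+ 2)%:E)%E ->
  L2 (fun x => (x ^+ s)%:C * f x) /\ `|mk (fun x => (x ^+ s)%:C * f x)| <= B.
Proof.
move=> B0 hB; have l2 : L2 (fun x => (x ^+ s)%:C * f x).
  split; first by apply: CmM => //; apply: CmC; apply: continuous_measurable_fun; exact: exprn_continuous.
  rewrite L2normE; apply: poweR_lty; apply: le_lt_trans (ltry (B ^+ 2)).
  by under eq_integral do rewrite n2_pow.
split=> //; rewrite -[leRHS]mul1r; apply: (errw ler01 B0 hB).
by apply: aeS (mkE l2) => x ->; rewrite n2_pow expr1n mul1r.
Qed.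
(** The Heisenberg equation for the regularised position. The commutator of D^2 with w is shared
    between the two vectors, so that w' appears and its derivative does not. *)
Lemma wX_d e a b (t : R) : 0 < e <= 1 -> Hm 2 a -> Hm 2 b ->
  is_derive t 1 (fun t => dot (mulf (wp e 1) (S0 t a)) (S0 t b))
   (dot (J (mulf (toC (wt' e)) (S0 t a))) (D (S0 t b)) - dot (J (mulf (toC (wt' e)) (D (S0 t a)))) (S0 t b)).
Proof.
move=> e01 ha hb.
have bw := bd_wp e01 1; have bw' := bd_wt' e01.
have mw : md (wp e 1) (toC (wt' e)).
  have := md_wp e01 1; rewrite (_ : wp' e 1 = toC (wt' e))//.
  by apply/funext => x; rewrite /wp' /toC expr0 mul1r mul1r.
have [ha' ea] := free_H2 hS0 t ha; have [hb' eb] := free_H2 hS0 t hb.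
have cz : {for t, continuous (fun t => mulf (wp e 1) (S0 t a))}.
  move=> A; apply: (@contH_continuous R 0 (fun t => mulf (wp e 1) (S0 t a))).
  split=> // x ep ep0.
  have K0 := bd_ge0 bw.
  have e1 : 0 < ep / (e^-1 ^+ 1 + 1) by rewrite divr_gt0// ltr_wpDl.
  have [d d0 hd] := (@free_contH 0 a I).2 x _ e1; exists d => // y /hd /= hy.
  rewrite -(mulfB _ _ bw); apply: le_trans (mulf_le _ bw) _.
  apply: le_trans (ler_wpM2l K0 hy) _; rewrite mulrA ler_pdivrMr ?ltr_wpDl//; nra.
have hd : is_derive t 1 (fun s => dot (mulf (wp e 1) (S0 s a)) (S0 t b)) (dot (S0 t (J (D (D a)))) (mulf (wp e 1) (S0 t b))).
  have := gen_dotd gS (mulf (wp e 1) (S0 t b)) t (gen_free hS0 ha).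
  by congr (is_derive _ _ _ _); apply/funext => s; rewrite (wp_sym e01).
have := @dot_derive R (fun t => mulf (wp e 1) (S0 t a)) (fun t => S0 t b) t _ _ cz hd (@gen_shift R S0 gS t _ _ (gen_free hS0 hb)).
congr (is_derive _ _ _ _); rewrite !(schr_J hS0) -ea -eb.
move: (S0 t a) (S0 t b) ha' hb' => A B [A1 [A2 _]] [B1 [B2 _]].
have e1 := wd_skew (wd_J A2) (mw _ _ B1).
have e2 := wd_skew (mw _ _ A1) (wd_J B2).
have e3 : dot (J (D A)) (mulf (toC (wt' e)) B) = dot (J (mulf (toC (wt' e)) (D A))) B.
  by rewrite -(dot_mulf_real _ _ bw') (mulfJ _ bw').
have e4 : dot (mulf (toC (wt' e)) A) (J (D B)) = - dot (J (mulf (toC (wt' e)) A)) (D B) by rewrite dotJl opprK.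
have e5 : dot (J (D A)) (mulf (wp e 1) (D B)) = - dot (mulf (wp e 1) (D A)) (J (D B)).
  by rewrite -(wp_sym e01) (wp_J e01) dotJl.
rewrite dotDr e3 e5 in e1; rewrite dotDl e4 in e2; rewrite e1; move: e2; gen_dots; lra.
Qed.
Lemma wt'_near (e x : R) : 0 <= e -> `|1 - wt' e x| <= 3 * e * x ^+ 2.
Proof.
move=> e0; have d0 := den_gt0 x e0; have x0 := sqr_ge0 x; have y0 := mulr_ge0 e0 x0.
rewrite /wt' -mulrA; move: d0 y0; set y := e * x ^+ 2 => d0 y0.
have -> : 1 - (1 - y) / (1 + y) ^+ 2 = (3 * y + y ^+ 2) / (1 + y) ^+ 2 by field; rewrite lt0r_neq0.
have p0 : 0 <= 3 * y + y ^+ 2 by rewrite addr_ge0 ?sqr_ge0// mulr_ge0.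
rewrite ger0_norm; last by rewrite divr_ge0// exprn_ge0// ltW.
rewrite ler_pdivrMr ?exprn_gt0//.
have y2 := sqr_ge0 y; have y3 : 0 <= y * y ^+ 2 by rewrite mulr_ge0.
have -> : 3 * y * (1 + y) ^+ 2 = 3 * y + 6 * y ^+ 2 + 3 * (y * y ^+ 2) by ring.
lra.
Qed.
(** With e = r^2 and r <= 1, the errors made on x and on the derivative of the weight are both O(r)
    times x^2, hence controlled by second moments. *)
Lemma wt_near (r x : R) : 0 < r -> `|x - wt (r ^+ 2) x| <= r * x ^+ 2.
Proof.
move=> r0; have e0 := sqr_ge0 r; have d0 := den_gt0 x e0.
have -> : x - wt (r ^+ 2) x = r ^+ 2 * x ^+ 3 / (1 + r ^+ 2 * x ^+ 2) by apply: (mulIf (lt0r_neq0 d0)); rewrite /wt mulrBl !divfK ?lt0r_neq0//; ring.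
rewrite normrM normfV (gtr0_norm d0) ler_pdivrMr// normrM (ger0_norm e0) normrX.
have <- : `|x| ^+ 2 = x ^+ 2 by rewrite real_normK ?num_real.
have := normr_ge0 x; set y := `|x| => y0.
have -> : r ^+ 2 * y ^+ 3 = r * y ^+ 2 * (r * y) by ring.
rewrite ler_wpM2l ?mulr_ge0 ?sqr_ge0 ?(ltW r0)// -exprMn.
have := sqr_ge0 (r * y - 1); have := sqr_ge0 (r * y); have -> : (r * y - 1) ^+ 2 = (r * y) ^+ 2 - 2 * (r * y) + 1 by ring.
lra.
Qed.
Lemma small0 (A C : R) : 0 <= C -> (forall r, 0 < r <= 1 -> `|A| <= r * C) -> A = 0.
Proof.
move=> C0 h; apply/eqP; rewrite -normr_le0; apply/ler_addgt0Pr => e e0; rewrite add0r.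
have q0 : 0 < e / (C + e + 1) by rewrite divr_gt0// addr_gt0// ltr_wpDl.
have q1 : e / (C + e + 1) <= 1 by rewrite ler_pdivrMr ?mul1r; lra.
have := h _ (introT andP (conj q0 q1)); move/le_trans; apply.
by rewrite mulrAC ler_pdivrMr; [nra|lra].
Qed.
Lemma Cre_B (x y : R) : (x - y)%:C = x%:C - y%:C.
Proof. by apply: cplx_eq; rewrite !ReImE; ring. Qed.
(** The Galilean operator x - 2 i t d/dx, which the free group conjugates to multiplication by x. *)
Definition Yt (t : R) a := Xm a - (2 * t) *: J (D a).
(** Paired with the evolution of [b], the regularised position corrected by the linear term 2 (i D
    a, b) tau is almost conserved. The error is O(r) by the second moments of the evolutions of a
    and D a, and r is arbitrary. *)
Lemma X_S0 a t : Dtest a -> 0 <= t -> ae_equal (S0 t (Yt t a)) (fun x => x%:C * S0 t a x).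
Proof.
move=> ta t0; have [wa tDa] := Dtest_D ta.
have [B1 B10 h1] := free_weight (isT : (0 < 1)%N) ta t0.
have [B2 B20 h2] := free_weight (isT : (0 < 2)%N) ta t0.
have [B3 B30 h3] := free_weight (isT : (0 < 2)%N) tDa t0.
have l2 tau : 0 <= tau <= t -> L2 (fun x => x%:C * S0 tau a x).
  by move=> /h1 h; have [] := weight_L2 B10 h.
have tt : 0 <= t <= t by rewrite t0 lexx.
have t00 : (0 : R) <= 0 <= t by rewrite lexx t0.
suff -> : S0 t (Yt t a) = Xm (S0 t a) by exact: mkE (l2 t tt).
have ha := Dtest_Hm 2 ta.
apply: (@dot_eq_dense R [set b | Hm 2 b]) => [|v hv]; first exact: Dn_test.
have -> : v = S0 t (S0 (- t) v) by rewrite (grpK' gS).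
have hb : Hm 2 (S0 (- t) v) by exact: free_Hm.
move: (S0 (- t) v) hb => b hb {v hv}.
rewrite (grp_dot gS); apply/eqP; rewrite eq_sym -subr_eq0; apply/eqP.
have nb := normr_ge0 b; have nDb := normr_ge0 (D b).
apply: (@small0 _ (2 * (B2 * `|b|) + 3 * (B3 * `|b| + B2 * `|D b|) * t)).
  have p1 := mulr_ge0 B20 nb; have p2 := mulr_ge0 B30 nb; have p3 := mulr_ge0 B20 nDb.
  have p4 := mulr_ge0 (addr_ge0 p2 p3) t0.
  by rewrite addr_ge0// ?mulr_ge0// addr_ge0.
move=> r /andP[r0 r1]; have e01 : 0 < r ^+ 2 <= 1 by rewrite exprn_gt0//= expr_le1// ltW.
have e0 : 0 <= r ^+ 2 by exact: sqr_ge0.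
have bw := bd_wp e01 1; have bw' := bd_wt' e01.
pose p tau := dot (mulf (wp (r ^+ 2) 1) (S0 tau a)) (S0 tau b).
have near tau (ht : 0 <= tau <= t) : `|dot (Xm (S0 tau a)) (S0 tau b) - p tau| <= r * (B2 * `|b|).
  rewrite /p -dotBl; apply: le_trans (dot_le _ _) _; rewrite (grp_nrm gS) mulrA ler_wpM2r//.
  apply: (errw (ltW r0) B20 (h2 _ ht)).
  apply: aeS (aeI (aeI (hB (Xm (S0 tau a)) (mulf (wp (r ^+ 2) 1) (S0 tau a))) (mkE (l2 _ ht))) (mulfE (S0 tau a) bw)) => x [[-> ->] ->].
  rewrite /wp /toC expr1 -mulrBl -Cre_B n2M n2C mulrA ler_wpM2r ?n2_ge0//.
  rewrite (_ : r ^+ 2 * x ^+ (2 * 2) = (r * x ^+ 2) ^+ 2); last by rewrite exprMn exprM.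
  have w1 := wt_near x r0; have w0 := le_trans (normr_ge0 _) w1.
  by rewrite -[leLHS]real_normK ?num_real// lerXn2r ?nnegrE.
have errJ (c : H) B tau : 0 <= B -> (\int[mu]_x (x ^+ (2 * 2) * n2 (S0 tau c x))%:E <= (B ^+ 2)%:E)%E ->
    `|S0 tau c - mulf (toC (wt' (r ^+ 2))) (S0 tau c)| <= 3 * r ^+ 2 * B.
  move=> B0' hB'; apply: (errw _ B0' hB'); first by rewrite mulr_ge0.
  apply: aeS (aeI (hB (S0 tau c) (mulf (toC (wt' (r ^+ 2))) (S0 tau c))) (mulfE (S0 tau c) bw')) => x [-> ->].
  rewrite /toC -{1}[S0 tau c x]mul1r -mulrBl (_ : 1 - (wt' (r ^+ 2) x)%:C = (1 - wt' (r ^+ 2) x)%:C); last by rewrite Cre_B.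
  rewrite n2M n2C mulrA ler_wpM2r ?n2_ge0//.
  rewrite (_ : (3 * r ^+ 2) ^+ 2 * x ^+ (2 * 2) = (3 * r ^+ 2 * x ^+ 2) ^+ 2); last by rewrite [RHS]exprMn [in LHS]exprM.
  have w1 := wt'_near x e0; have w0 := le_trans (normr_ge0 _) w1.
  by rewrite -[leLHS]real_normK ?num_real// lerXn2r ?nnegrE.
pose q tau := p tau + 2 * dot (J (D a)) b * tau.
have ng : `|q t - q 0| <= 3 * r ^+ 2 * (B3 * `|b| + B2 * `|D b|) * t - 3 * r ^+ 2 * (B3 * `|b| + B2 * `|D b|) * 0.
  apply: (@mono_norm R q _ (fun tau => 3 * r ^+ 2 * (B3 * `|b| + B2 * `|D b|) * tau) (fun=> 3 * r ^+ 2 * (B3 * `|b| + B2 * `|D b|)) 0 t t0).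
  - move=> tau _; have d1 := wX_d tau e01 ha hb; have d2 := is_derive_lin (2 * dot (J (D a)) b) tau; exact: (is_deriveD d1 d2).
  - by move=> tau _; exact: is_derive_lin.
  move=> tau ht.
  have e1 : dot (J (D a)) b = dot (J (D (S0 tau a))) (S0 tau b).
    rewrite (free_D hS0); last by exact: Hm1 ha.
    by rewrite -(schr_J hS0) (grp_dot gS).
  have e2 : dot (J (D a)) b = - dot (J (S0 tau a)) (D (S0 tau b)).
    rewrite e1; exact: (wd_skew (wd_J (free_Hm hS0 tau ha).1) (free_Hm hS0 tau hb).1).
  set W := mulf (toC (wt' (r ^+ 2))).
  have -> : dot (J (W (S0 tau a))) (D (S0 tau b)) - dot (J (W (D (S0 tau a)))) (S0 tau b) + 2 * dot (J (D a)) b =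
     dot (J (D (S0 tau a) - W (D (S0 tau a)))) (S0 tau b) - dot (J (S0 tau a - W (S0 tau a))) (D (S0 tau b)).
    by move: e1 e2; rewrite !(JB, dotBl); gen_dots; lra.
  apply: le_trans (ler_normB _ _) _; 
  have -> : 3 * r ^+ 2 * (B3 * `|b| + B2 * `|D b|) = 3 * r ^+ 2 * B3 * `|b| + 3 * r ^+ 2 * B2 * `|D b| by ring.
  apply: lerD; apply: le_trans (dot_le _ _) _; rewrite nrmJ.
    rewrite (grp_nrm gS) ler_wpM2r//; rewrite (free_D hS0); last by exact: Hm1 ha.
    exact: (errJ _ _ _ B30 (h3 _ ht)).
  rewrite (free_D hS0); last by exact: Hm1 hb.
  by rewrite (grp_nrm gS) ler_wpM2r//; exact: (errJ _ _ _ B20 (h2 _ ht)).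
have k1 := near t tt; have k2 := near 0 t00; have k3 := ng.
have E : dot (Xm (S0 t a)) (S0 t b) - dot (Yt t a) b =
  (dot (Xm (S0 t a)) (S0 t b) - p t) - (dot (Xm (S0 0 a)) (S0 0 b) - p 0) + (q t - q 0).
  by rewrite /q /Yt dotBl dotZl !(grp_0 gS); move: (p t) (p 0); gen_dots => *; ring.
rewrite E; apply: le_trans (ler_normD _ _) _; apply: le_trans (lerD (ler_normB _ _) (lexx _)) _.
apply: le_trans (lerD (lerD k1 k2) k3) _.
have p2 := mulr_ge0 B30 nb; have p3 := mulr_ge0 B20 nDb; have p4 := mulr_ge0 (addr_ge0 p2 p3) t0.
move: p4; move: (B2 * `|b|) (B3 * `|b| + B2 * `|D b|) => x y p4.
have : r ^+ 2 * (y * t) <= r * (y * t) by rewrite ler_wpM2r// expr2 ler_piMl// ltW.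
have -> : 3 * r ^+ 2 * y * t - 3 * r ^+ 2 * y * 0 = 3 * (r ^+ 2 * (y * t)) by ring.
have -> : r * (2 * x + 3 * y * t) = 2 * (r * x) + 3 * (r * (y * t)) by ring.
lra.
Qed.

(** * Powers of x - 2 i t d on test functions *)

Lemma Dtest_Y t a : Dtest a -> Dtest (Yt t a).
Proof.
move=> ta; rewrite /Yt -scaleNr addrC; apply: Dtest_lin; last exact: (Dtest_X ta).1.
by apply: Dtest_J; exact: (Dtest_D ta).2.
Qed.
Lemma D_lin' (r : R) a b : Dtest a -> Dtest b -> D (r *: a + b) = r *: D a + D b.
Proof.
by move=> ta tb; apply: DE; apply: wd_lin; [exact: (Dtest_D ta).1|exact: (Dtest_D tb).1].
Qed.
Lemma Y_lin t (r : R) a b : Dtest a -> Dtest b -> Yt t (r *: a + b) = r *: Yt t a + Yt t b.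
Proof.
move=> ta tb; rewrite /Yt (Xm_lin r ta tb) (D_lin' r ta tb) JD JZ.
hring.
Qed.
Lemma iterY_Dtest n t a : Dtest a -> Dtest (iter n (Yt t) a).
Proof. by move=> ta; elim: n => [//|n IH]; rewrite iterS; exact: Dtest_Y. Qed.
Lemma iterY_lin n t (r : R) a b : Dtest a -> Dtest b ->
  iter n (Yt t) (r *: a + b) = r *: iter n (Yt t) a + iter n (Yt t) b.
Proof.
by move=> ta tb; elim: n => [//|n IH]; rewrite !iterS IH Y_lin//; exact: iterY_Dtest.
Qed.
Lemma iterYE n t a : Dtest a -> 0 <= t ->
  ae_equal (S0 t (iter n (Yt t) a)) (fun x => (x ^+ n)%:C * S0 t a x).
Proof.
move=> ta t0; elim: n => [|n IH].
  by apply: aeW' => x; rewrite expr0 mul1r.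
rewrite iterS; apply: aeS (aeI (X_S0 (iterY_Dtest n t ta) t0) IH) => x [-> ->].
by rewrite exprS; apply: cplx_eq; rewrite !ReImE; ring.
Qed.
Definition Pd a := (-2 : R) *: J (D a).
Lemma Dtest_P a : Dtest a -> Dtest (Pd a).
Proof. by move=> ta; apply: Dtest_Z; apply: Dtest_J; exact: (Dtest_D ta).2. Qed.
Lemma YtE t a : Yt t a = t *: Pd a + Xm a.
Proof. by rewrite /Yt /Pd scalerA addrC -scaleNr; congr (_ *: _ + _); ring. Qed.
(** [Yt t] is t P + X with P and X preserving test functions. Expanding the innermost factor leaves
    t^n P^n and terms smaller by a factor 1 / t. *)
Lemma lim_Y n a : Dtest a -> exists2 C : R, 0 <= C & forall t, 1 <= t ->
  `|t^-1 ^+ n *: iter n (Yt t) a - iter n Pd a| <= C / t.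
Proof.
elim: n a => [|n IH] a ta.
  by exists 0 => // t _; rewrite expr0 scale1r subrr normr0 mul0r.
have [C1 C10 h1] := IH _ (Dtest_X ta).1; have [C2 C20 h2] := IH _ (Dtest_P ta).
exists (`|iter n Pd (Xm a)| + C1 + C2); first by rewrite !addr_ge0.
move=> t t1; have t0 : 0 < t by exact: lt_le_trans t1.
have tn : t != 0 by rewrite gt_eqF.
have ti1 : t^-1 <= 1 by rewrite invf_le1.
have ti0 : 0 <= t^-1 by rewrite invr_ge0 ltW.
rewrite !iterSr YtE (iterY_lin n t t (Dtest_P ta) (Dtest_X ta).1).
have k1 := h1 t t1; have k2 := h2 t t1.
have -> : t^-1 ^+ n.+1 *: (t *: iter n (Yt t) (Pd a) + iter n (Yt t) (Xm a)) - iter n Pd (Pd a) =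
  (t^-1 ^+ n *: iter n (Yt t) (Pd a) - iter n Pd (Pd a)) + t^-1 *: (t^-1 ^+ n *: iter n (Yt t) (Xm a) - iter n Pd (Xm a)) + t^-1 *: iter n Pd (Xm a).
  have E1 : t^-1 ^+ n.+1 * t = t^-1 ^+ n by rewrite exprSr -mulrA mulVf// mulr1.
  rewrite scalerDr scalerA E1 scalerBr scalerA -exprS.
  hring.
apply: le_trans (ler_normD _ _) _; apply: le_trans (lerD (ler_normD _ _) (lexx _)) _.
rewrite !normrZ (ger0_norm ti0).
have k3 : t^-1 * `|t^-1 ^+ n *: iter n (Yt t) (Xm a) - iter n Pd (Xm a)| <= C1 / t.
  rewrite mulrC; apply: ler_wpM2r => //; apply: le_trans k1 _.
  by rewrite ler_piMr.
move: k2 k3; rewrite !mulrDl; set x := t^-1 * `|iter n Pd (Xm a)|.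
have -> : `|iter n Pd (Xm a)| / t = x by rewrite mulrC.
move=> *; lra.
Qed.
Lemma Dtest_iterJ n a : Dtest a -> Dtest (iter n J a).
Proof. by move=> ta; elim: n => [//|n IH]; rewrite iterS; exact: Dtest_J. Qed.
Lemma DiterJ n a : Dtest a -> D (iter n J a) = iter n J (D a).
Proof.
move=> ta; elim: n => [//|n IH]; rewrite !iterS DJ ?IH//.
exact: (Dtest_Hm 1 (Dtest_iterJ n ta)).
Qed.
Lemma iterJZ n (r : R) a : iter n J (r *: a) = r *: iter n J a.
Proof. by elim: n => [//|n IH]; rewrite !iterS IH JZ. Qed.
Lemma nrm_iterJ n a : `|iter n J a| = `|a|.
Proof. by elim: n => [//|n IH]; rewrite iterS nrmJ. Qed.
(** P i = -2 i^2 D = 2 D, so a test vector of the form i^n a removes all phases. *)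
Lemma iterPJ n (r : R) a : Dtest a -> iter n Pd (iter n J (r *: a)) = (r * 2 ^+ n) *: Dn n a.
Proof.
elim: n r a => [|n IH] r a ta; first by rewrite /= expr0 mulr1.
rewrite iterSr iterS.
have -> : Pd (J (iter n J (r *: a))) = iter n J ((r * 2) *: D a).
  have [h _] := Dtest_D ta.
  have tr := Dtest_Z r ta.
  rewrite /Pd DJ; last by exact: (Dtest_Hm 1 (Dtest_iterJ n tr)).
  rewrite JJ (DiterJ n tr) (_ : D (r *: a) = r *: D a); last by apply: DE; exact: wd_Z.
  by rewrite !iterJZ scalerN -scaleNr opprK scalerA (mulrC r).
by rewrite (IH _ _ (Dtest_D ta).2) /Dn iterSr exprS mulrA.
Qed.

(** The test vector is psi = i^s chi with chi close to (-1)^s G. Moving x^s onto its evolution gives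
    Y_t^s psi, with leading part 2^s t^s D^s chi, and moving D^s back to fp produces the
    compensating sign (-1)^s. *)
Lemma lower_bound s (u : R -> H) fp (ep : R) : Hm s fp -> limT (fun t => `|u t - S0 t fp|) -> 0 < ep ->
  exists T1 : R, forall t, T1 <= t -> forall M : R, 0 <= M ->
   (\int[mu]_x (x ^+ (2 * s) * n2 (u t x))%:E <= (M ^+ 2)%:E)%E -> 2 ^+ s * `|Dn s fp| - ep <= M / t ^+ s.
Proof.
move=> hfp hu ep0; set G := Dn s fp.
(* The errors below are taken proportional to |G|, so G = 0, where the bound is trivial, is set
   apart. *)
have [G0|] := eqVneq G 0.
  exists 0 => t t0 M M0 _; rewrite G0 normr0 mulr0 sub0r; apply: (@le_trans _ _ 0); first by rewrite oppr_le0 ltW.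
  by rewrite divr_ge0// exprn_ge0.
rewrite -normr_gt0 => g0.
have p2 : 0 < 2 ^+ s :> R by rewrite exprn_gt0.
pose de := ep / (2 ^+ s * 8).
have de0 : 0 < de by rewrite divr_gt0// mulr_gt0.
have [chi tchi hchi] := dense_test ((-1) ^+ s *: G) de0.
pose psi := iter s J chi; have tpsi : Dtest psi by exact: Dtest_iterJ.
have Ppsi : iter s Pd psi = 2 ^+ s *: Dn s chi.
  by have := iterPJ s 1 tchi; rewrite scale1r mul1r.
have [C C0 hC] := lim_Y s tpsi.
set P := iter s Pd psi in Ppsi hC.
have m1 : `|(-1) ^+ s : R| = 1 by rewrite normrX normrN1 expr1n.
have nchi : `|chi| <= `|G| + de.
  have -> : chi = (-1) ^+ s *: G - ((-1) ^+ s *: G - chi) by rewrite subKr.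
  by apply: le_trans (ler_normB _ _) _; rewrite normrZ m1 mul1r lerD2l.
have main : 2 ^+ s * (`|G| ^+ 2 - de * `|G|) <= dot fp P.
  rewrite Ppsi dotZr ler_pM2l//.
  have -> : dot fp (Dn s chi) = dot G ((-1) ^+ s *: chi).
    rewrite dotZr (Dn_skew hfp (Dtest_Hm s tchi)) mulrA -exprD addnn -mul2n exprM sqrrN expr1n expr1n mul1r //.
  have -> : (-1) ^+ s *: chi = G - (-1) ^+ s *: ((-1) ^+ s *: G - chi).
    by rewrite scalerBr scalerA -exprD addnn -mul2n exprM sqrrN expr1n expr1n scale1r subKr.
  rewrite dotBr -nrm_sqr lerD2l lerN2; apply: le_trans (dot_le' _ _) _.
  by rewrite normrZ m1 mul1r mulrC ler_wpM2r.
have nP := normr_ge0 P; have nf := normr_ge0 fp.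
pose er := ep * `|G| / 4; have er0 : 0 < er by rewrite divr_gt0// mulr_gt0.
pose e1 := er / (`|P| + 1); have e10 : 0 < e1 by rewrite divr_gt0// ltr_wpDl.
have [T1 hT1] := hu _ e10.
pose T2 := C * (`|fp| + e1) / er + 1.
exists (Num.max T1 T2) => t; rewrite ge_max => /andP[t1 t2] M M0 hM.
have t3 : 1 <= t.
  by apply: le_trans t2; rewrite lerDr divr_ge0 ?(ltW er0)// mulr_ge0// addr_ge0// ltW.
have t0 : 0 < t by exact: lt_le_trans t3.
have [l2 nx] := weight_L2 M0 hM; set X := mk _ in nx.
have ut := hT1 t t1.
have nu : `|u t| <= `|fp| + e1.
  have -> : u t = S0 t fp + (u t - S0 t fp) by rewrite addrC subrK.
  by apply: le_trans (ler_normD _ _) _; rewrite (grp_nrm gS) lerD2l.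
have hY := iterYE s tpsi (ltW t0).
have E1 : dot X (S0 t psi) = dot (u t) (S0 t (iter s (Yt t) psi)).
  have l3 : Cmeasurable (fun x => (x ^+ s)%:C * S0 t psi x).
    by apply: CmM => //; apply: CmC; apply: continuous_measurable_fun; exact: exprn_continuous.
  rewrite (dot_ae _ _ (mkE l2) (ae_eq_refl (S0 t psi)))//; last by case: l2.
  rewrite (dot_ae _ l3 (ae_eq_refl (u t)) hY)//; apply: eq_Rintegral => x _.
  by rewrite /rdot !ReImE; ring.
have ti0 : 0 < t^-1 ^+ s by rewrite exprn_gt0// invr_gt0.
have E2 : t^-1 ^+ s * dot X (S0 t psi) <= M / t ^+ s * (`|G| + de).
  rewrite -exprVn (mulrC M) -mulrA ler_pM2l//; apply: le_trans (dot_le' _ _) _.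
  by rewrite (grp_nrm gS) nrm_iterJ ler_pM.
have E3 : t^-1 ^+ s * dot X (S0 t psi) = dot fp P + dot (u t) (S0 t (t^-1 ^+ s *: iter s (Yt t) psi - P)) + dot (u t - S0 t fp) (S0 t P).
  rewrite E1 -dotZr -(grpZ gS) (grpB gS) dotBr dotBl (grp_dot gS t fp P).
  by move: (dot (u t) _) (dot (u t) _) (dot fp P) => x1 x2 x3; ring.
have E4 : - er <= dot (u t) (S0 t (t^-1 ^+ s *: iter s (Yt t) psi - P)).
  rewrite lerNl; apply: le_trans (ler_norm _) _; rewrite normrN; apply: le_trans (dot_le _ _) _; rewrite (grp_nrm gS).
  have k := hC t t3; apply: (@le_trans _ _ ((`|fp| + e1) * (C / t))); first by rewrite ler_pM.
  rewrite mulrA ler_pdivrMr// mulrC; rewrite /T2 in t2.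
  have : C * (`|fp| + e1) / er <= t by lra.
  by rewrite ler_pdivrMr// (mulrC t).
have E5 : - er <= dot (u t - S0 t fp) (S0 t P).
  rewrite lerNl; apply: le_trans (ler_norm _) _; rewrite normrN; apply: le_trans (dot_le _ _) _; rewrite (grp_nrm gS).
  apply: le_trans (ler_wpM2r nP ut) _; rewrite /e1 mulrAC ler_pdivrMr ?ltr_wpDl// ler_pM2l//; lra.
rewrite E3 in E2.
have m0 : 0 <= M / t ^+ s by rewrite divr_ge0// exprn_ge0// ltW.
move: main E2 E4 E5 m0; rewrite /er; move: (M / t ^+ s) (dot _ (S0 t P)) (dot (u t) _) (dot fp P) => m x1 x2 x3.
have dE : 2 ^+ s * de = ep / 8 by rewrite /de; field; rewrite gt_eqF.
move: g0 p2 de0 dE; clear hchi nchi; clearbody de; move: (`|G|) (2 ^+ s : R) de => g p d g0 p0 d0 dE main E2 E4 E5 m0.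
rewrite leNgt; apply/negP => hlt.
have k1 : p * (g ^+ 2 - d * g) = p * g * g - ep / 8 * g by rewrite -dE; ring.
have k2 : m * (g + d) <= (p * g - ep) * (g + d) by rewrite ler_wpM2r ?addr_ge0 ?(ltW g0) ?(ltW d0)// ltW.
have k3 : (p * g - ep) * (g + d) = p * g * g - ep * g + ep / 8 * g - ep * d by rewrite -dE; ring.
have k4 : 0 < ep * d by rewrite mulr_gt0.
have k5 : 0 < ep * g by rewrite mulr_gt0.
have k6 : ep / 8 * g = ep * g / 8 by ring.
rewrite k1 k6 in main; rewrite k3 k6 in k2.
move: main k2 E2 E4 E5 k4 k5; set a := ep * g; set b := ep * d; set c := p * g * g; set w := m * (g + d) => *; lra.
Qed.
End lower.

(** * Asymptotics for positive times *)

Section core.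
Context {R : realType}.
Local Notation H := (Hsp R).
Local Notation mu := (@lebesgue_measure R).
Hint Resolve L2h Cmh : core.

Lemma bernoulli3 (s : nat) (y : R) : 0 <= y <= 1 -> (1 + y) ^+ s <= 1 + 3 ^+ s * y.
Proof.
move=> /andP[y0 y1]; elim: s => [|s IH]; first by rewrite !expr0 mul1r lerDl.
have c1 : 1 <= 3 ^+ s :> R by rewrite exprn_ege1// ler1n.
rewrite !exprS; apply: le_trans (ler_wpM2l (addr_ge0 ler01 y0) IH) _.
move: c1; set c := 3 ^+ s => c1.
have h1 : 0 <= (c - 1) * y by rewrite mulr_ge0// subr_ge0.
have h2 : 0 <= c * y * (1 - y) by rewrite !mulr_ge0 ?subr_ge0//; lra.
nra.
Qed.

Variables (S S0 : R -> H -> H) (c0 : R -> R) (K : R) (lam : R) (k : nat) (u : R -> H) (cc : nat -> R -> R[i]) (s : nat) (A M0 : R).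
Hypotheses (hS : schr S (toC c0)) (bc : bd K (toC c0)) (cc0 : cc 0%N = toC c0) (hch : chain s cc K).
Hypothesis hS0 : schr S0 (toC (fun=> 0)).
Hypothesis hsc : forall g, exists gp, limT (fun t => `|S t g - S0 t gp|).
Hypotheses (s0 : (0 < s)%N) (k2 : (2 <= k)%N) (A0 : 0 < A) (hA : forall t, 1 <= t -> bd (A / Num.sqrt t) (u t)).
Hypothesis uH1 : contH 1 u.
Hypothesis u0 : Hm s (u 0).
Hypothesis uD : forall v (t : R), is_derive t 1 (fun t => dot (S (- t) (u t)) v) (dot (J (S (- t) (NL lam k (u t)))) v).
Hypothesis M00 : 0 <= M0.
Hypothesis hM0 : (\int[mu]_x (x ^+ (2 * s) * n2 (u 0 x))%:E <= M0%:E)%E.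

Let us : contH s u := persistence_Hs hS bc cc0 uH1 uD s0 hch u0.

(** [phase] is used twice: from time 0 with a crude constant, to have a finite moment at the time T1
    from which |D^s u| stays below its limit plus e1, then from T1 with the sharp constant. The
    shift c' disappears in (1 + c' / t)^s. *)
Lemma forward_asymptotics : exists fp, [/\ Hm s fp, limT (fun t => hn s (u t - S0 t fp)) &
  forall ep : R, 0 < ep -> exists2 T : R, 1 <= T & forall t, T <= t -> exists m : R,
    [/\ 0 <= m, (\int[mu]_x (x ^+ (2 * s) * n2 (u t x))%:E = ((m * t ^+ s) ^+ 2)%:E)%E &
    `|m - 2 ^+ s * `|Dn s fp| | <= ep]].
Proof.
have [fp hfp lfp] := scattering_Hs hS bc cc0 hch hS0 hsc k2 A0 hA us uD.
exists fp; split=> // ep ep0; set g := `|Dn s fp|.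
have g0 : 0 <= g by exact: normr_ge0.
have [[C C0 hC] _] := uniform_bound hS bc cc0 hch k2 A0 hA us uD (leqnn s).
have p2 : 0 < 2 ^+ s :> R by rewrite exprn_gt0.
have p3 : 0 < 3 ^+ s :> R by rewrite exprn_gt0.
have hB0 t : 0 <= t -> [/\ Hm s (u t), hn s (u t) <= C & `|Dn s (u t)| <= C].
  by move=> t0; split; [exact: us.1|exact: hC|apply: le_trans (Dn_hn _ (leqnn s)) (hC t t0)].
have [c cp hc] := @phase R S c0 K lam k u hS bc uH1 uD s 0 C 1 C M0 s0 (lexx 0) C0 ltr01 C0 M00 hB0.
(* The upper bound contains e1 twice, once for |D^s u| and once as the margin of [phase]; together
   they cost ep / 2. *)
pose e1 := ep / (2 ^+ s * 4).
have e10 : 0 < e1 by rewrite divr_gt0// mulr_gt0.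
have e1E : 2 ^+ s * e1 = ep / 4 by rewrite /e1; field; rewrite gt_eqF.
have [Ta hTa] := lfp _ e10.
pose T1 := Num.max 0 Ta.
have T10 : 0 <= T1 by rewrite le_max lexx.
have hB1 t : T1 <= t -> [/\ Hm s (u t), hn s (u t) <= C & `|Dn s (u t)| <= g + e1].
  rewrite ge_max => /andP[t0 ta]; have [h1 h2 _] := hB0 t t0; split=> //.
  have hF : Hm s (S0 t fp) by exact: (free_Hm hS0).
  have -> : u t = 1 *: (u t - S0 t fp) + S0 t fp by rewrite scale1r subrK.
  rewrite (Dn_lin _ (leqnn s))//; last exact: HmB.
  apply: le_trans (ler_normD _ _) _; rewrite scale1r (free_Dn hS0 t (leqnn s) hfp) (grp_nrm (schr_grp hS0)) addrC lerD2l.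
  by apply: le_trans (Dn_hn _ (leqnn s)) (hTa t ta).
pose M1 := (C + 1) ^+ 2 * (2 * (T1 + c)) ^+ (s + s).
have M10 : 0 <= M1 by rewrite mulr_ge0 ?sqr_ge0// exprn_ge0// mulr_ge0// addr_ge0// ltW.
have ge1 : 0 <= g + e1 by rewrite addr_ge0// ltW.
have [c' cp' hc'] := @phase R S c0 K lam k u hS bc uH1 uD s T1 (g + e1) e1 C M1 s0 T10 ge1 e10 C0 M10 hB1.
have [T2 hT2] : exists T2 : R, forall t, T2 <= t -> forall M : R, 0 <= M ->
   (\int[mu]_x (x ^+ (2 * s) * n2 (u t x))%:E <= (M ^+ 2)%:E)%E -> 2 ^+ s * g - ep <= M / t ^+ s.
  apply: (lower_bound hS0 hfp _ ep0) => e e0.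
  have [T hT] := lfp e e0; exists T => t /hT; apply: le_trans; exact: nrm_hn.
have q0 : 0 <= 2 ^+ s * (g + e1 + e1) by rewrite mulr_ge0 ?(ltW p2)// addr_ge0// ltW.
(* Past T3 the factor (1 + c' / t)^s, estimated by [bernoulli3], costs at most the other ep / 2. *)
pose T3 := 2 ^+ s * (g + e1 + e1) * 3 ^+ s * c' / (ep / 2).
have T30 : 0 <= T3 by rewrite divr_ge0 ?divr_ge0 ?(ltW ep0)//; rewrite !mulr_ge0 ?(ltW cp') ?(ltW p3)//; exact: ltW p2 || lra.
exists (T1 + Num.max 0 T2 + T3 + c' + 1).
  have : 0 <= Num.max 0 T2 by rewrite le_max lexx.
  by move=> h; rewrite lerDr !addr_ge0// ltW.
move=> t ht; have t20 : 0 <= Num.max 0 T2 by rewrite le_max lexx.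
have t22 : T2 <= Num.max 0 T2 by rewrite le_max lexx orbT.
have t1 : T1 <= t by lra.
have t2 : T2 <= t by lra.
have t3 : T3 <= t by lra.
have t4 : c' <= t by lra.
have tp : 0 < t by lra.
pose M := (g + e1 + e1) * (2 * (t + c')) ^+ s.
have Mp : 0 <= M by rewrite mulr_ge0//; [lra|rewrite exprn_ge0//; lra].
have hI : (\int[mu]_x (x ^+ (2 * s) * n2 (u t x))%:E <= (M ^+ 2)%:E)%E.
  apply: weight_limit; first exact: sqr_ge0.
  move=> e e01; rewrite /M exprMn -exprM muln2 -addnn; apply: hc' => //.
  by apply: hc => //; exact: weight_le.
have I0 : (0 <= \int[mu]_x (x ^+ (2 * s) * n2 (u t x))%:E)%E.
  by apply: integral_ge0 => x _; rewrite lee_fin mulr_ge0 ?n2_ge0// exprM exprn_ge0// sqr_ge0.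
have fI : (\int[mu]_x (x ^+ (2 * s) * n2 (u t x))%:E)%E \is a fin_num.
  by rewrite ge0_fin_numE//; exact: le_lt_trans hI (ltry _).
move: hI I0 (hT2 t t2); rewrite -(fineK fI); set I := fine _ => hI I0 low {fI}.
rewrite !lee_fin in hI I0.
have tn : 0 < t ^+ s by rewrite exprn_gt0.
have sq : Num.sqrt I ^+ 2 = I by rewrite sqr_sqrtr.
exists (Num.sqrt I / t ^+ s); split.
- by rewrite divr_ge0 ?sqrtr_ge0// ltW.
- by rewrite divfK ?gt_eqF// sq.
have l1 : 2 ^+ s * g - ep <= Num.sqrt I / t ^+ s by apply: low; rewrite ?sqrtr_ge0// sq.
have l2 : Num.sqrt I <= M by rewrite -(ler_pXn2r (n := 2)) ?nnegrE ?sqrtr_ge0// sq.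
have l3 : Num.sqrt I / t ^+ s <= 2 ^+ s * (g + e1 + e1) * (1 + c' / t) ^+ s.
  rewrite ler_pdivrMr//; apply: le_trans l2 _; rewrite /M -[leRHS]mulrA -exprMn.
  have -> : (1 + c' / t) * t = t + c' by rewrite mulrDl mul1r divfK ?gt_eqF.
  by rewrite exprMn mulrCA mulrA.
have y01 : 0 <= c' / t <= 1 by rewrite divr_ge0 ?(ltW cp') ?(ltW tp)//= ler_pdivrMr// mul1r.
have l4 : 2 ^+ s * (g + e1 + e1) * (1 + c' / t) ^+ s <= 2 ^+ s * (g + e1 + e1) * (1 + 3 ^+ s * (c' / t)).
  by apply: ler_wpM2l => //; exact: bernoulli3.
have l5 : 2 ^+ s * (g + e1 + e1) * (3 ^+ s * (c' / t)) <= ep / 2.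
  rewrite !mulrA ler_pdivrMr//; move: t3; rewrite /T3 ler_pdivrMr//; last by rewrite divr_gt0.
  by rewrite (mulrC t).
rewrite ler_norml; apply/andP; split; first lra.
have l6 : 2 ^+ s * (g + e1 + e1) = 2 ^+ s * g + ep / 2 by rewrite !mulrDr e1E; field.
have l7 : 2 ^+ s * (g + e1 + e1) * (1 + 3 ^+ s * (c' / t)) = 2 ^+ s * (g + e1 + e1) + 2 ^+ s * (g + e1 + e1) * (3 ^+ s * (c' / t)).
  by rewrite mulrDr mulr1.
rewrite l7 in l4; have l8 := le_trans l3 l4.
rewrite lerBlDl; apply: le_trans l8 _; rewrite [leRHS](_ : _ = 2 ^+ s * g + ep / 2 + ep / 2); last by field.
by rewrite -l6 lerD2l.
Qed.
End core.

(** * From functions to vectors *)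

Section linking.
Context {R : realType}.
Local Notation H := (Hsp R).
Local Notation mu := (@lebesgue_measure R).
Implicit Types (F G : H) (f g h : R -> R[i]).
Hint Resolve L2h Cmh : core.

Lemma mkB f g : L2 f -> L2 g -> L2 (fun x => f x - g x) /\ mk (f \- g) = mk f - mk g.
Proof.
move=> lf lg; have l : L2 (fun x => f x - g x) by exact: (L2D lf (L2N lg)).
split=> //; apply: eqH.
by apply: aeS (aeI (mkE l) (aeI (hB (mk f) (mk g)) (aeI (mkE lf) (mkE lg)))) => x [-> [-> [-> ->]]].
Qed.
Lemma mk_i f : L2 f -> mk (fun x => 'i * f x) = J (mk f).
Proof.
move=> lf; apply: eqH.
by apply: aeS (aeI (mkE (L2Z 'i lf)) (aeI (JE (mk f)) (mkE lf))) => x [-> [-> ->]].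
Qed.
Lemma mkS (a : R) f : L2 f -> mk (fun x => a%:C * f x) = a *: mk f.
Proof.
move=> lf; apply: eqH.
by apply: aeS (aeI (mkE (L2Z a%:C lf)) (aeI (hZ a (mk f)) (mkE lf))) => x [-> [-> ->]].
Qed.
Lemma test_derive_n j (phi : R -> R) : test_function phi -> test_function (derive1n j phi).
Proof. by move=> tp; elim: j => [//|j IH]; rewrite derive1nS; exact: test_derive. Qed.
Lemma Cint_test f (phi : R -> R) : L2 f -> test_function phi ->
  Cintegral setT (fun x => f x * (phi x)%:C) = dot (mk f) (tm phi) +i* dot (mk f) (J (tm phi)).
Proof.
move=> lf tp; have l2 := L2tm tp; rewrite /Cintegral /tm -(mk_i l2) (dot_mk lf l2) (dot_mk lf (L2Z 'i l2)).
by congr (_ +i* _); apply: eq_Rintegral => x _; rewrite /rdot !ReImE; ring.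
Qed.
Definition wdn j F G := forall phi, test_function phi ->
  dot F (tm (derive1n j phi)) = (-1) ^+ j * dot G (tm phi) /\ dot F (J (tm (derive1n j phi))) = (-1) ^+ j * dot G (J (tm phi)).
Lemma sgn_cplx j (a b : R) : (-1) ^+ j * (a +i* b) = ((-1) ^+ j * a) +i* ((-1) ^+ j * b).
Proof.
elim: j => [|j IH]; first by rewrite !expr0 !mul1r.
by rewrite !exprS -!mulrA IH; apply: cplx_eq; rewrite !mulN1r.
Qed.
Lemma LI_L2 f : L2 f -> Clocally_integrable f.
Proof.
move=> lf; have [l1 l2] := LI_h (mk f); have [m1 m2] : Cmeasurable f by case: lf.
have key (p q : R -> R) : measurable_fun setT q -> locally_integrable setT p -> ae (fun x => p x = q x) -> locally_integrable setT q.
  move=> mq [mp o hp] pq; split=> // A sA cA; apply: le_lt_trans (hp A sA cA).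
  have mA := compact_measurable cA.
  rewrite le_eqVlt; apply/orP; left; apply/eqP; apply: ae_eq_integral => //.
  - by apply/measurable_EFinP; apply: measurableT_comp => //; exact: measurable_funTS.
  - by apply/measurable_EFinP; apply: measurableT_comp => //; exact: measurable_funTS.
  - by move: pq; apply: aeS => x -> _.
split; [apply: (key _ _ m1 l1)|apply: (key _ _ m2 l2)]; by apply: aeS (mkE lf) => x ->.
Qed.
Lemma wdnP j f g : L2 f -> L2 g -> is_weak_derivative j f g <-> wdn j (mk f) (mk g).
Proof.
move=> lf lg; split=> [[_ _ h] phi tp|h].
  have := h phi tp; rewrite (Cint_test lf (test_derive_n j tp)) (Cint_test lg tp) sgn_cplx.
  by case=> -> ->.
split; [exact: LI_L2|exact: LI_L2|] => phi tp.
rewrite (Cint_test lf (test_derive_n j tp)) (Cint_test lg tp) sgn_cplx.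
by have [-> ->] := h phi tp.
Qed.
Lemma wdn_uniq j F G G' : wdn j F G -> wdn j F G' -> G = G'.
Proof.
move=> h h'; apply/eqP; rewrite -subr_eq0; apply/eqP; apply: orth_test => phi tp.
have [a b] := h phi tp; have [a' b'] := h' phi tp.
have n0 : (-1) ^+ j != 0 :> R by rewrite signr_eq0.
rewrite !dotBl; split; apply/eqP; rewrite subr_eq0; apply/eqP; apply: (mulfI n0).
  by rewrite -a -a'.
by rewrite -b -b'.
Qed.
Lemma Dn_tm j (phi : R -> R) : test_function phi -> Hm j (tm phi) /\ Dn j (tm phi) = tm (derive1n j phi).
Proof.
move=> tp; elim: j phi tp => [//|j IH] phi tp.
have [h1 h2] := IH _ (test_derive tp); have hw := wd_tm tp.
split; first by split; rewrite (DE hw).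
by rewrite DnS (DE hw) h2 /derive1n iterSr.
Qed.
Lemma Dn_J j F : Hm j F -> Dn j (J F) = J (Dn j F).
Proof.
elim: j F => [//|j IH] F hF; rewrite !DnS DJ ?IH//; first by case: hF.
exact: Hm1 hF.
Qed.
Lemma Hm_wdn m j F : (j <= m)%N -> Hm m F -> wdn j F (Dn j F).
Proof.
move=> jm hF phi tp; have [h1 h2] := Dn_tm j tp; have hj := Hm_le jm hF.
have s2 (x : R) : x = (-1) ^+ j * ((-1) ^+ j * x) by rewrite mulrA -exprD addnn -mul2n exprM sqrrN expr1n expr1n mul1r.
rewrite -h2 -Dn_J// (Dn_skew hj h1) (Dn_skew hj); last exact: HmJ.
by rewrite -!s2.
Qed.
(** [Hs] asks for each weak derivative separately, [Hm] for successive ones; testing the lower order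
    with phi' links consecutive orders. *)
Lemma wdn_S j F G G' : wdn j F G -> wdn j.+1 F G' -> wd G G'.
Proof.
move=> h h'; apply/wd_weak => phi tp.
have [a b] := h _ (test_derive tp); have [a' b'] := h' _ tp.
have n0 : (-1) ^+ j != 0 :> R by rewrite signr_eq0.
have e : derive1n j (derive1 phi) = derive1n j.+1 phi by rewrite /derive1n iterSr.
rewrite e a' in a; rewrite e b' in b.
by split; apply: (mulfI n0); rewrite -?a -?b exprS; ring.
Qed.
Lemma Hm_chain m F (G : nat -> H) : G 0%N = F -> (forall j, (j < m)%N -> wd (G j) (G j.+1)) ->
  Hm m F /\ forall j, (j <= m)%N -> Dn j F = G j.
Proof.
elim: m F G => [|m IH] F G G0 h; first by split=> // j; rewrite leqn0 => /eqP ->.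
have h0 := h 0%N isT; rewrite G0 in h0.
have [h1 h2] := IH (D F) (fun j => G j.+1) (esym (DE h0)) (fun j jm => h j.+1 jm).
split; first by split=> //; rewrite (DE h0).
by case=> [//|j] jm; rewrite DnS h2.
Qed.
Lemma wderivP j f : (exists2 g, L2 g & is_weak_derivative j f g) ->
  L2 (wderiv j f) /\ is_weak_derivative j f (wderiv j f).
Proof.
move=> [g l w]; have : [set g | L2 g /\ is_weak_derivative j f g] (wderiv j f).
  by apply: xgetPex; exists g.
by [].
Qed.
Lemma wdn0 F G : wdn 0 F G -> G = F.
Proof. by move=> h; apply: (wdn_uniq h) => phi tp; rewrite /derive1n /= expr0 !mul1r. Qed.
Lemma HsP m f : Hs m f <-> L2 f /\ Hm m (mk f).
Proof.
split=> [[lf h]|[lf hf]]; split=> //.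
- have w j : (j <= m)%N -> wdn j (mk f) (mk (wderiv j f)).
    by move=> jm; have [l w] := wderivP (h j jm); apply/(wdnP _ lf l).
  have [] // := @Hm_chain m (mk f) (fun j => mk (wderiv j f)).
    exact: wdn0 (w 0%N isT).
  by move=> j jm; apply: wdn_S (w j (ltnW jm)) (w j.+1 jm).
- move=> j jm; exists (Dn j (mk f)) => //; apply/(wdnP _ lf) => //; rewrite mkK.
  exact: Hm_wdn hf.
Qed.
Lemma wderivE m j f : (j <= m)%N -> Hs m f -> L2 (wderiv j f) /\ mk (wderiv j f) = Dn j (mk f).
Proof.
move=> jm hf; have [lf h] := hf; have [l w] := wderivP (h j jm); split=> //.
have [_ hm] := (HsP m f).1 hf.
by apply: (@wdn_uniq j (mk f)); [apply/(wdnP _ lf l)|exact: Hm_wdn hm].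
Qed.
(** The Euclidean combination used by [Hsnorm]; [hs_hn] and [hn_hs] make it interchangeable with the
    sum [hn]. *)
Definition hs m F : R := Num.sqrt (\sum_(j < m.+1) `|Dn j F| ^+ 2).
Lemma HsnormE m f : Hs m f -> Hsnorm m f = (hs m (mk f))%:E.
Proof.
move=> hf; rewrite /Hsnorm; case: asboolP => // _.
have -> : (\sum_(j < m.+1) L2norm (wderiv j f) ^+ 2 = (\sum_(j < m.+1) `|Dn j (mk f)| ^+ 2)%:E)%E.
  rewrite -sumEFin; apply: eq_bigr => j _; have [l <-] := wderivE (leq_ord j) hf.
  by rewrite (L2norm_mk l) EFin_expe.
by rewrite poweR_EFin powR12_sqrt// sumr_ge0// => j _; exact: sqr_ge0.
Qed.
Lemma hs_ge0 m F : 0 <= hs m F. Proof. exact: sqrtr_ge0. Qed.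
Lemma hs_hn m F : hs m F <= hn m F.
Proof.
rewrite /hs hn_sum.
suff [h h0] : \sum_(j < m.+1) `|Dn j F| ^+ 2 <= (\sum_(j < m.+1) `|Dn j F|) ^+ 2 /\ 0 <= \sum_(j < m.+1) `|Dn j F|.
  by rewrite -[leRHS](ger0_norm h0) -sqrtr_sqr ler_wsqrtr.
elim: m.+1 => [|n [IH h0]]; first by rewrite !big_ord0 expr0n.
rewrite !big_ord_recr /=; split; last by rewrite addr_ge0.
move: h0 IH (normr_ge0 (Dn n F)); move: (\sum_(j < n) `|Dn j F| ^+ 2) (\sum_(j < n) `|Dn j F|) `|Dn n F| => x y z *.
nra.
Qed.
Lemma hn_hs m F : hn m F <= m.+1%:R * hs m F.
Proof.
have := @hn_bound R m F (hs m F); rewrite ?natr1; apply => j jm.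
rewrite -[leLHS]ger0_norm// -sqrtr_sqr ler_wsqrtr//.
rewrite (bigD1 (Ordinal (jm : (j < m.+1)%N)))//= lerDl sumr_ge0// => i _; exact: sqr_ge0.
Qed.
Lemma L2_cvg {T : Type} (FF : set_system T) {fFF : Filter FF} (v : T -> R -> R[i]) : (forall t, L2 (v t)) ->
  (L2norm (v t) @[t --> FF] --> 0%E) <-> (forall e : R, 0 < e -> \forall t \near FF, `|mk (v t)| <= e).
Proof.
move=> lv; have E : (fun t => L2norm (v t)) = (fun t => (`|mk (v t)|)%:E).
  by apply/funext => t; rewrite L2norm_mk.
rewrite E; split=> [/fine_cvgP[_ /cvgrPdist_le h] e /h|h].
  by apply: filterS => t /=; rewrite sub0r normrN normr_id.
apply/fine_cvgP; split; first by apply: nearW.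
apply/cvgrPdist_le => e /h; apply: filterS => t /=; by rewrite sub0r normrN normr_id.
Qed.
(** [Hsnorm] is +oo outside H^m, so convergence to 0 contains eventual membership. *)
Lemma Hs_cvg {T : Type} (FF : set_system T) {fFF : Filter FF} m (v : T -> R -> R[i]) :
  (Hsnorm m (v t) @[t --> FF] --> 0%E) <-> (forall e : R, 0 < e -> \forall t \near FF, Hs m (v t) /\ hn m (mk (v t)) <= e).
Proof.
split=> [/fine_cvgP[h1 /cvgrPdist_le h] e e0|h].
  have e1 : 0 < e / m.+1%:R by rewrite divr_gt0// ltr0n.
  have h2 := h _ e1; apply: filterS2 h1 h2 => t fin /=; rewrite sub0r normrN => hfin.
  have ht : Hs m (v t) by move: fin; rewrite /Hsnorm; case: asboolP.
  split=> //; apply: le_trans (hn_hs _ _) _; rewrite mulrC -ler_pdivlMr ?ltr0n//.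
  by move: hfin; rewrite HsnormE//= ger0_norm// hs_ge0.
apply/fine_cvgP; split.
  by apply: filterS (h 1 ltr01) => t [ht _]; rewrite HsnormE.
apply/cvgrPdist_le => e /h; apply: filterS => t [ht he] /=; rewrite sub0r normrN HsnormE//= ger0_norm ?hs_ge0//.
exact: le_trans (hs_hn _ _) he.
Qed.
Lemma nbhs_le (t : R) (P : R -> Prop) : (\forall s \near t, P s) <-> exists2 d : R, 0 < d & forall s, `|s - t| <= d -> P s.
Proof.
split=> [/nbhs_ballP[d /= d0 hd]|[d d0 hd]].
  exists (d / 2); first by rewrite divr_gt0.
  move=> s hs'; apply: hd; rewrite /ball /= distrC; apply: le_lt_trans hs' _.
  by rewrite ltr_pdivrMr// ltr_pMr// ltr1n.
apply/nbhs_ballP; exists d => //= s; rewrite /ball /= distrC => h; apply: hd; exact: ltW.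
Qed.
Lemma contHP m (u : R -> R -> R[i]) : (forall t, L2 (u t)) -> continuous_Hs m u <-> contH m (fun t => mk (u t)).
Proof.
move=> lu; have E s t : mk (u s \- u t) = mk (u s) - mk (u t) by exact: (mkB (lu s) (lu t)).2.
split=> [[h1 h2]|[h1 h2]]; split.
- by move=> t; have [] := (HsP m (u t)).1 (h1 t).
- move=> t e e0; have /Hs_cvg/(_ e e0)/nbhs_le[d d0 hd] := h2 t.
  by exists d => // s /hd[_]; rewrite E.
- by move=> t; apply/HsP.
move=> t; apply/Hs_cvg => e e0; apply/nbhs_le; have [d d0 hd] := h2 t e e0.
exists d => // s /hd; rewrite E; split=> //; apply/HsP; split; first exact: (mkB (lu s) (lu t)).1.
by rewrite E; exact: HmB.
Qed.
Lemma nbhs_y (P : R -> Prop) : (\forall t \near +oo, P t) <-> exists T : R, forall t, T <= t -> P t.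
Proof.
split=> [[M [_ h]]|[T hT]]; first by exists (M + 1) => t ht; apply: h; lra.
exists T; split; first exact: num_real.
by move=> t /ltW; exact: hT.
Qed.
Lemma nbhs_Ny (P : R -> Prop) : (\forall t \near -oo, P t) <-> exists T : R, forall t, T <= t -> P (- t).
Proof.
split=> [[M [_ h]]|[T hT]]; first by exists (1 - M) => t ht; apply: h; lra.
exists (- T); split; first exact: num_real.
by move=> t /ltW ht; rewrite -[t]opprK; apply: hT; lra.
Qed.

(** * From a propagator on functions to a group on classes *)

Section group.
Variables (V : R -> R) (U : R -> (R -> R[i]) -> (R -> R[i])) (K : R).
Hypotheses (hU : is_unitary_group V U) (bV : bd K (toC V)).
Definition grpH (t : R) F : H := mk (U t F).
Local Notation S := grpH.
Lemma U_lin t (a : R[i]) f g : L2 f -> L2 g -> ae_equal (U t (fun x => a * f x + g x)) (fun x => a * U t f x + U t g x).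
Proof. exact: group_linear hU _ _ _ _. Qed.
(** [U] acts on functions, and compatibility with almost everywhere equality has to be derived: by
    linearity and isometry it sends the null function [mk f] - [f] to a null function. *)
Lemma grpH_ae t f : L2 f -> grpH t (mk f) = mk (U t f).
Proof.
move=> lf; have lU := group_L2 hU t lf; have lU' := group_L2 hU t (L2h (mk f)).
have l0 : L2 (fun x => -1 * f x + mk f x) by exact: L2D (L2Z (-1) lf) (L2h _).
have e : ae_equal (fun x => -1 * f x + mk f x) (0 : H).
  by apply: aeS (aeI (mkE lf) (@h0 R)) => x [-> ->]; rewrite mulN1r addNr.
have n0 : mk (U t (fun x => -1 * f x + mk f x)) = 0.
  apply/eqP; rewrite -normr_eq0; apply/eqP/EFin_inj.
  rewrite -(L2norm_mk (group_L2 hU t l0)) (group_isometry hU t l0) (L2norm_mk l0).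
  by rewrite (mk_ae l0 (L2h _) e) mkK normr0.
apply: eqH; apply: ae_eq_trans (mkE lU') _; apply: ae_eq_sym; apply: ae_eq_trans (mkE lU) _.
have n1 := mkE (group_L2 hU t l0); rewrite n0 in n1.
apply: aeS (aeI n1 (aeI (@h0 R) (U_lin t (-1) lf (L2h (mk f))))) => x [a [b c]].
by move: a; rewrite b c mulN1r => /esym/eqP; rewrite addrC subr_eq0 => /eqP.
Qed.
Lemma grpH_lin t (z : R[i]) F G (P : H) : ae_equal P (fun x => z * F x + G x) -> ae_equal (S t P) (fun x => z * S t F x + S t G x).
Proof.
move=> hP; have l : L2 (fun x => z * F x + G x) by exact: L2D (L2Z z (L2h F)) (L2h G).
have -> : P = mk (fun x => z * F x + G x) by rewrite -(mk_ae (L2h P) l hP) mkK.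
rewrite (grpH_ae t l).
by apply: aeS (aeI (mkE (group_L2 hU t l)) (aeI (U_lin t z (L2h F) (L2h G))
  (aeI (mkE (group_L2 hU t (L2h F))) (mkE (group_L2 hU t (L2h G)))))) => x [-> [-> [-> ->]]].
Qed.
Lemma grpH_nrm t F : `|S t F| = `|F|.
Proof.
apply: EFin_inj; rewrite -(L2norm_mk (group_L2 hU t (L2h F))) (group_isometry hU t (L2h F)); exact: L2norm_h.
Qed.
Lemma grpH_Rlin t (a : R) F G : S t (a *: F + G) = a *: S t F + S t G.
Proof.
apply: eqH; have e : ae_equal (a *: F + G) (fun x => a%:C * F x + G x).
  by apply: aeS (aeI (hD (a *: F) G) (hZ a F)) => x [-> ->].
by apply: aeS (aeI (grpH_lin t e) (aeI (hD (a *: S t F) (S t G)) (hZ a (S t F)))) => x [-> [-> ->]].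
Qed.
Lemma grpH_add t t' F : S (t + t') F = S t (S t' F).
Proof.
rewrite [RHS](grpH_ae t (group_L2 hU t' (L2h F))); apply: mk_ae.
- exact: (group_L2 hU _ (L2h F)).
- exact: (group_L2 hU _ (group_L2 hU _ (L2h F))).
- exact: (group_add hU t t' (L2h F)).
Qed.
Lemma grpH_sub t F G : S t (F - G) = S t F - S t G.
Proof. by rewrite -[F - G]addrC -scaleN1r grpH_Rlin scaleN1r addrC. Qed.
Lemma grpH_grp : grp S.
Proof.
split; [exact: grpH_Rlin|exact: grpH_nrm| |exact: grpH_add|].
  by move=> F; rewrite -[RHS]mkK; apply: mk_ae => //; [exact: (group_L2 hU 0 (L2h F))|exact: (group_zero hU (L2h F))].
move=> F t; apply/cvgrPdist_le => e e0.
have l t' : L2 (U t' F \- F) by exact: (mkB (group_L2 hU t' (L2h F)) (L2h F)).1.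
have /(L2_cvg l)/(_ e e0)/nbhs_le[d d0 hd] := group_continuous hU (L2h F).
apply/nbhs_le; exists d => // s hs'.
have -> : S t F - S s F = - S t (S (s - t) F - F) by rewrite grpH_sub -grpH_add (addrC t) subrK opprB.
rewrite normrN grpH_nrm; have := hd (s - t); rewrite subr0 => /(_ hs').
by rewrite (mkB (group_L2 hU _ (L2h F)) (L2h F)).2 mkK.
Qed.
Lemma grpH_J t F : S t (J F) = J (S t F).
Proof.
apply: eqH; have e : ae_equal (J F) (fun x => 'i * F x + (0 : H) x).
  by apply: aeS (aeI (JE F) (@h0 R)) => x [-> ->]; rewrite addr0.
have z : S t 0 = 0 by have := grpH_sub t 0 0; rewrite !subr0 subrr.
by apply: aeS (aeI (grpH_lin t e) (aeI (JE (S t F)) (@h0 R))) => x [-> [-> h]]; rewrite z h addr0.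
Qed.
Lemma grpH_schr : schr S (toC V).
Proof.
split; [exact: grpH_grp|exact: grpH_J|] => G P.
have l (t : R) : L2 (fun x => (t^-1)%:C * (U t G x - G x) - P x).
  exact: L2D (L2Z _ (L2D (group_L2 hU t (L2h G)) (L2N (L2h G)))) (L2N (L2h P)).
have E (t : R) : mk (fun x => (t^-1)%:C * (U t G x - G x) - P x) = t^-1 *: (S t G - G) - P.
  have [l1 e1] := mkB (group_L2 hU t (L2h G)) (L2h G).
  by rewrite (mkB (L2Z _ l1) (L2h P)).2 mkK (mkS _ l1) e1 mkK.
have g1 : gen S G P <-> (L2norm (fun x => (t^-1)%:C * (U t G x - G x) - P x) @[t --> (0 : R)^'] --> 0%E).
  rewrite (@L2_cvg _ _ _ (fun t x => (t^-1)%:C * (U t G x - G x) - P x) l); split=> [[/cvgrPdist_le h] e /h|h].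
    by apply: filterS => t; rewrite distrC -E.
  by split; apply/cvgrPdist_le => e /h; apply: filterS => t; rewrite distrC -E.
rewrite g1 (group_generator hU (L2h G) (L2h P)).
have hs2 : Hs 2 G -> ae_equal (fun x => 'i * schrodinger V G x) (J (D (D G) + mulf (toC V) G)).
  move=> h; have [lw ew] := wderivE (leqnn 2) h; rewrite mkK in ew.
  by apply: aeS (aeI (aeI (JE (D (D G) + mulf (toC V) G)) (hD (D (D G)) (mulf (toC V) G))) (aeI (mulfE G bV) (mkE lw))) => x [[-> ->] [-> h2]];
    rewrite /schrodinger -h2 ew.
rewrite (HsP 2 G) mkK; split=> -[].
  move=> [_ h] e; split=> //; apply: eqH; apply: ae_eq_trans e _; apply: hs2; apply/HsP; by rewrite mkK.
move=> h e; split; first by [].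
by rewrite e; apply: ae_eq_sym; apply: hs2; apply/HsP; rewrite mkK.
Qed.
End group.
End linking.

(** * Duhamel formula, potential and time reversal *)

Section solution.
Context {R : realType}.
Local Notation H := (Hsp R).
Local Notation mu := (@lebesgue_measure R).
Local Notation cmod := (@ComplexField.Normc.normc R).
Hint Resolve L2h Cmh : core.

Lemma NL_mk (lam : R) k (g : R -> R[i]) : L2 g -> Hm 1 (mk g) ->
  L2 (nonlinearity lam k g) /\ mk (nonlinearity lam k g) = NL lam k (mk g).
Proof.
move=> lg [hw _]; have bg := bd_sup hw.
have e : ae_equal (NL lam k (mk g)) (nonlinearity lam k g).
  apply: aeS (aeI (hZ lam (it k (mk g))) (aeI (itE k bg) (mkE lg))) => x [-> [-> ->]].
  rewrite /nonlinearity exprM normc_sqr; apply: cplx_eq; rewrite !ReImE; ring.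
have m : Cmeasurable (nonlinearity lam k g).
  have mg : Cmeasurable g by case: lg.
  apply: CmM => //; apply: CmC; apply: measurable_funM; first exact: measurable_cst.
  by apply: measurable_funX; exact: m_cmod.
have l := L2_ae m (L2h _) e; split=> //.
by rewrite -[RHS]mkK; apply: mk_ae => //; exact: ae_eq_sym.
Qed.
Lemma Re_L2dot (f : R -> R[i]) (v : H) : L2 f -> complex.Re (L2dot f v) = dot (mk f) v.
Proof.
move=> lf; rewrite -[v in RHS]mkK (dot_mk lf (L2h v)); apply: eq_Rintegral => x _.
by rewrite /rdot !ReImE; ring.
Qed.
Lemma L2integral_dot (F : R -> R -> R[i]) D g v : is_L2integral F D g -> (forall t, L2 (F t)) ->
  dot (mk g) v = \int[mu]_(t in D) dot (mk (F t)) v.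
Proof.
move=> [lg h] lF; rewrite -(Re_L2dot v lg) (h v (L2h v)).2.
transitivity (\int[mu]_(t in D) complex.Re (L2dot (F t) v)); first by [].
by apply: eq_Rintegral => t _; rewrite Re_L2dot.
Qed.

(** Near t the oriented integral from 0 differs by a constant from an integral based at -(|t| + 1),
    to which the fundamental theorem applies. *)
Lemma primitive_derive (G P : R -> R) (c : R) : continuous G ->
  (forall t, P t = c + (if 0 <= t then \int[mu]_(s in `[0, t]) G s else - \int[mu]_(s in `[t, 0]) G s)) ->
  forall t : R, is_derive t 1 P (G t).
Proof.
move=> cG hP t; pose T := `|t| + 1.
have Tp : 0 < T by rewrite ltr_wpDl.
have tT1 : - T < t by rewrite /T; have := ler_norm (- t); rewrite normrN; lra.
have tT2 : t < T by rewrite /T; have := ler_norm t; lra.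
have iG (a b : R) : mu.-integrable `[a, b] (EFin \o G).
  by apply: continuous_compact_integrable; [exact: segment_compact|exact: continuous_subspaceT].
pose F0 (x : R) := \int[mu]_(s in `[- T, x]) G s.
have [d1 d2] := @continuous_FTC1 R G (BLeft (- T)) t T tT2 (iG _ _) tT1 (cG t).
have dF : is_derive t 1 F0 (G t) by apply: DeriveDef; [exact: d1|rewrite -derive1E; exact: d2].
have dF' : is_derive t 1 (fun x => F0 x + (c - F0 0)) (G t).
  by have := is_deriveD dF (is_derive_cst (c - F0 0) t (1 : R)); rewrite addr0; exact.
have half (a b : R) : - T < a -> a <= b -> F0 b - F0 a = \int[mu]_(s in `[a, b]) G s.
  move=> a1 ab; rewrite /F0 (Rintegral_itvB (iG _ _)).
  - rewrite Rintegral_itv_obnd_cbnd//; apply: integrableS (iG a b) => //.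
    by apply: subset_itvr; rewrite bnd_simp.
  - by rewrite bnd_simp ltW.
  - by rewrite bnd_simp.
apply: near_eq_is_derive dF'; apply/nbhs_le; exists ((t + T) / 2); first by lra.
move=> s hs'; have sT : - T < s.
  have h1 : t - s <= (t + T) / 2 by apply: le_trans (ler_norm _) _; rewrite distrC.
  lra.
rewrite hP; case: ifPn => s0; first by rewrite -(half 0 s)//; [ring|lra].
rewrite -ltNge in s0; rewrite -(half s 0)//; [ring|exact: ltW].
Qed.

Section duhamel.
Variables (V : R -> R) (U : R -> (R -> R[i]) -> (R -> R[i])) (K : R) (lam : R) (k : nat) (f : R -> R[i]) (u : R -> R -> R[i]).
Hypotheses (hU : is_unitary_group V U) (bV : bd K (toC V)) (hu : is_solution U lam k f u) (lf : L2 f).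
Local Notation S := (grpH U).
Local Notation w := (fun t => mk (u t)).
Lemma sol_L2 t : L2 (u t).
Proof. by case: hu => [[h _] _ _]; have [] := h t. Qed.
Lemma sol_H1 : contH 1 w.
Proof. by case: hu => [h _ _]; apply/contHP => //; exact: sol_L2. Qed.
Lemma sol_0 : w 0 = mk f.
Proof. by case: hu => [_ h _]; apply: mk_ae => //; exact: sol_L2. Qed.
(** Pairing the Duhamel formula with S(t) v removes t from the integrand, as S is unitary. What
    remains is a scalar oriented integral of a continuous function. *)
Lemma sol_D v (t : R) : is_derive t 1 (fun t => dot (S (- t) (w t)) v) (dot (J (S (- t) (NL lam k (w t)))) v).
Proof.
have gS := grpH_grp hU; have SJ := grpH_J hU.
pose G tau := dot (S (- tau) (NL lam k (w tau))) (- J v).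
have -> : dot (J (S (- t) (NL lam k (w t)))) v = G t by rewrite dotJl /G dotNr.
have lN tau := (NL_mk lam k (sol_L2 tau) (sol_H1.1 tau)).
have cG : continuous G.
  move=> x; apply: cvg_dot; last exact: cvg_cst.
  exact: (S_joint gS (N_cont sol_H1)).
apply: (primitive_derive (c := dot (mk f) v) cG) => {}t.
have [_ _ /(_ t)[z hz ez]] := hu.
have lF tau : L2 (U (t - tau) (nonlinearity lam k (u tau))) by apply: (group_L2 hU); exact: (lN tau).1.
have eF tau : dot (mk (U (t - tau) (nonlinearity lam k (u tau)))) (- J (S t v)) = G tau.
  rewrite -(grpH_ae hU _ (lN tau).1) (lN tau).2 (grp_add gS) -SJ /G !dotNr.
  by rewrite (grp_dot gS).
have lz : L2 z.
  move: hz; rewrite /is_L2primitive; case: ifP => _ [l _] //.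
  have -> : z = (fun x => - - z x) by apply/funext => x; rewrite opprK.
  exact: L2N.
have ew : w t = S t (mk f) + J (mk z).
  rewrite (grpH_ae hU t lf); apply: eqH; have lU := group_L2 hU t lf.
  by apply: aeS (aeI (mkE (sol_L2 t)) (aeI ez (aeI (hD (mk (U t f)) (J (mk z))) (aeI (mkE lU) (aeI (JE (mk z)) (mkE lz)))))) =>
    x [-> [-> [-> [-> [-> ->]]]]].
have -> : dot (S (- t) (w t)) v = dot (w t) (S t v).
  by rewrite (grp_adj gS) opprK.
rewrite ew dotDl (grp_dot gS) dotJl -dotNr; congr (_ + _).
move: hz; rewrite /is_L2primitive; case: ifPn => t0 hz.
  by rewrite (L2integral_dot _ hz lF); apply: eq_Rintegral => tau _.
have := L2integral_dot (- J (S t v)) hz lF.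
have -> : mk (fun x => - z x) = - mk z.
  by apply: eqH; apply: aeS (aeI (mkE (L2N lz)) (aeI (hN (mk z)) (mkE lz))) => x [-> [-> ->]].
rewrite dotNl => /eqP; rewrite eqr_oppLR => /eqP ->; congr (- _).
by apply: eq_Rintegral => tau _.
Qed.
End duhamel.

(** The norm of exponent +oo unfolds to the essential supremum once the total mass is known to be
    positive. *)
Lemma lebesgue_T_gt0 : (0 < mu setT)%E.
Proof.
apply: (@lt_le_trans _ _ (mu `[0%R, 1%R])); last by apply: le_measure; rewrite ?inE.
by rewrite lebesgue_measure_itv/= lte_fin ltr01 oppr0 adde0 lte_fin.
Qed.
Lemma Linfty_bd (V : R -> R) : V \in Lfun mu +oo%E -> exists K, bd K (toC V).
Proof.
move=> hV; have mV : measurable_fun setT V by have := sub_Lfun_mfun hV; rewrite inE.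
have : (ess_sup mu (abse \o (EFin \o V)) < +oo)%E.
  by have := sub_Lfun_finLfun hV; rewrite inE /finite_norm Lnorm.unlock lebesgue_T_gt0.
have := ess_sup_ge mu (abse \o (EFin \o V)).
move: (ess_sup _ _) => E hE Ey.
exists (Num.max 0 (fine E)); split; [exact: CmC|by rewrite le_max lexx|].
apply: aeS hE => x /= hx; rewrite /toC n2C -[leLHS]real_normK ?num_real//.
rewrite lerXn2r ?nnegrE ?le_max ?lexx//; apply/orP; right.
by move: E hx Ey => [r| |]//=; rewrite lee_fin.
Qed.
Definition wdnR j (p q : R -> R) := forall phi, test_function phi ->
  \int[mu]_x (p x * derive1n j phi x) = (-1) ^+ j * \int[mu]_x (q x * phi x).
Lemma weak_real j (p q : R -> R) : is_weak_derivative j (toC p) (toC q) ->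
  [/\ locally_integrable setT p, locally_integrable setT q & wdnR j p q].
Proof.
move=> [[lp _] [lq _] h]; split=> // phi tp; have := congr1 (@complex.Re R) (h phi tp).
have Er (a b : R -> R) : complex.Re (Cintegral setT (fun x => toC a x * (b x)%:C)) = \int[mu]_x (a x * b x).
  by apply: eq_Rintegral => x _; rewrite /toC !ReImE; ring.
have Es (z : R[i]) : complex.Re ((-1) ^+ j * z) = (-1) ^+ j * complex.Re z by case: z => a b; rewrite sgn_cplx.
by rewrite Es !Er.
Qed.
Lemma wdnR_S j (p q r : R -> R) : locally_integrable setT q -> locally_integrable setT r ->
  wdnR j p q -> wdnR j.+1 p r -> wdR q r.
Proof.
move=> lq lr h1 h2; split=> // phi tp.
have a := h1 _ (test_derive tp); have b := h2 _ tp.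
have e : derive1n j (derive1 phi) = derive1n j.+1 phi by rewrite /derive1n iterSr.
have n0 : (-1) ^+ j != 0 :> R by rewrite signr_eq0.
by rewrite e b exprS in a; apply: (mulfI n0); rewrite -a; ring.
Qed.
(** Weak derivatives of V of consecutive orders are linked by [wdnR_S], and each is bounded. Order 0
    is V itself, and the sum of the individual bounds serves all orders. *)
Lemma potential_chain (s : nat) (V : R -> R) : (1 <= s)%N -> V \in Lfun mu +oo%E ->
  (forall j, (1 <= j <= s)%N -> exists2 C : R, 0 < C & exists2 Vj : R -> R, is_weak_derivative j (toC V) (toC Vj) &
      forall x, `|Vj x| <= C * (1 + `|x|)^-1) ->
  exists K cc, [/\ bd K (toC V), cc 0%N = toC V & chain s cc K].
Proof.
move=> s1 /Linfty_bd[K0 bK0] hV.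
have /choice[W hW] : forall j, exists W : R -> R, (1 <= j <= s)%N ->
    is_weak_derivative j (toC V) (toC W) /\ exists K, bd K (toC W).
  move=> j; have [js|_] := boolP (1 <= j <= s)%N; last by exists V.
  have [C C0 [W w hC]] := hV j js; exists W => _; split=> //; exists C.
  have [_ [mW _ _] _] := weak_real w.
  apply: bd_real => //; first exact: ltW.
  move=> x; apply: le_trans (hC x) _; rewrite ler_pdivrMr ?ltr_pwDl//.
  by rewrite ler_peMr ?(ltW C0)// lerDl.
pose W' j := if j is j'.+1 then W j else V.
have lV : locally_integrable setT V.
  by have [] := weak_real (hW 1%N (introT andP (conj isT s1))).1.
have hW' j : (j <= s)%N -> wdnR j V (W' j) /\ locally_integrable setT (W' j).
  case: j => [|j] js; first by split=> // phi _; rewrite /derive1n /= expr0 mul1r.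
  by have [] := weak_real (hW j.+1 js).1.
have /choice[KK hK] : forall j, exists K, (j <= s)%N -> bd K (toC (W' j)).
  case=> [|j]; first by exists K0.
  have [js|_] := boolP (j < s)%N; last by exists 0.
  by have [_ [K hK]] := hW j.+1 js; exists K.
pose K := \sum_(j < s.+1) `|KK j|.
have bK j : (j <= s)%N -> bd K (toC (W' j)).
  move=> js; apply: bd_le (hK j js); apply: le_trans (ler_norm _) _.
  by rewrite /K (bigD1 (Ordinal (js : (j < s.+1)%N)))//= lerDl sumr_ge0.
exists K, (fun j => toC (W' j)); split; [exact: (bK 0%N)|by []|split=> // j js].
have [h1 l1] := hW' j (ltnW js); have [h2 l2] := hW' j.+1 js.
apply: (md_weak (wdnR_S l1 l2 h1 h2)); [exact: bK (ltnW js)|exact: bK js].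
Qed.
End solution.

(** * Time reversal by conjugation *)

Section reversal.
Context {R : realType}.
Local Notation H := (Hsp R).
Implicit Types (a b g h : H).
Hint Resolve L2h Cmh : core.
Definition revS (S : R -> H -> H) (t : R) g : H := cj (S (- t) (cj g)).
Lemma cj_inj a b : cj a = cj b -> a = b. Proof. by move=> h; rewrite -[a]cjK h cjK. Qed.
Lemma cj_mulf (c : R -> R) K g : bd K (toC c) -> cj (mulf (toC c) g) = mulf (toC c) (cj g).
Proof.
move=> bc; apply: eqH.
apply: aeS (aeI (cjE (mulf (toC c) g)) (aeI (mulfE g bc) (aeI (mulfE (cj g) bc) (cjE g)))) => x [-> [-> [-> ->]]].
by apply: cplx_eq; rewrite /toC !ReImE; ring.
Qed.
Lemma revS_grp (S : R -> H -> H) : grp S -> grp (revS S).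
Proof.
move=> gS; split.
- by move=> t a u v; rewrite /revS cjD cjZ (grp_lin gS) cjD cjZ.
- by move=> t u; rewrite /revS nrmcj (grp_nrm gS) nrmcj.
- by move=> u; rewrite /revS oppr0 (grp_0 gS) cjK.
- by move=> t t' u; rewrite /revS cjK opprD (grp_add gS).
move=> u t; apply/cvgrPdist_le => e e0.
have /cvgrPdist_le/(_ e e0) := @grp_cont R _ gS (cj u) (- t).
move=> /nbhs_le[d d0 hd]; apply/nbhs_le; exists d => // s hs'.
rewrite /revS -cjB nrmcj; apply: hd.
have -> : - s - - t = - (s - t) by ring.
by rewrite normrN.

Qed.
(** Conjugation turns i into -i and the reversal of time restores the sign; a real potential
    commutes with conjugation. *)
Lemma revS_schr (S : R -> H -> H) c K : bd K (toC c) -> schr S (toC c) -> schr (revS S) (toC c).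
Proof.
move=> bc hS; have gS := schr_grp hS; split; first exact: revS_grp.
  by move=> t g; rewrite /revS cjJ (grpN gS) (schr_J hS) cjN cjJ opprK.
move=> g h.
have E x : `|revS S x g - g - x *: h| = `|S (- x) (cj g) - cj g - (- x) *: - cj h|.
  by rewrite -nrmcj !cjB cjZ /revS cjK scalerN scaleNr opprK.
have -> : gen (revS S) g h <-> gen S (cj g) (- cj h).
  rewrite (genP (revS_grp gS)) (genP gS).
  split=> hg e /hg[d d0 hd]; exists d => // x xd.
    by have := hd (- x); rewrite normrN E !opprK; apply.
  by rewrite E; have := hd (- x); rewrite normrN; apply.
rewrite (schr_gen hS).
have key : Hm 2 g -> J (D (D (cj g)) + mulf (toC c) (cj g)) = - cj (J (D (D g) + mulf (toC c) g)).
  move=> hg; rewrite (Dcj (Hm1 hg)) (Dcj hg.2) -(cj_mulf g bc) -cjD cjJ opprK //.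
split=> -[hg e].
  have hg' : Hm 2 g by rewrite -[g]cjK; exact: Hmcj.
  by split=> //; apply: cj_inj; apply: oppr_inj; rewrite e key.
by split; [exact: Hmcj|rewrite key// e].
Qed.
Lemma NL_cj (lam : R) k a : Hm 1 a -> NL lam k (cj a) = cj (NL lam k a).
Proof.
move=> ha; have b1 := bd_sup ha.1; have b2 := bd_sup (Hmcj ha).1.
rewrite /NL cjZ; congr (_ *: _); apply: eqH.
apply: aeS (aeI (itE k b1) (aeI (itE k b2) (aeI (cjE a) (cjE (it k a))))) => x [e1 [-> [-> ->]]].
by rewrite e1 n2J; apply: cplx_eq; rewrite !ReImE; ring.
Qed.
Definition revp (p : R -> H) (t : R) : H := cj (p (- t)).
Lemma revp_contH m (p : R -> H) : contH m p -> contH m (revp p).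
Proof.
move=> [h1 h2]; split=> [t|t e e0]; first exact: Hmcj.
have [d d0 hd] := h2 (- t) e e0; exists d => // s hs'.
rewrite /revp -cjB hncj; last exact: HmB.
apply: hd; have -> : - s - - t = - (s - t) by ring.
by rewrite normrN.
Qed.
Lemma revp_D (S : R -> H -> H) (lam : R) k (p : R -> H) : grp S -> contH 1 p ->
  (forall v (t : R), is_derive t 1 (fun t => dot (S (- t) (p t)) v) (dot (J (S (- t) (NL lam k (p t)))) v)) ->
  forall v (t : R), is_derive t 1 (fun t => dot (revS S (- t) (revp p t)) v) (dot (J (revS S (- t) (NL lam k (revp p t)))) v).
Proof.
move=> gS hp h v t.
have e1 : (fun t => dot (revS S (- t) (revp p t)) v) = (fun s => dot (S (- s) (p s)) (cj v)) \o -%R.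
  by apply/funext => s /=; rewrite /revS /revp cjK dotcjl.
have e2 : dot (J (revS S (- t) (NL lam k (revp p t)))) v = -1 * dot (J (S (- - t) (NL lam k (p (- t))))) (cj v).
  rewrite /revS /revp (NL_cj _ _ (hp.1 _)) cjK; set Y := S _ _.
  by have := dotcjl (J Y) v; rewrite cjJ dotNl => <-; rewrite mulN1r opprK.
have d1 : is_derive t 1 (-%R : R -> R) (-1) by exact: (is_deriveN (is_derive_id t (1 : R))).
have d2 := @is_derive1_comp R _ -%R t _ _ (h (cj v) (- t)) d1.
rewrite e2; apply: (@eq_ind _ _ (fun q : R -> R => is_derive t 1 q _) _ _ (esym e1)).
by apply: (is_derive_eq d2); exact: mulrC.
Qed.
Lemma revS_limT (S S0 : R -> H -> H) g : (exists gm, limT (fun t => `|S (- t) (cj g) - S0 (- t) gm|)) ->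
  exists gp, limT (fun t => `|revS S t g - revS S0 t gp|).
Proof.
move=> [gm h]; exists (cj gm) => e /h[T hT]; exists T => t /hT.
by rewrite /revS cjK -cjB nrmcj.
Qed.
End reversal.

(** * Moments, pointwise decay and the initial datum *)

Section final.
Context {R : realType}.
Local Notation H := (Hsp R).
Local Notation mu := (@lebesgue_measure R).
Local Notation cmod := (@ComplexField.Normc.normc R).
Hint Resolve L2h Cmh : core.

Lemma Dn_cj j (F : H) : Hm j F -> Dn j (cj F) = cj (Dn j F).
Proof.
elim: j F => [//|j IH] F hF; rewrite !DnS Dcj ?IH//; first by case: hF.
exact: Hm1 hF.
Qed.
Lemma weight_ae s (g : R -> R[i]) (a : H) : Cmeasurable g -> ae (fun x => n2 (g x) = n2 (a x)) ->
  (\int[mu]_x (x ^+ (2 * s) * n2 (g x))%:E = \int[mu]_x (x ^+ (2 * s) * n2 (a x))%:E)%E.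
Proof.
move=> mg h.
have m (b : R -> R[i]) : Cmeasurable b -> measurable_fun setT (fun x : R => (x ^+ (2 * s) * n2 (b x))%:E).
  move=> mb; apply/measurable_EFinP; apply: measurable_funM; last exact: m_n2.
  by apply: continuous_measurable_fun; exact: exprn_continuous.
apply: ae_eq_integral => //; [exact: m|exact: m|].
by apply: aeS h => x -> _.
Qed.
Lemma int_scaled s (g : R -> R[i]) (a : H) (t m : R) : L2 g -> t != 0 -> ae (fun x => n2 (g x) = n2 (a x)) ->
  (\int[mu]_x (x ^+ (2 * s) * n2 (a x))%:E = ((m * `|t| ^+ s) ^+ 2)%:E)%E ->
  (\int[mu]_x ((x / t) ^+ (2 * s) * cmod (g x) ^+ 2)%:E = (m ^+ 2)%:E)%E.
Proof.
move=> [mg _] t0 hga hI.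
have -> : (fun x => ((x / t) ^+ (2 * s) * cmod (g x) ^+ 2)%:E) = (fun x => ((t ^+ (2 * s))^-1)%:E * (x ^+ (2 * s) * n2 (g x))%:E)%E.
  by apply/funext => x; rewrite -EFinM normc_sqr exprMn exprVn mulrCA mulrA.
have p0 (x : R) : 0 <= x ^+ (2 * s) by rewrite exprM exprn_ge0// sqr_ge0.
rewrite ge0_integralZl_EFin//.
- rewrite (weight_ae s mg hga) hI -EFinM; congr EFin.
  have -> : t ^+ (2 * s) = (`|t| ^+ s) ^+ 2 by rewrite exprM -(real_normK (num_real t)) -!exprM mulnC.
  by rewrite exprMn mulrCA mulVf ?mulr1// expf_neq0// expf_neq0// normr_eq0.
- by move=> x _; rewrite lee_fin mulr_ge0 ?n2_ge0.
- apply/measurable_EFinP; apply: measurable_funM; last exact: m_n2.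
  by apply: continuous_measurable_fun; exact: exprn_continuous.
- by rewrite invr_ge0.
Qed.
(** For |m - L| <= 1, |L^2 - m^2| <= (2 L + 1) |m - L|, which gives the choice of [d]. *)
Lemma cvg_sq (FF : set_system R) {fFF : Filter FF} (Ft : R -> \bar R) (L : R) : 0 <= L ->
  (forall ep : R, 0 < ep -> \forall t \near FF, exists m : R, [/\ 0 <= m, Ft t = (m ^+ 2)%:E & `|m - L| <= ep]) ->
  Ft t @[t --> FF] --> (L ^+ 2)%:E.
Proof.
move=> L0 h; apply/fine_cvgP; split.
  by apply: filterS (h 1 ltr01) => t [m [_ -> _]].
apply/cvgrPdist_le => e e0.
pose d := Num.min 1 (e / (2 * L + 1)).
have q0 : 0 < 2 * L + 1 by rewrite ltr_wpDl// mulr_ge0.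
have d0 : 0 < d by rewrite lt_min ltr01 divr_gt0.
apply: filterS (h d d0) => t [m [m0 mE hm]] /=; rewrite mE /=.
have : `|m - L| <= 1 /\ `|m - L| <= e / (2 * L + 1) by move: hm; rewrite le_min => /andP[].
rewrite ler_pdivlMr// distrC => -[h1 h2].
have -> : L ^+ 2 - m ^+ 2 = (L - m) * (L + m) by ring.
rewrite normrM; apply: le_trans h2; rewrite distrC ler_wpM2l//.
rewrite ger0_norm ?addr_ge0//; have := ler_norm (m - L); rewrite distrC; lra.
Qed.
(** [japanese t] is at least |t|; the maximum with 1 makes the constant positive. *)
Lemma decay_bd (u : R -> R -> R[i]) : (forall t, L2 (u t)) ->
  (ereal_sup [set (japanese tx.1 `^ 2^-1 * cmod (u tx.1 tx.2))%:E | tx in [set: R * R]] < +oo)%E ->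
  exists2 A : R, 0 < A & forall t, 1 <= `|t| -> bd (A / Num.sqrt `|t|) (mk (u t)).
Proof.
move=> lu; set E := ereal_sup _ => hE.
have ub t x : ((japanese t `^ 2^-1 * cmod (u t x))%:E <= E)%E.
  by apply: ereal_sup_ubound; exists (t, x).
exists (Num.max 1 (fine E)); first by rewrite lt_max ltr01.
move=> t t1; have t0 : 0 < `|t| by exact: lt_le_trans t1.
have s0 : 0 < Num.sqrt `|t| by rewrite sqrtr_gt0.
have A0 : 0 <= Num.max 1 (fine E) by rewrite le_max ler01.
split; [exact: Cmh|by rewrite divr_ge0// ltW|].
apply: aeS (mkE (lu t)) => x ->; rewrite -normc_sqr lerXn2r ?nnegrE ?normc_ge0' ?divr_ge0 ?(ltW s0)//.
rewrite ler_pdivlMr// mulrC.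
have j0 : 0 <= 1 + t ^+ 2 by rewrite addr_ge0// sqr_ge0.
have jt : `|t| <= japanese t.
  rewrite /japanese powR12_sqrt// -sqrtr_sqr ler_wsqrtr//; lra.
have h1 : Num.sqrt `|t| * cmod (u t x) <= japanese t `^ 2^-1 * cmod (u t x).
  rewrite ler_wpM2r ?normc_ge0'// powR12_sqrt ?ler_wsqrtr//.
  exact: le_trans jt.
apply: le_trans h1 _; rewrite le_max; apply/orP; right.
by have := ub t x; move: E hE {ub A0} => [r| |].
Qed.
(** [Hsnorm] is +oo outside H^s, so finiteness of the sum forces membership as well as a finite
    moment. *)
Lemma Sigma_finite s (f : R -> R[i]) : Sigma s f -> Hs s f /\
  exists2 M0 : R, 0 <= M0 & (\int[mu]_x (x ^+ (2 * s) * n2 (mk f x))%:E <= M0%:E)%E.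
Proof.
rewrite /Sigma /Sigma_normsq; set I := (\int[_]_x _)%E => h.
have I0 : (0 <= I)%E.
  by apply: integral_ge0 => x _; rewrite lee_fin mulr_ge0 ?sqr_ge0// exprM exprn_ge0// sqr_ge0.
have hs : Hs s f.
  move: h; rewrite /Hsnorm; case: asboolP => // _; rewrite expe2 mulyy addye//.
  by move: I0; case: I.
split=> //; have lf : L2 f by case: hs.
have e : I = (\int[mu]_x (x ^+ (2 * s) * n2 (mk f x))%:E)%E.
  have <- : (\int[mu]_x (x ^+ (2 * s) * n2 (f x))%:E = \int[mu]_x (x ^+ (2 * s) * n2 (mk f x))%:E)%E.
    by apply: weight_ae; [case: lf|apply: aeS (mkE lf) => x ->].
  by apply: eq_integral => x _; rewrite normc_sqr.
rewrite -e; move: h; rewrite HsnormE// -EFin_expe.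
move: I0; case: I {e} => [r| |]// r0 _; exists r; rewrite ?lexx//.
Qed.
End final.

Theorem theorem1p4 (R : realType) (s k : nat) (lam : R) (V : R -> R)
    (* U t = e^{it(d^2/dx^2 + V)} and U0 t = e^{it d^2/dx^2} *)
    (U U0 : R -> (R -> R[i]) -> (R -> R[i]))
    (f : R -> R[i]) (u : R -> R -> R[i])
    (hs : (1 <= s)%N) (hk : (2 <= k)%N) (hlam : lam < 0)
    (hV : V \in Lfun (@lebesgue_measure R) +oo%E)
    (hdV : forall j, (1 <= j <= s)%N ->
       exists2 C : R, 0 < C &
       exists2 Vj : R -> R, is_weak_derivative j (toC V) (toC Vj) &
         forall x, `|Vj x| <= C * (1 + `|x|)^-1)
    (hpos : nonnegative_operator (fun g x => - schrodinger V g x) (Hs 2))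
    (hU : is_unitary_group V U)
    (hU0 : is_unitary_group (fun _ => 0) U0)
    (hscat : forall g, L2 g ->
       (exists2 gp, L2 gp & L2norm (U t g \- U0 t gp) @[t --> +oo] --> 0%E) /\
       (exists2 gm, L2 gm & L2norm (U t g \- U0 t gm) @[t --> -oo] --> 0%E))
    (hf : Sigma s f)
    (hu : is_solution U lam k f u)
    (hdecay : (ereal_sup
       [set (japanese tx.1 `^ 2^-1 * ComplexField.Normc.normc (u tx.1 tx.2))%:E
         | tx in [set: R * R]] < +oo)%E) :
  continuous_Hs s u /\
  exists fp fm : R -> R[i],
    [/\ Hs s fp, Hs s fm,
        Hsnorm s (u t \- U0 t fp) @[t --> +oo] --> 0%E &
        Hsnorm s (u t \- U0 t fm) @[t --> -oo] --> 0%E] /\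
    (\int[lebesgue_measure]_x
        ((x / t) ^+ (2 * s) * ComplexField.Normc.normc (u t x) ^+ 2)%:E)%E
      @[t --> +oo] -->
      ((2 ^+ (2 * s))%:E * L2norm (wderiv s fp) ^+ 2)%E /\
    (\int[lebesgue_measure]_x
        ((x / t) ^+ (2 * s) * ComplexField.Normc.normc (u t x) ^+ 2)%:E)%E
      @[t --> -oo] -->
      ((2 ^+ (2 * s))%:E * L2norm (wderiv s fm) ^+ 2)%E.
Proof.
have [K [cc [bV cc0 hch]]] := potential_chain hs hV hdV.
have [hfs [M0 M00 hM0]] := Sigma_finite hf.
have lf : L2 f by case: hfs.
have lu := sol_L2 hu.
have [A A0 hA] := decay_bd lu hdecay.
pose S := grpH U; pose S0 := grpH U0; pose w t := mk (u t).
have hS : schr S (toC V) := grpH_schr hU bV.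
have hS0 : schr S0 (toC (fun=> 0)) := grpH_schr hU0 (@b00 R).
have gS := schr_grp hS; have gS0 := schr_grp hS0.
have wH1 : contH 1 w := sol_H1 hu.
have w0 : w 0 = mk f := sol_0 hu lf.
have wD := sol_D hU hu lf.
have w0s : Hm s (w 0) by rewrite w0; have [] := (HsP s f).1 hfs.
have ws : contH s w := persistence_Hs hS bV cc0 wH1 wD hs hch w0s.
split; first exact/contHP.
have lS (t : R) (g : Hsp R) : L2 (u t \- U0 t g) /\ mk (u t \- U0 t g) = w t - S0 t g.
  by have [a b] := mkB (lu t) (group_L2 hU0 t (L2h g)).
have sE (t : R) (g gp : R -> R[i]) : L2 g -> L2 gp -> L2 (U t g \- U0 t gp) /\ mk (U t g \- U0 t gp) = S t (mk g) - S0 t (mk gp).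
  by move=> lg lp; have := mkB (group_L2 hU t lg) (group_L2 hU0 t lp); rewrite -(grpH_ae hU t lg) -(grpH_ae hU0 t lp).
have hsc (g : Hsp R) : exists gp, limT (fun t => `|S t g - S0 t gp|).
  have [[gp lp h] _] := hscat g (L2h g); exists (mk gp) => e e0.
  have l t := (sE t g gp (L2h g) lp).1.
  have [T hT] := (nbhs_y _).1 ((L2_cvg l).1 h e e0); exists T => t /hT.
  by rewrite (sE t g gp (L2h g) lp).2 mkK.
(* The backward wave operators, stated for conjugated data so as to feed [revS_limT]. *)
have hsc' (g : Hsp R) : exists gm, limT (fun t => `|S (- t) (cj g) - S0 (- t) gm|).
  have [_ [gm lm h]] := hscat (cj g) (L2h _); exists (mk gm) => e e0.
  have l t := (sE t (cj g) gm (L2h _) lm).1.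
  have [T hT] := (nbhs_Ny _).1 ((L2_cvg l).1 h e e0); exists T => t /hT.
  by rewrite (sE (- t) (cj g) gm (L2h _) lm).2 mkK.
(* The limit is written as a square, the form that [cvg_sq] delivers. *)
have limE (g : Hsp R) : Hs s g -> ((2 ^+ (2 * s))%:E * L2norm (wderiv s g) ^+ 2)%E = ((2 ^+ s * `|Dn s g|) ^+ 2)%:E.
  move=> hg; have [l e] := wderivE (leqnn s) hg.
  by rewrite (L2norm_mk l) e mkK -EFin_expe -EFinM exprMn -exprM (mulnC s).
have HsH (g : Hsp R) : Hm s g -> Hs s g by move=> hg; apply/HsP; rewrite mkK; split=> //; exact: L2h.
have L0 (g : Hsp R) : 0 <= 2 ^+ s * `|Dn s g| by rewrite mulr_ge0// exprn_ge0.
have [||fp [hfp lfp ifp]] := @forward_asymptotics R S S0 V K lam k w cc s A M0 hS bV cc0 hch hS0 hsc hs hk A0 _ wH1 w0s wD M00.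
- by move=> t t1; have := hA t; rewrite ger0_norm; [apply|lra].
- by rewrite w0.
(* From here the hypotheses of [forward_asymptotics] are rebuilt for the reversed path [revp w] and
   the reversed groups. *)
have hS' : schr (revS S) (toC V) := revS_schr bV hS.
have hS0' : schr (revS S0) (toC (fun=> 0)) := revS_schr (@b00 R) hS0.
have w0' : revp w 0 = cj (w 0) by rewrite /revp oppr0.
have cjn2 (a : Hsp R) : ae (fun x => n2 (cj a x) = n2 (a x)).
  by apply: aeS (cjE a) => x ->; rewrite n2J.
have [|||fm' [hfm lfm ifm]] := @forward_asymptotics R (revS S) (revS S0) V K lam k (revp w) cc s A M0 hS' bV cc0 hch hS0'
   (fun g => revS_limT (hsc' g)) hs hk A0 _ (revp_contH wH1) _ (revp_D gS wH1 wD) M00.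
- move=> t t1; apply: bdHcj; have := hA (- t); rewrite normrN ger0_norm; [apply|]; lra.
- by rewrite w0'; exact: Hmcj.
- by rewrite w0' (weight_ae s (Cmh _) (cjn2 _)) w0.
(* Conjugating the forward state of the reversed path gives the backward state of [u], whose
   derivatives have the same norms. *)
pose fm := cj fm'.
have hfm2 : Hm s fm by exact: Hmcj.
exists fp, fm; split; first split.
- exact: HsH.
- exact: HsH.
- apply/Hs_cvg => e e0; apply/nbhs_y; have [T hT] := lfp e e0; exists T => t /hT h.
  have [l1 e1] := lS t fp; rewrite e1; split=> //; apply/HsP; split=> //; rewrite e1.
  by apply: HmB; [exact: ws.1|exact: (free_Hm hS0)].
- apply/Hs_cvg => e e0; apply/nbhs_Ny; have [T hT] := lfm e e0; exists T => t /hT h.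
  have [l1 e1] := lS (- t) fm; rewrite e1.
  have hm : Hm s (w (- t) - S0 (- t) fm) by apply: HmB; [exact: ws.1|exact: (free_Hm hS0)].
  split; first by apply/HsP; rewrite e1.
  by move: h; rewrite /revp /revS -cjB hncj.
split.
- rewrite (limE _ (HsH _ hfp)); apply: cvg_sq => // ep ep0; apply/nbhs_y.
  have [T T1 hT] := ifp ep ep0; exists T => t tT; have [m [m0 hI hm]] := hT t tT.
  have t0 : 0 < t by lra.
  exists m; split=> //; apply: (int_scaled (lu t) _ (a := w t)); first by rewrite gt_eqF.
    by apply: aeS (mkE (lu t)) => x ->.
  by rewrite hI gtr0_norm.
- rewrite (limE _ (HsH _ hfm2)) (Dn_cj hfm) nrmcj; apply: cvg_sq => // ep ep0; apply/nbhs_Ny.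
  have [T T1 hT] := ifm ep ep0; exists T => t tT; have [m [m0 hI hm]] := hT t tT.
  have t0 : 0 < t by lra.
  exists m; split=> //; apply: (int_scaled (lu (- t)) _ (a := revp w t)); first by rewrite oppr_eq0 gt_eqF.
    by apply: aeS (aeI (mkE (lu (- t))) (cjn2 (w (- t)))) => x [e1 ->]; rewrite e1.
  by rewrite hI normrN gtr0_norm.
Qed.
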